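(* Let $(\mathbb P^{s,x})_{(s,x)\in[0,T]\times E}$ be a canonical Markov class associated to a transition kernel measurable in time, solving the martingale problem associated to $(\mathcal D(a),a,V)$. Let $\psi=(\psi_1,\dots,\psi_d)\in\mathcal D(a)^d$ be such that for every $i$: $\langle M[\psi_i]^{s,x}\rangle$ is absolutely continuous with respect to $V$ under every $\mathbb P^{s,x}$; $a(\psi_i)\in\mathcal L^2_X$; and $\mathfrak G^{\psi_i}(\psi_i)$ is bounded. Let $\zeta,\eta:E\to\mathbb R_+$ be Borel such that the class satisfies $H^{mom}(\zeta,\eta)$, and let $(f,g)$ satisfy $H^{growth}(\zeta,\eta)$. Let $(u,v)$ be a solution of $IP(f,g)$ and fix $(s,x)\in[0,T]\times E$. Then the couple of processes $$\Big(u(t,X_t),\ \ u(t,X_t)-u(s,x)+\int_s^tf(\cdot,\cdot,u,v)(r,X_r)dV_r\Big)_{t\in[s,T]}$$ has a $\mathbb P^{s,x}$-version which solves $BSDE^{s,x}(f,g)$ on $[s,T]$. In particular, if $(f,g)$ satisfies the stronger hypothesis $H^{lip}(\zeta,\eta)$ and $(u,v)$ is the unique solution of $IP(f,g)$, then for any $(s,x)\in[0,T]\times E$ the couple $\big(u(t,X_t),\ u(t,X_t)-u(s,x)+\int_s^tf(\cdot,\cdot,u,v)(r,X_r)dV_r\big)_{t\in[s,T]}$ is a $\mathbb P^{s,x}$-modification of the unique solution of $BSDE^{s,x}(f,g)$ on $[s,T]$.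
   Context: **Canonical Markov class.** $E$ is a Polish space, $\Omega$ the space of càdlàg functions $[0,T]\to E$, $X$ the canonical process, $\mathcal F=\sigma(X_r:r\in[0,T])$, $\mathcal F_t=\bigcap_{u\in]t,T]}\sigma(X_r:r\le u)$ for $t<T$, $\mathcal F_T=\mathcal F$. A transition kernel $P=(P_{s,t})$ is a family of Markov kernels on $E$ with $P_{s,t}(x,A)=\mathbf 1_A(x)$ if $t\le s$ and $\int P_{s,t}(x,dy)P_{t,u}(y,A)=P_{s,u}(x,A)$ for $s<t<u$; it is measurable in time if $(s,x)\mapsto P_{s,t}(x,A)$ is Borel for all $t,A$. A canonical Markov class associated to $P$ is a family of probabilities $\mathbb P^{s,x}$ on $(\Omega,\mathcal F)$ with $\mathbb P^{s,x}(X_t\in A)=P_{s,t}(x,A)$ for all $t,A$, and $\mathbb P^{s,x}(X_u\in A\mid\mathcal F_t)=P_{t,u}(X_t,A)$ $\mathbb P^{s,x}$-a.s. for $s\le t\le u$. $(\mathcal F^{s,x},(\mathcal F^{s,x}_t))$ are the $\mathbb P^{s,x}$-completions; martingales under $\mathbb P^{s,x}$ refer to this basis. $P_{s,t}[\phi](x)=\int\phi(y)P_{s,t}(x,dy)$. **Martingale problem.** $V:[0,T]\to\mathbb R_+$ is non-decreasing, continuous, $V_0=0$; $\mathcal D(a)$ is a linear space of Borel functions $[0,T]\times E\to\mathbb R$ and $a$ a linear operator from $\mathcal D(a)$ to the Borel functions. The class solves the martingale problem for $(\mathcal D(a),a,V)$ if for all $(s,x)$: $\mathbb P^{s,x}(X_t=x\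 \forall t\in[0,s])=1$, and for every $\phi\in\mathcal D(a)$, $\phi(\cdot,X_\cdot)-\int_s^\cdot a(\phi)(r,X_r)dV_r$ on $[s,T]$ is a càdlàg square integrable $\mathbb P^{s,x}$-martingale. $M[\phi]^{s,x}:=\mathbf 1_{[s,T]}(\phi(\cdot,X_\cdot)-\phi(s,x)-\int_s^\cdot a(\phi)(r,X_r)dV_r)$; $M[\psi]^{s,x}=(M[\psi_1]^{s,x},\dots,M[\psi_d]^{s,x})$. $\langle\cdot,\cdot\rangle$: predictable angle bracket; $dA/dV$: Radon-Nikodym derivative (componentwise for vectors). **Spaces.** A Borel set $A\subset[0,T]\times E$ is of zero potential if $\mathbb E^{s,x}[\int_s^T\mathbf 1_{\{(t,X_t)\in A\}}dV_t]=0$ for all $(s,x)$. For $p>0$, $\mathcal L^p_X$ is the set of Borel $\phi:[0,T]\times E\to\mathbb R$ with $\mathbb E^{s,x}[\int_s^T|\phi|^p(r,X_r)dV_r]<\infty$ for all $(s,x)$. Under the absolute continuity assumption, $\mathfrak G^{\psi_i}(\psi_i)$ is the Borel function, unique up to zero potential sets, with $\langle M[\psi_i]^{s,x}\rangle=\int_s^{\cdot\vee s}\mathfrak G^{\psi_i}(\psi_i)(r,X_r)dV_r$ under every $\mathbb P^{s,x}$. **Hypotheses.** $H^{mom}(\zeta,\eta)$: $\mathbb E^{s,x}[\zeta^2(X_T)]<\infty$ and $\mathbb E^{s,x}[\int_0^T\eta^2(X_r)dV_r]<\infty$ for all $(s,x)$. For Borel $f:[0,T]\times E\times\mathbb R\times\mathbb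 R^d\to\mathbb R$, $g:E\to\mathbb R$: $H^{growth}(\zeta,\eta)$ means that for some positive constants $|g(x)|\le C(1+\zeta(x))$ and $|f(t,x,y,z)|\le C'(1+\eta(x)+|y|+\|z\|)$; $H^{lip}(\zeta,\eta)$ means that for some positive constants $|g(x)|\le C(1+\zeta(x))$, $|f(t,x,0,0)|\le C'(1+\eta(x))$, $|f(t,x,y,z)-f(t,x,y',z')|\le K^Y|y-y'|+K^Z\|z-z'\|$. **Identification problem.** A couple of Borel functions $u:[0,T]\times E\to\mathbb R$, $v=(v_1,\dots,v_d):[0,T]\times E\to\mathbb R^d$ is a solution of $IP(f,g)$ if $u,v_1,\dots,v_d\in\mathcal L^2_X$ and for every $(s,x)$ and $i\in\{1,\dots,d\}$, $$u(s,x)=P_{s,T}[g](x)+\int_s^TP_{s,r}[f(\cdot,\cdot,u,v)(r,\cdot)](x)dV_r,$$ $$u\psi_i(s,x)=P_{s,T}[g\psi_i(T,\cdot)](x)-\int_s^TP_{s,r}[(v_i+ua(\psi_i)-\psi_if(\cdot,\cdot,u,v))(r,\cdot)](x)dV_r,$$ where $f(\cdot,\cdot,u,v)(t,x)=f(t,x,u(t,x),v(t,x))$. (Uniqueness of $v$ is up to zero potential sets.) **BSDE on $[s,T]$.** A couple $(Y,M)$ of processes indexed by $[s,T]$ solves $BSDE^{s,x}(f,g)$ on $[s,T]$ if, under $\mathbb P^{s,x}$, $Y$ is càdlàg adapted with $\mathbb E^{s,x}[\int_s^TY_r^2dV_r]<\infty$, $M$ is a square integrable martingale with $M_s=0$,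 and on $[s,T]$, up to indistinguishability, $Y_\cdot=g(X_T)+\int_\cdot^Tf\big(r,X_r,Y_r,\frac{d\langle M,M[\psi]^{s,x}\rangle}{dV}(r)\big)dV_r-(M_T-M_\cdot)$. Under $H^{lip}(\zeta,\eta)$ the solution is unique. A $\mathbb P^{s,x}$-version is a modification under $\mathbb P^{s,x}$. *)

(* Defs.v *)
From HB Require Import structures.
From mathcomp Require Import all_boot all_order all_algebra.
From mathcomp Require Import all_classical all_reals all_analysis.
From mathcomp Require Import measurable_realfun.
Set Implicit Arguments.
Unset Strict Implicit.
Unset Printing Implicit Defensive.
Import Order.TTheory GRing.Theory Num.Theory.
Import numFieldNormedType.Exports.
Local Open Scope classical_set_scope.
Local Open Scope ring_scope.

Definition polish (R : realType) (E : topologicalType) : Prop :=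
  (exists2 S : set E, countable S & dense S) /\
  exists dist : E -> E -> R,
    [/\ forall x y, (dist x y = 0) <-> (x = y),
        forall x y, dist x y = dist y x,
        forall x y z, dist x z <= dist x y + dist y z,
        (forall x (A : set E),
           nbhs x A <-> exists2 e : R, 0 < e & [set y | dist x y < e] `<=` A) &
        forall x_ : nat -> E,
          (forall e : R, 0 < e -> exists N : nat, forall m n : nat,
             (N <= m)%N -> (N <= n)%N -> dist (x_ m) (x_ n) < e) ->
          exists l : E, x_ n @[n --> \oo] --> l].

Notation borel E := (g_sigma_algebraType (@open E)).

Definition cadlag_on (R : realType) (E : topologicalType) (a b : R)
    (y : R -> E) : Prop :=
  (forall t, a <= t < b -> y r @[r --> t^'+] --> y t) /\
  (forall t, a < t <= b -> exists l : E, y r @[r --> t^'-] --> l).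

Definition euclidean_norm (R : realType) (d : nat) (z : 'I_d -> R) : R :=
  Num.sqrt (\sum_(i < d) z i ^+ 2).

(* The integrals from s to t below are over ]s, t]: a cumulative function lives
   on the whole real line and V is only required to be continuous on [0, T], so
   dV may have an atom at 0 that must not be counted. *)
Notation dV V := (lebesgue_stieltjes_measure V).

Section filtered_space.
Context {d} {W : measurableType d} {R : realType}.
Implicit Types (mu : {measure set W -> \bar R}) (G : set (set W)).
Implicit Types (Flt : R -> set (set W)) (M N A H : R -> W -> R).

Definition measurable_wrt G (f : W -> R) : Prop :=
  forall B, measurable B -> G (f @^-1` B).

Definition is_cond_exp mu G (Y Z : W -> R) : Prop :=
  [/\ mu.-integrable setT (EFin \o Y), mu.-integrable setT (EFin \o Z),
      measurable_wrt G Z &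
      forall B, G B -> \int[mu]_(w in B) Z w = \int[mu]_(w in B) Y w].

Definition adapted Flt (a b : R) M : Prop :=
  forall t, a <= t <= b -> measurable_wrt (Flt t) (M t).

Definition martingale mu Flt (a b : R) M : Prop :=
  adapted Flt a b M /\
  (forall t, a <= t <= b -> mu.-integrable setT (EFin \o M t)) /\
  forall u t, a <= u -> u <= t -> t <= b -> is_cond_exp mu (Flt u) (M t) (M u).

Definition ae_cadlag mu (a b : R) M : Prop :=
  {ae mu, forall w, cadlag_on a b (M ^~ w)}.

Definition sqint_martingale mu Flt (a b : R) M : Prop :=
  [/\ martingale mu Flt a b M, ae_cadlag mu a b M &
      forall t, a <= t <= b -> (\int[mu]_w ((M t w) ^+ 2)%:E < +oo)%E].

Definition predictable_sigma Flt (a b : R) : set (set (R * W)) :=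
  <<s `[a, b]%classic `*` setT,
     [set C | (exists2 B, Flt a B & C = [set a] `*` B) \/
              (exists t t' B, [/\ a <= t, t <= t', t' <= b, Flt t B &
                 C = `]t, t']%classic `*` B])] >>.

Definition predictable Flt (a b : R) H : Prop :=
  forall B, measurable B ->
    predictable_sigma Flt a b
      ((`[a, b]%classic `*` setT) `&` (fun z => H z.1 z.2) @^-1` B).

(* [A] is a version of the predictable angle bracket <M, N> on [a, b] of two
   square integrable martingales (unique up to indistinguishability). *)
Definition angle_bracket mu Flt (a b : R) M N A : Prop :=
  [/\ predictable Flt a b A,
      {ae mu, forall w, [/\ A a w = 0, cadlag_on a b (A ^~ w) &
                            bounded_variation a b (A ^~ w)]} &
      martingale mu Flt a b (fun t w => M t w * N t w - A t w)].

End filtered_space.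

Section completion.
Context {d} {W : measurableType d} {R : realType}.
Variable P : probability W R.

(* The Caratheodory sigma-algebra of the outer measure of a probability is its
   completion. *)
Definition completion : {measure set (caratheodory_type (P^*)%mu) -> \bar R} :=
  @completed_measure_extension _ _ _ P.

Definition completed_sub (G : set (set W)) : set (set W) :=
  [set A | exists2 B, G B & P.-negligible (A `+` B)].

End completion.

(* [phi] has density [z] with respect to V on [a, b], i.e. z = dphi/dV. *)
Definition RN_density (R : realType) (V : cumulative R R) (a b : R)
    (phi z : R -> R) : Prop :=
  (dV V).-integrable `]a, b]%classic (EFin \o z) /\
  forall t, a <= t <= b -> phi t - phi a = \int[dV V]_(r in `]a, t]) z r.

(* d phi << dV on ]a, b], for [phi] non-decreasing and right-continuous. *)
Definition Stieltjes_dominated (R : realType) (V : cumulative R R) (a b : R)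
    (phi : R -> R) : Prop :=
  exists F : cumulative R R, (forall t, a <= t <= b -> F t = phi t) /\
    forall B, measurable B -> B `<=` `]a, b]%classic ->
      dV V B = 0%E -> dV F B = 0%E.

Section canonical_space.
Context {R : realType}.
Variables (T : R) (E : ptopologicalType).

Definition clamp (t : R) : R := Num.max 0 (Num.min t T).

(* A cadlag function [0, T] -> E is represented by its unique extension to the
   real line that is constant on ]-oo, 0] and on [T, +oo[. *)
Definition cadlag_path : Type :=
  set_type [set y : R -> E | cadlag_on 0 T y /\ forall t, y t = y (clamp t)].

Let cst_path : [set y : R -> E | cadlag_on 0 T y /\
  forall t, y t = y (clamp t)] (fun=> point).
Proof. by split=> //; split=> t _; [|exists point]; exact: cvg_cst. Qed.

HB.instance Definition _ := Choice.on cadlag_path.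
HB.instance Definition _ :=
  isPointed.Build cadlag_path (SigSub (mem_set cst_path)).

Definition coord (t : R) (w : cadlag_path) : borel E := set_val w t.

Definition cylinders (u : R) : set (set cadlag_path) :=
  [set A | exists r B, [/\ 0 <= r <= u, measurable B & A = coord r @^-1` B]].

Definition Omega := g_sigma_algebraType (cylinders T).

Definition X (t : R) (w : Omega) : borel E := coord t w.

Definition filtration (t : R) : set (set Omega) :=
  [set A : set Omega | if t < T then forall u, t < u <= T -> <<s cylinders u >> A
           else measurable A].

Definition time_space : set (R * borel E) := `[0, T]%classic `*` setT.

Definition borel_on_time_space (phi : R * borel E -> R) : Prop :=
  measurable_fun time_space phi.

End canonical_space.
Arguments time_space {R} T E _.
Arguments X {R T E}.
Arguments filtration {R T E}.

Section markov.
Context {R : realType} (T : R) (E : ptopologicalType).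
Implicit Types (P : R -> R -> R.-pker borel E ~> borel E).
Implicit Types (PP : R -> borel E -> probability (Omega T E) R).

Definition transition_kernel P : Prop :=
  (forall s t : R, 0 <= s <= T -> 0 <= t <= T -> t <= s ->
     forall x A, measurable A -> P s t x A = \d_x A) /\
  (forall s t u : R, 0 <= s -> s < t -> t < u -> u <= T ->
     forall x A, measurable A -> (\int[P s t x]_y P t u y A = P s u x A)%E).

Definition measurable_in_time P : Prop :=
  forall (t : R) (A : set (borel E)), 0 <= t <= T -> measurable A ->
    measurable_fun (time_space T E)
      (fun z : R * borel E => P z.1 t z.2 A : \bar R).

Definition canonical_markov_class P PP : Prop :=
  forall (s : R) (x : borel E), 0 <= s <= T ->
    (forall (t : R) (A : set (borel E)), 0 <= t <= T -> measurable A ->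
       PP s x (X t @^-1` A) = P s t x A) /\
    (forall (t u : R) (A : set (borel E)), s <= t -> t <= u -> u <= T -> measurable A ->
       is_cond_exp (PP s x) (filtration t) (\1_(X u @^-1` A))
         (fun w => fine (P t u (X t w) A))).

(* P_{s,t}[phi](x) *)
Definition kint P (s t : R) (phi : borel E -> R) (x : borel E) : R :=
  \int[P s t x]_y phi y.

End markov.

Section martingale_problem.
Context {R : realType} (T : R) (E : ptopologicalType).
Variables (PP : R -> borel E -> probability (Omega T E) R) (V : cumulative R R).
Implicit Types (phi psi G : R * borel E -> R).

Definition P_compl (s : R) (x : borel E) := completion (PP s x).

Definition F_compl (s : R) (x : borel E) (t : R) : set (set (Omega T E)) :=
  completed_sub (PP s x) (filtration t).

Definition linear_operator_on (Da : set (R * borel E -> R))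
    (a : (R * borel E -> R) -> R * borel E -> R) : Prop :=
  [/\ forall phi, Da phi ->
        borel_on_time_space T phi /\ borel_on_time_space T (a phi),
      Da (fun=> 0),
      forall (k : R) phi psi, Da phi -> Da psi ->
        Da (fun z => k * phi z + psi z) &
      forall (k : R) phi psi, Da phi -> Da psi ->
        forall z, time_space T E z ->
          a (fun z' => k * phi z' + psi z') z = k * a phi z + a psi z].

Definition solves_martingale_problem (Da : set (R * borel E -> R))
    (a : (R * borel E -> R) -> R * borel E -> R) : Prop :=
  forall (s : R) (x : borel E), 0 <= s <= T ->
    PP s x [set w | forall t, 0 <= t <= s -> X t w = x] = 1%E /\
    forall phi, Da phi ->
      {ae P_compl s x, forall w, (dV V).-integrable `]s, T]%classic
                                  (fun r => (a phi (r, X r w))%:E)} /\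
      sqint_martingale (P_compl s x) (F_compl s x) s T
        (fun t w => phi (t, X t w) -
                    \int[dV V]_(r in `]s, t]) a phi (r, X r w)).

(* M[phi]^{s,x} on [s, T]; it vanishes on [0, s[. *)
Definition Mart (a : (R * borel E -> R) -> R * borel E -> R) phi
    (s : R) (x : borel E) (t : R) (w : Omega T E) : R :=
  phi (t, X t w) - phi (s, x) - \int[dV V]_(r in `]s, t]) a phi (r, X r w).

Definition zero_potential (A : set (R * borel E)) : Prop :=
  [/\ measurable A, A `<=` time_space T E &
      forall (s : R) (x : borel E), 0 <= s <= T ->
        (\int[PP s x]_w \int[dV V]_(r in `]s, T])
           (\1_A (r, X r w))%:E = 0)%E].

Definition L2X phi : Prop :=
  borel_on_time_space T phi /\
  forall (s : R) (x : borel E), 0 <= s <= T ->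
    (\int[PP s x]_w \int[dV V]_(r in `]s, T])
       (`|phi (r, X r w)| ^+ 2)%:E < +oo)%E.

Definition bracket_abs_continuous
    (a : (R * borel E -> R) -> R * borel E -> R) psi : Prop :=
  forall (s : R) (x : borel E), 0 <= s <= T ->
    exists A : R -> Omega T E -> R,
      angle_bracket (P_compl s x) (F_compl s x) s T
        (Mart a psi s x) (Mart a psi s x) A /\
      {ae P_compl s x, forall w, Stieltjes_dominated V s T (A ^~ w)}.

(* [G] is a version of the function whose dV-integral along X is the bracket of
   M[psi]^{s,x} for all (s, x) at once. *)
Definition bracket_density
    (a : (R * borel E -> R) -> R * borel E -> R) psi G : Prop :=
  borel_on_time_space T G /\
  forall (s : R) (x : borel E), 0 <= s <= T ->
    exists A : R -> Omega T E -> R,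
      angle_bracket (P_compl s x) (F_compl s x) s T
        (Mart a psi s x) (Mart a psi s x) A /\
      {ae P_compl s x, forall w,
         RN_density V s T (A ^~ w) (fun r => G (r, X r w))}.

Definition bounded_up_to_zero_potential G : Prop :=
  exists C : R, zero_potential (time_space T E `&` [set z | C < `|G z|]).

Definition H_mom (zeta eta : borel E -> R) : Prop :=
  forall (s : R) (x : borel E), 0 <= s <= T ->
    (\int[PP s x]_w (zeta (X T w) ^+ 2)%:E < +oo)%E /\
    (\int[PP s x]_w \int[dV V]_(r in `]0%R, T])
       (eta (X r w) ^+ 2)%:E < +oo)%E.

End martingale_problem.

Section driver.
Context {R : realType} (T : R) (E : ptopologicalType) (d : nat).
Implicit Types (f : R * borel E * R * d.-tuple R -> R) (g : borel E -> R).
Implicit Types (zeta eta : borel E -> R).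

Definition borel_data f g : Prop :=
  measurable_fun [set q | 0 <= q.1.1.1 <= T] f /\ measurable_fun setT g.

Definition H_growth zeta eta f g : Prop :=
  (exists2 C, 0 < C & forall x, `|g x| <= C * (1 + zeta x)) /\
  (exists2 C', 0 < C' & forall t x y z, 0 <= t <= T ->
     `|f (t, x, y, z)| <= C' * (1 + eta x + `|y| + euclidean_norm (tnth z))).

Definition H_lip zeta eta f g : Prop :=
  [/\ exists2 C, 0 < C & forall x, `|g x| <= C * (1 + zeta x),
      exists2 C', 0 < C' & forall t x, 0 <= t <= T ->
        `|f (t, x, 0, [tuple 0 | i < d])| <= C' * (1 + eta x) &
      exists KY KZ, [/\ 0 < KY, 0 < KZ &
        forall t x y y' z z', 0 <= t <= T ->
          `|f (t, x, y, z) - f (t, x, y', z')| <=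
            KY * `|y - y'| +
            KZ * euclidean_norm (fun i => tnth z i - tnth z' i)]].

(* f(., ., u, v) *)
Definition fuv f (u : R * borel E -> R) (v : 'I_d -> R * borel E -> R)
    (z : R * borel E) : R :=
  f (z, u z, [tuple v i z | i < d]).

End driver.

Section problems.
Context {R : realType} (T : R) (E : ptopologicalType) (d : nat).
Variables (P : R -> R -> R.-pker borel E ~> borel E).
Variables (PP : R -> borel E -> probability (Omega T E) R) (V : cumulative R R).
Variables (a : (R * borel E -> R) -> R * borel E -> R).
Variables (psi : 'I_d -> R * borel E -> R).
Variables (f : R * borel E * R * d.-tuple R -> R) (g : borel E -> R).

Definition IP_solution (u : R * borel E -> R)
    (v : 'I_d -> R * borel E -> R) : Prop :=
  [/\ L2X PP V u, forall i, L2X PP V (v i) &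
      forall (s : R) (x : borel E), 0 <= s <= T ->
        u (s, x) = kint P s T g x +
          \int[dV V]_(r in `]s, T]) kint P s r (fun y => fuv f u v (r, y)) x /\
        forall i,
          u (s, x) * psi i (s, x) =
            kint P s T (fun y => g y * psi i (T, y)) x -
            \int[dV V]_(r in `]s, T])
              kint P s r (fun y => v i (r, y) + u (r, y) * a (psi i) (r, y) -
                                   psi i (r, y) * fuv f u v (r, y)) x].

Definition IP_unique_solution (u : R * borel E -> R)
    (v : 'I_d -> R * borel E -> R) : Prop :=
  IP_solution u v /\
  forall u' v', IP_solution u' v' ->
    (forall z, time_space T E z -> u' z = u z) /\
    forall i, zero_potential PP V
      (time_space T E `&` [set z | v' i z != v i z]).

(* [Z] is the (predictable) process d<M, M[psi]^{s,x}>/dV. *)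
Definition BSDE_solution (s : R) (x : borel E)
    (Y M : R -> Omega T E -> R) : Prop :=
  [/\ adapted (F_compl PP s x) s T Y,
      ae_cadlag (P_compl PP s x) s T Y,
      (\int[P_compl PP s x]_w \int[dV V]_(r in `]s, T])
         (Y r w ^+ 2)%:E < +oo)%E,
      sqint_martingale (P_compl PP s x) (F_compl PP s x) s T M /\
      {ae P_compl PP s x, forall w, M s w = 0} &
      exists A Z : 'I_d -> R -> Omega T E -> R,
        [/\ forall i, angle_bracket (P_compl PP s x) (F_compl PP s x) s T
                        M (Mart V a (psi i) s x) (A i),
            forall i, predictable (F_compl PP s x) s T (Z i),
            forall i, {ae P_compl PP s x, forall w,
                         RN_density V s T (A i ^~ w) (Z i ^~ w)} &
            {ae P_compl PP s x, forall w,
               let F r := f (r, X r w, Y r w, [tuple Z i r w | i < d]) in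
               (dV V).-integrable `]s, T]%classic (EFin \o F) /\
               forall t, s <= t <= T ->
                 Y t w = g (X T w) + \int[dV V]_(r in `]t, T]) F r -
                         (M T w - M t w)}]].

Definition BSDE_unique_solution (s : R) (x : borel E)
    (Y M : R -> Omega T E -> R) : Prop :=
  BSDE_solution s x Y M /\
  forall Y' M', BSDE_solution s x Y' M' ->
    {ae P_compl PP s x, forall w, forall t, s <= t <= T ->
       Y' t w = Y t w /\ M' t w = M t w}.

Definition modification (s : R) (x : borel E)
    (N N' : R -> Omega T E -> R) : Prop :=
  forall t, s <= t <= T -> {ae P_compl PP s x, forall w, N t w = N' t w}.

End problems.

(* Main.v *)
(* By the Markov property, IP(f, g) says that u(t, X_t) + int f and
   (u psi_i)(t, X_t) - int (v_i + u a(psi_i) - psi_i f) are martingales. Integration by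
   parts then identifies d<M, M[psi_i]>/dV with v_i(r, X_r); replacing X_r by its left
   limit makes it predictable, and costs nothing because V has no atoms on ]0, T].
   For uniqueness, a bounded d<M[psi_i]>/dV gives E int z_i^2 dV <= c E (M_T - M_t)^2 for
   the density z_i of <M, M[psi_i]>, and a backward Gronwall argument applies. *)

(* The obstacle is the estimate for the densities [z_i]. The definition of the bracket makes [z]
   integrable along almost every path, but not over the product of time and probability, and the
   processes may jump. Paths are therefore weighted by rho = exp(- eps * int |z|): rho decreases
   from 1, so eps * int rho |z| <= 1 on every path, and no stopping time enters. For a simple
   predictable H, summing the means of (dm + rho H dN)^2 >= 0 over a fine grid gives - 2 E int H rho
   z dV <= c E int H^2 dV + E (m_T^2 - m_t^2). The choice H = - z / c, truncated, bounds E int z^2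
   dV once eps tends to 0 and the truncation is lifted. IP yields martingales without path
   regularity, and solutions are regular only almost surely. Both are replaced by versions that are
   cadlag on every path with squares below one integrable variable, so that pathwise calculus meets
   no exceptional set and limits have a dominant. These versions come from the values on dyadic
   grids: the mean number of moves of size e is at most E M_T^2 / e^2 whatever the grid, which
   excludes oscillations. *)
Require Import Defs.
From HB Require Import structures.
From mathcomp Require Import all_boot all_order all_algebra.
From mathcomp Require Import all_classical all_reals all_analysis.
From mathcomp Require Import measurable_realfun.
From mathcomp Require Import ring lra.
Set Implicit Arguments.
Unset Strict Implicit.
Unset Printing Implicit Defensive.
Import Order.TTheory GRing.Theory Num.Theory.
Import numFieldNormedType.Exports.
Local Open Scope classical_set_scope.
Local Open Scope ring_scope.

(* The type ascription selects the measurable structure on which [dV V] lives. *)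
Notation Ioc R a b := (`]a, b]%classic : set (measurableTypeR R)).
Notation no_atom V a b := (forall t, a < t <= b -> dV V [set t] = 0%E).
Notation dV_integrable V a b f := ((dV V).-integrable `]a, b]%classic (EFin \o f)).
Notation bracket_le mu Flt V a b c N := (forall p q (h : _ -> _) (B : _),
  a <= p -> p <= q -> q <= b -> measurable_wrt (Flt p) h -> (forall w, `|h w| <= B) ->
  \int[mu]_w (h w * (N q w - N p w)) ^+ 2 <= c * (V q - V p) * \int[mu]_w h w ^+ 2).

(** * Tonelli and Fubini for a time set [I] and the sample space *)

Section iterated_integrals.
Context d1 d2 (T1 : measurableType d1) (W : measurableType d2) (R : realType).
Variables (la : {sigma_finite_measure set T1 -> \bar R}).
Variables (mu : {sigma_finite_measure set W -> \bar R}).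
Variables (I : set T1) (mI : measurable I).

Let D : set (T1 * W) := I `*` setT.

Let mD : measurable D. Proof. exact: measurableX. Qed.

Let pE (f : T1 -> W -> \bar R) r w :
  ((fun z => f z.1 z.2) \_ D) (r, w) = ((f ^~ w) \_ I) r.
Proof. by rewrite !patchE /D in_setX/= in_setT andbT. Qed.

Let pE2 (f : T1 -> W -> \bar R) r w :
  ((fun z => f z.1 z.2) \_ D) (r, w) = if r \in I then f r w else 0%E.
Proof. by rewrite pE patchE. Qed.

Lemma measurable_pathI d3 (T3 : measurableType d3) (f : T1 -> W -> T3) w :
  measurable_fun D (fun z => f z.1 z.2) -> measurable_fun I (f ^~ w).
Proof.
move=> mf; apply: (@measurable_comp _ _ _ _ _ _ D (fun z => f z.1 z.2) I (fun r => (r, w))) => //.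
  by move=> _ [r Ir <-]; split.
exact: measurable_funTS (pair2_measurable w).
Qed.

Lemma measurable_sliceI d3 (T3 : measurableType d3) (f : T1 -> W -> T3) r :
  I r -> measurable_fun D (fun z => f z.1 z.2) -> measurable_fun setT (f r).
Proof.
move=> Ir mf; apply: (@measurable_comp _ _ _ _ _ _ D (fun z => f z.1 z.2) setT (fun w => (r, w))) => //.
  by move=> _ [w _ <-]; split.
exact: pair1_measurable.
Qed.

Section tonelli.
Variable f : T1 -> W -> \bar R.
Hypothesis mf : measurable_fun D (fun z => f z.1 z.2).
Hypothesis f0 : forall r w, I r -> (0 <= f r w)%E.

(** Extension by zero outside [I]: the theorems for full products then apply, and nonnegativity,
    assumed on [I] only, holds everywhere. *)
Let F := ((fun z => f z.1 z.2) \_ D) : T1 * W -> \bar R.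

Let mF : measurable_fun setT F.
Proof. by apply/(measurable_restrictT _ mD). Qed.

Let F0 z : (0 <= F z)%E.
Proof. by case: z => r w; rewrite /F pE2; case: ifPn => // /set_mem; exact: f0. Qed.

Lemma measurable_inner : measurable_fun setT (fun w => \int[la]_(r in I) f r w)%E.
Proof.
apply: eq_measurable_fun (measurable_fun_fubini_tonelli_G (m1 := la) _ mF F0).
move=> w _; rewrite /fubini_G [RHS]integral_mkcond.
by apply: eq_integral => r _; rewrite /F pE.
Qed.

Lemma measurable_outer : measurable_fun I (fun r => \int[mu]_w f r w)%E.
Proof.
have := measurable_fun_fubini_tonelli_F (m2 := mu) _ mF F0.
move=> /(measurable_funS measurableT (@subsetT _ I)).
apply: eq_measurable_fun => r rI; rewrite /fubini_F.
by apply: eq_integral => w _; rewrite /F pE2 rI.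
Qed.

Lemma tonelli_iter : (\int[mu]_w \int[la]_(r in I) f r w =
  \int[la]_(r in I) \int[mu]_w f r w)%E.
Proof.
transitivity (\int[mu]_w \int[la]_r F (r, w))%E.
  apply: eq_integral => w _; rewrite integral_mkcond.
  by apply: eq_integral => r _; rewrite /F pE.
rewrite -fubini_tonelli// [RHS]integral_mkcond; apply: eq_integral => r _.
rewrite !patchE; case: ifPn => rI.
  by apply: eq_integral => w _; rewrite /F pE2 rI.
by apply: integral0_eq => w _; rewrite /F pE2 (negbTE rI).
Qed.

End tonelli.

Section fubini.
Variable f : T1 -> W -> R.
Hypothesis mf : measurable_fun D (fun z => f z.1 z.2).
Hypothesis fin : (\int[mu]_w \int[la]_(r in I) `|f r w|%:E < +oo)%E.

Let F := ((fun z => (f z.1 z.2)%:E) \_ D) : T1 * W -> \bar R.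

Let mF : measurable_fun setT F.
Proof. by apply/(measurable_restrictT _ mD); exact/measurable_EFinP. Qed.

Let abseF r w : (`|F (r, w)| = if r \in I then `|f r w|%:E else 0)%E.
Proof. by rewrite /F (pE2 (fun r w => (f r w)%:E)); case: ifPn => //; rewrite abse0. Qed.

Let iF : (la \x mu)%E.-integrable setT F.
Proof.
apply/integrable21ltyP => //; apply: le_lt_trans fin.
rewrite le_eqVlt; apply/orP; left; apply/eqP; apply: eq_integral => w _.
by rewrite [RHS]integral_mkcond; apply: eq_integral => r _; rewrite abseF patchE.
Qed.

Let EG w : (fubini_G la F w = \int[la]_(r in I) (f r w)%:E)%E.
Proof.
rewrite /fubini_G [RHS]integral_mkcond; apply: eq_integral => r _.
by rewrite /F (pE (fun r w => (f r w)%:E)).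
Qed.

Lemma fubini_ae_path :
  {ae mu, forall w, la.-integrable I (EFin \o f ^~ w)}.
Proof.
have := ae_integrable2 iF; apply: filterS => w /=.
move=> h; apply/integrable_mkcond => //; apply: eq_integrable h => //= r _.
by rewrite /F (pE (fun r w => (f r w)%:E)).
Qed.

Lemma fubini_ae_time :
  {ae la, forall r, I r -> mu.-integrable setT (EFin \o f r)}.
Proof.
have := ae_integrable1 iF; apply: filterS => r /= + rI.
apply: eq_integrable => // w _.
by rewrite /F (pE2 (fun r w => (f r w)%:E)) mem_set.
Qed.

Lemma fubini_integrable :
  mu.-integrable setT (fun w => \int[la]_(r in I) (f r w)%:E)%E.
Proof.
apply/integrableP; split.
  by apply: eq_measurable_fun (measurable_fubini_G iF) => w _; rewrite EG.
apply: le_lt_trans fin; apply: ge0_le_integral => //.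
- apply: measurableT_comp => //.
  by apply: eq_measurable_fun (measurable_fubini_G iF) => w _; rewrite EG.
- apply: (@measurable_inner (fun r w => `|f r w|%:E)) => [|r w _]; last by rewrite lee_fin.
  by apply/measurable_EFinP; exact: measurableT_comp.
- move=> w _; apply: le_trans (le_abse_integral _ _ _) _ => //.
  by apply/measurable_EFinP; exact: measurable_pathI.
Qed.

Lemma fubini_time_integrable :
  la.-integrable I (fun r => \int[mu]_w (f r w)%:E)%E.
Proof.
apply/integrable_mkcond => //; apply: eq_integrable (integrable_fubini_F iF) => // r _.
rewrite /fubini_F patchE; case: ifPn => rI.
  by apply: eq_integral => w _; rewrite /F (pE2 (fun r w => (f r w)%:E)) rI.
by rewrite integral0_eq// => w _; rewrite /F (pE2 (fun r w => (f r w)%:E)) (negbTE rI).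
Qed.

Lemma fubini_swap : (\int[mu]_w \int[la]_(r in I) (f r w)%:E =
  \int[la]_(r in I) \int[mu]_w (f r w)%:E)%E.
Proof.
have := Fubini iF.
rewrite (_ : (\int[mu]_y _)%E = (\int[mu]_w \int[la]_(r in I) (f r w)%:E)%E); last first.
  by apply: eq_integral => w _; exact: EG.
move=> <-; rewrite [RHS]integral_mkcond; apply: eq_integral => r _.
rewrite patchE; case: ifPn => rI.
  by apply: eq_integral => w _; rewrite /F (pE2 (fun r w => (f r w)%:E)) rI.
by rewrite integral0_eq// => w _; rewrite /F (pE2 (fun r w => (f r w)%:E)) (negbTE rI).
Qed.

(** [Rintegral] is [fine] of the extended integral, hence 0 on a path where that one is infinite.
    Its absolute value is thus below the extended one on every path, and the domination needs no
    exceptional set. *)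
Lemma fubini_Rintegrable :
  mu.-integrable setT (fun w => (\int[la]_(r in I) (f r w))%:E).
Proof.
apply: (@le_integrable _ _ _ mu setT measurableT _
  (fun w => \int[la]_(r in I) (f r w)%:E)%E); last exact: fubini_integrable.
- apply/measurable_EFinP; apply: measurableT_comp => //.
  exact: measurable_int fubini_integrable.
- by move=> w _; rewrite /Rintegral; case: (integral _ _ _) => //= *; rewrite ?normr0 ?leey ?lee_fin.
Qed.

Lemma fubini_RintE :
  (\int[mu]_w (\int[la]_(r in I) (f r w))%:E)%E = (\int[mu]_w \int[la]_(r in I) (f r w)%:E)%E.
Proof.
apply: ae_eq_integral => //.
- exact: measurable_int fubini_Rintegrable.
- exact: measurable_int fubini_integrable.
have := fubini_ae_path; apply: filterS => w /= iw _.
by rewrite /Rintegral fineK//; exact: integrable_fin_num.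
Qed.

Lemma fubini_Rswap :
  \int[mu]_w \int[la]_(r in I) (f r w) = \int[la]_(r in I) \int[mu]_w (f r w).
Proof.
rewrite {1}/Rintegral fubini_RintE fubini_swap [in RHS]/Rintegral; congr fine.
apply: ae_eq_integral => //.
- exact: measurable_int fubini_time_integrable.
- apply/measurable_EFinP; apply: measurableT_comp => //.
  exact: measurable_int fubini_time_integrable.
have := fubini_ae_time; apply: filterS => w /= iw Iw.
by rewrite fineK//; apply: integrable_fin_num => //; exact: iw.
Qed.

End fubini.

End iterated_integrals.

(** * Integration against a sub-sigma-algebra [G] *)

Section sub_sigma_algebra.
Context d (W : measurableType d) (R : realType) (G : set (set W)).
Hypothesis sG : sigma_algebra setT G.

Lemma g_sigma_id : (measurable : set (set (g_sigma_algebraType G))) = G.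
Proof. exact: sigma_algebra_id. Qed.

Lemma measurable_wrtP (f : W -> R) :
  measurable_wrt G f <-> measurable_fun setT (f : g_sigma_algebraType G -> R).
Proof.
split=> mf.
  by move=> _ B mB; rewrite setTI g_sigma_id; exact: mf.
by move=> B mB; rewrite -g_sigma_id -[_ @^-1` _]setTI; exact: mf.
Qed.

Hypothesis subG : G `<=` measurable.

Lemma g_sigma_measurable (A : set W) :
  measurable (A : set (g_sigma_algebraType G)) -> G A.
Proof. by rewrite g_sigma_id. Qed.

Lemma g_sigma_sub (A : set W) :
  measurable (A : set (g_sigma_algebraType G)) -> measurable A.
Proof. by move/g_sigma_measurable; exact: subG. Qed.

Lemma measurable_funT_sub d' (U : measurableType d') (f : W -> U) :
  measurable_fun setT (f : g_sigma_algebraType G -> U) -> measurable_fun setT f.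
Proof. by move=> mf _ B mB; apply: g_sigma_sub; exact: mf. Qed.

Variable mu : {measure set W -> \bar R}.

Import HBNNSimple.

(** The level sets of a simple function on [g_sigma_algebraType G] belong to [G], so [p] enters only
    through its integrals over sets of [G]. This is where a comparison known on [G] alone becomes
    usable. *)
Let simple_integral (p : W -> \bar R) (mp : measurable_fun setT p)
  (p0 : forall w, (0 <= p w)%E) (h : {nnsfun (g_sigma_algebraType G) >-> R}) :
  (\int[mu]_w ((h w)%:E * p w) =
  \sum_(y \in range h) y%:E * \int[mu]_(w in h @^-1` [set y]) p w)%E.
Proof.
have mh y : measurable (h @^-1` [set y] : set W).
  apply: g_sigma_sub; rewrite -[_ @^-1` _]setTI.
  exact: (@measurable_funPT _ _ _ _ h).
rewrite (eq_integral (fun w : W => \sum_(y \in range h) (y%:E * (\1_(h @^-1` [set y]) w)%:E * p w))%E).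
  rewrite ge0_integral_fsum//.
  - apply: eq_fsbigr => y /set_mem [w _ <-].
    under eq_integral do rewrite -muleA.
    rewrite ge0_integralZl//; last 3 first.
    + by apply: emeasurable_funM => //; apply/measurable_EFinP; exact: measurable_indic.
    + by move=> w' _; rewrite mule_ge0// lee_fin.
    + by rewrite lee_fin fun_ge0.
    congr (_ * _)%E; rewrite [RHS]integral_mkcond; apply: eq_integral => w' _.
    by rewrite patchE indicE; case: ifPn => _; rewrite ?mul1e ?mul0e.
  - move=> y; apply: emeasurable_funM => //; apply: emeasurable_funM => //.
    by apply/measurable_EFinP; exact: measurable_indic.
  - move=> y w _; rewrite mule_ge0//.
    have [->|/set0P[w' /= <-]] := eqVneq (h @^-1` [set y]) set0.
    by rewrite indic0 mule0.
    by rewrite mule_ge0// lee_fin ?fun_ge0.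
move=> w _; rewrite [in LHS](fimfunE h w) -fsumEFin// ge0_mule_fsuml//.
move=> y; have [->|/set0P[w' /= <-]] := eqVneq (h @^-1` [set y]) set0.
  by rewrite indic0 mulr0.
by rewrite lee_fin mulr_ge0// fun_ge0.
Qed.

(* The hypothesis says that one density is dominated by the other on the sub-sigma-algebra only. *)
Lemma le_integral_density (p q : W -> R) (Y : W -> \bar R) :
  measurable_fun setT p -> measurable_fun setT q ->
  (forall w, 0 <= p w) -> (forall w, 0 <= q w) ->
  (forall B, G B -> \int[mu]_(w in B) (p w)%:E <= \int[mu]_(w in B) (q w)%:E)%E ->
  measurable_fun setT (Y : g_sigma_algebraType G -> \bar R) ->
  (forall w, 0 <= Y w)%E ->
  (\int[mu]_w (Y w * (p w)%:E) <= \int[mu]_w (Y w * (q w)%:E))%E.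
Proof.
move=> /measurable_EFinP mp /measurable_EFinP mq p0 q0 pq mY Y0.
pose h := nnsfun_approx measurableT mY.
have mhW n : measurable_fun setT (h n : W -> R).
  apply: measurable_funT_sub; exact: measurable_funPT.
have hnd a b (w : g_sigma_algebraType G) : (a <= b)%N -> h a w <= h b w.
  by move=> ab; exact/lefP/nd_nnsfun_approx.
have hY w : (h n w)%:E @[n --> \oo] --> Y w by exact: cvg_nnsfun_approx.
have hle n w : ((h n w)%:E <= Y w)%E.
  rewrite -(cvg_lim _ (hY w))//; apply: lime_ge; first by apply/cvg_ex; exists (Y w).
  by exists n => // m /= nm; rewrite lee_fin; exact: hnd.
have -> : (\int[mu]_w (Y w * (p w)%:E) = limn (fun n => \int[mu]_w ((h n w)%:E * (p w)%:E)))%E.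
  rewrite -monotone_convergence//.
  - apply: eq_integral => w _; apply/esym/cvg_lim => //.
    exact: cvgeZr.
  - by move=> n; apply: emeasurable_funM => //; exact/measurable_EFinP.
  - by move=> n w _; rewrite mule_ge0// lee_fin.
  - move=> w _ a b ab; apply: lee_wpmul2r; rewrite lee_fin//.
    exact: hnd.
apply: lime_le.
  apply: ereal_nondecreasing_is_cvgn => a b ab; apply: ge0_le_integral => //.
  - by move=> w _; rewrite mule_ge0// lee_fin.
  - by apply: emeasurable_funM => //; exact/measurable_EFinP.
  - by apply: emeasurable_funM => //; exact/measurable_EFinP.
  - move=> w _; apply: lee_wpmul2r; rewrite lee_fin//.
    exact: hnd.
(* The densities are compared for the simple function, whose level sets are in [G]; on the
   right-hand side [h n] is then enlarged to [Y]. *)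
apply: nearW => n; apply: (@le_trans _ _ (\int[mu]_w ((h n w)%:E * (q w)%:E))%E).
  rewrite !simple_integral//; apply: lee_fsum => // y [w _ <-].
  apply: lee_wpmul2l; first by rewrite lee_fin.
  apply: pq; apply: g_sigma_measurable; rewrite -[_ @^-1` _]setTI.
  exact: (@measurable_funPT _ _ _ _ (h n)).
apply: ge0_le_integral => //.
- by move=> w _; rewrite mule_ge0// lee_fin.
- by apply: emeasurable_funM => //; exact/measurable_EFinP.
- by apply: emeasurable_funM => //; exact: measurable_funT_sub.
- by move=> w _; apply: lee_wpmul2r; rewrite ?lee_fin.
Qed.

End sub_sigma_algebra.

(** * Real-valued integrals and square-integrable variables *)

Section rintegral_tools.
Context d (W : measurableType d) (R : realType) (mu : {measure set W -> \bar R}).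

Lemma ae_eq_Rintegral (D : set W) (f g : W -> R) : measurable D ->
  measurable_fun D f -> measurable_fun D g ->
  {ae mu, forall x, D x -> f x = g x} ->
  \int[mu]_(x in D) f x = \int[mu]_(x in D) g x.
Proof.
move=> mD mf mg fg; congr fine; apply: ae_eq_integral => //; try exact/measurable_EFinP.
by apply: filterS fg => x /= + Dx => ->.
Qed.

Lemma ae_eq_integrable (D : set W) (f g : W -> R) : measurable D ->
  measurable_fun D g -> {ae mu, forall x, D x -> f x = g x} ->
  mu.-integrable D (EFin \o f) -> mu.-integrable D (EFin \o g).
Proof.
move=> mD mg fg /integrableP[mf fi]; apply/integrableP.
split; first exact/measurable_EFinP.
rewrite -(@ae_eq_integral _ _ _ mu D _ (fun x => `|(f x)%:E|%E))//.
- exact: measurableT_comp.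
- by apply: measurableT_comp => //; exact/measurable_EFinP.
- by apply: filterS fg => x /= + Dx => ->.
Qed.

Lemma Rintegral_indic (C : set W) (f : W -> R) :
  \int[mu]_(w in C) f w = \int[mu]_w (\1_C w * f w).
Proof.
rewrite Rintegral_mkcond; apply: eq_Rintegral => w _.
by rewrite patchE indicE; case: ifP; rewrite ?mul1r ?mul0r.
Qed.

Lemma integrable_indicM (C : set W) (f : W -> R) : measurable C ->
  mu.-integrable setT (EFin \o f) ->
  mu.-integrable setT (fun w => (\1_C w * f w)%:E).
Proof.
move=> mC fi; have /measurable_EFinP mf := measurable_int mu fi.
apply: le_integrable fi => //.
  by apply/measurable_EFinP; apply: measurable_funM => //; exact: measurable_indic.
by move=> w _ /=; rewrite lee_fin normrM ler_piMl// indicE; case: (_ \in _); rewrite ?normr1 ?normr0.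
Qed.

End rintegral_tools.

Section square_integrable.
Context d (W : measurableType d) (R : realType) (mu : probability W R).

Definition sqi (f : W -> R) : Prop :=
  measurable_fun setT f /\ (\int[mu]_w ((f w) ^+ 2)%:E < +oo)%E.

(** A bound by two squares serves sums, running maxima and updates of the form
    [if ... then g else h]; a single bound is the case [h = 0]. *)
Lemma le_sqi (f g h : W -> R) : measurable_fun setT f ->
  (forall w, f w ^+ 2 <= g w ^+ 2 + h w ^+ 2) -> sqi g -> sqi h -> sqi f.
Proof.
move=> mf fgh [mg gi] [mh hi]; split => //.
have m2 (k : W -> R) : measurable_fun setT k -> measurable_fun setT (fun w => (k w ^+ 2)%:E).
  by move=> mk; apply/measurable_EFinP; exact: measurable_funX.
apply: (@le_lt_trans _ _ (\int[mu]_w ((g w ^+ 2)%:E + (h w ^+ 2)%:E))%E).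
  apply: ge0_le_integral => //.
  - by move=> w _; rewrite lee_fin sqr_ge0.
  - exact: m2.
  - by apply: emeasurable_funD; exact: m2.
  - by move=> w _; rewrite -EFinD lee_fin.
rewrite ge0_integralD//; try exact: m2; try (by move=> w _; rewrite lee_fin sqr_ge0).
by rewrite lte_add_pinfty.
Qed.

Lemma sqi0 : sqi (fun=> 0).
Proof. by split => //; rewrite integral0_eq ?ltry// => w _; rewrite expr0n. Qed.

Lemma sqiZ (k : R) f : sqi f -> sqi (fun w => k * f w).
Proof.
move=> [mf fi]; split; first exact: measurable_funM.
under eq_integral do rewrite exprMn EFinM.
rewrite ge0_integralZl_EFin ?sqr_ge0//; last first.
- by apply/measurable_EFinP; exact: measurable_funX.
- by move=> w _; rewrite lee_fin sqr_ge0.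
by rewrite lte_mul_pinfty ?lee_fin ?sqr_ge0.
Qed.

Lemma sqiD f g : sqi f -> sqi g -> sqi (fun w => f w + g w).
Proof.
move=> sf sg; apply: (@le_sqi _ (fun w => 2 * f w) (fun w => 2 * g w)).
- by apply: measurable_funD; [case: sf|case: sg].
- move=> w; have := sqr_ge0 (f w - g w); have := sqr_ge0 (f w); have := sqr_ge0 (g w).
  by nra.
- exact: sqiZ.
- exact: sqiZ.
Qed.

Lemma sqiN f : sqi f -> sqi (fun w => - f w).
Proof. by move=> /(sqiZ (-1)); under eq_fun do rewrite mulN1r. Qed.

Lemma sqiB f g : sqi f -> sqi g -> sqi (fun w => f w - g w).
Proof. by move=> sf sg; apply: sqiD => //; exact: sqiN. Qed.

Lemma sqi_cst (k : R) : sqi (fun=> k).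
Proof.
split => //; rewrite integral_cst//= probability_setT mule1 ltry//.
Qed.

Lemma sqiM_integrable f g : sqi f -> sqi g ->
  mu.-integrable setT (fun w => (f w * g w)%:E).
Proof.
move=> [mf fi] [mg gi].
have m2 (k : W -> R) : measurable_fun setT k -> measurable_fun setT (fun w => (k w ^+ 2)%:E).
  by move=> mk; apply/measurable_EFinP; exact: measurable_funX.
apply/integrableP; split; first by apply/measurable_EFinP; exact: measurable_funM.
apply: (@le_lt_trans _ _ (\int[mu]_w ((f w ^+ 2)%:E + (g w ^+ 2)%:E))%E).
  apply: ge0_le_integral => //.
  - by apply: measurableT_comp => //; apply/measurable_EFinP; exact: measurable_funM.
  - by apply: emeasurable_funD; exact: m2.
  - move=> w _; rewrite -EFinD lee_fin ler_norml; apply/andP; split; nra.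
rewrite ge0_integralD//; try exact: m2; try (by move=> w _; rewrite lee_fin sqr_ge0).
by rewrite lte_add_pinfty.
Qed.

Lemma sqi_integrable f : sqi f -> mu.-integrable setT (EFin \o f).
Proof.
move=> sf; have := sqiM_integrable sf (sqi_cst 1).
by under eq_fun do rewrite mulr1.
Qed.

Lemma sqi_sqr f : sqi f -> mu.-integrable setT (fun w => (f w ^+ 2)%:E).
Proof. by move=> sf; have := sqiM_integrable sf sf. Qed.

Lemma sqi_indic (C : set W) f : measurable C -> sqi f -> sqi (fun w => \1_C w * f w).
Proof.
move=> mC sf; apply: (@le_sqi _ f (fun=> 0)) => //; last exact: sqi0.
  by apply: measurable_funM; [exact: measurable_indic|case: sf].
move=> w; rewrite indicE; case: (_ \in _); rewrite ?mul1r ?mul0r expr0n ?addr0//.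
exact: sqr_ge0.
Qed.

End square_integrable.

Lemma funrpos_sub_neg (T : Type) (R : realType) (f : T -> R) w : f w = f^\+ w - f^\- w.
Proof. by have /(congr1 (@^~ w)) := funrposBneg f. Qed.

Lemma funrpos_add_neg (T : Type) (R : realType) (f : T -> R) w : `|f w| = f^\+ w + f^\- w.
Proof. by have /(congr1 (@^~ w)) := funrposDneg f. Qed.

(** * Pulling out known factors, and martingales on [[a, b]] *)

Section conditional.
Context d (W : measurableType d) (R : realType) (mu : probability W R).
Variable G : set (set W).
Hypothesis sG : sigma_algebra setT G.
Hypothesis subG : G `<=` measurable.

(** A vanishing conditional expectation means that the positive and negative parts of [h] have equal
    integrals over sets of [G]. Using [le_integral_density] in both directions equates their
    integrals against any nonnegative [G]-measurable weight, so that only the product [Y * h] has to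
    be integrable and [Y] may be unbounded. *)
Lemma cond_pull (h Y : W -> R) : mu.-integrable setT (EFin \o h) ->
  (forall B, G B -> \int[mu]_(w in B) h w = 0) ->
  measurable_wrt G Y -> mu.-integrable setT (fun w => (Y w * h w)%:E) ->
  \int[mu]_w (Y w * h w) = 0.
Proof.
move=> hi h0 /(measurable_wrtP sG) mY Yhi.
have mh : measurable_fun setT h by apply/measurable_EFinP; exact: (measurable_int _ hi).
have mYW : measurable_fun setT Y by exact: measurable_funT_sub mY.
have hpi := integrable_funrpos measurableT hi.
have hni := integrable_funrneg measurableT hi.
have hpE B : G B -> (\int[mu]_(w in B) (h^\+ w)%:E = \int[mu]_(w in B) (h^\- w)%:E)%E.
  move=> GB; have mB := subG GB.
  have sB : B `<=` setT by [].
  have pB := integrableS measurableT mB sB hpi.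
  have nB := integrableS measurableT mB sB hni.
  have := h0 _ GB; rewrite (@eq_Rintegral _ _ _ mu B (fun w => h^\+ w - h^\- w)); last first.
    by move=> w _; exact: funrpos_sub_neg.
  rewrite RintegralB// => /eqP; rewrite subr_eq0 => /eqP.
  move=> e; have := congr1 EFin e.
  by rewrite /Rintegral !fineK//; exact: integrable_fin_num.
(* Used for the positive and the negative part of [Y]; the bound by [|Y|] transfers the
   integrability of [Y * h]. *)
have key (Z : W -> R) : (forall w, 0 <= Z w) -> (forall w, Z w <= `|Y w|) ->
    measurable_fun setT (Z : g_sigma_algebraType G -> R) ->
    mu.-integrable setT (fun w => (Z w * h w)%:E) /\ \int[mu]_w (Z w * h w) = 0.
  move=> Z0 ZY mZ; have mZW : measurable_fun setT Z by exact: measurable_funT_sub mZ.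
  have Zi (q : W -> R) : measurable_fun setT q -> (forall w, `|q w| <= `|h w|) ->
    mu.-integrable setT (fun w => (Z w * q w)%:E).
    move=> mq qh; apply: le_integrable Yhi => //.
    by apply/measurable_EFinP; exact: measurable_funM.
    by move=> w _ /=; rewrite lee_fin !normrM ler_pM// ger0_norm.
  have hp w : `|h^\+ w| <= `|h w|.
    by rewrite ger0_norm ?funrpos_ge0// funrpos_add_neg lerDl funrneg_ge0.
  have hn w : `|h^\- w| <= `|h w|.
    by rewrite ger0_norm ?funrneg_ge0// funrpos_add_neg lerDr funrpos_ge0.
  have mp := measurable_funrpos mh; have mn := measurable_funrneg mh.
  split; first exact: Zi.
  rewrite (@eq_Rintegral _ _ _ mu setT (fun w => Z w * h^\+ w - Z w * h^\- w)); last first.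
    by move=> w _; rewrite -mulrBr -funrpos_sub_neg.
  rewrite RintegralB//; try exact: Zi.
  apply/eqP; rewrite subr_eq0; apply/eqP; congr fine.
  have EZ : measurable_fun setT ((EFin \o Z) : g_sigma_algebraType G -> \bar R).
    exact/measurable_EFinP.
  apply/eqP; rewrite eq_le; apply/andP; split.
    have := @le_integral_density _ _ _ _ sG subG mu _ _ (EFin \o Z) mp mn.
    by apply => // B /hpE ->.
  have := @le_integral_density _ _ _ _ sG subG mu _ _ (EFin \o Z) mn mp.
  by apply => // B /hpE ->.
have absY w : `|Y w| = Y^\+ w + Y^\- w.
  exact: funrpos_add_neg.
have [pi p0] : mu.-integrable setT (fun w => (Y^\+ w * h w)%:E) /\ \int[mu]_w (Y^\+ w * h w) = 0.
  apply: key => [w|w|]; [exact: funrpos_ge0| |exact: measurable_funrpos].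
  by rewrite absY lerDl funrneg_ge0.
have [ni n0] : mu.-integrable setT (fun w => (Y^\- w * h w)%:E) /\ \int[mu]_w (Y^\- w * h w) = 0.
  apply: key => [w|w|]; [exact: funrneg_ge0| |exact: measurable_funrneg].
  by rewrite absY lerDr funrpos_ge0.
rewrite (@eq_Rintegral _ _ _ mu setT (fun w => Y^\+ w * h w - Y^\- w * h w)); last first.
  by move=> w _; rewrite -mulrBl -funrpos_sub_neg.
by rewrite RintegralB// p0 n0 subr0.
Qed.

End conditional.

Section martingales.
Context d (W : measurableType d) (R : realType) (mu : probability W R).
Variables (Flt : R -> set (set W)) (a b : R).

Record filtration_on : Prop := FiltrationOn {
  flt_sigma : forall t, a <= t <= b -> sigma_algebra setT (Flt t);
  flt_sub : forall t, a <= t <= b -> Flt t `<=` measurable;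
  flt_mono : forall s t, a <= s -> s <= t -> t <= b -> Flt s `<=` Flt t }.

Hypothesis hF : filtration_on.
Implicit Types (M N : R -> W -> R).

Lemma flt_wrtP t : a <= t <= b -> forall f : W -> R,
  measurable_wrt (Flt t) f <-> measurable_fun setT (f : g_sigma_algebraType (Flt t) -> R).
Proof. by move=> tab f; exact: (measurable_wrtP (flt_sigma hF tab)). Qed.

Lemma adapted_measurable M t : adapted Flt a b M -> a <= t <= b ->
  measurable_fun setT (M t).
Proof.
move=> adM tab; apply: (measurable_funT_sub (flt_sigma hF tab) (flt_sub hF tab)).
by apply/(measurable_wrtP (flt_sigma hF tab)); exact: adM.
Qed.

Lemma measurable_wrt_mono s t (f : W -> R) : a <= s -> s <= t -> t <= b ->
  measurable_wrt (Flt s) f -> measurable_wrt (Flt t) f.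
Proof. by move=> ha st tb mf B mB; apply: (flt_mono hF ha st tb); exact: mf. Qed.

Lemma wrt_measurable t (f : W -> R) : a <= t <= b ->
  measurable_wrt (Flt t) f -> measurable_fun setT f.
Proof.
move=> tab mf; apply: (measurable_funT_sub (flt_sigma hF tab) (flt_sub hF tab)).
by apply/(measurable_wrtP (flt_sigma hF tab)).
Qed.

Lemma martingaleI M : adapted Flt a b M ->
  (forall t, a <= t <= b -> mu.-integrable setT (EFin \o M t)) ->
  (forall r t B, a <= r -> r <= t -> t <= b -> Flt r B ->
  \int[mu]_(w in B) M r w = \int[mu]_(w in B) M t w) ->
  martingale mu Flt a b M.
Proof.
move=> adM iM eM; split=> //; split=> // u t au ut tb; split => //.
- by apply: iM; rewrite (le_trans au).
- by apply: iM; rewrite au (le_trans ut).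
- by apply: adM; rewrite au (le_trans ut).
- by move=> B FB; exact: eM.
Qed.

Lemma martingale_eq M r t B : martingale mu Flt a b M ->
  a <= r -> r <= t -> t <= b -> Flt r B ->
  \int[mu]_(w in B) M r w = \int[mu]_(w in B) M t w.
Proof. by move=> [_ [_ eM]] ar rt tb; have [_ _ _] := eM _ _ ar rt tb; apply. Qed.

Lemma martingale_int M t : martingale mu Flt a b M -> a <= t <= b ->
  mu.-integrable setT (EFin \o M t).
Proof. by move=> [_ [+ _]]; apply. Qed.

Lemma martingale_measurable M t : martingale mu Flt a b M -> a <= t <= b ->
  measurable_fun setT (M t).
Proof. by move=> [+ _]; exact: adapted_measurable. Qed.

Lemma flt_measurable t B : a <= t <= b -> Flt t B -> measurable B.
Proof. by move=> tab; exact: (flt_sub hF tab). Qed.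

Lemma martingale_linear M N (k : R) : martingale mu Flt a b M ->
  martingale mu Flt a b N -> martingale mu Flt a b (fun t w => k * M t w + N t w).
Proof.
move=> mM mN; apply: martingaleI.
- move=> t tab; have sF := flt_sigma hF tab; apply/(measurable_wrtP sF).
  apply: measurable_funD; first apply: measurable_funM => //.
    by apply/(measurable_wrtP sF); case: mM => + _; exact.
  by apply/(measurable_wrtP sF); case: mN => + _; exact.
- move=> t tab; have := integrableD measurableT (integrableZl measurableT k (martingale_int mM tab)) (martingale_int mN tab).
  by apply: eq_integrable => // w _ /=.
- move=> r t B ar rt tb FB.
  have rab : a <= r <= b by rewrite ar (le_trans rt).
  have tab : a <= t <= b by rewrite (le_trans ar).
  have mB := flt_measurable rab FB.
  have iM s : a <= s <= b -> mu.-integrable B (EFin \o M s).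
    by move=> sab; apply: integrableS (martingale_int mM sab).
  have iN s : a <= s <= b -> mu.-integrable B (EFin \o N s).
    by move=> sab; apply: integrableS (martingale_int mN sab).
  have ikM s : a <= s <= b -> mu.-integrable B (EFin \o (fun w => k * M s w)).
    by move=> sab; apply: eq_integrable (integrableZl mB k (iM _ sab)) => //.
  rewrite !RintegralD//; try (by apply: ikM); try (by apply: iN).
  rewrite !RintegralZl//; try (by apply: iM).
  by rewrite (martingale_eq mM ar rt tb FB) (martingale_eq mN ar rt tb FB).
Qed.

Lemma martingale_cst (k : R) : martingale mu Flt a b (fun _ _ => k).
Proof.
apply: martingaleI => // t tab; last exact: finite_measure_integrable_cst.
by apply/(measurable_wrtP (flt_sigma hF tab)); exact: measurable_cst.
Qed.

Lemma martingaleZ M (k : R) : martingale mu Flt a b M ->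
  martingale mu Flt a b (fun t w => k * M t w).
Proof.
move=> mM; have := martingale_linear k mM (martingale_cst 0).
by under eq_fun do under eq_fun do rewrite addr0.
Qed.

Lemma martingaleD M N : martingale mu Flt a b M ->
  martingale mu Flt a b N -> martingale mu Flt a b (fun t w => M t w + N t w).
Proof.
move=> mM mN; have := martingale_linear 1 mM mN.
by under eq_fun do under eq_fun do rewrite mul1r.
Qed.

Lemma martingaleB M N : martingale mu Flt a b M ->
  martingale mu Flt a b N -> martingale mu Flt a b (fun t w => M t w - N t w).
Proof.
move=> mM mN; apply: martingaleD => //.
have := martingaleZ (-1) mN.
by under eq_fun do under eq_fun do rewrite mulN1r.
Qed.

Lemma modification_martingale M N : martingale mu Flt a b M -> adapted Flt a b N ->
  (forall t, a <= t <= b -> {ae mu, forall w, M t w = N t w}) ->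
  martingale mu Flt a b N.
Proof.
move=> mM adN MN; have mN t : a <= t <= b -> measurable_fun setT (N t).
  exact: adapted_measurable.
apply: martingaleI => //.
- move=> t tab; apply: (@ae_eq_integrable _ _ _ mu setT (M t)) => //.
  + exact: mN.
  + by have := MN _ tab; apply: filterS.
  + exact: martingale_int.
- move=> r t B ar rt tb FB.
  have rab : a <= r <= b by rewrite ar (le_trans rt).
  have tab : a <= t <= b by rewrite (le_trans ar).
  have mB := flt_measurable rab FB.
  have E s : a <= s <= b -> \int[mu]_(w in B) M s w = \int[mu]_(w in B) N s w.
    move=> sab; apply: ae_eq_Rintegral => //.
    - by apply: measurable_funTS; exact: martingale_measurable.
    - by apply: measurable_funTS; exact: mN.
    - by have := MN _ sab; apply: filterS.
  by rewrite -!E//; exact: martingale_eq.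
Qed.

(** On each of the two sets where [M r] keeps its sign, the absolute value can be taken outside the
    integral, where the martingale equality applies; both sets belong to [Flt r]. *)
Lemma martingale_le_abs M r t B : martingale mu Flt a b M ->
  a <= r -> r <= t -> t <= b -> Flt r B ->
  (\int[mu]_(w in B) `|M r w|%:E <= \int[mu]_(w in B) `|M t w|%:E)%E.
Proof.
move=> mM ar rt tb FB.
have rab : a <= r <= b by rewrite ar (le_trans rt).
have tab : a <= t <= b by rewrite (le_trans ar).
have sF := flt_sigma hF rab.
have mMr : measurable_fun setT (M r : g_sigma_algebraType (Flt r) -> R).
  by apply/(measurable_wrtP sF); case: mM => + _; exact.
pose P := [set w | 0 <= M r w].
have FP : Flt r P.
  apply: (g_sigma_measurable sF).
  rewrite (_ : P = setT `&` M r @^-1` `[0, +oo[%classic); first exact: mMr.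
  by apply/seteqP; split=> w; rewrite /P /= in_itv/= andbT => // -[].
have FI A C : Flt r A -> Flt r C -> Flt r (A `&` C).
  by rewrite -(g_sigma_id sF) => mA mC; exact: measurableI.
have FPC : Flt r (~` P) by move: FP; rewrite -(g_sigma_id sF); exact: measurableC.
have mB := flt_measurable rab FB.
have iM A s : measurable A -> a <= s <= b -> mu.-integrable A (EFin \o M s).
  by move=> mA sab; apply: integrableS (martingale_int mM sab).
have mabs A s : measurable A -> a <= s <= b -> measurable_fun A (fun w => `|M s w|%:E).
  move=> mA sab; apply/measurable_EFinP; apply: measurableT_comp => //.
  by apply: measurable_funTS; exact: martingale_measurable.
have half A : Flt r A -> A `<=` P \/ A `<=` ~` P ->
    (\int[mu]_(w in A) `|M r w|%:E <= \int[mu]_(w in A) `|M t w|%:E)%E.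
  move=> FA hA; have mA := flt_measurable rab FA.
  have -> : (\int[mu]_(w in A) `|M r w|%:E = `|\int[mu]_(w in A) (M r w)%:E|)%E.
    case: hA => hA.
    rewrite gee0_abs; last by apply: integral_ge0 => w /hA; rewrite lee_fin.
    by apply: eq_integral => w /set_mem/hA /= ?; rewrite ger0_norm.
    rewrite (_ : integral mu A _ = \int[mu]_(w in A) - (M r w)%:E)%E; last first.
    apply: eq_integral => w /set_mem/hA /= /negP.
    by rewrite -ltNge => /ltW ?; rewrite ler0_norm.
    have h0 w : A w -> (0 <= (- M r w)%:E)%E.
    by move=> /hA /= /negP; rewrite -ltNge lee_fin oppr_ge0 => /ltW.
    have -> : (\int[mu]_(w in A) (M r w)%:E = - \int[mu]_(w in A) - (M r w)%:E)%E.
    rewrite -integral_ge0N//; first by apply: eq_integral => w _; rewrite oppeK.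
    rewrite abseN gee0_abs//; exact: integral_ge0.
  have -> : (\int[mu]_(w in A) (M r w)%:E = \int[mu]_(w in A) (M t w)%:E)%E.
    have := congr1 EFin (martingale_eq mM ar rt tb FA).
    by rewrite /Rintegral !fineK//; apply: integrable_fin_num => //; exact: iM.
  exact: le_abse_integral (measurable_int _ (iM _ _ mA tab)).
have mP := flt_measurable rab FP.
have split s : a <= s <= b -> (\int[mu]_(w in B) `|M s w|%:E =
   \int[mu]_(w in B `&` P) `|M s w|%:E + \int[mu]_(w in B `&` ~` P) `|M s w|%:E)%E.
  move=> sab; rewrite -[in LHS](setUIDK B P) setDE ge0_integral_setU//.
  - exact: measurableI.
  - by apply: measurableI => //; exact: measurableC.
  - by rewrite -setDE setUIDK; exact: mabs.
  - by apply/disj_set2P/seteqP; split=> // w [[_ Pw] [_]].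
rewrite !split//; apply: leeD; apply: half.
- exact: FI.
- by left; exact: subIsetr.
- exact: FI.
- by right; exact: subIsetr.
Qed.

(** No product is assumed integrable and both sides may be infinite. This is what makes [Y * M r]
    integrable as soon as [Y * M t] is. *)
Lemma martingale_pull_le M r t (Y : W -> R) : martingale mu Flt a b M ->
  a <= r -> r <= t -> t <= b -> measurable_wrt (Flt r) Y ->
  (\int[mu]_w `|Y w * M r w|%:E <= \int[mu]_w `|Y w * M t w|%:E)%E.
Proof.
move=> mM ar rt tb mY.
have rab : a <= r <= b by rewrite ar (le_trans rt).
have tab : a <= t <= b by rewrite (le_trans ar).
under eq_integral do rewrite normrM EFinM.
under [leRHS]eq_integral do rewrite normrM EFinM.
have sF := flt_sigma hF rab.
apply: (le_integral_density sF (flt_sub hF rab) (Y := fun w => `|Y w|%:E)) => //.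
- by apply: measurableT_comp => //; exact: martingale_measurable.
- by apply: measurableT_comp => //; exact: martingale_measurable.
- by move=> B FB; exact: martingale_le_abs.
- by apply/measurable_EFinP; apply: measurableT_comp => //; exact/(measurable_wrtP sF).
Qed.

Lemma martingale_pull_int M r t (Y : W -> R) : martingale mu Flt a b M ->
  a <= r -> r <= t -> t <= b -> measurable_wrt (Flt r) Y ->
  mu.-integrable setT (fun w => (Y w * M t w)%:E) ->
  mu.-integrable setT (fun w => (Y w * M r w)%:E).
Proof.
move=> mM ar rt tb mY /integrableP[_ iYM].
have rab : a <= r <= b by rewrite ar (le_trans rt).
apply/integrableP; split.
  apply/measurable_EFinP; apply: measurable_funM; last exact: martingale_measurable.
  exact: wrt_measurable mY.
by apply: le_lt_trans iYM; exact: martingale_pull_le.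
Qed.

Lemma martingale_pull M r t (Y : W -> R) : martingale mu Flt a b M ->
  a <= r -> r <= t -> t <= b -> measurable_wrt (Flt r) Y ->
  mu.-integrable setT (fun w => (Y w * M t w)%:E) ->
  \int[mu]_w (Y w * M r w) = \int[mu]_w (Y w * M t w).
Proof.
move=> mM ar rt tb mY iYt.
have rab : a <= r <= b by rewrite ar (le_trans rt).
have tab : a <= t <= b by rewrite (le_trans ar).
have iYr := martingale_pull_int mM ar rt tb mY iYt.
apply/eqP; rewrite -subr_eq0 -RintegralB//; apply/eqP.
have ih : mu.-integrable setT (EFin \o (fun w => M r w - M t w)).
  have := integrableB measurableT (martingale_int mM rab) (martingale_int mM tab).
  by apply: eq_integrable.
rewrite (@eq_Rintegral _ _ _ mu setT (fun w => Y w * (M r w - M t w))); last first.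
  by move=> w _; rewrite mulrBr.
apply: (cond_pull (flt_sigma hF rab) (flt_sub hF rab)) => //.
- move=> B FB; have mB := flt_measurable rab FB.
  rewrite RintegralB//; last 2 first.
  + exact: integrableS (martingale_int mM rab).
  + exact: integrableS (martingale_int mM tab).
  by rewrite (martingale_eq mM ar rt tb FB) subrr.
- have := integrableB measurableT iYr iYt.
  by apply: eq_integrable => // w _ /=; rewrite -EFinB mulrBr.
Qed.

Section fubini_martingale.
Variables (la : {sigma_finite_measure set (measurableTypeR R) -> \bar R}) (M k : R -> W -> R) (p t : R).
Hypotheses (mM : martingale mu Flt a b M) (ap : a <= p) (tb : t <= b).
Hypothesis jM : measurable_fun ((Ioc R p t) `*` setT) (fun z => M z.1 z.2).
Hypothesis jk : measurable_fun ((Ioc R p t) `*` setT) (fun z => k z.1 z.2).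
Let mI : measurable (Ioc R p t). Proof. exact: measurable_itv. Qed.
Hypothesis ak : forall r, p < r <= t -> measurable_wrt (Flt r) (k r).
Hypothesis kMt : (\int[mu]_w \int[la]_(r in `]p, t]) `|k r w * M t w|%:E < +oo)%E.

Let rab r : p < r <= t -> a <= r /\ r <= t.
Proof. by move=> /andP[pr rt]; rewrite rt (le_trans ap (ltW pr)). Qed.

(** Nothing places [t] above [a] when []p, t]] is empty, so its bounds are derived from a point of
    the interval. *)
Let tab : (exists r, p < r <= t) -> a <= t <= b.
Proof. by move=> [r /rab[ar rt]]; rewrite tb (le_trans ar). Qed.

Let jMt : measurable_fun ((Ioc R p t) `*` setT) (fun z : measurableTypeR R * W => k z.1 z.2 * M t z.2).
Proof.
have [[r hr]|nr] := pselect (exists r, p < r <= t); last first.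
  rewrite (_ : _ `*` _ = set0); first exact: measurable_fun_set0.
  by apply/seteqP; split => // -[r w] [/= hr _]; apply: nr; exists r; rewrite in_itv/= in hr.
apply: measurable_funM => //; apply: measurable_funTS.
apply: (measurableT_comp (f := M t)) => //.
by apply: martingale_measurable => //; apply: tab; exists r.
Qed.

Let jMr : measurable_fun ((Ioc R p t) `*` setT) (fun z : measurableTypeR R * W => k z.1 z.2 * M z.1 z.2).
Proof. exact: measurable_funM. Qed.

Lemma fubini_martingale_le :
  (\int[mu]_w \int[la]_(r in `]p, t]) `|k r w * M r w|%:E <=
  \int[mu]_w \int[la]_(r in `]p, t]) `|k r w * M t w|%:E)%E.
Proof.
have mr : measurable_fun ((Ioc R p t) `*` setT) (fun z : measurableTypeR R * W => `|k z.1 z.2 * M z.1 z.2|%:E).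
  by apply/measurable_EFinP; exact: measurableT_comp.
have mt : measurable_fun ((Ioc R p t) `*` setT) (fun z : measurableTypeR R * W => `|k z.1 z.2 * M t z.2|%:E).
  by apply/measurable_EFinP; exact: measurableT_comp.
rewrite (tonelli_iter la mu mI (f := fun r w => `|k r w * M r w|%:E))//.
rewrite (tonelli_iter la mu mI (f := fun r w => `|k r w * M t w|%:E))//.
apply: ge0_le_integral => //.
- by move=> r _; apply: integral_ge0.
- exact: (@measurable_outer _ _ _ _ _ mu _ mI (fun r w => `|k r w * M r w|%:E) mr).
- exact: (@measurable_outer _ _ _ _ _ mu _ mI (fun r w => `|k r w * M t w|%:E) mt).
- move=> r /=; rewrite in_itv/= => hr; have [ar rt] := rab hr.
  by apply: martingale_pull_le => //; exact: ak.
Qed.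

(** At a fixed time [r] the factor [k r] is known, so [M r] may be replaced by [M t] under the mean;
    Fubini does this under the time integral. This identity takes the place of the vanishing mean of
    a stochastic integral throughout. *)
Lemma fubini_martingale :
  \int[mu]_w \int[la]_(r in `]p, t]) (k r w * M r w) =
  \int[mu]_w \int[la]_(r in `]p, t]) (k r w * M t w).
Proof.
have fr := le_lt_trans fubini_martingale_le kMt.
rewrite (fubini_Rswap (f := fun r w => k r w * M r w) mI _ fr)//.
rewrite (fubini_Rswap (f := fun r w => k r w * M t w) mI _ kMt)//.
apply: ae_eq_Rintegral => //.
- apply/measurable_EFinP; apply: (@eq_measurable_fun _ _ _ _ _ (fun r => (fine (\int[mu]_w (k r w * M r w)%:E))%:E)) => //.
  apply/measurable_EFinP; apply: measurableT_comp => //.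
  exact: (measurable_int _ (fubini_time_integrable (f := fun r w => k r w * M r w) mI _ fr)).
- apply/measurable_EFinP; apply: (@eq_measurable_fun _ _ _ _ _ (fun r => (fine (\int[mu]_w (k r w * M t w)%:E))%:E)) => //.
  apply/measurable_EFinP; apply: measurableT_comp => //.
  exact: (measurable_int _ (fubini_time_integrable (f := fun r w => k r w * M t w) mI _ kMt)).
- have := fubini_ae_time (f := fun r w => k r w * M t w) mI jMt kMt.
  apply: filterS => r /= h hr; have := hr; rewrite in_itv/= => hr'.
  have [ar rt] := rab hr'.
  by apply: martingale_pull => //; [exact: ak|exact: h].
Qed.

End fubini_martingale.

End martingales.

Section dominated.
Context d (W : measurableType d) (R : realType) (mu : {measure set W -> \bar R}).

Lemma Rintegral_dct (D : set W) (f_ : nat -> W -> R) (f g : W -> R) : measurable D ->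
  (forall n, measurable_fun D (f_ n)) -> measurable_fun D f ->
  {ae mu, forall x, D x -> f_ n x @[n --> \oo] --> f x} ->
  mu.-integrable D (EFin \o g) ->
  {ae mu, forall x n, D x -> `|f_ n x| <= g x} ->
  mu.-integrable D (EFin \o f) /\
  (\int[mu]_(x in D) f_ n x @[n --> \oo] --> \int[mu]_(x in D) f x).
Proof.
move=> mD mf_ mf ff ig fg.
have [] := @dominated_convergence _ _ _ mu D mD (fun n => EFin \o f_ n) (EFin \o f) (EFin \o g).
- by move=> n; exact/measurable_EFinP.
- exact/measurable_EFinP.
- apply: filterS ff => x /= + Dx => /(_ Dx) h; apply: cvg_EFin; [exact: nearW|exact: h].
- by [].
- by apply: filterS fg => x /= + n Dx => /(_ n Dx); rewrite lee_fin.
move=> fi _ cv; split => //.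
apply: fine_cvg; rewrite fineK//; exact: integrable_fin_num.
Qed.

End dominated.

(** * Indefinite integrals with respect to [V]: continuity, integration by parts, exponential,
    Gronwall *)

Section stieltjes_paths.
Context {R : realType} (V : cumulative R R).

Lemma dV_itv (s t : R) : s <= t -> dV V `]s, t]%classic = (V t - V s)%:E.
Proof.
move=> st; rewrite /lebesgue_stieltjes_measure /measure_extension/=.
by rewrite measurable_mu_extE/= ?wlength_itv_bnd//; exact: is_ocitv.
Qed.

Lemma dV_itv_lty (s t : R) : (dV V `]s, t]%classic < +oo)%E.
Proof.
have [st|ts] := leP s t; first by rewrite dV_itv// ltry.
by rewrite set_itv_ge ?measure0 ?ltry// bnd_simp -leNgt ltW.
Qed.

Lemma dV_cst_integrable (s t c : R) : dV_integrable V s t (cst c).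
Proof.
apply: measurable_bounded_integrable => //; first exact: dV_itv_lty.
by exists `|c|; split; [exact: num_real|move=> M cM w _ /=; exact: ltW].
Qed.

Variables (a b : R).
Hypothesis natom : no_atom V a b.

Definition pint (k : R -> R) (t : R) : R := \int[dV V]_(r in `]a, t]) k r.

Section one_path.
Variable k : R -> R.
Hypothesis ik : dV_integrable V a b k.

Lemma path_integrableS s t : a <= s -> t <= b -> dV_integrable V s t k.
Proof.
move=> ha tb; apply: integrableS ik => //.
by apply: subset_itv; rewrite bnd_simp.
Qed.

(** A moving upper bound becomes a moving integrand on the fixed domain []a, b]], which is the form
    that dominated convergence and Fubini need. *)
Lemma pint_indic t : t <= b ->
  pint k t = \int[dV V]_(r in `]a, b]) (\1_(`]-oo, t]%classic : set R) r * k r).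
Proof.
move=> tb; rewrite /pint [LHS]Rintegral_mkcond [RHS]Rintegral_mkcond.
apply: eq_Rintegral => r _; rewrite !patchE indicE !mem_setE !in_itv/=.
case: (ltP a r) => //= ar; case: (leP r t) => rt /=; rewrite ?mul1r ?mul0r ?if_same//.
by rewrite (le_trans rt tb).
Qed.

Lemma pint_split s t : a <= s -> s <= t -> t <= b ->
  pint k t = pint k s + \int[dV V]_(r in `]s, t]) k r.
Proof.
move=> ha st tb; rewrite /pint.
have E : `]a, t]%classic = `]a, s]%classic `|` `]s, t]%classic.
  by rewrite -itv_bndbnd_setU// bnd_simp.
rewrite [in LHS]E Rintegral_setU//.
- by rewrite -E; exact: path_integrableS.
- apply/disj_set2P/seteqP; split => // r []; rewrite /= !in_itv/= => /andP[_ rs] /andP[sr _].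
  by have := lt_le_trans sr rs; rewrite ltxx.
Qed.

Lemma pint_start : pint k a = 0.
Proof. by rewrite /pint set_itv_ge ?Rintegral_set0// bnd_simp ltxx. Qed.

(** The indicators of []-oo, u n]] converge at every point other than [t], and [t] is null by
    [natom]; dominated convergence does the rest. Sequences may approach [t] from both sides. *)
Lemma pint_cvg (u : nat -> R) t : (forall n, u n <= b) -> t <= b ->
  u n @[n --> \oo] --> t -> pint k (u n) @[n --> \oo] --> pint k t.
Proof.
move=> ub tb ut; rewrite (pint_indic tb).
under eq_fun do rewrite pint_indic//.
have mk : measurable_fun `]a, b]%classic k by apply/measurable_EFinP; exact: (measurable_int _ ik).
have mi c : measurable_fun `]a, b]%classic (fun r => \1_(`]-oo, c]%classic : set R) r * k r).
  by apply: measurable_funM => //; apply: measurable_indic.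
have dct := @Rintegral_dct _ _ _ (dV V) `]a, b]%classic
  (fun n r => \1_(`]-oo, u n]%classic : set R) r * k r)
  (fun r => \1_(`]-oo, t]%classic : set R) r * k r) (Num.norm \o k) (measurable_itv _)
  (fun n => mi (u n)) (mi t).
suff ae : {ae dV V, forall r, `]a, b]%classic r ->
    \1_(`]-oo, u n]%classic : set R) r * k r @[n --> \oo] --> \1_(`]-oo, t]%classic : set R) r * k r}.
  apply: (proj2 (dct ae _ _)); first exact: integrable_norm.
  apply: aeW => r n _ /=; rewrite normrM ler_piMl//.
  by rewrite indicE; case: (_ \in _) => /=; rewrite ?normr1 ?normr0.
have ind c r : \1_(`]-oo, c]%classic : set R) r = (r <= c)%R%:R :> R.
  by rewrite indicE mem_setE in_itv.
have [at_|ta] := ltP a t; last first.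
  apply: aeW => r /=; rewrite in_itv/= => /andP[ar rb].
  have tr : t < r by exact: le_lt_trans ar.
  rewrite ind leNgt tr /= mul0r; apply: cvg_near_cst.
  have /cvgrPdist_lt/(_ (r - t)) := ut; rewrite subr_gt0 => /(_ tr).
  apply: filterS => n; rewrite ltr_distlC => /andP[_]; rewrite addrC subrK => h.
  by rewrite ind leNgt h mul0r.
exists [set t]; split => //; first by apply: natom; rewrite at_ tb.
move=> r /=; apply: contra_notP => /eqP rt.
rewrite in_itv/= => /andP[ar rb]; apply: cvg_near_cst.
have [rlt|trl] := ltP r t.
  have /cvgrPdist_lt/(_ (t - r)) := ut; rewrite subr_gt0 => /(_ rlt).
  apply: filterS => n; rewrite ltr_distlC => /andP[+ _]; rewrite opprB addrC subrK => h.
  by rewrite !ind (ltW h) (ltW rlt).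
have tr : t < r by rewrite lt_neqAle trl eq_sym rt.
have /cvgrPdist_lt/(_ (r - t)) := ut; rewrite subr_gt0 => /(_ tr).
apply: filterS => n; rewrite ltr_distlC => /andP[_]; rewrite addrC subrK => h.
by rewrite !ind !leNgt h tr.
Qed.

Lemma pint_cadlag : cadlag_on a b (pint k).
Proof.
(* [pint_cvg] concerns times up to [b], where [k] is integrable. Sequences are cut at [b], and
   [near] then removes a cut that is eventually inactive. *)
have C (u : nat -> R) t : t <= b -> u n @[n --> \oo] --> t ->
    pint k (Num.min (u n) b) @[n --> \oo] --> pint k t.
  move=> tb ut; apply: pint_cvg => //; first by move=> n; rewrite ge_min lexx orbT.
  apply/cvgrPdist_lt => e e0; have /cvgrPdist_lt/(_ e e0) := ut.
  apply: filterS => n; apply: le_lt_trans.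
  have [//|bu] := leP (u n) b.
  by rewrite !ler0_norm ?subr_le0 ?(le_trans tb (ltW bu))// lerN2 lerD2l lerN2 ltW.
have near (F : set_system R) t : Filter F -> (\forall r \near F, r <= b) ->
    pint k (Num.min r b) @[r --> F] --> pint k t -> pint k r @[r --> F] --> pint k t.
  move=> FF Fb; apply: cvg_trans; apply: near_eq_cvg.
  by apply: filterS Fb => r rb; rewrite min_l.
split=> t /andP[at_ tb].
  apply: near; first exact: nbhs_right_le.
  by apply/cvg_at_rightP => u [_ ut]; exact: (C u t (ltW tb) ut).
exists (pint k t); apply: near.
  by apply: filterS (nbhs_left_le t) => r rt; exact: le_trans tb.
by apply/cvg_at_leftP => u [_ ut]; exact: (C u t tb ut).
Qed.

(** The integral of [k] is the difference of those of [k + |k|] and [|k|], both non-decreasing. *)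
Lemma pint_bounded_variation : a <= b -> bounded_variation a b (pint k).
Proof.
rewrite le_eqVlt => /predU1P[<-|ab]; first exact: bounded_variationxx.
have inorm : dV_integrable V a b (Num.norm \o k) by exact: integrable_norm.
pose g t := \int[dV V]_(r in `]a, t]) `|k r|.
have gsplit s t : a <= s -> s <= t -> t <= b -> g t = g s + \int[dV V]_(r in `]s, t]) `|k r|.
  move=> ha st tb; rewrite /g.
  have E : `]a, t]%classic = `]a, s]%classic `|` `]s, t]%classic :> set R.
    by rewrite -itv_bndbnd_setU// bnd_simp.
  rewrite [in LHS]E Rintegral_setU//.
  - rewrite -E; apply: integrableS inorm => //; by apply: subset_itvl; rewrite bnd_simp.
  - apply/disj_set2P/seteqP; split => // r []; rewrite /= !in_itv/= => /andP[_ rs] /andP[sr _].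
    by have := lt_le_trans sr rs; rewrite ltxx.
have BVg : bounded_variation a b g.
  apply: nondecreasing_bounded_variation => s t.
  rewrite !in_itv/= => /andP[as_ sb] /andP[at_ tb] st.
  by rewrite (gsplit s t)// lerDl; apply: Rintegral_ge0.
have BVf : bounded_variation a b (pint k \+ g).
  apply: nondecreasing_bounded_variation => s t.
  rewrite !in_itv/= => /andP[as_ sb] /andP[at_ tb] st.
  rewrite /= (gsplit s t)// (pint_split as_ st tb) addrACA lerDl.
  have ikst : dV_integrable V s t k by exact: path_integrableS.
  have innst : dV_integrable V s t (Num.norm \o k) by exact: integrable_norm.
  rewrite -RintegralD//; apply: Rintegral_ge0 => r _ /=.
  by rewrite -lerBlDl sub0r lerNl; have := ler_norm (- k r); rewrite normrN lerNl.
have -> : pint k = (pint k \+ g) \+ (\- g) by apply/funext => t /=; rewrite addrK.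
by apply: bounded_variationD => //; exact: bounded_variationN.
Qed.

End one_path.
End stieltjes_paths.

Section measurable_inner_signed.
Context d1 d2 (T1 : measurableType d1) (W : measurableType d2) (R : realType).
Variables (la : {sigma_finite_measure set T1 -> \bar R}).
Variables (I : set T1) (mI : measurable I).

Lemma measurable_inner_signed (f : T1 -> W -> \bar R) :
  measurable_fun (I `*` setT) (fun z => f z.1 z.2) ->
  measurable_fun setT (fun w => \int[la]_(r in I) f r w)%E.
Proof.
move=> mf.
rewrite (_ : (fun w => _) = (fun w => \int[la]_(r in I) (f^~ w)^\+ r) \- (fun w => \int[la]_(r in I) (f^~ w)^\- r))%E; last first.
  by apply/funext => w; rewrite integralE.
apply: emeasurable_funB.
- apply: (measurable_inner la mI (f := fun r w => (f^~ w)^\+%E r)).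
    rewrite (_ : (fun z => _) = (fun z => f z.1 z.2)^\+%E); first exact: measurable_funepos.
    by apply/funext => -[r w]; rewrite !funeposE.
  by move=> r w _; exact: funepos_ge0.
- apply: (measurable_inner la mI (f := fun r w => (f^~ w)^\-%E r)).
    rewrite (_ : (fun z => _) = (fun z => f z.1 z.2)^\-%E); first exact: measurable_funeneg.
    by apply/funext => -[r w]; rewrite !funenegE.
  by move=> r w _; exact: funeneg_ge0.
Qed.

Lemma measurable_inner_Rintegral (f : T1 -> W -> R) :
  measurable_fun (I `*` setT) (fun z => f z.1 z.2) ->
  measurable_fun setT (fun w => \int[la]_(r in I) f r w).
Proof.
move=> mf; apply: (measurableT_comp (f := fine)) => //.
by apply: (measurable_inner_signed (f := fun r w => (f r w)%:E)); exact/measurable_EFinP.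
Qed.

End measurable_inner_signed.

Lemma indic_itvNy (R : realType) (t r : R) :
  \1_(`]-oo, t]%classic : set R) r = (r <= t)%R%:R :> R.
Proof. by rewrite indicE mem_setE in_itv. Qed.

Lemma indic_leq_pair (R : realType) (z : R * R) :
  \1_[set z : R * R | z.1 <= z.2] z = (z.1 <= z.2)%R%:R :> R.
Proof. by rewrite indicE; congr (nat_of_bool _)%:R; apply/idP/idP; rewrite inE. Qed.

Section stieltjes_calculus.
Context {R : realType} (V : cumulative R R).
Variables (a b : R).
Hypothesis natom : no_atom V a b.

Let itvS (s t u v : R) : u <= s -> t <= v -> `]s, t]%classic `<=` `]u, v]%classic.
Proof. by move=> us tv; apply: subset_itv; rewrite bnd_simp. Qed.

Section triangle.
Variables k l : R -> R.
Hypothesis ik : dV_integrable V a b k.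
Hypothesis il : dV_integrable V a b l.

Let mk : measurable_fun `]a, b]%classic k.
Proof. by apply/measurable_EFinP; exact: (measurable_int _ ik). Qed.

Lemma measurable_leq_pair : measurable [set z : measurableTypeR R * measurableTypeR R | z.1 <= z.2].
Proof.
rewrite (_ : [set z | _] = setT `&` (fun z : measurableTypeR R * measurableTypeR R => z.2 - z.1) @^-1` `[0, +oo[%classic).
  by apply: (measurable_funB (f := snd) (g := fst)).
by apply/seteqP; split => z /=; rewrite in_itv/= andbT subr_ge0 // => -[].
Qed.

Lemma measurable_pint : measurable_fun `]a, b]%classic (pint V a k).
Proof.
apply: (@eq_measurable_fun _ _ (measurableTypeR R) R _ (fun t : measurableTypeR R => \int[dV V]_(r in `]a, b])
   (k r * \1_[set z : measurableTypeR R * measurableTypeR R | z.1 <= z.2] (r, t)))).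
  move=> t; rewrite mem_setE in_itv/= => /andP[at_ tb].
  rewrite (pint_indic V a k tb); apply: eq_Rintegral => r _.
  by rewrite mulrC indic_itvNy (indic_leq_pair (r, t)).
apply: measurable_funTS.
apply: (measurable_inner_Rintegral (dV V) (measurable_itv _) (W := measurableTypeR R) (f := fun r t => k r * \1_[set z : measurableTypeR R * measurableTypeR R | z.1 <= z.2] (r, t))) => //.
apply: measurable_funM.
  apply: (@measurable_comp _ _ _ _ _ _ `]a, b]%classic k _ fst) => //.
    by move=> _ [[r w] [/= h _] <-].
  exact: measurable_funTS measurable_fst.
rewrite (_ : (fun z => _) = \1_[set z : measurableTypeR R * measurableTypeR R | z.1 <= z.2]).
  by apply: measurable_indic; exact: measurable_leq_pair.
by apply/funext => -[].
Qed.

Lemma pint_bound t : t <= b -> `|pint V a k t| <= \int[dV V]_(r in `]a, b]) `|k r|.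
Proof.
move=> tb; have ikt : dV_integrable V a t k.
  by apply: integrableS ik => //; exact: itvS.
have ikb : dV_integrable V a b (Num.norm \o k) by exact: integrable_norm.
have ikt' : dV_integrable V a t (Num.norm \o k) by exact: integrable_norm.
apply: le_trans (le_normr_Rintegral _ ikt) _ => //.
rewrite /Rintegral fine_le//.
- exact: integrable_fin_num ikt'.
- exact: integrable_fin_num ikb.
- apply: ge0_subset_integral => //; last exact: itvS.
  exact: (measurable_int _ ikb).
Qed.

End triangle.

Lemma pint_mul_integrable k l :
  dV_integrable V a b k ->
  dV_integrable V a b l ->
  dV_integrable V a b (fun r => pint V a k r * l r).
Proof.
move=> ik il; pose C := \int[dV V]_(r in `]a, b]) `|k r|.
have C0 : 0 <= C by apply: Rintegral_ge0.
apply: (le_integrable _ _ _ (integrableZl _ C il)) => //.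
  apply/measurable_EFinP; apply: measurable_funM; first exact: measurable_pint.
  by apply/measurable_EFinP; exact: (measurable_int _ il).
move=> r; rewrite /= in_itv/= => /andP[ar rb].
by rewrite lee_fin !normrM ler_wpM2r// (ger0_norm C0); exact: pint_bound.
Qed.

(** Integration by parts through Fubini on the triangle [r <= q] of the square. Integrating first in
    [r] gives int K l, first in [q] gives int (L(b) - L) k, where K and L are the two indefinite
    integrals. *)
Lemma pint_prod_end k l :
  dV_integrable V a b k ->
  dV_integrable V a b l ->
  pint V a k b * pint V a l b =
  \int[dV V]_(r in `]a, b]) (pint V a k r * l r + pint V a l r * k r).
Proof.
move=> ik il.
pose I : set R := `]a, b]%classic.
pose TT := measurableTypeR R.
pose D := [set z : TT * TT | z.1 <= z.2].
(* [l] is extended by zero because [q] ranges over the whole line in the iterated integral. *)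
pose f (r q : TT) := k r * ((l \_ I) q * \1_D (r, q)).
have mk : measurable_fun I k by apply/measurable_EFinP; exact: (measurable_int _ ik).
have ml : measurable_fun I l by apply/measurable_EFinP; exact: (measurable_int _ il).
have mD : measurable D by exact: measurable_leq_pair.
have mI : measurable (I : set TT) by exact: measurable_itv.
have mf : measurable_fun (I `*` setT) (fun z : TT * TT => f z.1 z.2).
  apply: measurable_funM.
    apply: (@measurable_comp _ _ _ _ _ _ I k _ fst) => //.
    by move=> _ [[r w] [/= h _] <-].
    exact: measurable_funTS measurable_fst.
  apply: measurable_funM.
    apply: measurable_funTS; apply: (measurableT_comp (f := l \_ I)); last exact: measurable_snd.
    exact/(measurable_restrictT _ mI).
  rewrite (_ : (fun z => _) = \1_D); first exact: measurable_indic.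
  by apply/funext => -[].
have fin : (\int[dV V]_q \int[dV V]_(r in I) `|f r q|%:E < +oo)%E.
  apply: (@le_lt_trans _ _ (\int[dV V]_q (`|(l \_ I) q|%:E * \int[dV V]_(r in I) `|k r|%:E))%E).
    apply: ge0_le_integral => //.
    - by move=> q _; apply: integral_ge0 => r _.
    - apply: (measurable_inner (dV V) mI (f := fun r q => `|f r q|%:E)) => //.
    by apply/measurable_EFinP; exact: measurableT_comp.
    - apply: emeasurable_funM => //; apply/measurable_EFinP; apply: measurableT_comp => //.
    exact/(measurable_restrictT _ mI).
    - move=> q _; rewrite -ge0_integralZl//; last by apply/measurable_EFinP; exact: measurableT_comp.
    apply: ge0_le_integral => //.
    + by apply/measurable_EFinP; apply: measurableT_comp => //; exact: (measurable_pathI mI q mf).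
    + by apply: emeasurable_funM => //; apply/measurable_EFinP; exact: measurableT_comp.
    + move=> r _; rewrite -EFinM lee_fin /f !normrM mulrCA ler_wpM2l// ler_piMr//.
    by rewrite indicE; case: (_ \in _); rewrite ?normr1 ?normr0.
  have /integrableP[_ ik'] := ik; have /integrableP[_ il'] := il.
  rewrite ge0_integralZr//; last 2 first.
  - by apply/measurable_EFinP; apply: measurableT_comp => //; exact/(measurable_restrictT _ mI).
  - by apply: integral_ge0.
  apply: lte_mul_pinfty; first exact: integral_ge0.
  - rewrite ge0_fin_numE; last exact: integral_ge0.
    rewrite (_ : integral _ _ _ = \int[dV V]_(x in I) `|(EFin \o l) x|)%E//.
    rewrite [RHS]integral_mkcond; apply: eq_integral => x _.
    by rewrite !patchE; case: ifP => //; rewrite normr0.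
  - exact: ik'.
have := @fubini_Rswap _ _ TT TT R (dV V) (dV V) I mI f mf fin.
have -> : \int[dV V]_q \int[dV V]_(r in I) f r q = \int[dV V]_(q in I) (pint V a k q * l q).
  rewrite [RHS]Rintegral_mkcond; apply: eq_Rintegral => q _.
  rewrite patchE; case: ifPn => qI; last first.
    under eq_Rintegral do rewrite /f patchE (negbTE qI) mul0r mulr0.
    by rewrite Rintegral_cst// mul0r.
  have qb : q <= b by move: qI; rewrite mem_setE in_itv/= => /andP[].
  rewrite (pint_indic V a k qb) -RintegralZr//.
    apply: eq_Rintegral => r _; rewrite /f patchE qI.
    rewrite indic_itvNy (indic_leq_pair (r, q)) /=; ring.
  apply: (le_integrable _ _ _ ik) => //.
    by apply/measurable_EFinP; apply: measurable_funM => //; exact: measurable_indic.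
  move=> r _ /=; rewrite lee_fin normrM ler_piMl// indicE.
  by case: (_ \in _); rewrite ?normr1 ?normr0.
have -> : \int[dV V]_(r in I) \int[dV V]_q f r q = \int[dV V]_(r in I) (pint V a l b * k r - pint V a l r * k r).
  apply: eq_Rintegral => r; rewrite mem_setE in_itv/= => /andP[ar rb].
  rewrite -mulrBl (_ : pint V a l b - pint V a l r = \int[dV V]_(q in `]r, b]) l q); last first.
    by rewrite (pint_split il (ltW ar) rb (lexx _)) addrAC subrr add0r.
  rewrite mulrC [X in _ = k r * X]Rintegral_mkcond -RintegralZl//; last first.
    rewrite -restrict_EFin.
    have mrb : measurable (Ioc R r b) by exact: measurable_itv.
    apply: (proj1 (@integrable_mkcond _ _ _ (dV V) _ (EFin \o l) mrb)).
    by apply: integrableS il => //; apply: itvS => //; exact: ltW.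
  apply: ae_eq_Rintegral => //.
    have Ir : I r by rewrite /I /= in_itv/= ar rb.
    exact: (measurable_sliceI mI Ir mf).
  have mrb : measurable (Ioc R r b) by exact: measurable_itv.
  apply: measurable_funM => //; apply/(measurable_restrictT _ mrb).
  by apply: measurable_funS ml => //; apply: itvS => //; exact: ltW.
  (* The two integrands differ on the diagonal [q = r] only: the triangle is closed there, []r, b]]
     is open. A single point carries no mass. *)
  exists [set r]; split => //; first by apply: natom; rewrite ar rb.
  move=> q /=; apply: contra_notP => /eqP qr _.
  rewrite /f !patchE !mem_setE !in_itv/= (indic_leq_pair (r, q))/=.
  have [rq|rq|rq] := ltgtP r q; last by rewrite rq eqxx in qr.
    by rewrite (lt_trans ar rq) /=; case: (leP q b) => _ /=; rewrite ?mulr1 ?mul0r ?mulr0.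
  by rewrite !mulr0.
have i1 := pint_mul_integrable ik il. have i2 := pint_mul_integrable il ik.
move=> e; rewrite RintegralD// e RintegralB//; last first.
  by have := integrableZl mI (pint V a l b) ik; apply: eq_integrable.
by rewrite subrK RintegralZl// mulrC.
Qed.

End stieltjes_calculus.

Section stieltjes_exponential.
Context {R : realType} (V : cumulative R R).
Variables (a b : R).
Hypothesis natom : no_atom V a b.

Let mI s t : measurable (Ioc R s t). Proof. exact: measurable_itv. Qed.

Let itvS (s t u v : R) : u <= s -> t <= v -> `]s, t]%classic `<=` `]u, v]%classic.
Proof. by move=> us tv; apply: subset_itv; rewrite bnd_simp. Qed.

Lemma pint_prod k l t : t <= b ->
  dV_integrable V a b k ->
  dV_integrable V a b l ->
  pint V a k t * pint V a l t = pint V a (fun r => pint V a k r * l r + pint V a l r * k r) t.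
Proof.
move=> tb ik il; apply: pint_prod_end.
- by move=> s /andP[as_ st]; apply: natom; rewrite as_ (le_trans st).
- by apply: integrableS ik => //; exact: itvS.
- by apply: integrableS il => //; exact: itvS.
Qed.

Variable k : R -> R.
Hypothesis ik : dV_integrable V a b k.
Notation D := (pint V a k).

Let integrable_comp (p : R -> R) (C : R) : measurable_fun setT p ->
  (forall r, a < r <= b -> `|p (D r)| <= C) ->
  dV_integrable V a b (fun r => p (D r) * k r).
Proof.
move=> mp pC.
have mk : measurable_fun (Ioc R a b) k by apply/measurable_EFinP; exact: (measurable_int _ ik).
apply: (le_integrable _ _ _ (integrableZl _ C ik)) => //.
  apply/measurable_EFinP; apply: measurable_funM => //.
  apply: (measurableT_comp (f := p)) => //; exact: measurable_pint.
move=> r; rewrite /= in_itv/= => /pC pr.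
rewrite lee_fin !normrM ler_wpM2r// (ger0_norm (le_trans _ pr))//.
Qed.

Let C0 := \int[dV V]_(r in `]a, b]) `|k r|.

Let DC r : r <= b -> `|D r| <= C0. Proof. exact: pint_bound. Qed.

Let C00 : 0 <= C0. Proof. exact: Rintegral_ge0. Qed.

Lemma pint_pow_integrable n :
  dV_integrable V a b (fun r => D r ^+ n * k r).
Proof.
apply: (integrable_comp (p := fun x => x ^+ n) (C := C0 ^+ n)) => //.
move=> r /andP[_ rb]; rewrite normrX; apply: lerXn2r; rewrite ?nnegrE//.
exact: DC.
Qed.

(** The chain rule for powers: [pint_prod] applied to the integrals representing [D ^+ n.+1] and
    [D]. *)
Lemma pint_pow n t : t <= b -> D t ^+ n.+1 = n.+1%:R * pint V a (fun r => D r ^+ n * k r) t.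
Proof.
elim: n t => [|n IH] t tb.
  by rewrite expr1 mul1r; apply: eq_Rintegral => r _; rewrite expr0 mul1r.
have ikn := pint_pow_integrable n.
have ikn' : dV_integrable V a b (fun r => n.+1%:R * (D r ^+ n * k r)).
  by have := integrableZl (mI a b) n.+1%:R ikn; apply: eq_integrable.
have itb s (l : R -> R) : s <= b -> dV_integrable V a b l ->
   dV_integrable V a s l.
  by move=> sb il; apply: integrableS il => //; exact: itvS.
have E s : s <= b -> pint V a (fun r => n.+1%:R * (D r ^+ n * k r)) s = D s ^+ n.+1.
  by move=> sb; rewrite /pint RintegralZl//; [rewrite IH|exact: itb].
rewrite exprSr -{1}E// pint_prod//.
rewrite -RintegralZl//; last exact: itb (pint_pow_integrable n.+1).
apply: eq_Rintegral => r; rewrite mem_setE in_itv/= => /andP[ar rt].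
rewrite E; last exact: le_trans tb.
rewrite -[in RHS]natr1 exprS; ring.
Qed.

Let s N (x : R) := \sum_(i < N) x ^+ i / i`!%:R.

Let sE x N : s N x = series (exp_coeff x) N.
Proof. by rewrite /series/= big_mkord. Qed.

Let s_cvg x : s N x @[N --> \oo] --> expR x.
Proof. by under eq_fun do rewrite sE; exact: is_cvg_series_exp_coeff. Qed.

Let s_abs N x : `|s N x| <= expR `|x|.
Proof.
apply: (@le_trans _ _ (s N `|x|)).
  rewrite /s (le_trans (ler_norm_sum _ _ _))//; apply: ler_sum => i _.
  by rewrite normrM normrX ler_wpM2l ?exprn_ge0// ger0_norm// invr_ge0.
rewrite -(cvg_lim _ (@s_cvg `|x|))//; apply: nondecreasing_cvgn_le.
  apply/nondecreasing_seqP => n; rewrite /s big_ord_recr/= lerDl.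
  by rewrite mulr_ge0 ?exprn_ge0 ?invr_ge0.
by apply/cvg_ex; exists (expR `|x|); exact: s_cvg.
Qed.

Let ms N : measurable_fun setT (s N : R -> R).
Proof.
apply: measurable_sum => i; apply: measurable_funM => //.
Qed.

Let is_ N : dV_integrable V a b (fun r => s N (D r) * k r).
Proof.
apply: (integrable_comp (C := expR C0)) => // r /andP[_ rb].
by apply: le_trans (s_abs _ _) _; rewrite ler_expR; exact: DC.
Qed.

Lemma pint_expR_integrable :
  dV_integrable V a b (fun r => expR (D r) * k r).
Proof.
apply: (integrable_comp (C := expR C0)) => // r /andP[_ rb].
rewrite ger0_norm ?expR_ge0// ler_expR.
by apply: le_trans (ler_norm _) _; exact: DC.
Qed.

Let s_pint N t : t <= b -> s N.+1 (D t) = 1 + pint V a (fun r => s N (D r) * k r) t.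
Proof.
move=> tb; elim: N => [|N IH].
  rewrite /s big_ord_recl/= expr0 divr1 big_ord0 addr0 /pint.
  rewrite (_ : \int[_]_(_ in _) _ = 0) ?addr0//.
  rewrite (@eq_Rintegral _ _ _ _ _ (cst 0)); first by rewrite Rintegral_cst// mul0r.
  by move=> r _; rewrite big_ord0 mul0r.
have itb l : dV_integrable V a b l ->
   dV_integrable V a t l.
  by move=> il; apply: integrableS il => //; exact: itvS.
rewrite {1}/s big_ord_recr/= -/(s N.+1 (D t)) IH -addrA; congr (_ + _).
rewrite pint_pow// -/(pint V a _ t) factS natrM invfM.
have -> : forall x, N.+1%:R * x * (N.+1%:R^-1 * (N`!%:R)^-1) = (N`!%:R)^-1 * x :> R.
  by move=> x; rewrite mulrACA [_ * N.+1%:R^-1]mulfV ?mul1r// ?pnatr_eq0//; rewrite mulrC.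
rewrite /pint -RintegralZl//; last exact: itb (pint_pow_integrable N).
rewrite -RintegralD//; last 2 first.
- exact: itb (is_ N).
- by have := integrableZl (mI a t) (N`!%:R)^-1 (itb _ (pint_pow_integrable N)); apply: eq_integrable.
apply: eq_Rintegral => r _; rewrite /s [in RHS]big_ord_recr/=; ring.
Qed.

(** The chain rule for the exponential. Termwise integration of the power series gives [s_pint], and
    all partial sums along [D] are below [expR C0], so the limit passes under the integral. *)
Lemma expR_pint t : t <= b -> expR (D t) = 1 + pint V a (fun r => expR (D r) * k r) t.
Proof.
move=> tb.
have mk : measurable_fun (Ioc R a t) k.
  apply: measurable_funS (_ : measurable_fun (Ioc R a b) k) => //.
    exact: itvS.
  by apply/measurable_EFinP; exact: (measurable_int _ ik).
have mD : measurable_fun (Ioc R a t) D.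
  by apply: measurable_funS (measurable_pint ik) => //; exact: itvS.
have cv : pint V a (fun r => s N (D r) * k r) t @[N --> \oo] --> pint V a (fun r => expR (D r) * k r) t.
  apply: (proj2 (@Rintegral_dct _ _ _ (dV V) _ (fun N r => s N (D r) * k r) (fun r => expR (D r) * k r)
    (fun r => expR C0 * `|k r|) (mI a t) _ _ _ _ _)).
  - by move=> N; apply: measurable_funM => //; exact: (measurableT_comp (f := s N)).
  - by apply: measurable_funM => //; exact: (measurableT_comp (f := expR)).
  - by apply: aeW => r _; apply: cvgM; [exact: s_cvg|exact: cvg_cst].
  - have ikt : dV_integrable V a t k by apply: integrableS ik => //; exact: itvS.
    have ikn : dV_integrable V a t (Num.norm \o k) by exact: integrable_norm.
    by have := integrableZl (mI a t) (expR C0) ikn; apply: eq_integrable.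
  - apply: aeW => r N /=; rewrite in_itv/= => /andP[_ rt]; rewrite normrM ler_wpM2r//.
    apply: le_trans (s_abs _ _) _; rewrite ler_expR; apply: DC.
    exact: le_trans tb.
have : s N.+1 (D t) @[N --> \oo] --> 1 + pint V a (fun r => expR (D r) * k r) t.
  by under eq_fun do rewrite s_pint//; apply: cvgD => //; exact: cvg_cst.
have : s N.+1 (D t) @[N --> \oo] --> expR (D t).
  by rewrite (@cvg_shiftS _ (fun N => s N (D t))); exact: s_cvg.
by move=> c1 c2; exact: (cvg_unique _ c1 c2).
Qed.

End stieltjes_exponential.

Section gronwall.
Context {R : realType} (V : cumulative R R).
Variables (a b : R).
Hypothesis natom : no_atom V a b.

(** Let Phi be the integral of [h] and [E] the exponential of the integral of [C]. By hypothesis E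
    (C (Phi b - Phi) - h) >= 0, and this is the density of E (Phi b - Phi), whose total increment is
    - Phi b. Hence Phi b <= 0, which together with [h >= 0] forces [h = 0]. *)
Lemma backward_gronwall (h : R -> R) (C : R) : 0 <= C ->
  dV_integrable V a b h ->
  (forall t, a <= t <= b -> 0 <= h t <= C * \int[dV V]_(r in `]t, b]) h r) ->
  forall t, a <= t <= b -> h t = 0.
Proof.
move=> C0 ih hC t /andP[at_ tb].
have ab := le_trans at_ tb.
have ic : dV_integrable V a b (fun=> C) by exact: dV_cst_integrable.
pose E r := expR (pint V a (fun=> C) r).
pose e r := E r * C.
have ie : dV_integrable V a b e by exact: pint_expR_integrable.
pose Phi := pint V a h.
have EE r : r <= b -> E r = 1 + pint V a e r by exact: expR_pint.
have prod := pint_prod natom (lexx b) ie ih.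
have prod' : \int[dV V]_(r in `]a, b]) (pint V a e r * h r + Phi r * e r) = pint V a e b * Phi b by exact: esym prod.
have i1 := pint_mul_integrable ie ih. have i2 := pint_mul_integrable ih ie.
have Psi r : a <= r <= b -> \int[dV V]_(q in `]r, b]) h q = Phi b - Phi r.
  by move=> /andP[ar rb]; rewrite /Phi (pint_split ih ar rb (lexx _)) addrAC subrr add0r.
have mI : measurable (Ioc R a b) by exact: measurable_itv.
have Phib : Phi b <= 0.
  have iPe : dV_integrable V a b (fun r => Phi b * e r).
    by have := integrableZl mI (Phi b) ie; apply: eq_integrable.
  (* Integration by parts cancels the two terms [pint V a e b * Phi b]; what is left is the boundary
     term at [a]. *)
  have key : \int[dV V]_(r in `]a, b]) (Phi b * e r - (pint V a e r * h r + Phi r * e r) - h r) = - Phi b.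
    have i12 := integrableD mI i1 i2.
    rewrite RintegralB//; last first.
    have := integrableB mI iPe i12; apply: eq_integrable => //.
    rewrite RintegralB//.
    rewrite RintegralZl// prod'.
    rewrite -/(pint V a e b) -/(pint V a h b) -/(Phi b); ring.
  rewrite -oppr_ge0 -key; apply: Rintegral_ge0 => r; rewrite /= in_itv/= => /andP[ar rb].
  have rab : a <= r <= b by rewrite (ltW ar).
  have /andP[_ h2] := hC _ rab; rewrite Psi// in h2.
  have E0 : 0 <= E r by exact: expR_ge0.
  rewrite (_ : _ - _ = E r * (C * (Phi b - Phi r) - h r)); last first.
    by rewrite /e (EE _ rb); ring.
  by rewrite mulr_ge0// subr_ge0.
have h0 r : a <= r <= b -> 0 <= h r by move=> /hC/andP[].
have Phit : 0 <= Phi t.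
  apply: Rintegral_ge0 => r; rewrite /= in_itv/= => /andP[ar rt].
  by apply: h0; rewrite (ltW ar) (le_trans rt).
have tab : a <= t <= b by rewrite at_.
have /andP[h1 h2] := hC _ tab; apply/eqP; rewrite eq_le h1 andbT.
apply: le_trans h2 _; rewrite Psi// mulr_ge0_le0// subr_le0.
exact: le_trans Phit.
Qed.

End gronwall.

(** * Dyadic grids; progressive and predictable processes *)

Section dyadic_grid.
Context {R : realType} (a : R).
Implicit Types (n k : nat) (r : R).

Definition grid n k : R := a + k%:R / 2 ^+ n.

Definition ridx n r : nat := Num.truncn ((r - a) * 2 ^+ n).

(* The index k with grid n k < r <= grid n k.+1. *)
Definition lidx n r : nat :=
  let x := (r - a) * 2 ^+ n in
  if (Num.truncn x)%:R == x then (Num.truncn x).-1 else Num.truncn x.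

Lemma grid_lt n k r : (grid n k < r) = (k%:R < (r - a) * 2 ^+ n).
Proof. by rewrite /grid -ltrBrDl ltr_pdivrMr. Qed.

Lemma grid_le n k r : (grid n k <= r) = (k%:R <= (r - a) * 2 ^+ n).
Proof. by rewrite /grid -lerBrDl ler_pdivrMr. Qed.

Lemma le_grid n k r : (r <= grid n k) = ((r - a) * 2 ^+ n <= k%:R).
Proof. by rewrite /grid -lerBlDl ler_pdivlMr. Qed.

Lemma lt_grid n k r : (r < grid n k) = ((r - a) * 2 ^+ n < k%:R).
Proof. by rewrite /grid -ltrBlDl ltr_pdivlMr. Qed.

Lemma grid_ge n k : a <= grid n k.
Proof. by rewrite /grid lerDl divr_ge0// ltW. Qed.

Lemma grid0 n : grid n 0 = a. Proof. by rewrite /grid mul0r addr0. Qed.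

Lemma grid_mono n k l : (k <= l)%N -> grid n k <= grid n l.
Proof. by move=> kl; rewrite /grid lerD2l ler_pM2r ?invr_gt0// ler_nat. Qed.

Lemma gridS n k : grid n k.+1 = grid n k + 2 ^- n.
Proof. by rewrite /grid -natr1 mulrDl mul1r addrA. Qed.

Lemma grid_double n k : grid n.+1 k.*2 = grid n k.
Proof.
rewrite /grid -muln2 natrM exprSr invfM mulrACA mulfV ?mulr1//.
Qed.

Lemma ridxP n r : a <= r -> grid n (ridx n r) <= r < grid n (ridx n r).+1.
Proof.
move=> ar; rewrite grid_le lt_grid; apply: truncn_itv.
by rewrite mulr_ge0 ?subr_ge0// ltW.
Qed.

Lemma ridx_eq n k r : grid n k <= r < grid n k.+1 -> ridx n r = k.
Proof. by rewrite grid_le lt_grid; exact: truncn_def. Qed.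

Lemma lidxP n r : a < r -> grid n (lidx n r) < r <= grid n (lidx n r).+1.
Proof.
move=> ar; rewrite grid_lt le_grid /lidx; set x := (r - a) * _.
have x0 : 0 < x by rewrite mulr_gt0// subr_gt0.
have /andP[t1 t2] := truncn_itv (ltW x0).
case: ifPn => [/eqP e|ne]; last by rewrite lt_neqAle ne t1 ltW.
have k0 : (0 < Num.truncn x)%N by rewrite -(ltr0n R) e.
by rewrite prednK// -{2 3}e lexx andbT ltr_nat prednK.
Qed.

Lemma lidx_eq n k r : grid n k < r <= grid n k.+1 -> lidx n r = k.
Proof.
move=> kr; have ar : a < r by case/andP: kr => + _; apply: le_lt_trans (grid_ge _ _).
have := lidxP n ar; move: kr; rewrite !grid_lt !le_grid => /andP[k1 k2] /andP[l1 l2].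
apply/eqP; rewrite eqn_leq; apply/andP; split; rewrite -ltnS -(ltr_nat R).
- exact: lt_le_trans l1 k2.
- exact: lt_le_trans k1 l2.
Qed.

Lemma cvg_mesh : (2 ^- n : R) @[n --> \oo] --> 0.
Proof.
have := @cvg_expr R (2^-1); rewrite ger0_norm// invf_lt1// ltr1n => /(_ isT).
suff -> : (fun n => 2 ^- n : R) = GRing.exp (2^-1) by [].
by apply/funext => n; rewrite exprVn.
Qed.

Lemma cvg_right_grid r : a <= r -> grid n (ridx n r).+1 @[n --> \oo] --> r.
Proof.
move=> ar; apply: (@squeeze_cvgr _ _ _ _ (fun=> r) (fun n => r + 2 ^- n)).
- apply: nearW => n; have /andP[h1 h2] := ridxP n ar.
  by rewrite ltW//= gridS lerD2r.
- exact: cvg_cst.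
- by rewrite -[X in _ --> X]addr0; apply: cvgD; [exact: cvg_cst|exact: cvg_mesh].
Qed.

Lemma cvg_left_grid r : a < r -> grid n (lidx n r) @[n --> \oo] --> r.
Proof.
move=> ar; apply: (@squeeze_cvgr _ _ _ _ (fun n => r - 2 ^- n) (fun=> r)).
- apply: nearW => n; have /andP[h1 h2] := lidxP n ar.
  by rewrite (ltW h1) andbT lerBlDr -gridS.
- by rewrite -[X in _ --> X]subr0; apply: cvgB; [exact: cvg_cst|exact: cvg_mesh].
- exact: cvg_cst.
Qed.

End dyadic_grid.

Section patchwork.
Context d1 d2 d3 (T : measurableType d1) (W : measurableType d2) (U : measurableType d3).

(** A process constant in time on countably many pieces of [I]. Measurability of [F k] is asked only
    of pieces that occur, since other indices may point beyond the horizon. *)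
Lemma measurable_patchwork (I : set T) (q : T -> nat) (F : nat -> W -> U) :
  (forall k, measurable [set r | I r /\ q r = k]) ->
  (forall k, (exists2 r, I r & q r = k) -> measurable_fun setT (F k)) ->
  measurable_fun (I `*` setT) (fun z => F (q z.1) z.2).
Proof.
move=> mq mF mD B mB.
rewrite (_ : _ `&` _ = \bigcup_k ([set r | I r /\ q r = k] `*` (F k @^-1` B))).
  apply: bigcupT_measurable => k.
  have [[r Ir qr]|nr] := pselect (exists2 r, I r & q r = k).
    apply: measurableX; first exact: mq.
    by rewrite -[_ @^-1` _]setTI; apply: mF => //; exists r.
  rewrite (_ : _ `*` _ = set0)//; apply/seteqP; split => // -[r w] [/= [Ir qr] _].
  by apply: nr; exists r.
apply/seteqP; split => [[r w] [[/= Ir _] FB]|[r w] [k _ [/= [Ir <-] FB]]].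
  by exists (q r) => //; split.
by split.
Qed.

End patchwork.

Section cadlag_measurable.
Context {R : realType}.
Notation TT := (measurableTypeR R).

(** The approximation takes the value at the next grid point, cut at [t]. The cut keeps it
    measurable for the information at time [t], so that the lemma applied with [Flt t] on the sample
    space gives progressive measurability. *)
Lemma measurable_rcont d (W : measurableType d) (M : R -> W -> R) (a t : R) :
  (forall r, a <= r <= t -> measurable_fun setT (M r)) ->
  (forall w r, a <= r < t -> M q w @[q --> r^'+] --> M r w) ->
  measurable_fun ((Ioc R a t) `*` setT) (fun z : TT * W => M z.1 z.2).
Proof.
move=> mM rM.
have mI : measurable (Ioc R a t) by exact: measurable_itv.
apply: (measurable_fun_cvg (h := fun n (z : TT * W) => M (Num.min t (grid a n (ridx a n z.1).+1)) z.2)).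
- move=> n; apply: (measurable_patchwork (F := fun k w => M (Num.min t (grid a n k.+1)) w)).
    move=> k; rewrite (_ : [set r | _] = (Ioc R a t) `&` (`[grid a n k, grid a n k.+1[%classic : set TT)).
    by apply: measurableI.
    apply/seteqP; split => r /= [Ir].
    by move=> <-; split => //=; rewrite in_itv/=; apply: ridxP; move: Ir; rewrite in_itv/= => /andP[/ltW].
    by rewrite in_itv/= => /ridx_eq.
  move=> k [r + _]; rewrite /= in_itv/= => /andP[ar rt]; apply: mM.
  rewrite le_min grid_ge (ltW (lt_le_trans ar rt))/=.
  by rewrite ge_min lexx.
- move=> [r w] [/=]; rewrite in_itv/= => /andP[ar rt] _.
  have c := cvg_right_grid (ltW ar).
  have [rt'|] := ltP r t; last first.
    move=> tr; have -> : r = t by apply/eqP; rewrite eq_le rt tr.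
    apply: cvg_near_cst; apply: nearW => n; congr (M _ _).
    apply: min_l; apply: ltW; have := ridxP n (ltW ar).
    by have -> : r = t; [apply/eqP; rewrite eq_le rt tr|move=> /andP[]].
  have := rM w r; rewrite (ltW ar) rt' => /(_ isT)/cvg_at_rightP; apply; split.
    by move=> n; rewrite lt_min rt'; have /andP[_] := ridxP n (ltW ar).
  apply: (@squeeze_cvgr _ _ _ _ (fun=> r) (fun n => grid a n (ridx a n r).+1)) => //.
    apply: nearW => n; rewrite le_min (ltW rt')/= ge_min lexx orbT andbT.
    by have /andP[_ /ltW] := ridxP n (ltW ar).
  exact: cvg_cst.
Qed.

End cadlag_measurable.

Section progressive.
Context d (W : measurableType d) (R : realType).
Variables (Flt : R -> set (set W)) (a b : R).
Notation TT := (measurableTypeR R).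
Notation gst G := (g_sigma_algebraType G).

(** Progressive measurability, on the half-open intervals over which [dV] is integrated; [U] is
    general because the canonical process has values in [E]. *)
Definition prog d' (U : measurableType d') (H : R -> W -> U) : Prop :=
  forall t, a <= t <= b ->
  measurable_fun ((Ioc R a t) `*` setT) (fun z : TT * gst (Flt t) => H z.1 z.2).

Variable mu : probability W R.
Hypothesis hF : filtration_on Flt a b.
Implicit Types (H M : R -> W -> R).

Let mI (s t : R) : measurable (Ioc R s t). Proof. exact: measurable_itv. Qed.

Lemma prog_slice d' (U : measurableType d') (H : R -> W -> U) r : prog H -> a < r <= b ->
  measurable_fun setT (H r : gst (Flt r) -> U).
Proof.
move=> pH /andP[ar rb].
have rab : a <= r <= b by rewrite (ltW ar).
have Ir : (Ioc R a r) r by rewrite /= in_itv/= ar lexx.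
exact: (measurable_sliceI (mI _ _) Ir (pH _ rab)).
Qed.

Lemma prog_slice_wrt H r : prog H -> a < r <= b -> measurable_wrt (Flt r) (H r).
Proof.
move=> pH /[dup] rab' /andP[ar rb]; have rab : a <= r <= b by rewrite (ltW ar).
by apply/(flt_wrtP hF rab); exact: prog_slice.
Qed.

Lemma measurable_to_big d' (U : measurableType d') (t : R) (D : set TT) (h : TT * W -> U) :
  a <= t <= b -> measurable D ->
  measurable_fun (D `*` setT) (h : TT * gst (Flt t) -> U) ->
  measurable_fun (D `*` setT) h.
Proof.
move=> tab mD mh.
apply: (@measurable_comp _ _ _ _ _ _ (D `*` setT : set (TT * gst (Flt t))) h _ (fun z : TT * W => (z : TT * gst (Flt t)))) => //.
- by apply: measurableX.
- by move=> _ [z h' <-].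
- apply: measurable_funTS; apply/measurable_fun_pairP; split; first exact: measurable_fst.
  apply: (@measurableT_comp _ _ _ _ _ _ (fun w : W => (w : gst (Flt t))) setT (@snd TT W)).
    move=> _ B mB; rewrite setTI; apply: (flt_sub hF tab).
    by rewrite -(g_sigma_id (flt_sigma hF tab)).
  exact: measurable_snd.
Qed.

Lemma prog_joint d' (U : measurableType d') (H : R -> W -> U) s t : prog H -> a <= s -> t <= b ->
  measurable_fun ((Ioc R s t) `*` setT) (fun z : TT * W => H z.1 z.2).
Proof.
move=> pH as_ tb; have [st|ts] := ltP s t; last first.
  rewrite set_itv_ge ?set0X; last by rewrite bnd_simp -leNgt.
  exact: measurable_fun_set0.
have tab : a <= t <= b by rewrite tb (le_trans as_ (ltW st)).
apply: (@measurable_funS _ _ _ _ ((Ioc R a t) `*` setT)).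
- exact: measurableX.
- by move=> [r w] [/=]; rewrite !in_itv/= => /andP[sr rt] _; split => //=; rewrite ?in_itv/= rt (le_lt_trans as_ sr).
- exact: (measurable_to_big tab (mI _ _) (pH _ tab)).
Qed.

Lemma rcont_prog M : adapted Flt a b M ->
  (forall w r, a <= r < b -> M q w @[q --> r^'+] --> M r w) -> prog M.
Proof.
move=> adM rM t /[dup] tab /andP[at_ tb].
apply: (@measurable_rcont _ _ (gst (Flt t))).
- move=> r /andP[ar rt]; apply/(flt_wrtP hF tab).
  apply: (measurable_wrt_mono hF ar rt tb); apply: adM.
  by rewrite ar (le_trans rt).
- by move=> w r /andP[ar rt]; apply: rM; rewrite ar (lt_le_trans rt).
Qed.

(** Fubini is used with the sample space carrying [Flt t] instead of the full sigma-algebra. *)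
Lemma prog_pint (V : cumulative R R) H t : prog H -> a <= t <= b ->
  measurable_wrt (Flt t) (fun w => pint V a (H^~ w) t).
Proof.
move=> pH tab; apply/(flt_wrtP hF tab).
exact: (measurable_inner_Rintegral (dV V) (mI a t) (W := gst (Flt t)) (pH _ tab)).
Qed.

End progressive.

Section predictable_maps.
Context d (W : measurableType d) (R : realType).
Variables (Flt : R -> set (set W)) (a b : R).
Hypothesis hF : filtration_on Flt a b.
Hypothesis ab : a <= b.
Notation TT := (measurableTypeR R).
Notation gst G := (g_sigma_algebraType G).
Notation PS := (predictable_sigma Flt a b).
Notation PT := (g_sigma_algebraType PS).

Let D : set (R * W) := `[a, b]%classic `*` setT.

(** Predictability for values in any measurable space, needed for left limits in [E]; [predictableP]
    relates the real case to [predictable]. *)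
Definition predictable_map d' (U : measurableType d') (H : R -> W -> U) : Prop :=
  measurable_fun (D : set PT) (fun z : PT => H z.1 z.2).

Let PS_alg : sigma_algebra D PS. Proof. exact: smallest_sigma_algebra. Qed.

(** [predictable_sigma] is a sigma-algebra on [[a, b] x W], not on the full type, while measurable
    maps refer to the one it generates there. Tracing on [D] goes back. *)
Lemma predictable_trace (C : set (R * W)) : <<s PS >> C -> PS (D `&` C).
Proof.
apply: (@smallest_sub _ (sigma_algebra setT) PS [set C | PS (D `&` C)]).
- split.
  + by rewrite /= setI0; case: PS_alg.
  + move=> A /= PA; have [_ h _] := PS_alg; have := h _ PA.
    by rewrite setDIr setDv set0U setDE setTD.
  + by move=> F /= PF; rewrite setI_bigcupr; case: PS_alg => _ _; exact.
- move=> A PA /=; suff sub : PS `<=` [set C | C `<=` D] by rewrite setIidr//; exact: sub.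
  apply: smallest_sub; first by split => [//|C' CD z []//|F FD z [i _ /FD]].
  move=> C' [[B FB ->]|[t [t' [B [at_ tt tb FB ->]]]]] [r w] [/=].
    by move=> -> _; split => //=; rewrite in_itv/= lexx.
  rewrite in_itv/= => /andP[tr rt] _; split => //=.
  by rewrite in_itv/= (le_trans at_ (ltW tr)) (le_trans rt).
Qed.

Lemma predictable_measurableD : measurable (D : set PT).
Proof.
apply: sub_sigma_algebra; case: PS_alg => p0 /(_ _ p0) + _.
by rewrite setD0.
Qed.

Lemma predictableP (H : R -> W -> R) : predictable Flt a b H <-> predictable_map H.
Proof.
split=> [pH _ B mB|mH B mB].
  by apply: sub_sigma_algebra; exact: pH.
have := predictable_trace (mH predictable_measurableD B mB).
by rewrite setIA setIid.
Qed.

Lemma predictable_left_grid d' (U : measurableType d') (N : R -> W -> U) n :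
  (forall q, a <= q <= b -> measurable_fun setT (N q : gst (Flt q) -> U)) ->
  predictable_map (fun r w => N (grid a n (lidx a n r)) w).
Proof.
move=> mN _ B mB.
have pre q : a <= q <= b -> Flt q (N q @^-1` B).
  move=> qab; apply: (g_sigma_measurable (flt_sigma hF qab)).
  by rewrite -[_ @^-1` _]setTI; exact: mN.
have lidxa : lidx a n a = 0%N.
  by rewrite /lidx subrr mul0r truncn0 eqxx.
rewrite (_ : D `&` _ = ([set a] `*` (N a @^-1` B)) `|` \bigcup_k
  (if grid a n k < b then `]grid a n k, Num.min (grid a n k.+1) b]%classic `*` (N (grid a n k) @^-1` B) else set0)).
  apply: measurableU.
    apply: sub_sigma_algebra; apply: sub_sigma_algebra; left; exists (N a @^-1` B) => //.
    by apply: pre; rewrite lexx.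
  apply: bigcupT_measurable => k; case: ifPn => // kb.
  apply: sub_sigma_algebra; apply: sub_sigma_algebra; right.
  exists (grid a n k), (Num.min (grid a n k.+1) b), (N (grid a n k) @^-1` B); split => //.
  - exact: grid_ge.
  - by rewrite le_min (ltW kb) andbT grid_mono.
  - by rewrite ge_min lexx orbT.
  - by apply: pre; rewrite grid_ge ltW.
apply/seteqP; split => [[r w] [[/= + _] NB]|[r w]].
  rewrite in_itv/= => /andP[ar rb]; have [ra|ar'] := leP r a.
    have E : r = a by apply/eqP; rewrite eq_le ra.
    by left; split => //=; move: NB; rewrite /= E lidxa grid0.
  right; exists (lidx a n r) => //; have /andP[l1 l2] := lidxP n ar'.
  by rewrite (lt_le_trans l1 rb); split => //=; rewrite in_itv/= l1 le_min l2.
case=> [[/= ->] NB|[k _]].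
  by split; [split => //=; rewrite in_itv/= lexx|rewrite /= lidxa grid0].
case: ifPn => // kb [/=]; rewrite in_itv/= le_min => /andP[kr /andP[rk rb]] NB.
split; first by split => //=; rewrite in_itv/= rb (le_trans (grid_ge _ n k) (ltW kr)).
by rewrite /= (@lidx_eq _ _ _ k) ?kr.
Qed.

Lemma predictable_limit (h : nat -> R -> W -> R) (H : R -> W -> R) :
  (forall n, predictable_map (h n)) ->
  (forall r w, a <= r <= b -> h n r w @[n --> \oo] --> H r w) ->
  predictable_map H.
Proof.
move=> ph hH; apply: (measurable_fun_cvg (h := fun n (z : PT) => h n z.1 z.2)) => //.
by move=> [r w] [/= + _]; rewrite in_itv/=; exact: hH.
Qed.

Lemma left_limit_grid (x : R -> R) (l r : R) : a < r ->
  x q @[q --> r^'-] --> l -> x (grid a n (lidx a n r)) @[n --> \oo] --> l.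
Proof.
move=> ar /cvg_at_leftP; apply; split; last exact: cvg_left_grid.
by move=> n; have /andP[] := lidxP n ar.
Qed.

(** Cut at time [t], a generator []p, q] x A] becomes empty or a rectangle with [A] in [Flt t], and
    the slice at [a] disappears from []a, t]]. *)
Lemma predictable_map_prog d' (U : measurableType d') (H : R -> W -> U) :
  predictable_map H -> prog Flt a b H.
Proof.
move=> pH t /andP[at_ tb] mI B mB.
have tab : a <= t <= b by rewrite at_.
have mJ : measurable ((Ioc R a t) `*` (setT : set (gst (Flt t)))).
  by apply: measurableX => //; exact: measurable_itv.
pose Q := [set C : set (R * W) | measurable
  ((((Ioc R a t) `*` (setT : set (gst (Flt t)))) `&` C) : set (TT * gst (Flt t)))].
suff PQ : PS `<=` Q.
  have := PQ _ (predictable_trace (pH predictable_measurableD B mB)).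
  rewrite /Q /= (_ : _ `&` (_ `&` _) = (`]a, t]%classic `*` [set: gst (Flt t)]) `&` (fun z => H z.1 z.2) @^-1` B)//.
  apply/seteqP; split => [[r w] [[h1 h2] [_ [_ h3]]]//|[r w] [[/= h1 h2] h3]].
  have hD : D (r, w).
    split => //=; move: h1; rewrite !in_itv/= => /andP[ar rt].
    by rewrite (ltW ar) (le_trans rt).
  by split => //; split => //; split.
apply: smallest_sub.
- split.
  + by rewrite /Q /= setI0.
  + move=> A QA; rewrite /Q /=.
    rewrite (_ : _ `&` _ = (`]a, t]%classic `*` setT) `\` ((`]a, t]%classic `*` setT) `&` A)).
    exact: measurableD.
    apply/seteqP; split => [[r w] [h1 [h2 h3]]|[r w] [[/= h1 h1'] h2]].
    by split => // -[].
    split => //; split.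
    split => //=; move: h1; rewrite !in_itv/= => /andP[ar rt].
    by rewrite (ltW ar) (le_trans rt).
    by move=> rA; apply: h2.
  + by move=> F QF; rewrite /Q /= setI_bigcupr; exact: bigcupT_measurable.
- move=> C [[A FA ->]|[p [q [A [ap pq qb FA ->]]]]]; rewrite /Q /=.
    rewrite (_ : _ `&` _ = set0)//; apply/seteqP; split => // -[r w] [[/= + _] [/= E _]].
    by rewrite E in_itv/= ltxx.
  have [pt|tp] := ltP p t; last first.
    rewrite (_ : _ `&` _ = set0)//; apply/seteqP; split => // -[r w] [[/= + _] [/= + _]].
    rewrite !in_itv/= => /andP[_ rt] /andP[pr _].
    by have := lt_le_trans pr (le_trans rt tp); rewrite ltxx.
  rewrite (_ : _ `&` _ = (`]p, Num.min q t]%classic : set TT) `*` (A : set (gst (Flt t)))).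
    apply: measurableX; first exact: measurable_itv.
    by rewrite (g_sigma_id (flt_sigma hF tab)); apply: (flt_mono hF ap (ltW pt) tb).
  apply/seteqP; split => [[r w] [[/= + _] [/= + Aw]]|[r w] [/= + Aw]].
    by rewrite !in_itv/= => /andP[ar rt] /andP[pr rq]; split => //=; rewrite ?in_itv/= pr le_min rq.
  rewrite in_itv/= le_min => /andP[pr /andP[rq rt]]; split; split => //=.
    by rewrite ?in_itv/= rt (le_lt_trans ap).
  by rewrite ?in_itv/= pr.
Qed.

End predictable_maps.

(** * Counting moves along a sequence, and Doob's inequality *)

Section anchor.
Context {R : realType}.
Implicit Types (x : nat -> R) (e : R).

(* The anchor jumps to the current value each time the path has moved by [e] away from it;
  the second component counts the jumps. *)
Fixpoint anchor x e k : R * nat :=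
  if k is k'.+1 then
  let Ac := anchor x e k' in
  if e <= `|x k - Ac.1| then (x k, Ac.2.+1) else Ac
  else (x 0%N, 0%N).

Lemma anchor_close x e k : 0 < e -> `|x k - (anchor x e k).1| < e.
Proof.
move=> e0; case: k => [|k] /=; first by rewrite subrr normr0.
by case: ifPn => /= [_|]; [rewrite subrr normr0|rewrite -ltNge].
Qed.

Lemma anchor_count_mono x e k l : (k <= l)%N -> ((anchor x e k).2 <= (anchor x e l).2)%N.
Proof.
move=> /subnK <-; elim: (l - k)%N => //= n IH.
by case: ifP => //= _; rewrite (leq_trans IH).
Qed.

Lemma anchor_count_eq x e k l : (k <= l)%N -> (anchor x e k).2 = (anchor x e l).2 ->
  (anchor x e k).1 = (anchor x e l).1.
Proof.
move=> /subnK <-; elim: (l - k)%N => //= n IH.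
case: ifP => //= _ E.
have := anchor_count_mono x e (leq_addl n k); by rewrite E ltnn.
Qed.

(** Without a jump in between, both values lie within [e] of the same anchor. *)
Lemma anchor_oscillation x e k l : 0 < e -> (k <= l)%N -> 2 * e <= `|x k - x l| ->
  ((anchor x e k).2 < (anchor x e l).2)%N.
Proof.
move=> e0 kl; apply: contraTT; rewrite -leqNgt -ltNge => lk.
have E : (anchor x e k).2 = (anchor x e l).2.
  by apply/eqP; rewrite eqn_leq lk anchor_count_mono.
have hk := anchor_close x k e0; have := anchor_close x l e0.
rewrite -(anchor_count_eq kl E) distrC => hl.
have -> : x k - x l = (x k - (anchor x e k).1) + ((anchor x e k).1 - x l) by ring.
by rewrite mulr_natl mulr2n; apply: le_lt_trans (ler_normD _ _) (ltrD hk hl).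
Qed.

(** A jump raises the first term by [e ^+ 2] and removes a squared distance of at least that size.
    In the mean, this balance bounds the number of jumps. *)
Lemma anchor_step x e k : 0 <= e ->
  e ^+ 2 * (anchor x e k.+1).2%:R + (x k.+1 - (anchor x e k.+1).1) ^+ 2 <=
  e ^+ 2 * (anchor x e k).2%:R + (x k.+1 - (anchor x e k).1) ^+ 2.
Proof.
move=> e0 /=; case: ifP => //= h; rewrite subrr expr0n addr0.
rewrite -natr1 mulrDr mulr1 lerD2l -[leRHS]real_normK ?num_real//.
by apply: lerXn2r; rewrite ?nnegrE.
Qed.

Fixpoint runmax x k : R := if k is k'.+1 then Num.max (runmax x k') `|x k| else `|x 0%N|.

Lemma runmax_ge0 x k : 0 <= runmax x k.
Proof. by elim: k => //= k IH; rewrite le_max IH. Qed.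

Lemma runmax_ge x k l : (k <= l)%N -> `|x k| <= runmax x l.
Proof.
elim: l k => [|l IH] k /=; first by rewrite leqn0 => /eqP ->.
rewrite leq_eqVlt => /predU1P[->|/IH h]; first by rewrite le_max lexx orbT.
by rewrite le_max h.
Qed.

(** A pathwise form of Doob's inequality with S = [runmax]: the quantity 2 |x| S - S^2 gains at
    least 2 S times the increment of |x|. For a martingale these increments have nonnegative mean
    against S, so the mean of 2 |x| S - S^2 stays nonnegative. *)
Lemma runmax_step x k :
  2 * `|x k| * runmax x k - runmax x k ^+ 2 + 2 * runmax x k * (`|x k.+1| - `|x k|) <=
  2 * `|x k.+1| * runmax x k.+1 - runmax x k.+1 ^+ 2.
Proof.
rewrite /=; set S := runmax x k; set y := `|x k.+1|; set z := `|x k|.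
have [yS|Sy] := leP y S; first by lra.
rewrite -subr_ge0; have -> : 2 * y * y - y ^+ 2 - (2 * z * S - S ^+ 2 + 2 * S * (y - z)) = (y - S) ^+ 2 by ring.
exact: sqr_ge0.
Qed.

End anchor.

(** Cancels a finite [x] in 2 x <= 2 y <= x + z; used when a truncated moment appears on both
    sides. *)
Lemma ereal_absorb (R : realType) (x y z : \bar R) : (0 <= x)%E -> (0 <= z)%E ->
  (x <= y)%E -> (y + y <= x + z)%E -> (x < +oo)%E -> (z < +oo)%E -> (x <= z)%E.
Proof.
case: x => [x| |]//; case: z => [z| |]//; case: y => [y| |]//.
by rewrite -!EFinD !lee_fin => *; lra.
Qed.

Section l2_martingales.
Context d (W : measurableType d) (R : realType) (mu : probability W R).
Variables (Flt : R -> set (set W)) (a b : R).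
Hypothesis hF : filtration_on Flt a b.
Variable M : R -> W -> R.
Hypothesis mM : martingale mu Flt a b M.

(** [M r] is not known to be square integrable, so it is tested against the bounded
    [Y n = min(|M r|, n)]. From 2 Y |M t| <= Y^2 + (M t)^2 and Y^2 <= Y |M r| the truncated moment
    is absorbed, and [n] goes to infinity by monotone convergence. *)
Lemma martingale_sqi r t : a <= r -> r <= t -> t <= b -> sqi mu (M t) ->
  sqi mu (M r) /\ (\int[mu]_w (M r w ^+ 2)%:E <= \int[mu]_w (M t w ^+ 2)%:E)%E.
Proof.
move=> ar rt tb [mMt st].
have rab : a <= r <= b by rewrite ar (le_trans rt).
have mMr : measurable_fun setT (M r) by exact: (martingale_measurable hF mM rab).
have iMr := martingale_int mM rab.
pose Y n w := Num.min `|M r w| n%:R.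
have Y0 n w : 0 <= Y n w by rewrite /Y le_min normr_ge0 ler0n.
have mYG n : measurable_wrt (Flt r) (Y n).
  apply/(flt_wrtP hF rab); apply: measurable_minr => //.
  apply: measurableT_comp => //; apply/(flt_wrtP hF rab).
  by case: mM => + _; exact.
have mY n : measurable_fun setT (Y n) by exact: (wrt_measurable hF rab).
have m2 (k : W -> R) : measurable_fun setT k -> measurable_fun setT (fun w => (k w ^+ 2)%:E).
  by move=> mk; apply/measurable_EFinP; exact: measurable_funX.
have bound n : (\int[mu]_w `|Y n w * M r w|%:E <= \int[mu]_w (M t w ^+ 2)%:E)%E.
  have h1 := martingale_pull_le hF mM ar rt tb (mYG n).
  have If : (\int[mu]_w `|Y n w * M r w|%:E < +oo)%E.
    have /integrableP[_ +] := integrableZl measurableT n%:R iMr; apply: le_lt_trans.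
    apply: ge0_le_integral => //.
    - by apply/measurable_EFinP; apply: measurableT_comp => //; exact: measurable_funM.
    - by apply: measurableT_comp => //; apply/measurable_EFinP; exact: measurable_funM.
    - move=> w _; rewrite /= lee_fin !normrM ler_wpM2r// (ger0_norm (Y0 n w)).
    by rewrite ger0_norm// /Y ge_min lexx orbT.
  have h2 : (\int[mu]_w `|Y n w * M t w|%:E + \int[mu]_w `|Y n w * M t w|%:E <=
    \int[mu]_w `|Y n w * M r w|%:E + \int[mu]_w (M t w ^+ 2)%:E)%E.
    have ma : measurable_fun setT (fun w => `|Y n w * M t w|%:E).
    by apply/measurable_EFinP; apply: measurableT_comp => //; exact: measurable_funM.
    have mb : measurable_fun setT (fun w => `|Y n w * M r w|%:E).
    by apply/measurable_EFinP; apply: measurableT_comp => //; exact: measurable_funM.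
    rewrite -!ge0_integralD//; last 2 first.
    - by move=> w _; rewrite lee_fin sqr_ge0.
    - exact: m2.
    apply: ge0_le_integral => //.
    - by move=> w _; rewrite adde_ge0// lee_fin.
    - exact: emeasurable_funD.
    - by apply: emeasurable_funD => //; exact: m2.
    - move=> w _; rewrite -!EFinD lee_fin !normrM (ger0_norm (Y0 n w)).
    have := sqr_ge0 (Y n w - `|M t w|).
    have : Y n w ^+ 2 <= Y n w * `|M r w| by rewrite expr2 ler_wpM2l// /Y ge_min lexx.
    have : M t w ^+ 2 = `|M t w| ^+ 2 by rewrite real_normK ?num_real.
    by move=> ->; nra.
  move: h1 h2 If st.
  by apply: ereal_absorb; apply: integral_ge0 => // w _; rewrite lee_fin sqr_ge0.
have key : (\int[mu]_w (M r w ^+ 2)%:E <= \int[mu]_w (M t w ^+ 2)%:E)%E.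
  have cv w : `|Y n w * M r w|%:E @[n --> \oo] --> (M r w ^+ 2)%:E.
    apply: cvg_near_cst; exists (Num.truncn `|M r w|).+1 => // n /= hn; congr EFin.
    rewrite /Y min_l; last first.
    apply: (@le_trans _ _ (Num.truncn `|M r w|).+1%:R); last by rewrite ler_nat.
    by apply/ltW; exact: truncnS_gt.
    by rewrite normrM normr_id -expr2 real_normK ?num_real.
  have ms n : measurable_fun setT (fun w => `|Y n w * M r w|%:E).
    by apply/measurable_EFinP; apply: measurableT_comp => //; exact: measurable_funM.
  have nd w m n : (m <= n)%N -> `|Y m w * M r w| <= `|Y n w * M r w|.
    move=> mn; rewrite !normrM ler_wpM2r// !ger0_norm// /Y le_min ge_min lexx/=.
    by rewrite ge_min ler_nat mn orbT.
  have -> : (\int[mu]_w (M r w ^+ 2)%:E = limn (fun n => \int[mu]_w `|Y n w * M r w|%:E))%E.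
    rewrite -monotone_convergence//.
    - by apply: eq_integral => w _; apply/esym/cvg_lim.
    - by move=> w _ m n mn; rewrite lee_fin nd.
  apply: lime_le; last exact: nearW.
  apply: ereal_nondecreasing_is_cvgn => m n mn; apply: ge0_le_integral => // w _.
  by rewrite lee_fin nd.
by split=> //; split => //; exact: le_lt_trans st.
Qed.

End l2_martingales.

(** * Orthogonality of increments and discrete martingale inequalities *)

Section inner_product.
Context d (W : measurableType d) (R : realType) (mu : probability W R).
Implicit Types f g h : W -> R.

Definition ip f g : R := \int[mu]_w (f w * g w).

Lemma ipC f g : ip f g = ip g f.
Proof. by apply: eq_Rintegral => w _; rewrite mulrC. Qed.

Lemma ip_ge0 f : 0 <= ip f f.
Proof. by apply: Rintegral_ge0 => w _; rewrite -expr2 sqr_ge0. Qed.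

Lemma ipDl f g h : sqi mu f -> sqi mu g -> sqi mu h ->
  ip (fun w => f w + g w) h = ip f h + ip g h.
Proof.
move=> sf sg sh; rewrite -RintegralD//; try exact: sqiM_integrable.
by apply: eq_Rintegral => w _; rewrite mulrDl.
Qed.

Lemma ipZl k f g : sqi mu f -> sqi mu g -> ip (fun w => k * f w) g = k * ip f g.
Proof.
move=> sf sg; rewrite -RintegralZl//; last exact: sqiM_integrable.
by apply: eq_Rintegral => w _; rewrite mulrA.
Qed.

Lemma ipBl f g h : sqi mu f -> sqi mu g -> sqi mu h ->
  ip (fun w => f w - g w) h = ip f h - ip g h.
Proof.
move=> sf sg sh; rewrite -RintegralB//; try exact: sqiM_integrable.
by apply: eq_Rintegral => w _; rewrite mulrBl.
Qed.

Lemma ip_subsq f g : sqi mu f -> sqi mu g ->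
  ip (fun w => f w - g w) (fun w => f w - g w) = ip f f - 2 * ip f g + ip g g.
Proof.
move=> sf sg; have sfg := sqiB sf sg.
rewrite ipBl// ipC ipBl// [X in _ - X]ipC ipBl// (ipC g f); ring.
Qed.

Lemma ip_addsq f g : sqi mu f -> sqi mu g ->
  ip (fun w => f w + g w) (fun w => f w + g w) = ip f f + 2 * ip f g + ip g g.
Proof.
move=> sf sg; have sfg := sqiD sf sg.
rewrite ipDl// ipC ipDl// [X in _ + X]ipC ipDl// (ipC g f); ring.
Qed.

Lemma ip_sqrE f : sqi mu f -> (\int[mu]_w (f w ^+ 2)%:E = (ip f f)%:E)%E.
Proof. by move=> sf; rewrite /ip /Rintegral fineK// integrable_fin_num//; exact: sqi_sqr. Qed.

Lemma le_ip f g : sqi mu f -> sqi mu g -> (forall w, f w ^+ 2 <= g w ^+ 2) -> ip f f <= ip g g.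
Proof. by move=> sf sg fg; apply: le_Rintegral => //; [exact: sqi_sqr|exact: sqi_sqr|move=> w _; exact: fg]. Qed.

Lemma ip_young f g : sqi mu f -> sqi mu g -> 2 * ip f g <= ip f f + ip g g.
Proof.
move=> sf sg; rewrite -subr_ge0 addrAC -ip_subsq//; exact: ip_ge0.
Qed.

Lemma ip0_ae f : sqi mu f -> ip f f = 0 -> {ae mu, forall w, f w = 0}.
Proof.
move=> sf e; have f0 := congr1 EFin e; rewrite -ip_sqrE// in f0.
have mf2 : measurable_fun setT (fun w => (f w ^+ 2)%:E).
  by apply/measurable_EFinP; apply: measurable_funX; case: sf.
have : (\int[mu]_w `|(f w ^+ 2)%:E| = 0)%E.
  by apply: etrans f0; apply: eq_integral => w _; rewrite gee0_abs// lee_fin sqr_ge0.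
move/(ae_eq_integral_abs mu measurableT mf2); apply: filterS => w /= /(_ I) [] /eqP.
by rewrite sqrf_eq0 => /eqP.
Qed.

End inner_product.

Section discrete_martingales.
Context d (W : measurableType d) (R : realType) (mu : probability W R).
Variables (Flt : R -> set (set W)) (a b : R).
Hypothesis hF : filtration_on Flt a b.
Variable M : R -> W -> R.
Hypothesis mM : martingale mu Flt a b M.
Hypothesis sM : sqi mu (M b).
Notation gst G := (g_sigma_algebraType G).
Notation ip := (ip mu).

Lemma sqi_mart t : a <= t <= b -> sqi mu (M t).
Proof. by move=> /andP[at_ tb]; have [] := martingale_sqi hF mM at_ tb (lexx _) sM. Qed.

Lemma martingale_ip r t (Y : W -> R) : a <= r -> r <= t -> t <= b ->
  measurable_wrt (Flt r) Y -> sqi mu Y -> ip (M t) Y = ip (M r) Y.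
Proof.
move=> ar rt tb mY sY; rewrite ipC [RHS]ipC; apply/esym.
apply: (martingale_pull hF mM) => //; apply: sqiM_integrable => //.
by apply: sqi_mart; rewrite tb (le_trans ar).
Qed.

(** The cross terms of the two squares agree because [Y] is known at time [r]. *)
Lemma martingale_ip_incr r t (Y : W -> R) : a <= r -> r <= t -> t <= b ->
  measurable_wrt (Flt r) Y -> sqi mu Y ->
  ip (fun w => M t w - Y w) (fun w => M t w - Y w) =
  ip (M t) (M t) - ip (M r) (M r) + ip (fun w => M r w - Y w) (fun w => M r w - Y w).
Proof.
move=> ar rt tb mY sY.
have sr : sqi mu (M r) by apply: sqi_mart; rewrite ar (le_trans rt).
have st : sqi mu (M t) by apply: sqi_mart; rewrite tb (le_trans ar).
rewrite !ip_subsq// (martingale_ip ar rt tb mY sY); ring.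
Qed.

Lemma martingale_incr_sqr r t : a <= r -> r <= t -> t <= b ->
  ip (fun w => M t w - M r w) (fun w => M t w - M r w) = ip (M t) (M t) - ip (M r) (M r).
Proof.
move=> ar rt tb.
have rab : a <= r <= b by rewrite ar (le_trans rt).
rewrite (martingale_ip_incr ar rt tb)//; last 2 first.
- by case: mM => + _; exact.
- exact: sqi_mart.
rewrite [X in _ + X](_ : _ = 0) ?addr0//; transitivity (\int[mu]_w (cst 0 w : R)); last by rewrite Rintegral_cst// mul0r.
by apply: eq_Rintegral => w _; rewrite subrr mul0r.
Qed.

Variable tau : nat -> R.
Hypothesis tab : forall k, a <= tau k <= b.
Hypothesis tau_mono : forall k, tau k <= tau k.+1.

Let x w := fun k => M (tau k) w.

Let mtau k l : (k <= l)%N -> tau k <= tau l.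
Proof. by move=> /subnK <-; elim: (l - k)%N => //= n IH; apply: le_trans IH _; exact: tau_mono. Qed.

Let Mtau k : measurable_fun setT (M (tau k) : gst (Flt (tau k)) -> R).
Proof. by apply/(flt_wrtP hF (tab k)); case: mM => + _; exact. Qed.

Let up k (f : W -> R) : measurable_fun setT (f : gst (Flt (tau k)) -> R) ->
  measurable_fun setT (f : gst (Flt (tau k.+1)) -> R).
Proof.
move=> /(flt_wrtP hF (tab k)) mf; apply/(flt_wrtP hF (tab k.+1)).
have /andP[h1 _] := tab k; have /andP[_ h2] := tab k.+1.
exact: (measurable_wrt_mono hF h1 (tau_mono k) h2).
Qed.

Section count.
Variable e : R.
Hypothesis e0 : 0 < e.

Let A k w := (anchor (x w) e k).1.
Let C k w : R := (anchor (x w) e k).2%:R.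

Let mAC k : measurable_fun setT (A k : gst (Flt (tau k)) -> R) /\
  measurable_fun setT (C k : gst (Flt (tau k)) -> R).
Proof.
elim: k => [|k [mA mC]]; first by split; [exact: Mtau|exact: measurable_cst].
have mb : measurable_fun setT (fun w : gst (Flt (tau k.+1)) => e <= `|M (tau k.+1) w - A k w|).
  apply: measurable_fun_ler => //; apply: measurableT_comp => //; apply: measurable_funB => //; exact: up.
split.
  rewrite (_ : A k.+1 = fun w => if e <= `|M (tau k.+1) w - A k w| then M (tau k.+1) w else A k w).
    by apply: measurable_fun_ifT => //; exact: up.
  by apply/funext => w; rewrite /A /=; case: ifP.
rewrite (_ : C k.+1 = fun w => if e <= `|M (tau k.+1) w - A k w| then C k w + 1 else C k w).
  apply: measurable_fun_ifT => //; last exact: up.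
  by apply: measurable_funD => //; exact: up.
by apply/funext => w; rewrite /C /A /=; case: ifP => //= _; rewrite natr1.
Qed.

Let mAwrt k : measurable_wrt (Flt (tau k)) (A k).
Proof. by apply/(flt_wrtP hF (tab k)); exact: (mAC k).1. Qed.

Lemma measurable_anchor_count k : measurable_fun setT (fun w => (anchor (x w) e k).2%:R : R).
Proof.
apply: (wrt_measurable hF (tab k)); apply/(flt_wrtP hF (tab k)).
exact: (mAC k).2.
Qed.

Let sA k : sqi mu (A k).
Proof.
elim: k => [|k IH]; first exact: sqi_mart.
apply: (@le_sqi _ _ _ _ _ (M (tau k.+1)) (A k)) => //.
- exact: (wrt_measurable hF (tab k.+1)).
- move=> w; rewrite /A /=; case: ifP => _ /=; first by rewrite lerDl sqr_ge0.
  by rewrite lerDr sqr_ge0.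
- exact: sqi_mart.
Qed.

Lemma integrable_anchor_count k : mu.-integrable setT (EFin \o C k).
Proof.
apply: measurable_bounded_integrable => //.
- exact: (le_lt_trans (probability_le1 mu measurableT) (ltry 1)).
- exact: measurable_anchor_count.
- exists k%:R; split; first exact: num_real.
  move=> y ky w _ /=; rewrite ger0_norm//; apply: le_trans (ltW ky); rewrite ler_nat.
  by elim: k {ky} => //= k IH; case: ifP => //= _; exact: leqW.
Qed.

(** [anchor_step] holds on every path, and in the mean the move from [tau k] to [tau k.+1] costs
    exactly the gain in second moment. The bound does not involve the number of points, hence it
    survives every refinement of the grid. *)
Lemma anchor_count_expectation k :
  e ^+ 2 * \int[mu]_w C k w <= ip (M (tau k)) (M (tau k)).
Proof.
pose f l w := M (tau l) w - A l w.
have sf l : sqi mu (f l) by apply: sqiB => //; exact: sqi_mart.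
(* The induction needs the residual distance to the anchor on the left-hand side. *)
suff h : e ^+ 2 * \int[mu]_w C k w + ip (f k) (f k) <= ip (M (tau k)) (M (tau k)).
  by apply: le_trans h; rewrite lerDl ip_ge0.
elim: k => [|k IH].
  rewrite (_ : \int[mu]_w C 0 w = 0); last by rewrite Rintegral_cst// mul0r.
  rewrite mulr0 add0r; apply: le_ip => //; first exact: sqi_mart.
  by move=> w; rewrite /f /A /= subrr expr0n sqr_ge0.
pose g w := M (tau k.+1) w - A k w.
have sg : sqi mu g by apply: sqiB => //; exact: sqi_mart.
have E : ip g g = ip (M (tau k.+1)) (M (tau k.+1)) - ip (M (tau k)) (M (tau k)) + ip (f k) (f k).
  have /andP[h1 _] := tab k; have /andP[_ h2] := tab k.+1.
  exact: martingale_ip_incr.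
have ie l : mu.-integrable setT (EFin \o (fun w => e ^+ 2 * C l w)).
  by have := integrableZl measurableT (e ^+ 2) (integrable_anchor_count l); apply: eq_integrable.
have ls l (h : W -> R) : sqi mu h -> e ^+ 2 * \int[mu]_w C l w + ip h h =
    \int[mu]_w (e ^+ 2 * C l w + h w * h w).
  move=> sh; rewrite RintegralD//; last exact: sqiM_integrable.
  by rewrite RintegralZl//; exact: integrable_anchor_count.
have id l (h : W -> R) : sqi mu h -> mu.-integrable setT (EFin \o (fun w => e ^+ 2 * C l w + h w * h w)).
  move=> sh; have := integrableD measurableT (ie l) (sqiM_integrable sh sh); apply: eq_integrable => //.
have : e ^+ 2 * \int[mu]_w C k.+1 w + ip (f k.+1) (f k.+1) <= e ^+ 2 * \int[mu]_w C k w + ip g g.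
  rewrite !ls//; apply: le_Rintegral => //; try exact: id.
  by move=> w _; rewrite -!expr2; exact: anchor_step (ltW e0).
rewrite E; lra.
Qed.

End count.

Let S k w := runmax (x w) k.

Let mS k : measurable_fun setT (S k : gst (Flt (tau k)) -> R).
Proof.
elim: k => [|k IH]; first by apply: measurableT_comp.
by apply: measurable_maxr; [exact: up|exact: measurableT_comp].
Qed.

Let mSwrt k : measurable_wrt (Flt (tau k)) (S k).
Proof. by apply/(flt_wrtP hF (tab k)); exact: mS. Qed.

Let sqi_norm f : sqi mu f -> sqi mu (fun w => `|f w|).
Proof.
move=> [mf fi]; split; first exact: measurableT_comp.
by under eq_integral do rewrite real_normK ?num_real//.
Qed.

Lemma sqi_runmax k : sqi mu (S k).
Proof.
elim: k => [|k IH]; first by apply: sqi_norm; exact: sqi_mart.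
apply: (@le_sqi _ _ _ _ _ (S k) (M (tau k.+1))) => //.
- exact: (wrt_measurable hF (tab k.+1)).
- move=> w; rewrite /S /=; case: (leP (runmax (x w) k) `|x w k.+1|) => _; last by rewrite lerDl sqr_ge0.
  by rewrite real_normK ?num_real// lerDr sqr_ge0.
- exact: sqi_mart.
Qed.

(** The classical constant 4 results from 0 <= 2 E(y S) - E S^2, where y = |M|, combined with
    Young's inequality for 2 y and S. *)
Lemma doob_discrete k : ip (S k) (S k) <= 4 * ip (M (tau k)) (M (tau k)).
Proof.
pose y l w := `|M (tau l) w|.
have sy l : sqi mu (y l) by apply: sqi_norm; exact: sqi_mart.
have g l : 0 <= 2 * ip (y l) (S l) - ip (S l) (S l).
  elim: l => [|l IH].
    have -> : ip (S 0) (S 0) = ip (y 0%N) (S 0) by [].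
    have -> : ip (y 0%N) (S 0) = ip (y 0%N) (y 0%N) by [].
    by have := ip_ge0 mu (y 0%N); lra.
  (* The absolute value of a martingale is a submartingale, also against the known nonnegative
     weight [S l]. *)
  have sub : ip (y l) (S l) <= ip (y l.+1) (S l).
    have /andP[h1 _] := tab l; have /andP[_ h2] := tab l.+1.
    have := martingale_pull_le hF mM h1 (tau_mono l) h2 (mSwrt l).
    have E q : (\int[mu]_w `|S l w * M (tau q) w|%:E = (ip (y q) (S l))%:E)%E.
    have ii := sqiM_integrable (sy q) (sqi_runmax l).
    rewrite /ip /Rintegral fineK; last by apply: integrable_fin_num.
    apply: eq_integral => w _; rewrite normrM mulrC [`|S l w|]ger0_norm//; exact: runmax_ge0.
    by rewrite !E lee_fin.
  have iSS q r : mu.-integrable setT (EFin \o (fun w => S q w * S r w)) by exact: sqiM_integrable (sqi_runmax q) (sqi_runmax r).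
  have iyS q r : mu.-integrable setT (EFin \o (fun w => 2 * (y q w * S r w))).
    by have := integrableZl measurableT 2 (sqiM_integrable (sy q) (sqi_runmax r)); apply: eq_integrable.
  have EE q r : 2 * ip (y q) (S r) - ip (S r) (S r) = \int[mu]_w (2 * (y q w * S r w) - S r w * S r w).
    rewrite RintegralB// RintegralZl//; exact: sqiM_integrable (sy q) (sqi_runmax r).
  apply: le_trans IH _.
  apply: (@le_trans _ _ (2 * ip (y l.+1) (S l) - ip (S l) (S l))); first by lra.
  have iB q r : mu.-integrable setT (EFin \o (fun w => 2 * (y q w * S r w) - S r w * S r w)).
    by have := integrableB measurableT (iyS q r) (iSS r r); apply: eq_integrable.
  rewrite !EE; apply: le_Rintegral => // w _.
  by have := runmax_step (x w) l; rewrite -/(S l w) -/(S l.+1 w) -!/(y _ w) !expr2; lra.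
have := g k; have := ip_young (sqiZ 2 (sy k)) (sqi_runmax k).
have s2 := sqiZ 2 (sy k).
rewrite (ipZl _ (sy k) s2) (ipZl _ (sy k) (sqi_runmax k)) (ipC _ (y k) (fun w => 2 * y k w)) (ipZl _ (sy k) (sy k)).
have -> : ip (y k) (y k) = ip (M (tau k)) (M (tau k)).
  by apply: eq_Rintegral => w _; rewrite /y -expr2 real_normK ?num_real.
lra.
Qed.

End discrete_martingales.

(** * Paths whose dyadic values have right and left limits *)

Section dyadic_regularity.
Context {R : realType} (a b : R).
Implicit Types (x : R -> R) (e t u v p q : R) (n k : nat).

Definition tau n k : R := Num.min b (grid a n k).
Definition last_idx n : nat := (ridx a n b).+1.
Definition next n t : R := tau n (ridx a n t).+1.
Definition path_count x e n k : nat := (anchor (fun j => x (tau n j)) e k).2.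
(** The counts are bounded along infinitely many levels only, that is, their lower limit is finite;
    this is what Fatou's lemma can provide. *)
Definition tame x e : Prop :=
  exists K : nat, forall N, exists2 n, (N <= n)%N & (path_count x e n (last_idx n) <= K)%N.
Definition dyadic p : Prop := exists n k, p = grid a n k.

Lemma dyadic_refine p : dyadic p -> exists N, forall n, (N <= n)%N -> exists k, p = grid a n k.
Proof.
move=> [N [k ->]]; exists N => n /subnK <-.
elim: (n - N)%N => [|m [l IH]]; first by exists k.
by exists l.*2; rewrite addSn grid_double.
Qed.

Lemma ridx_mono n u v : u <= v -> (ridx a n u <= ridx a n v)%N.
Proof. by move=> uv; apply: le_truncn; rewrite ler_wpM2r ?lerD2r ?exprn_ge0. Qed.

Lemma ridx_grid n k : ridx a n (grid a n k) = k.
Proof. by apply: ridx_eq; rewrite lexx/= gridS ltrDl invr_gt0 exprn_gt0. Qed.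

Lemma tau_bounds n k : a <= b -> a <= tau n k <= b.
Proof. by move=> ab; rewrite le_min ab grid_ge/= ge_min lexx. Qed.

Lemma tau_nondecreasing n k : tau n k <= tau n k.+1.
Proof. by rewrite /tau le_min !ge_min lexx/= grid_mono ?orbT. Qed.

Lemma tau_last n : a <= b -> tau n (last_idx n) = b.
Proof. by move=> ab; apply: min_l; have /andP[_ /ltW] := ridxP n ab. Qed.

Lemma tau_grid n k : grid a n k <= b -> tau n k = grid a n k.
Proof. by move=> h; apply: min_r. Qed.

Lemma cvg_next t : a <= t <= b -> next n t @[n --> \oo] --> t.
Proof.
move=> /andP[at_ tb]; apply: (@squeeze_cvgr _ _ _ _ (fun=> t) (fun n => grid a n (ridx a n t).+1)).
- apply: nearW => n; have /andP[_ /ltW h] := ridxP n at_.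
  by rewrite /next /tau le_min tb h/= ge_min lexx orbT.
- exact: cvg_cst.
- exact: cvg_right_grid.
Qed.

Lemma next_gt n t : a <= t -> t < b -> t < next n t.
Proof. by move=> at_ tb; rewrite /next /tau lt_min tb; have /andP[_] := ridxP n at_. Qed.

Lemma next_end n : a <= b -> next n b = b.
Proof. exact: tau_last. Qed.

(* Eventually [next n t] is a dyadic point below any [v > t]. *)
Lemma next_dyadic t v : a <= t -> t < v -> v <= b ->
  \forall n \near \oo, dyadic (next n t) /\ t < next n t < v.
Proof.
move=> at_ tv vb; have tb := lt_le_trans tv vb.
have tab : a <= t <= b by rewrite at_ ltW.
have /cvgrPdist_lt/(_ (v - t)) := cvg_next tab; rewrite subr_gt0 => /(_ tv).
apply: filterS => n; have tn := next_gt n at_ tb.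
rewrite ltr0_norm ?subr_lt0// opprB ltrD2r => nv; rewrite tn nv; split => //.
exists n, (ridx a n t).+1; apply: tau_grid; rewrite leNgt; apply/negP => h.
have E : next n t = b by apply: min_l; exact: ltW.
by have := lt_le_trans nv vb; rewrite E ltxx.
Qed.

Section counts.
Variables (x : R -> R) (e : R).
Hypothesis e0 : 0 < e.
Hypothesis hx : tame x e.

Let c n v := path_count x e n (ridx a n v).

Let c_mono n u v : u <= v -> (c n u <= c n v)%N.
Proof. by move=> uv; apply: anchor_count_mono; exact: ridx_mono. Qed.

(** Both points belong to every sufficiently fine grid, so the anchor process sees the oscillation
    between them. *)
Let c_jump p q : dyadic p -> dyadic q -> p < q -> q <= b -> 2 * e <= `|x p - x q| ->
  exists N, forall n, (N <= n)%N -> (c n p < c n q)%N.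
Proof.
move=> /dyadic_refine[N1 h1] /dyadic_refine[N2 h2] pq qb osc.
exists (maxn N1 N2) => n; rewrite geq_max => /andP[/h1[k kp] /h2[l lq]].
apply: anchor_oscillation => //; first by apply: ridx_mono; exact: ltW.
by rewrite kp lq !ridx_grid !tau_grid -?lq -?kp// (le_trans (ltW pq)).
Qed.

Let c_bounded (u v : R) : v <= b ->
  ~ (forall K : nat, exists N, forall n, (N <= n)%N -> (c n u + K <= c n v)%N).
Proof.
move=> vb h; have [K hK] := hx; have [N hN] := h K.+1; have [n Nn] := hK N.
apply/negP; rewrite -ltnNge.
have : (c n v <= path_count x e n (last_idx n))%N.
  apply: anchor_count_mono; rewrite /last_idx; exact: leqW (ridx_mono n vb).
by apply: leq_trans; apply: leq_trans (hN _ Nn); exact: leq_addl.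
Qed.

(** Oscillations found closer and closer to [t] occupy disjoint intervals and each costs a jump, so
    any number of them fits to the right of [t]. For a tame path this contradicts [c_bounded]. *)
Let right_counts t : (forall v, t < v <= b ->
  exists p q, [/\ dyadic p, dyadic q, t < p, p < q & q < v /\ 2 * e <= `|x p - x q|]) ->
  forall (K : nat) v, t < v <= b -> exists N, forall n, (N <= n)%N -> (c n t + K <= c n v)%N.
Proof.
move=> H; elim=> [|K IH] v /[dup] tvb /andP[tv vb].
  by exists 0%N => n _; rewrite addn0; apply: c_mono; exact: ltW.
have [p [q [dp dq tp pq [qv osc]]]] := H _ tvb.
have pb : p <= b by rewrite (le_trans _ vb)// ltW// (lt_trans pq).
have [N1 h1] := IH p (introT andP (conj tp pb)).
have qb : q <= b by rewrite (le_trans (ltW qv)).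
have [N2 h2] := c_jump dp dq pq qb osc.
exists (maxn N1 N2) => n; rewrite geq_max => /andP[/h1 g1 /h2 g2].
rewrite addnS; apply: leq_trans (c_mono n (ltW qv)).
by apply: leq_ltn_trans g2.
Qed.

Let left_counts t : t <= b -> (forall u, a <= u < t ->
  exists p q, [/\ dyadic p, dyadic q, u < p, p < q & q < t /\ 2 * e <= `|x p - x q|]) ->
  forall (K : nat) u, a <= u < t -> exists N, forall n, (N <= n)%N -> (c n u + K <= c n t)%N.
Proof.
move=> tb H; elim=> [|K IH] u /[dup] aut /andP[au ut].
  by exists 0%N => n _; rewrite addn0; apply: c_mono; exact: ltW.
have [p [q [dp dq up pq [qt osc]]]] := H _ aut.
have aq : a <= q by rewrite (le_trans au)// ltW// (lt_trans up).
have [N1 h1] := IH q (introT andP (conj aq qt)).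
have qb : q <= b by rewrite (le_trans (ltW qt)).
have [N2 h2] := c_jump dp dq pq qb osc.
exists (maxn N1 N2) => n; rewrite geq_max => /andP[/h1 g1 /h2 g2].
rewrite addnS -addSn; apply: leq_trans g1; rewrite leq_add2r.
by apply: leq_ltn_trans g2; exact: c_mono (ltW up).
Qed.

Let symmetric_osc (u v : R) :
  ~ (exists p q, [/\ dyadic p, dyadic q, u < p, p < q & q < v /\ 2 * e <= `|x p - x q|]) ->
  forall p q, dyadic p -> dyadic q -> u < p < v -> u < q < v -> `|x p - x q| < 2 * e.
Proof.
move=> H p q dp dq /andP[up pv] /andP[uq qv].
rewrite ltNge; apply/negP => osc; apply: H.
have [pq|qp|pq] := ltgtP p q; [by exists p, q|by exists q, p; split => //; rewrite distrC|].
by move: osc; rewrite pq subrr normr0 leNgt mulr_gt0.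
Qed.

Lemma right_oscillation t : a <= t -> t < b -> exists2 v, t < v <= b &
  forall p q, dyadic p -> dyadic q -> t < p < v -> t < q < v -> `|x p - x q| < 2 * e.
Proof.
move=> at_ tb; apply: contrapT => H.
apply: (@c_bounded t b (lexx _)) => K.
apply: right_counts; last by rewrite tb lexx.
move=> v tv; apply: contrapT => H'; apply: H; exists v => //; exact: symmetric_osc.
Qed.

Lemma left_oscillation t : a < t -> t <= b -> exists2 u, a <= u < t &
  forall p q, dyadic p -> dyadic q -> u < p < t -> u < q < t -> `|x p - x q| < 2 * e.
Proof.
move=> at_ tb; apply: contrapT => H.
apply: (@c_bounded a t tb) => K.
apply: left_counts => //; last by rewrite lexx.
move=> u ut; apply: contrapT => H'; apply: H; exists u => //; exact: symmetric_osc.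
Qed.

End counts.

Section version.
Variable x : R -> R.
Hypothesis hx : forall j : nat, tame x j.+1%:R^-1.

(** The right limit along grid points strictly after [t]; at [b], where [next] returns [b], it keeps
    the value of [x]. *)
Definition rversion t : R := limn (fun n => x (next n t)).

Let small (eps : R) : 0 < eps -> exists2 e, 0 < e & tame x e /\ 2 * e < eps.
Proof.
move=> e0; have [j _ hj] := (near_infty_natSinv_lt (PosNum (divr_gt0 e0 (ltr0n R 2)))).
exists j.+1%:R^-1; first by rewrite invr_gt0.
split => //; have := hj j (leqnn _) => /=.
by rewrite ltr_pdivlMr// mulrC.
Qed.

Lemma rversion_cvg t : a <= t <= b -> x (next n t) @[n --> \oo] --> rversion t.
Proof.
move=> /andP[at_ tb]; suff : cvgn (fun n => x (next n t)) by [].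
move: tb; rewrite le_eqVlt => /predU1P[tE|tb].
  apply/cvg_ex; exists (x b); apply: cvg_near_cst; apply: nearW => n.
  by rewrite tE next_end// -tE.
apply/cauchy_cvgP/cauchy_exP => eps e0; have [e e_gt0 [te ee]] := small e0.
have [v /andP[tv vb] hv] := right_oscillation e_gt0 te at_ tb.
have nd := next_dyadic at_ tv vb.
have [N _ hN] := nd.
exists (x (next N t)); apply: filterS nd => n [dn hn].
have [dN hN'] := hN N (leqnn _).
by rewrite /ball/=; apply: lt_trans ee; exact: hv.
Qed.

Lemma rversion_end : a <= b -> rversion b = x b.
Proof.
move=> ab; apply: cvg_lim => //; apply: cvg_near_cst; apply: nearW => n.
by rewrite next_end.
Qed.

Lemma rversion_cadlag : cadlag_on a b rversion.
Proof.
(* The oscillation bound over dyadic points passes to the limits. As [next] lies strictly to the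
   right, the left end [u] itself is included. *)
have close eps u v r r' : 0 < eps -> a <= u -> v <= b ->
    (forall p q, dyadic p -> dyadic q -> u < p < v -> u < q < v -> `|x p - x q| < eps) ->
    u <= r < v -> u <= r' < v -> `|rversion r - rversion r'| <= eps.
  move=> e0 au vb H /andP[ur rv] /andP[ur' r'v].
  have ar : a <= r by exact: le_trans ur.
  have ar' : a <= r' by exact: le_trans ur'.
  have c1 := @rversion_cvg r; rewrite ar (le_trans (ltW rv) vb) in c1.
  have c2 := @rversion_cvg r'; rewrite ar' (le_trans (ltW r'v) vb) in c2.
  have c : `|x (next n r) - x (next n r')| @[n --> \oo] --> `|rversion r - rversion r'|.
    by apply: cvg_norm; apply: cvgB; [exact: c1|exact: c2].
  rewrite -(cvg_lim _ c)//; apply: limr_le; first by apply/cvg_ex; eexists; exact: c.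
  near=> n.
  have [d1 /andP[p1 p2]] : dyadic (next n r) /\ r < next n r < v by near: n; exact: next_dyadic.
  have [d2 /andP[q1 q2]] : dyadic (next n r') /\ r' < next n r' < v by near: n; exact: next_dyadic.
  by apply: ltW; apply: H => //; rewrite ?p2 ?q2 andbT; [exact: le_lt_trans p1|exact: le_lt_trans q1].
split=> t /andP[at_ tb].
  apply/cvgrPdist_le => eps e0; have [e e_gt0 [te ee]] := small e0.
  have [v /andP[tv vb] hv] := right_oscillation e_gt0 te at_ tb.
  near=> r; have tr : t < r by near: r; exact: nbhs_right_gt.
  have rv : r < v by near: r; exact: nbhs_right_lt.
  apply: (close eps t v) => //; last 2 first.
  - by rewrite lexx.
  - by rewrite (ltW tr).
  - by move=> p q dp dq hp hq; apply: lt_trans ee; exact: hv.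
apply/cvg_ex/cauchy_cvgP/cauchy_exP => eps e0; have [e e_gt0 [te ee]] := small e0.
have [u /andP[au ut] hu] := left_oscillation e_gt0 te at_ tb.
exists (rversion ((u + t) / 2)).
suff : \forall r \near t^'-, ball (rversion ((u + t) / 2)) eps (rversion r) by [].
near=> r.
have ur : u < r by near: r; exact: nbhs_left_gt.
have rt : r < t by near: r; exact: nbhs_left_lt.
rewrite /ball/=; apply: (le_lt_trans _ ee); apply: (close (2 * e) u t) => //.
- by rewrite mulr_gt0.
- by rewrite !midf_le ?midf_lt// ltW.
- by rewrite (ltW ur).
Unshelve. all: by end_near. Qed.

End version.

End dyadic_regularity.

(** * Maximal bounds and cadlag versions of square-integrable martingales *)

Section fatou_dominant.
Context d (W : measurableType d) (R : realType) (mu : probability W R).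

Lemma le_limn_einf (u : nat -> \bar R) (c : \bar R) N :
  (forall n, (N <= n)%N -> (c <= u n)%E) -> (c <= limn_einf u)%E.
Proof.
move=> h; rewrite limn_einf_lim.
apply: lime_ge; first exact: is_cvg_einfs.
exists N => // n /= Nn; apply: le_trans (nondecreasing_einfs u Nn).
apply: le_ereal_inf_tmp => _ [m /= Nm <-]; exact: h.
Qed.

Lemma limn_einf_le_cst (u : nat -> \bar R) (c : \bar R) :
  (forall n, (u n <= c)%E) -> (limn_einf u <= c)%E.
Proof.
move=> h; rewrite limn_einf_lim; apply: lime_le; first exact: is_cvg_einfs.
apply: nearW => n; apply: le_trans (h n).
by apply: ereal_inf_lbound; exists n => /=.
Qed.

(** The lower limit of [f n] is integrable by Fatou and lies above whatever the [f n] eventually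
    exceed. It bounds the squares at dyadic points in one application and the numbers of jumps in
    another. *)
Lemma fatou_dominant (f : nat -> W -> R) (c : R) :
  (forall n, measurable_fun setT (f n)) -> (forall n w, 0 <= f n w) ->
  (forall n, (\int[mu]_w (f n w)%:E <= c%:E)%E) ->
  exists G : W -> R, [/\ mu.-integrable setT (EFin \o G), forall w, 0 <= G w &
  {ae mu, forall w K, (exists N, forall n, (N <= n)%N -> K <= f n w) -> K <= G w}].
Proof.
move=> mf f0 fc; pose g w := limn_einf (fun n => (f n w)%:E).
have mfE n : measurable_fun setT (fun w => (f n w)%:E) by exact/measurable_EFinP.
have g0 w : (0 <= g w)%E.
  by apply: (@le_limn_einf _ _ 0%N) => n _; rewrite lee_fin.
have mg : measurable_fun setT g.
  apply: (@emeasurable_fun_cvg _ _ _ _ (fun n w => einfs (fun n => (f n w)%:E) n)).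
    by move=> n; exact: measurable_fun_einfs.
  by move=> w _; rewrite /g limn_einf_lim; exact: is_cvg_einfs.
have ig : mu.-integrable setT g.
  apply/integrableP; split => //; under eq_integral do rewrite gee0_abs//.
  apply: (@le_lt_trans _ _ c%:E); last by rewrite ltry.
  have f0E n w : setT w -> (0 <= (f n w)%:E)%E by rewrite lee_fin.
  apply: (le_trans (fatou mu measurableT mfE f0E)).
  exact: limn_einf_le_cst.
have mfg : measurable_fun setT (fine \o g).
  by apply: measurableT_comp => //; exact: mg.
exists (fine \o g); split.
- apply: (le_integrable measurableT _ _ ig); first exact/measurable_EFinP.
  move=> w _ /=; rewrite ger0_norm ?fine_ge0//.
  by case: (g w) (g0 w) => [r r0|_|//]; [rewrite gee0_abs|rewrite leey].
- by move=> w /=; exact: fine_ge0.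
- have := integrable_ae measurableT ig; apply: filterS => w /(_ I) fg K [N hN] /=.
  rewrite -lee_fin fineK//; apply: (@le_limn_einf _ _ N) => n Nn.
  by rewrite lee_fin; exact: hN.
Qed.

End fatou_dominant.

Section cond_zero.
Context d (W : measurableType d) (R : realType) (mu : probability W R) (G : set (set W)).
Hypotheses (sG : sigma_algebra setT G) (subG : G `<=` measurable).

Lemma cond_zero (h : W -> R) : mu.-integrable setT (EFin \o h) ->
  measurable_wrt G h -> (forall B, G B -> \int[mu]_(w in B) h w = 0) ->
  {ae mu, forall w, h w = 0}.
Proof.
move=> ih mh h0.
have mh' : measurable_fun setT (h : g_sigma_algebraType G -> R) by exact/measurable_wrtP.
(* The sign of [h], with value 1 at 0, so that [Y * h] is the absolute value. *)
pose Y w : R := 2 * \1_(`[0, +oo[%classic : set R) (h w) - 1.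
have msg : measurable_fun setT (Y : g_sigma_algebraType G -> R).
  apply: measurable_funB => //; apply: measurable_funM => //.
  by apply: measurableT_comp => //; exact: measurable_indic.
have E w : Y w * h w = `|h w|.
  rewrite /Y indicE mem_setE in_itv/= andbT; case: ger0P => _; first by rewrite mulr1 addrK mul1r.
  by rewrite mulr0 sub0r mulN1r.
have ia : mu.-integrable setT (fun w => (Y w * h w)%:E).
  under eq_fun do rewrite E.
  exact: (integrable_abse ih).
have := cond_pull sG subG ih h0 (proj2 (measurable_wrtP sG _) msg) ia.
under eq_Rintegral do rewrite E.
move=> z; have : (\int[mu]_w `|(EFin \o h) w| = 0)%E.
  rewrite -[LHS]fineK; first by congr (_%:E); exact: z.
  have /integrableP[_ hlt] := ih.
  by rewrite fin_num_abs gee0_abs ?integral_ge0.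
move/(ae_eq_integral_abs mu measurableT (measurable_int _ ih)).
by apply: filterS => w /(_ I) /= [].
Qed.

End cond_zero.

Section regularization.
Context d (W : measurableType d) (R : realType) (mu : probability W R).
Variables (Flt : R -> set (set W)) (a b : R).
Hypotheses (ab : a <= b) (hF : filtration_on Flt a b).
Notation gst G := (g_sigma_algebraType G).

(** A dyadic point belongs to all finer grids, so the value there is eventually below the running
    maximum [S n]; Doob bounds the mean of [S n ^+ 2] uniformly in [n]. *)
Lemma dyadic_dominant M : martingale mu Flt a b M -> sqi mu (M b) ->
  exists G : W -> R, [/\ mu.-integrable setT (EFin \o G), forall w, 0 <= G w &
  {ae mu, forall w n k, M (tau a b n k) w ^+ 2 <= G w}].
Proof.
move=> mM sM; pose tb n k := @tau_bounds _ a b n k ab.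
pose x n w k := M (tau a b n k) w.
pose S n w := runmax (x n w) (last_idx a b n).
have sS n : sqi mu (S n).
  exact: (sqi_runmax hF mM sM (tb n) (tau_nondecreasing a b n)).
have [|n w|n|G [iG G0 hG]] := @fatou_dominant _ _ _ mu (fun n w => S n w ^+ 2) (4 * ip mu (M b) (M b)).
- by move=> n; apply: measurable_funX; exact: (sS n).1.
- exact: sqr_ge0.
- rewrite (ip_sqrE (sS n)) lee_fin.
  have := doob_discrete hF mM sM (tb n) (tau_nondecreasing a b n) (last_idx a b n).
  by rewrite tau_last.
exists G; split => //; apply: filterS hG => w hG n k; apply: hG.
suff H m l : (l <= last_idx a b m)%N -> M (tau a b m l) w ^+ 2 <= S m w ^+ 2.
  have [gb|gb] := leP (grid a n k) b; last first.
    exists 0%N => m _; rewrite /tau (min_l (ltW gb)) -[X in M X w](tau_last m ab).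
    exact: H.
  have [N hN] := dyadic_refine (ex_intro _ n (ex_intro _ k erefl) : dyadic a (grid a n k)).
  exists N => m /hN[l kl]; rewrite tau_grid// kl -(@tau_grid _ a b) -?kl//; apply: H.
  have := ridx_mono a m gb; rewrite kl ridx_grid /last_idx => h; exact: leqW.
move=> lm; rewrite -(real_normK (num_real (M _ _))) lerXn2r ?nnegrE//.
  exact: runmax_ge0.
exact: (runmax_ge (x m w) lm).
Qed.

Lemma doob_dominant M : martingale mu Flt a b M -> sqi mu (M b) ->
  (forall w r, a <= r < b -> M q w @[q --> r^'+] --> M r w) ->
  exists G : W -> R, [/\ mu.-integrable setT (EFin \o G), forall w, 0 <= G w &
  {ae mu, forall w t, a <= t <= b -> M t w ^+ 2 <= G w}].
Proof.
move=> mM sM cM; have [G [iG G0 hG]] := dyadic_dominant mM sM.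
exists G; split => //; apply: filterS hG => w hG t /andP[at_ ].
rewrite le_eqVlt => /predU1P[->|tb]; first by have := hG 0%N (last_idx a b 0); rewrite tau_last.
have c : M (next a b n t) w @[n --> \oo] --> M t w.
  have /cvg_at_rightP := cM w t (introT andP (conj at_ tb)); apply.
  split; first by move=> n; exact: next_gt.
  by apply: cvg_next; rewrite at_ ltW.
have c2 : M (next a b n t) w ^+ 2 @[n --> \oo] --> M t w ^+ 2.
  by rewrite expr2; under eq_fun do rewrite expr2; exact: cvgM.
rewrite -(cvg_lim _ c2)//; apply: limr_le; first by apply/cvg_ex; eexists; exact: c2.
by apply: nearW => n; exact: hG.
Qed.

(** On a path that is not tame the counts tend to infinity, while their means are bounded uniformly
    in the level. The finite dominant [G] excludes this almost surely. *)
Lemma ae_tame M e : martingale mu Flt a b M -> sqi mu (M b) -> 0 < e ->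
  {ae mu, forall w, tame a b (M^~ w) e}.
Proof.
move=> mM sM e0; pose tb n k := @tau_bounds _ a b n k ab.
pose C n w : R := (path_count a b (M^~ w) e n (last_idx a b n))%:R.
have mC n : measurable_fun setT (C n).
  exact: (measurable_anchor_count hF mM (tb n) (tau_nondecreasing a b n)).
have cE n : (\int[mu]_w (C n w)%:E <= (ip mu (M b) (M b) / e ^+ 2)%:E)%E.
  have iC := integrable_anchor_count hF mM (tb n) (tau_nondecreasing a b n) e (last_idx a b n).
  rewrite -(fineK (integrable_fin_num measurableT iC)) lee_fin ler_pdivlMr ?exprn_gt0// mulrC.
  have := anchor_count_expectation hF mM sM (tb n) (tau_nondecreasing a b n) e0 (last_idx a b n).
  by rewrite tau_last.
have C0 n w : 0 <= C n w by rewrite /C.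
have [G [_ _ hG]] := fatou_dominant mC C0 cE.
apply: filterS hG => w hG; apply: contrapT => h.
have {}h K : exists N, forall n, (N <= n)%N -> (K < path_count a b (M^~ w) e n (last_idx a b n))%N.
  apply: contrapT => h'; apply: h; exists K => N; apply: contrapT => h2; apply: h'.
  exists N => n Nn; rewrite ltnNge; apply/negP => h3; apply: h2; by exists n.
have := truncnS_gt (G w).
have [N hN] := h (Num.truncn (G w)).+1.
have : (Num.truncn (G w)).+2%:R <= G w.
  by apply: hG; exists N => n Nn; rewrite ler_nat; exact: hN.
move=> h1 h2.
by have := le_lt_trans h1 h2; rewrite ltr_nat ltnNge leqnSn.
Qed.

Hypothesis complete : forall t B, a <= t <= b -> mu.-negligible B -> Flt t B.
Hypothesis right_continuous : forall t B, a <= t -> t < b ->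
  (forall u, t < u <= b -> Flt u B) -> Flt t B.

Section version.
Variable M : R -> W -> R.
Hypotheses (mM : martingale mu Flt a b M) (sM : sqi mu (M b)).

Let Good : set W := [set w | forall j : nat, tame a b (M^~ w) j.+1%:R^-1].

Let ae_good : {ae mu, forall w, Good w}.
Proof.
by apply/ae_foralln => j; apply: ae_tame.
Qed.

Let F_good t : a <= t <= b -> Flt t Good.
Proof.
move=> atb; have [_ hC _] := flt_sigma hF atb.
rewrite -[Good]setCK -setTD; apply: hC; apply: complete => //.
Qed.

Let V t w : R := \1_Good w * rversion a b (M^~ w) t.

Let wE : {ae mu, forall w, V^~ w = rversion a b (M^~ w)}.
Proof.
apply: filterS ae_good => w gw; apply/funext => t.
by rewrite /V indicE mem_set// mul1r.
Qed.

Let V_cadlag w : cadlag_on a b (V^~ w).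
Proof.
rewrite /V indicE; have [gw|gw] := pselect (Good w).
  by rewrite mem_set//=; under eq_fun do rewrite mul1r; exact: rversion_cadlag.
rewrite memNset//=; under eq_fun do rewrite mul0r.
by split => t _; [exact: cvg_cst|exists 0; exact: cvg_cst].
Qed.

Let mgood t : a <= t <= b -> measurable_fun setT (\1_Good : gst (Flt t) -> R).
Proof.
move=> atb; apply: (measurable_indic (R := R)); apply: sub_sigma_algebra; exact: F_good.
Qed.

Let V_adapted : adapted Flt a b V.
Proof.
move=> t /[dup] atb /andP[at_].
rewrite le_eqVlt => /predU1P[tE|tb].
  apply/(flt_wrtP hF atb); subst t.
  rewrite (_ : V b = (fun w => \1_Good w * M b w)).
    apply: measurable_funM; first exact: mgood.
    exact/(flt_wrtP hF atb)/mM.1.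
  by apply/funext => w; rewrite /V rversion_end.
move=> B mB; apply: right_continuous => // u /andP[tu ub].
have aub : a <= u <= b by rewrite ub andbT (le_trans at_)// ltW.
have su := flt_sigma hF aub.
suff : measurable_fun setT (V t : gst (Flt u) -> R) by move/(measurable_wrtP su); exact.
(* Cut at [u], the values at the next grid points are known at time [u], and the cut is eventually
   inactive. As [u > t] is arbitrary, right continuity of the filtration yields time [t]. *)
apply: (@measurable_fun_cvg _ (gst (Flt u)) R setT (fun n (w : gst (Flt u)) => \1_Good w * M (Num.min u (next a b n t)) w)).
  move=> n; apply: measurable_funM; first exact: mgood.
  apply/(measurable_wrtP su).
  have bn : a <= Num.min u (next a b n t) <= u.
    rewrite le_min ge_min lexx/= andbT (le_trans at_ (ltW tu))/=.
    by have /andP[] := tau_bounds n (ridx a n t).+1 ab.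
  have /andP[n1 n2] := bn.
  apply: (measurable_wrt_mono hF n1 n2 ub); apply: mM.1.
  by rewrite n1 (le_trans n2).
move=> w _; rewrite /V indicE; have [gw|gw] := pselect (Good w); last first.
  by rewrite memNset//= mul0r; under eq_fun do rewrite mul0r; exact: cvg_cst.
rewrite mem_set//= mul1r; under eq_fun do rewrite mul1r.
have c := rversion_cvg gw atb.
apply: cvg_trans c; apply: near_eq_cvg; near=> n.
rewrite (_ : Num.min u _ = next a b n t)//.
apply: min_r; apply: ltW.
by near: n; apply: filterS (next_dyadic at_ tu ub) => n [_ /andP[]].
Unshelve. all: by end_near. Qed.

(** Over a set of [Flt t] the integral of [M] at the next grid point does not depend on [n], and it
    converges to that of [V t]. Both variables are [Flt t]-measurable, so [cond_zero] applies to
    their difference. *)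
Let V_modif t : a <= t <= b -> {ae mu, forall w, M t w = V t w}.
Proof.
move=> /[dup] atb /andP[at_].
rewrite le_eqVlt => /predU1P[->|tb].
  by apply: filterS wE => w /(congr1 (fun f => f b)) ->; rewrite rversion_end.
have [G [iG G0 hG]] := dyadic_dominant mM sM.
have mV : measurable_fun setT (V t) by exact: (adapted_measurable hF V_adapted).
have nb n : a <= next a b n t <= b by exact: tau_bounds.
(* [G] dominates squares; |x| <= 1 + x^2 gives a dominant for the values. *)
have iG1 : mu.-integrable setT (EFin \o (fun w => 1 + G w)).
  have := integrableD measurableT (finite_measure_integrable_cst mu (1 : R) measurableT) iG.
  exact: eq_integrable.
have D B : measurable B -> mu.-integrable B (EFin \o V t) /\
    \int[mu]_(w in B) M (next a b n t) w @[n --> \oo] --> \int[mu]_(w in B) V t w.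
  move=> mB; apply: (@Rintegral_dct _ _ _ mu B (fun n => M (next a b n t)) (V t) (fun w => 1 + G w)) => //.
  - by move=> n; apply: measurable_funTS; exact: (martingale_measurable hF mM).
  - exact: measurable_funTS.
  - move: ae_good wE; apply: filterS2 => w gw /(congr1 (fun f => f t)) -> _.
    exact: rversion_cvg.
  - exact: integrableS iG1.
  - apply: filterS hG => w hG n _; have := hG n (ridx a n t).+1.
    rewrite -/(next a b n t); set x := M _ _ => hx.
    apply: (@le_trans _ _ (1 + x ^+ 2)); last by rewrite lerD2l.
    rewrite -(real_normK (num_real x)) -subr_ge0.
    have := sqr_ge0 (`|x| - 1 / 2); lra.
have iV := (D setT measurableT).1.
have iM := martingale_int mM atb.
have z : {ae mu, forall w, M t w - V t w = 0}.
  apply: (cond_zero (flt_sigma hF atb) (flt_sub hF atb)).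
  - exact: (integrableB measurableT iM iV).
  - apply/(flt_wrtP hF atb); apply: measurable_funB;
    apply/(flt_wrtP hF atb); [exact: mM.1|exact: V_adapted].
  - move=> B FB; have mB := flt_sub hF atb FB.
    rewrite RintegralB//; [|exact: integrableS iM|exact: integrableS iV].
    apply/eqP; rewrite subr_eq0; apply/eqP.
    apply: (cvg_unique _ _ (D B mB).2) => //.
    apply: cvg_near_cst; apply: nearW => n; apply/esym.
    apply: (martingale_eq mM) => //; last by have /andP[] := nb n.
    exact: ltW (next_gt n at_ tb).
by apply: filterS z => w /eqP; rewrite subr_eq0 => /eqP.
Qed.

Lemma cadlag_version : exists M' : R -> W -> R,
  [/\ martingale mu Flt a b M', forall w, cadlag_on a b (M'^~ w) &
  forall t, a <= t <= b -> {ae mu, forall w, M t w = M' t w}].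
Proof.
exists V; split; [|exact: V_cadlag|exact: V_modif].
exact: (modification_martingale hF mM V_adapted V_modif).
Qed.

End version.

End regularization.

(** * Usual conditions and versions that are regular on every path *)

Section usual_conditions.
Context d (W : measurableType d) (R : realType) (mu : probability W R).
Variables (Flt : R -> set (set W)) (a b : R).

Record usual : Prop := Usual {
  us_le : a <= b;
  us_flt : filtration_on Flt a b;
  us_complete : forall t B, a <= t <= b -> mu.-negligible B -> Flt t B;
  us_right : forall t B, a <= t -> t < b -> (forall u, t < u <= b -> Flt u B) -> Flt t B }.

(** Cadlag on every path and dominated in the square by one variable for all times: pathwise
    calculus then has no exceptional set, and products of two such processes come with an integrable
    bound. *)
Definition nice (M : R -> W -> R) : Prop :=
  [/\ martingale mu Flt a b M, sqi mu (M b), forall w, cadlag_on a b (M^~ w) &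
  exists2 G : W -> R, mu.-integrable setT (EFin \o G) &
  forall w t, a <= t <= b -> M t w ^+ 2 <= G w].

Hypothesis us : usual.
Let ab := us_le us.
Let hF := us_flt us.
Notation gst G := (g_sigma_algebraType G).

Lemma flt_ae t (A : set W) : a <= t <= b -> {ae mu, forall w, A w} -> Flt t A.
Proof.
move=> atb h; have [_ hC _] := flt_sigma hF atb.
by rewrite -[A]setCK -setTD; apply: hC; exact: us_complete.
Qed.

Lemma flt_indic t (A : set W) : a <= t <= b -> {ae mu, forall w, A w} ->
  measurable_fun setT (\1_A : gst (Flt t) -> R).
Proof.
move=> atb h; apply: (measurable_indic (R := R)).
by apply: sub_sigma_algebra; exact: flt_ae.
Qed.

Lemma adapted_null M (A : set W) : {ae mu, forall w, A w} -> adapted Flt a b M ->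
  adapted Flt a b (fun t w => \1_A w * M t w).
Proof.
move=> h aM t atb; apply/(flt_wrtP hF atb).
apply: measurable_funM; first exact: flt_indic.
exact/(flt_wrtP hF atb)/aM.
Qed.

Lemma indic_null (M : R -> W -> R) (A : set W) : {ae mu, forall w, A w} ->
  {ae mu, forall w t, M t w = \1_A w * M t w}.
Proof. by apply: filterS => w Aw t; rewrite indicE mem_set// mul1r. Qed.

Lemma martingale_null M (A : set W) : {ae mu, forall w, A w} ->
  martingale mu Flt a b M -> martingale mu Flt a b (fun t w => \1_A w * M t w).
Proof.
move=> h mM; apply: (modification_martingale hF mM (adapted_null h mM.1)) => t _.
by apply: filterS (indic_null M h).
Qed.

Lemma cadlag_null (x : R -> R) (A : set W) w : (A w -> cadlag_on a b x) ->
  cadlag_on a b (fun t => \1_A w * x t).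
Proof.
rewrite indicE; have [Aw /(_ Aw)|Aw _] := pselect (A w).
  by move=> c; under eq_fun do rewrite mem_set// mul1r.
rewrite memNset//=; under eq_fun do rewrite mul0r.
by split => t _; [exact: cvg_cst|exists 0; exact: cvg_cst].
Qed.

Lemma sqi_null (f : W -> R) (A : set W) : {ae mu, forall w, A w} ->
  sqi mu f -> sqi mu (fun w => \1_A w * f w).
Proof.
move=> h; apply: sqi_indic; apply: (flt_sub hF (t := b)); first by rewrite ab lexx.
by apply: flt_ae => //; rewrite ab lexx.
Qed.

(** Two null sets are erased by setting paths to 0: first the paths that are not cadlag, which makes
    Doob's bound available, then those on which that bound fails. Adaptedness survives by
    completeness. *)
Lemma nice_version M : martingale mu Flt a b M -> sqi mu (M b) -> ae_cadlag mu a b M ->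
  exists2 M', nice M' & {ae mu, forall w t, M t w = M' t w}.
Proof.
move=> mM sM cM; pose A1 := [set w | cadlag_on a b (M^~ w)].
pose M1 t w := \1_A1 w * M t w.
have c1 w : cadlag_on a b (M1^~ w) by exact: cadlag_null.
have m1 : martingale mu Flt a b M1 by exact: martingale_null.
have s1 : sqi mu (M1 b) by exact: sqi_null.
have [G [iG G0 hG]] : exists G : W -> R, [/\ mu.-integrable setT (EFin \o G), forall w, 0 <= G w &
    {ae mu, forall w t, a <= t <= b -> M1 t w ^+ 2 <= G w}].
  exact: (doob_dominant ab hF m1 s1 (fun w => (c1 w).1)).
pose A2 := [set w | forall t, a <= t <= b -> M1 t w ^+ 2 <= G w].
exists (fun t w => \1_A2 w * M1 t w).
  split; [exact: martingale_null|exact: sqi_null|by move=> w; exact: cadlag_null|].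
  exists G => // w t atb; rewrite indicE; have [Aw|Aw] := pselect (A2 w).
    by rewrite mem_set// mul1r; exact: Aw.
  by rewrite memNset// mul0r expr0n G0.
have e1 : {ae mu, forall w t, M t w = M1 t w} := indic_null M (A := A1) cM.
have e2 : {ae mu, forall w t, M1 t w = \1_A2 w * M1 t w} := indic_null M1 (A := A2) hG.
by move: e1 e2; apply: filterS2 => w h1 h2 t; rewrite h1 -h2.
Qed.

(** No regularity of the paths of [M] is assumed, hence agreement at each fixed time only, in
    contrast with [nice_version]. *)
Lemma nice_modification M : martingale mu Flt a b M -> sqi mu (M b) ->
  exists2 M', nice M' & forall t, a <= t <= b -> {ae mu, forall w, M t w = M' t w}.
Proof.
move=> mM sM; have [M1 [m1 c1 e1]] := cadlag_version ab hF (us_complete us) (us_right us) mM sM.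
have bb : a <= b <= b by rewrite ab lexx.
have s1 : sqi mu (M1 b).
  split; first exact: (martingale_measurable hF m1).
  rewrite (_ : (\int[mu]_w _ = \int[mu]_w (M b w ^+ 2)%:E)%E); first exact: sM.2.
  have mM2 := martingale_measurable hF m1 bb.
  apply: ae_eq_integral => //; [| |].
  - by apply/measurable_EFinP; exact: measurable_funX.
  - by apply/measurable_EFinP; apply: measurable_funX; exact: sM.1.
  - by apply: filterS (e1 b bb) => w -> _.
have [|M2 n2 e2] := nice_version m1 s1; first by apply: aeW.
exists M2 => // t atb; move: (e1 t atb) e2; apply: filterS2 => w -> h.
exact: h.
Qed.

End usual_conditions.

Section nice_facts.
Context d (W : measurableType d) (R : realType) (mu : probability W R).
Variables (Flt : R -> set (set W)) (a b : R).
Hypothesis us : usual mu Flt a b.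
Let hF := us_flt us.
Implicit Types M N : R -> W -> R.

Lemma nice_sqi M t : nice mu Flt a b M -> a <= t <= b -> sqi mu (M t).
Proof.
case=> mM sM _ _ /andP[at_ tb].
by have [] := martingale_sqi hF mM at_ tb (lexx b) sM.
Qed.

Lemma nice_rcont M w r : nice mu Flt a b M -> a <= r < b -> M q w @[q --> r^'+] --> M r w.
Proof. by case=> _ _ h _ arb; exact: (h w).1. Qed.

Lemma nice_prog M : nice mu Flt a b M -> prog Flt a b M.
Proof.
move=> nM; apply: rcont_prog => //; first by case: nM => -[].
by move=> w r; exact: nice_rcont.
Qed.

Lemma nice_linear M N (k : R) : nice mu Flt a b M -> nice mu Flt a b N ->
  nice mu Flt a b (fun t w => k * M t w + N t w).
Proof.
move=> [mM sM cM [G iG hG]] [mN sN cN [H iH hH]]; split.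
- exact: martingale_linear.
- by apply: sqiD => //; exact: sqiZ.
- move=> w; split => t ht.
    by apply: cvgD; [apply: cvgMr; exact: (cM w).1|exact: (cN w).1].
  have [l1 h1] := (cM w).2 t ht; have [l2 h2] := (cN w).2 t ht.
  by exists (k * l1 + l2); apply: cvgD => //; exact: cvgMr.
- exists (fun w => 2 * k ^+ 2 * G w + 2 * H w).
    have i1 : mu.-integrable setT (EFin \o (fun w => 2 * k ^+ 2 * G w)).
    by have := integrableZl measurableT (2 * k ^+ 2) iG; apply: eq_integrable.
    have i2 : mu.-integrable setT (EFin \o (fun w => 2 * H w)).
    by have := integrableZl measurableT 2 iH; apply: eq_integrable.
    by have := integrableD measurableT i1 i2; apply: eq_integrable.
  move=> w t atb; have h1 := hG w t atb; have h2 := hH w t atb.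
  have h3 : k ^+ 2 * M t w ^+ 2 <= k ^+ 2 * G w by rewrite ler_wpM2l ?sqr_ge0.
  apply: (@le_trans _ _ (2 * (k ^+ 2 * M t w ^+ 2) + 2 * N t w ^+ 2)).
    rewrite -subr_ge0; have := sqr_ge0 (k * M t w - N t w); rewrite !sqrrB sqrrD exprMn.
    lra.
  rewrite -mulrA; lra.
Qed.

Lemma nice_bound M N : nice mu Flt a b M -> nice mu Flt a b N ->
  exists2 G : W -> R, mu.-integrable setT (EFin \o G) &
  forall w r t, a <= r <= b -> a <= t <= b -> `|M r w * N t w| <= G w.
Proof.
move=> [_ _ _ [G iG hG]] [_ _ _ [H iH hH]].
exists (fun w => G w + H w).
  by have := integrableD measurableT iG iH; apply: eq_integrable.
move=> w r t ar at_; apply: le_trans (lerD (hG w r ar) (hH w t at_)).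
rewrite normrM -(real_normK (num_real (M r w))) -(real_normK (num_real (N t w))).
have := sqr_ge0 (`|M r w| - `|N t w|); rewrite sqrrB.
have := sqr_ge0 (`|M r w| + `|N t w|); rewrite sqrrD; lra.
Qed.

End nice_facts.

Section subinterval.
Context d (W : measurableType d) (R : realType) (mu : probability W R).
Variables (Flt : R -> set (set W)) (a b t : R).
Hypotheses (at_ : a <= t) (tb : t <= b).

Lemma usualS : usual mu Flt a b -> usual mu Flt t b.
Proof.
case=> ab [h1 h2 h3] h4 h5; have sub u : t <= u <= b -> a <= u <= b.
  by move=> /andP[tu ->]; rewrite (le_trans at_).
split=> //; first split.
- by move=> u /sub; exact: h1.
- by move=> u /sub; exact: h2.
- by move=> r u tr; apply: h3; exact: le_trans tr.
- by move=> u B /sub; exact: h4.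
- by move=> u B tu; apply: h5; exact: le_trans tu.
Qed.

Lemma martingaleS M : martingale mu Flt a b M -> martingale mu Flt t b M.
Proof.
have sub u : t <= u <= b -> a <= u <= b.
  by move=> /andP[tu ->]; rewrite (le_trans at_).
case=> h1 [h2 h3]; split; first by move=> u /sub; exact: h1.
split; first by move=> u /sub; exact: h2.
by move=> r u tr; apply: h3; exact: le_trans tr.
Qed.

Lemma niceS M : nice mu Flt a b M -> nice mu Flt t b M.
Proof.
case=> mM sM cM [G iG hG]; split => //; first exact: martingaleS.
  move=> w; split => r /andP[tr rb].
    by apply: (cM w).1; rewrite rb (le_trans at_).
  by apply: (cM w).2; rewrite rb (le_lt_trans at_).
by exists G => // w r /andP[tr rb]; apply: hG; rewrite rb (le_trans at_).
Qed.

End subinterval.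

(** * Predictable processes and null sets; restarting at a later time *)

Section predictable_tools.
Context d (W : measurableType d) (R : realType) (mu : probability W R).
Variables (Flt : R -> set (set W)) (a b : R).
Hypothesis us : usual mu Flt a b.
Notation PT Flt a b := (g_sigma_algebraType (predictable_sigma Flt a b)).
Let hF := us_flt us.
Let ab := us_le us.

Lemma predictable_indic (A : set W) : Flt a A ->
  predictable_map Flt a b (fun _ w => \1_A w : R).
Proof.
move=> FA; have mS : measurable ((`[a, b]%classic `*` A) : set (PT Flt a b)).
  rewrite -[`[a, b]%classic](setUidr (A := [set a])) ?setDE; last first.
    by move=> _ ->; rewrite /= in_itv/= lexx ab.
  rewrite (_ : (_ `|` _) `*` A = ([set a] `*` A) `|` (`]a, b]%classic `*` A)).
    apply: measurableU; apply: sub_sigma_algebra; apply: sub_sigma_algebra; first by left; exists A.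
    by right; exists a, b, A.
  apply/seteqP; split => [[r w] [/= [->|rab] Aw]|[r w] [] [/= h Aw]].
  - by left.
  - have := rab; rewrite in_itv/= => /andP[ar rb].
    move: ar; rewrite le_eqVlt => /predU1P[<-|ar]; [by left|right; split => //=].
    by rewrite in_itv/= ar.
  - by split => //=; left.
  - split => //=; right; move: h; rewrite !in_itv/= => /andP[ar ->]; by rewrite ltW.
rewrite /predictable_map; apply: (eq_measurable_fun (\1_(`[a, b]%classic `*` A : set (PT Flt a b)) : _ -> R)).
  move=> [r w]; rewrite inE => -[/= rab _]; rewrite !indicE.
  by have [Aw|Aw] := pselect (A w); [rewrite !mem_set|rewrite !memNset// => -[]].
exact: measurable_indic.
Qed.

Lemma predictable_null (H : R -> W -> R) (A : set W) : {ae mu, forall w, A w} ->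
  predictable_map Flt a b H -> predictable_map Flt a b (fun r w => \1_A w * H r w).
Proof.
move=> hA pH; apply: measurable_funM => //; apply: predictable_indic.
by apply: (flt_ae us) => //; rewrite ab lexx.
Qed.

(** A generator []u, u'] x B] with [u < t] is cut to []t, u'] x B], which generates for the
    filtration restarted at [t]. The value at [t] is set to 0; integrals over []t, b]] do not see
    it. *)
Lemma predictable_restrict t (H : R -> W -> R) : a <= t -> t <= b ->
  predictable_map Flt a b H ->
  predictable_map Flt t b (fun r w => if t < r then H r w else 0).
Proof.
move=> at_ tb pH.
have ust := usualS at_ tb us.
pose I : set (R * W) := `]t, b]%classic `*` setT.
have tbb : t <= t <= b by rewrite lexx tb.
have FT : Flt t setT.
  have [h0 hC _] := flt_sigma (us_flt ust) tbb.
  by rewrite -(setD0 setT); exact: hC.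
have mI : measurable (I : set (PT Flt t b)).
  by apply: sub_sigma_algebra; apply: sub_sigma_algebra; right; exists t, b, setT.
have mD := @predictable_measurableD _ W R Flt t b.
have sub : predictable_sigma Flt a b `<=` [set C | measurable (I `&` C : set (PT Flt t b))].
  apply: smallest_sub.
    split => /=.
    - by rewrite setI0; exact: measurable0.
    - move=> C mC; rewrite (_ : I `&` _ = I `\` (I `&` C)); first exact: measurableD.
    apply/seteqP; split => [z [Iz [_ nC]]|z [Iz h]].
    by split => // -[_ /nC].
    split => //; split; last by move=> Cz; exact: h.
    case: Iz => + _; rewrite /= in_itv/= => /andP[tz zb]; split => //=.
    by rewrite in_itv/= zb (le_trans at_ (ltW tz)).
    - by move=> F mF; rewrite setI_bigcupr; exact: bigcupT_measurable.
  move=> C [[B FB ->]|[u [u' [B [au uu' u'b FB ->]]]]] /=.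
    rewrite (_ : _ `&` _ = set0); first exact: measurable0.
    apply/seteqP; split => // -[r w] [[/= + _] [/= ra _]].
    by rewrite in_itv/= ra ltNge at_.
  have [tu'|u't] := leP t u'; last first.
    rewrite (_ : _ `&` _ = set0); first exact: measurable0.
    apply/seteqP; split => // -[r w] [[/= + _] [/= + _]].
    rewrite !in_itv/= => /andP[tr _] /andP[_ ru'].
    by have := lt_le_trans tr ru'; rewrite ltNge (ltW u't).
  apply: sub_sigma_algebra; apply: sub_sigma_algebra; right.
  exists (Num.max t u), u', B; split => //.
  - by rewrite le_max lexx.
  - by rewrite ge_max tu' uu'.
  - apply: (flt_mono hF au) FB; first by rewrite le_max lexx orbT.
    by rewrite ge_max tb (le_trans uu').
  - apply/seteqP; split => [[r w] [[/= h1 _] [/= h2 Bw]]|[r w] [/= h Bw]].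
    split => //=; move: h1 h2; rewrite !in_itv/= gt_max => /andP[-> _] /andP[-> ->].
    by [].
    move: h; rewrite in_itv/= gt_max => /andP[/andP[h1 h2] h3].
    by split; split => //=; rewrite in_itv/= ?h1 ?h2 ?h3// (le_trans h3).
move=> _ B mB.
rewrite (_ : _ `&` _ = (I `&` ((`[a, b]%classic `*` setT) `&` (fun z => H z.1 z.2) @^-1` B)) `|`
   ((`[t, b]%classic `*` setT) `\` I) `&` (fun=> 0) @^-1` B).
  apply: measurableU.
    apply: sub; have := predictable_trace ab (pH (@predictable_measurableD _ _ _ _ _ _) _ mB).
    by rewrite setIA setIid.
  apply: (@measurableI _ (PT Flt t b)); first exact: measurableD.
  by rewrite preimage_cst; case: ifP => _; [exact: measurableT|exact: measurable0].
apply/seteqP; split => [[r w] [[/= rtb _]]|[r w] []].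
- case: ifPn => tr h; [left|right].
    move: rtb; rewrite in_itv/= => /andP[tr' rb].
    by split; [split => //=; rewrite in_itv/= tr|split => //; split => //=; rewrite in_itv/= rb (le_trans at_)].
  by split => //; split => // -[/= + _]; rewrite in_itv/= (negbTE tr).
- move=> [[/= + _] [_ h]]; rewrite in_itv/= => /andP[tr rb]; rewrite tr; split => //.
  by split => //=; rewrite in_itv/= rb ltW.
- move=> [[[/= rtb _] nI] h]; split => //; case: ifPn => // tr; exfalso; apply: nI.
  split => //=; move: rtb; rewrite !in_itv/= => /andP[_ ->]; by rewrite tr.
Qed.

End predictable_tools.

(** * Integrals over time and probability *)

Section product_integrals.
Context d1 d2 (T1 : measurableType d1) (W : measurableType d2) (R : realType).
Variables (la : {sigma_finite_measure set T1 -> \bar R}).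
Variables (mu : {sigma_finite_measure set W -> \bar R}).
Implicit Types (I : set T1) (f : T1 -> W -> R).

Definition ini I f : Prop :=
  (la \x mu)%E.-integrable (I `*` setT) (fun z => (f z.1 z.2)%:E).
(** The mean of the time integral over [I], taken as one integral for the product measure so that
    linearity, monotonicity and dominated convergence apply directly; [EIE] and [EI_swap] return to
    iterated integrals. *)
Definition EI I f : R := \int[(la \x mu)%E]_(z in I `*` setT) f z.1 z.2.

Variables (I : set T1) (mI : measurable I).

Let mD : measurable (I `*` setT : set (T1 * W)). Proof. exact: measurableX. Qed.

Lemma ini_measurable f : ini I f -> measurable_fun (I `*` setT) (fun z => f z.1 z.2).
Proof. by move/measurable_int/measurable_EFinP. Qed.

Lemma prod_tonelli (f : T1 -> W -> \bar R) :
  measurable_fun (I `*` setT) (fun z => f z.1 z.2) -> (forall r w, I r -> (0 <= f r w)%E) ->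
  (\int[(la \x mu)%E]_(z in I `*` setT) f z.1 z.2 = \int[mu]_w \int[la]_(r in I) f r w)%E.
Proof.
move=> mf f0; rewrite integral_mkcond fubini_tonelli2; last 2 first.
- exact/(measurable_restrictT _ mD).
- by move=> [r w]; rewrite patchE; case: ifPn => //; rewrite inE => -[/= Ir _]; exact: f0.
apply: eq_integral => w _; rewrite /fubini_G [RHS]integral_mkcond.
apply: eq_integral => r _; rewrite !patchE.
by have [Ir|nI] := pselect (I r); [rewrite !mem_set|rewrite !memNset// => -[]].
Qed.

Lemma iniP f : measurable_fun (I `*` setT) (fun z => f z.1 z.2) ->
  (\int[mu]_w \int[la]_(r in I) `|f r w|%:E < +oo)%E -> ini I f.
Proof.
move=> mf fin; apply/integrableP; split; first exact/measurable_EFinP.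
rewrite (@prod_tonelli (fun r w => `|f r w|%:E))//.
by apply/measurable_EFinP; exact: measurableT_comp.
Qed.

Lemma ini_fin f : ini I f -> (\int[mu]_w \int[la]_(r in I) `|f r w|%:E < +oo)%E.
Proof.
move=> /[dup] /ini_measurable mf /integrableP[_].
rewrite (@prod_tonelli (fun r w => `|f r w|%:E))//.
by apply/measurable_EFinP; exact: measurableT_comp.
Qed.

Lemma ini_path f : ini I f -> {ae mu, forall w, la.-integrable I (EFin \o f^~ w)}.
Proof. by move=> h; apply: fubini_ae_path (ini_fin h) => //; exact: ini_measurable. Qed.

Lemma ini_inner f : ini I f -> mu.-integrable setT (EFin \o (fun w => \int[la]_(r in I) f r w)).
Proof. by move=> h; apply: fubini_Rintegrable (ini_fin h) => //; exact: ini_measurable. Qed.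

Lemma EI_swap f : ini I f -> EI I f = \int[la]_(r in I) \int[mu]_w f r w.
Proof.
move=> h; have mf := ini_measurable h.
rewrite -(fubini_Rswap mI mf (ini_fin h)) /EI [in LHS]/Rintegral.
rewrite [in RHS]/Rintegral (fubini_RintE mI mf (ini_fin h)); congr fine.
rewrite integral_mkcond -fubini2; last exact/(integrable_mkcond _ mD).
apply: eq_integral => w _; rewrite /fubini_G [RHS]integral_mkcond.
apply: eq_integral => r _; rewrite !patchE.
by have [Ir|nI] := pselect (I r); [rewrite !mem_set|rewrite !memNset// => -[]].
Qed.

Lemma EIE f : ini I f -> EI I f = \int[mu]_w \int[la]_(r in I) f r w.
Proof.
by move=> h; rewrite EI_swap// (fubini_Rswap mI (ini_measurable h) (ini_fin h)).
Qed.

Lemma le_ini f g : measurable_fun (I `*` setT) (fun z => f z.1 z.2) ->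
  (forall r w, I r -> `|f r w| <= g r w) -> ini I g -> ini I f.
Proof.
move=> mf fg; apply: le_integrable => //; first exact/measurable_EFinP.
move=> [r w] [/= Ir _]; rewrite lee_fin; apply: le_trans (fg _ _ Ir) _; exact: ler_norm.
Qed.

Lemma iniD f g : ini I f -> ini I g -> ini I (fun r w => f r w + g r w).
Proof. by move=> hf hg; have := integrableD mD hf hg; exact: eq_integrable. Qed.

Lemma iniZ k f : ini I f -> ini I (fun r w => k * f r w).
Proof. by move=> hf; have := integrableZl mD k hf; exact: eq_integrable. Qed.

Lemma iniB f g : ini I f -> ini I g -> ini I (fun r w => f r w - g r w).
Proof. by move=> hf hg; have := integrableB mD hf hg; exact: eq_integrable. Qed.

Lemma ini_norm f : ini I f -> ini I (fun r w => `|f r w|).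
Proof. by move=> hf; exact: (integrable_abse hf). Qed.

Lemma EID f g : ini I f -> ini I g -> EI I (fun r w => f r w + g r w) = EI I f + EI I g.
Proof. by move=> hf hg; rewrite /EI RintegralD. Qed.

Lemma EIB f g : ini I f -> ini I g -> EI I (fun r w => f r w - g r w) = EI I f - EI I g.
Proof. by move=> hf hg; rewrite /EI RintegralB. Qed.

Lemma EIZ k f : ini I f -> EI I (fun r w => k * f r w) = k * EI I f.
Proof. by move=> hf; rewrite /EI RintegralZl. Qed.

Lemma le_EI f g : ini I f -> ini I g -> (forall r w, I r -> f r w <= g r w) -> EI I f <= EI I g.
Proof. by move=> hf hg fg; apply: le_Rintegral => // -[r w] [/= Ir _]; exact: fg. Qed.

Lemma eq_EI f g : (forall r w, I r -> f r w = g r w) -> EI I f = EI I g.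
Proof.
move=> fg; apply: (@eq_Rintegral _ _ _ (la \x mu)%E (I `*` setT) (fun z => g z.1 z.2)) => -[r w].
by rewrite inE => -[/= Ir _]; exact: fg.
Qed.

Lemma eq_ini f g : (forall r w, I r -> f r w = g r w) -> ini I f -> ini I g.
Proof.
move=> fg; apply: eq_integrable => // -[r w]; rewrite inE => -[/= Ir _].
by rewrite fg.
Qed.

Lemma ini_const (c : R) (h : W -> R) : (la I < +oo)%E -> mu.-integrable setT (EFin \o h) ->
  ini I (fun _ w => c * h w).
Proof.
move=> lI ih; have mh := measurable_int _ ih; apply: iniP.
  apply: measurable_funM => //; apply: measurable_funTS.
  by apply: measurableT_comp => //; exact/measurable_EFinP.
under eq_integral do rewrite integral_cst//.
have ih' : mu.-integrable setT (EFin \o (fun w => `|c * h w|)).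
  apply: (integrable_abse (f := fun w => (c * h w)%:E)).
  by have := integrableZl measurableT c ih; exact: eq_integrable.
have lfin : la I \is a fin_num by rewrite ge0_fin_numE.
rewrite ge0_integralZr//; last exact: (measurable_int _ ih').
have fi := integrable_fin_num measurableT ih'.
rewrite -(fineK fi); apply: lte_mul_pinfty => //.
by rewrite (fineK fi); apply: integral_ge0 => w _; rewrite lee_fin.
Qed.

End product_integrals.

(** * The weight and the estimate on one grid step *)

Section indefinite.
Context {R : realType} (V : cumulative R R) (a b : R).
Hypothesis natom : no_atom V a b.

Lemma pint_sub k s t : dV_integrable V a b k ->
  a <= s -> s <= t -> t <= b -> \int[dV V]_(r in `]s, t]) k r = pint V a k t - pint V a k s.
Proof. by move=> ik as_ st tb; rewrite (pint_split ik as_ st tb) addrC addKr. Qed.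

Lemma le_pint0 k t : (forall r, a < r <= t -> k r <= 0) -> pint V a k t <= 0.
Proof.
move=> k0; rewrite /pint /Rintegral.
rewrite (_ : (\int[_]_(r in _) _ = - \int[dV V]_(r in `]a, t]) (- k r)%:E)%E).
  rewrite fineN oppr_le0; apply: fine_ge0; apply: integral_ge0 => r /=.
  by rewrite in_itv/= lee_fin oppr_ge0 => /k0.
rewrite -integral_ge0N ?oppeK//; last first.
  by move=> r /=; rewrite in_itv/= lee_fin oppr_ge0 => /k0.
by apply: eq_integral => r _; rewrite EFinN oppeK.
Qed.

(* Integration by parts for rho = exp (- eps * int |z|), whose density is [rho * k]. *)
Lemma exp_parts k z p q : dV_integrable V a b k ->
  dV_integrable V a b z ->
  a <= p -> p <= q -> q <= b ->
  expR (pint V a k p) * (pint V a z q - pint V a z p) -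
  \int[dV V]_(r in `]p, q]) (expR (pint V a k r) * z r) =
  - \int[dV V]_(r in `]p, q]) (expR (pint V a k r) * k r * (pint V a z q - pint V a z r)).
Proof.
move=> ik iz ap pq qb; have pb := le_trans pq qb; have aq := le_trans ap pq.
pose kap r := expR (pint V a k r) * k r.
have ikap : dV_integrable V a b kap by exact: pint_expR_integrable.
pose K := pint V a kap; pose A := pint V a z.
have rE t : t <= b -> expR (pint V a k t) = 1 + K t by exact: expR_pint.
have iAk := pint_mul_integrable iz ikap.
have iKz := pint_mul_integrable ikap iz.
have mI : measurable (Ioc R p q) by exact: measurable_itv.
have mab : measurable (Ioc R a b) by exact: measurable_itv.
have S f (i : dV_integrable V a b f) :
  dV_integrable V p q f := path_integrableS i ap qb.
have iS : dV_integrable V a b (fun r => K r * z r + A r * kap r).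
  by have := integrableD mab iKz iAk; exact: eq_integrable.
have e1 : \int[dV V]_(r in `]p, q]) (expR (pint V a k r) * z r) =
    (A q - A p) + \int[dV V]_(r in `]p, q]) (K r * z r).
  rewrite -(pint_sub iz)// -RintegralD//; [|exact: S iz|exact: S iKz].
  apply: eq_Rintegral => r; rewrite inE/= in_itv/= => /andP[_ rq].
  by rewrite rE ?(le_trans rq)// mulrDl mul1r.
have e2 : \int[dV V]_(r in `]p, q]) (expR (pint V a k r) * k r * (pint V a z q - pint V a z r)) =
    A q * (K q - K p) - \int[dV V]_(r in `]p, q]) (A r * kap r).
  have iAq : dV_integrable V a b (fun r => A q * kap r).
    by have := integrableZl mab (A q) ikap; exact: eq_integrable.
  rewrite -(pint_sub ikap)// -RintegralZl//; last exact: S ikap.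
  rewrite -RintegralB//; [|exact: S iAq|exact: S iAk].
  by apply: eq_Rintegral => r _; rewrite -/(kap r) mulrBr [kap r * _]mulrC [kap r * _]mulrC.
have e3 : K q * A q - K p * A p =
    \int[dV V]_(r in `]p, q]) (K r * z r) + \int[dV V]_(r in `]p, q]) (A r * kap r).
  rewrite (pint_prod natom qb ikap iz) (pint_prod natom pb ikap iz) -(pint_sub iS)//.
  by rewrite RintegralD//; [exact: S iKz|exact: S iAk].
rewrite e1 e2 rE//.
have -> : \int[dV V]_(r in `]p, q]) (K r * z r) = K q * A q - K p * A p -
  \int[dV V]_(r in `]p, q]) (A r * kap r) by rewrite e3 addrK.
rewrite -/A; ring.
Qed.

End indefinite.

Lemma sub_swap (R : zmodType) (x y u v : R) : y - v = x - u -> x - y = u - v.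
Proof. by move=> h; apply/eqP; rewrite subr_eq addrAC -addrA h addrC subrK. Qed.

Lemma step_arith (R : realType) (kappa k1 k1' k2 e1 e2 e3 B : R) :
  0 <= kappa + 2 * k1 + k2 -> k1 = k1' -> k1' - e1 = - e2 -> `|e2| <= B * e3 ->
  - 2 * e1 <= k2 + kappa + 2 * B * e3.
Proof. by move=> h0 e h1; rewrite ler_norml => /andP[h2 h3]; subst k1'; lra. Qed.

Lemma mul_sub4 (R : realType) (k x y u v : R) :
  k * (u - v) = k * (x - y) - (k * (x - u) - k * (y - v)).
Proof. ring. Qed.

Lemma kw_lin (R : realType) (x h u i1 i2 j1 j2 : R) : x * u - i1 = - i2 ->
  j1 = h * i1 -> j2 = h * i2 -> x * h * u - j1 = -1 * j2.
Proof. by move=> e -> ->; rewrite [x * h]mulrC -mulrA -mulrBr e mulrN mulN1r. Qed.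

Section kw_step.
Context d (W : measurableType d) (R : realType) (mu : probability W R).
Variables (Flt : R -> set (set W)) (a b : R) (V : cumulative R R).
Hypothesis us : usual mu Flt a b.
Hypothesis natom : no_atom V a b.
Variables (m N z : R -> W -> R) (c : R).
Hypotheses (nm : nice mu Flt a b m) (nN : nice mu Flt a b N).
Hypothesis pz : prog Flt a b z.
Hypothesis iz : forall w, dV_integrable V a b (z^~ w).
Hypothesis mX : martingale mu Flt a b (fun t w => m t w * N t w - pint V a (z^~ w) t).
Hypothesis hN : bracket_le mu Flt V a b c N.
Variable eps : R.
Hypothesis eps0 : 0 < eps.
Notation TT := (measurableTypeR R).
Let hF := us_flt us.
Let ab := us_le us.

(** [kwrho] is the exponential of the integral of [kwk], and [kwmass] is its density. Hence |kwmass|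
    = eps |kwrho z| measures both how fast the weight decreases and how large the weighted [z]
    is. *)
Definition kwk r w := - (eps * `|z r w|).
Definition kwrho t w := expR (pint V a (kwk^~ w) t).
Definition kwmass r w := kwrho r w * kwk r w.
Let A t w := pint V a (z^~ w) t.
Let X t w := m t w * N t w.

Let mab : measurable (Ioc R a b). Proof. exact: measurable_itv. Qed.
Let mpq p q : measurable (Ioc R p q). Proof. exact: measurable_itv. Qed.

Lemma kwk_int w : dV_integrable V a b (kwk^~ w).
Proof.
have := integrableZl mab (- eps) (integrable_abse (iz w)).
by apply: eq_integrable => // r _; rewrite /= /kwk -mulNr EFinM.
Qed.

Let iS (k : R -> R) p q : a <= p -> q <= b -> dV_integrable V a b k ->
  dV_integrable V p q k.
Proof. by move=> ap qb ik; exact: (path_integrableS ik ap qb). Qed.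

Lemma kwk_prog : prog Flt a b kwk.
Proof.
move=> t tab; have := pz tab => mz.
by rewrite /kwk; apply: measurableT_comp => //; apply: measurable_funM => //; exact: measurableT_comp.
Qed.

Lemma kwrho_adapted : adapted Flt a b kwrho.
Proof.
move=> t tab; apply/(flt_wrtP hF tab).
apply: (measurableT_comp (f := expR)) => //.
by apply/(flt_wrtP hF tab); exact: (prog_pint hF V kwk_prog tab).
Qed.

Lemma kwrho_prog : prog Flt a b kwrho.
Proof.
apply: (rcont_prog hF kwrho_adapted) => w r rab.
by apply: continuous_cvg; [exact: continuous_expR|exact: (pint_cadlag natom (kwk_int w)).1].
Qed.

Lemma kwmass_prog : prog Flt a b kwmass.
Proof. by move=> t tab; apply: measurable_funM; [exact: kwrho_prog|exact: kwk_prog]. Qed.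

Lemma kwrho_ge0 t w : 0 < kwrho t w. Proof. exact: expR_gt0. Qed.

Lemma kwk_le0 r w : kwk r w <= 0. Proof. by rewrite oppr_le0 mulr_ge0// ltW. Qed.

Lemma kwrho_le1 t w : kwrho t w <= 1.
Proof. by rewrite -expR0 ler_expR; apply: le_pint0 => r _; exact: kwk_le0. Qed.

Lemma kwmass_le0 r w : kwmass r w <= 0.
Proof. by rewrite /kwmass mulr_ge0_le0 ?kwk_le0// ltW ?kwrho_ge0. Qed.

Lemma kwmass_int w : dV_integrable V a b (kwmass^~ w).
Proof. by have := pint_expR_integrable (kwk_int w). Qed.

(** The mass is the total decrease of the weight, which starts at 1 and stays positive; the bound
    holds for every path and every [z]. *)
Lemma kwmass_total p q w : a <= p -> q <= b ->
  (\int[dV V]_(r in `]p, q]) `|kwmass r w|%:E <= 1)%E.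
Proof.
move=> ap qb; have i := iS ap qb (kwmass_int w).
apply: (@le_trans _ _ (\int[dV V]_(r in `]a, b]) `|kwmass r w|%:E)%E).
  apply: ge0_subset_integral => //.
    by apply/measurable_EFinP; apply: measurableT_comp => //; apply/measurable_EFinP; exact: (measurable_int _ (kwmass_int w)).
  by move=> r /=; rewrite !in_itv/= => /andP[pr rq]; rewrite (le_lt_trans ap)// (le_trans rq).
have ik := kwmass_int w.
have e1 : \int[dV V]_(r in `]a, b]) `|kwmass r w| = - pint V a (kwmass^~ w) b.
  rewrite -mulN1r -RintegralZl//.
  by apply: eq_Rintegral => r _; rewrite ler0_norm ?kwmass_le0// mulN1r.
have fi := integrable_fin_num mab (integrable_abse ik).
rewrite -(fineK fi) lee_fin -[leLHS]/(\int[dV V]_(r in `]a, b]) `|kwmass r w|) e1.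
have := expR_pint natom (kwk_int w) (lexx b); rewrite -/(kwrho b w) => e.
have := kwrho_ge0 b w; rewrite e => h.
by rewrite lerNl -subr_ge0 opprK addrC ltW.
Qed.

(** Each path carries [kwmass] of total at most 1, so an integrable variable times [kwmass] is
    integrable over time and probability. *)
Lemma kw_dominated p q (f : R -> W -> R) (G : W -> R) : a <= p -> q <= b ->
  mu.-integrable setT (EFin \o G) ->
  measurable_fun ((Ioc R p q) `*` setT) (fun x : TT * W => f x.1 x.2) ->
  (forall r w, p < r <= q -> `|f r w| <= `|kwmass r w| * G w) ->
  ini (dV V) mu (Ioc R p q) f.
Proof.
move=> ap qb iG mf fG; apply: iniP => //.
have mk w : measurable_fun (Ioc R p q) (fun r => `|kwmass r w|).
  apply: measurableT_comp => //; apply/measurable_EFinP.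
  exact: (measurable_int _ (iS ap qb (kwmass_int w))).
have /integrableP[mG] := iG; apply: le_lt_trans.
have mfE : measurable_fun ((Ioc R p q) `*` setT) (fun x : TT * W => `|f x.1 x.2|%:E).
  by apply/measurable_EFinP; exact: measurableT_comp.
apply: ge0_le_integral => //.
- by move=> w _; exact: integral_ge0.
- exact: (@measurable_inner _ _ _ _ _ (dV V) _ (mpq p q) (fun r w => `|f r w|%:E)).
- exact: measurableT_comp.
move=> w _; apply: (@le_trans _ _ (\int[dV V]_(r in `]p, q]) (`|kwmass r w|%:E * `|G w|%:E))%E).
  apply: ge0_le_integral => //.
  - apply/measurable_EFinP; apply: measurableT_comp => //.
    by have := measurable_pathI (mpq p q) w mf.
  - by apply: emeasurable_funM => //; exact/measurable_EFinP.
  - move=> r /=; rewrite in_itv/= => hr; rewrite -EFinM lee_fin.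
    by apply: le_trans (fG r w hr) _; rewrite ler_wpM2l// ler_norm.
rewrite ge0_integralZr//; last exact/measurable_EFinP.
rewrite -[leRHS]mul1e; apply: lee_wpmul2r => //.
exact: kwmass_total.
Qed.

(** At a fixed time [A] is the difference of the integrable product [m * N] and a martingale. For
    [z] itself no integrability over the product space follows, hence the weight. *)
Let A_int t : a <= t <= b -> mu.-integrable setT (EFin \o A t).
Proof.
move=> tab; have i1 := sqiM_integrable (nice_sqi us nm tab) (nice_sqi us nN tab).
have := integrableB measurableT i1 (martingale_int mX tab).
by apply: eq_integrable => // w _; rewrite -EFinB /=; congr (_%:E); rewrite opprB addrC subrK.
Qed.

(* Integrating [rho * (dm + h dN)^2 >= 0] on a step and comparing [rho] with its value at the left end. *)
Lemma kw_step p q (h : W -> R) (B : R) : a <= p -> p <= q -> q <= b ->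
  0 <= B -> measurable_wrt (Flt p) h -> (forall w, `|h w| <= B) ->
  - 2 * EI (dV V) mu (Ioc R p q) (fun r w => h w * (kwrho r w * z r w)) <=
  c * (V q - V p) * \int[mu]_w h w ^+ 2 + (ip mu (m q) (m q) - ip mu (m p) (m p)) +
  2 * B * EI (dV V) mu (Ioc R p q) (fun r w => `|kwmass r w| * `|X q w - X r w|).
Proof.
move=> ap pq qb B0 wh hB; have aq := le_trans ap pq; have pb := le_trans pq qb.
have pab : a <= p <= b by rewrite ap. have qab : a <= q <= b by rewrite aq.
have mI := mpq p q.
have mh : measurable_fun setT h by exact: (wrt_measurable hF pab).
pose Y w := kwrho p w * h w.
have wY : measurable_wrt (Flt p) Y.
  apply/(flt_wrtP hF pab); apply: measurable_funM.
    exact/(flt_wrtP hF pab)/kwrho_adapted.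
  exact/(flt_wrtP hF pab).
have mY : measurable_fun setT Y by exact: (wrt_measurable hF pab).
have rho_norm t w : `|kwrho t w| <= 1 by rewrite ger0_norm ?kwrho_le1// ltW ?kwrho_ge0.
have YB w : `|Y w| <= B.
  by rewrite normrM -[B]mul1r ler_pM ?rho_norm.
have bnd (f g : W -> R) : measurable_fun setT g -> (forall w, `|g w| <= B) ->
    mu.-integrable setT (EFin \o f) -> mu.-integrable setT (fun w => (g w * f w)%:E).
  move=> mg gB i_f; apply: (le_integrable measurableT _ _ (integrableZl measurableT B i_f)).
    apply/measurable_EFinP; apply: measurable_funM => //.
    exact/measurable_EFinP/(measurable_int _ i_f).
  by move=> w _; rewrite -EFinM lee_fin !normrM ler_wpM2r// (ger0_norm B0).
have bsq (f g : W -> R) : measurable_fun setT g -> (forall w, `|g w| <= B) ->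
    sqi mu f -> sqi mu (fun w => g w * f w).
  move=> mg gB sf; apply: (@le_sqi _ _ _ mu _ (fun w => B * f w) (fun=> 0)); last exact: sqi0.
  - by apply: measurable_funM => //; case: sf.
  - move=> w; rewrite expr0n addr0 !exprMn ler_wpM2r ?sqr_ge0//.
    by rewrite -real_normK ?num_real// lerXn2r ?nnegrE.
  - exact: sqiZ.
have smp := nice_sqi us nm pab; have smq := nice_sqi us nm qab.
have sNp := nice_sqi us nN pab; have sNq := nice_sqi us nN qab.
have sdm := sqiB smq smp; have sdN := sqiB sNq sNp.
have mmm : martingale mu Flt a b m by case: nm.
have mmN : martingale mu Flt a b N by case: nN.
have smb : sqi mu (m b) by case: nm.
(* The mean of (dm + Y dN)^2, expanded. Since the weight is at most 1, the last square may be taken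
   with [h] in place of [Y], which is where [hN] enters. *)
have quad : 0 <= (ip mu (m q) (m q) - ip mu (m p) (m p)) +
    2 * \int[mu]_w (Y w * ((m q w - m p w) * (N q w - N p w))) +
    c * (V q - V p) * \int[mu]_w h w ^+ 2.
  apply: (@le_trans _ _ (\int[mu]_w ((m q w - m p w) * (m q w - m p w)) +
    2 * \int[mu]_w (Y w * ((m q w - m p w) * (N q w - N p w))) +
    \int[mu]_w (h w * (N q w - N p w)) ^+ 2)); last first.
    apply: lerD; last exact: hN.
    by rewrite lerD2r -(martingale_incr_sqr hF mmm smb ap pq qb).
  have i1 := sqiM_integrable sdm sdm.
  have i2 := bnd _ _ mY YB (sqiM_integrable sdm sdN).
  have i2' := integrableZl measurableT 2 i2.
  have i3 := sqi_sqr (bsq _ _ mh hB sdN).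
  rewrite -RintegralZl// -RintegralD//.
  rewrite -RintegralD//; last by have := integrableD measurableT i1 i2'; exact: eq_integrable.
  apply: Rintegral_ge0 => w _; rewrite /Y.
  set x := m q w - m p w; set y := N q w - N p w.
  have r0 := ltW (kwrho_ge0 p w); have r1 := kwrho_le1 p w; set rr := kwrho p w in r0 r1 *.
  rewrite (_ : _ + _ = (x + rr * (h w * y)) ^+ 2 + (1 - rr ^+ 2) * (h w * y) ^+ 2); last by ring.
  by rewrite addr_ge0 ?sqr_ge0// mulr_ge0 ?sqr_ge0// subr_ge0 expr_le1.
have iXq := sqiM_integrable smq sNq. have iXp := sqiM_integrable smp sNp.
have iA t (tab : a <= t <= b) := bnd _ _ mY YB (A_int tab).
(* Mixed products such as m_p N_q project onto m_p N_p, which leaves the increment of [m * N]; its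
   martingale part has mean zero against [Y], and the increment of [A] remains. *)
have cross : \int[mu]_w (Y w * ((m q w - m p w) * (N q w - N p w))) = \int[mu]_w (Y w * (A q w - A p w)).
  have wYf f : measurable_wrt (Flt p) f -> measurable_wrt (Flt p) (fun w => Y w * f w).
    move=> wf; apply/(flt_wrtP hF pab); apply: measurable_funM;
    exact/(flt_wrtP hF pab).
  have assoc (f g : W -> R) : sqi mu f -> sqi mu g -> mu.-integrable setT (fun w => (Y w * f w * g w)%:E).
    move=> sf sg; have := bnd _ _ mY YB (sqiM_integrable sf sg).
    by apply: eq_integrable => // w _; rewrite mulrA.
  have j1 := assoc _ _ smq sNq. have j2 := assoc _ _ smp sNq.
  have j3 := assoc _ _ sNp smq. have j4 := assoc _ _ smp sNp.
  have c1 := martingale_pull hF mmN ap pq qb (wYf _ (mmm.1 p pab)) j2.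
  have c2 := martingale_pull hF mmm ap pq qb (wYf _ (mmN.1 p pab)) j3.
  have jX : mu.-integrable setT (fun w => (Y w * (m q w * N q w - A q w))%:E).
    exact: bnd (martingale_int mX qab).
  have c3 := martingale_pull hF mX ap pq qb wY jX.
  have dX t : a <= t <= b -> \int[mu]_w (Y w * (m t w * N t w - A t w)) =
    \int[mu]_w (Y w * m t w * N t w) - \int[mu]_w (Y w * A t w).
    move=> tab; have i1 := assoc _ _ (nice_sqi us nm tab) (nice_sqi us nN tab).
    rewrite -(RintegralB measurableT i1 (iA t tab)).
    by apply: eq_Rintegral => w _; rewrite mulrBr mulrA.
  have {}c3 := etrans (esym (dX p pab)) (etrans c3 (dX q qab)).
  have -> : \int[mu]_w (Y w * (A q w - A p w)) = \int[mu]_w (Y w * A q w) - \int[mu]_w (Y w * A p w).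
    rewrite -(RintegralB measurableT (iA q qab) (iA p pab)).
    by apply: eq_Rintegral => w _; rewrite mulrBr.
  have j12 := integrableB measurableT j1 j2. have j34 := integrableB measurableT j4 j3.
  have -> : \int[mu]_w (Y w * ((m q w - m p w) * (N q w - N p w))) =
    (\int[mu]_w (Y w * m q w * N q w) - \int[mu]_w (Y w * m p w * N q w)) +
    (\int[mu]_w (Y w * m p w * N p w) - \int[mu]_w (Y w * N p w * m q w)).
    rewrite -(RintegralB measurableT j1 j2) -(RintegralB measurableT j4 j3) -(RintegralD measurableT j12 j34).
    by apply: eq_Rintegral => w _; ring.
  rewrite -c1 -c2.
  have -> : \int[mu]_w (Y w * N p w * m p w) = \int[mu]_w (Y w * m p w * N p w).
    by apply: eq_Rintegral => w _; ring.
  by rewrite subrr addr0; exact: sub_swap.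
have [G iG hG] := nice_bound nm nN.
have jh : measurable_fun ((Ioc R p q) `*` setT) (fun x : TT * W => h x.2).
  by apply: measurable_funTS; apply: measurableT_comp.
have jk : measurable_fun ((Ioc R p q) `*` setT) (fun x : TT * W => kwmass x.1 x.2).
  exact: (prog_joint hF kwmass_prog ap qb).
have jhk : measurable_fun ((Ioc R p q) `*` setT) (fun x : TT * W => h x.2 * kwmass x.1 x.2).
  exact: measurable_funM.
have pX : prog Flt a b X.
  by move=> t tab; apply: measurable_funM; [exact: (nice_prog us nm)|exact: (nice_prog us nN)].
have pA : prog Flt a b A.
  apply: (rcont_prog hF) => [t tab|w r rab]; first exact: (prog_pint hF V pz tab).
  exact: (pint_cadlag natom (iz w)).1.
have jX := prog_joint hF pX ap qb. have jA := prog_joint hF pA ap qb.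
have jc (f : W -> R) : measurable_fun setT f ->
    measurable_fun ((Ioc R p q) `*` setT) (fun x : TT * W => f x.2).
  by move=> mf; apply: measurable_funTS; apply: measurableT_comp.
have mXq : measurable_fun setT (X q) by exact/measurable_EFinP/(measurable_int _ iXq).
have iX2 : mu.-integrable setT (EFin \o (fun w => 2 * G w)).
  by have := integrableZl measurableT 2 iG; exact: eq_integrable.
have Xd r w : p < r <= q -> `|X q w - X r w| <= 2 * G w.
  move=> /andP[pr rq]; have arb : a <= r <= b by rewrite (le_trans ap (ltW pr)) (le_trans rq).
  apply: le_trans (ler_normB _ _) _.
  by have := hG w q q qab qab; have := hG w r r arb arb; rewrite /X; lra.
have iX1 : ini (dV V) mu (Ioc R p q) (fun r w => `|kwmass r w| * `|X q w - X r w|).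
  apply: (kw_dominated ap qb iX2).
    apply: measurable_funM; first exact: measurableT_comp.
    by apply: measurableT_comp => //; apply: measurable_funB => //; exact: jc.
  by move=> r w /(Xd _ w) h1; rewrite normrM !normr_id ler_wpM2l.
have iBX := iniZ mI B iX1.
have iXX : ini (dV V) mu (Ioc R p q) (fun r w => h w * kwmass r w * (X q w - X r w)).
  apply: (le_ini mI _ _ iBX).
    by apply: measurable_funM => //; apply: measurable_funB => //; exact: jc.
  by move=> r w _; rewrite !normrM -mulrA ler_wpM2r// mulr_ge0.
(* By [exp_parts] the freezing error is an integral of [kwmass] against A_q - A_r. There [A] may be
   replaced by the product [X], because [fubini_martingale] kills the difference, which is a
   martingale. Unlike [A], the process [X] has an integrable bound uniform in time. *)
have err : \int[mu]_w (Y w * (A q w - A p w)) -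
    EI (dV V) mu (Ioc R p q) (fun r w => h w * (kwrho r w * z r w)) =
    - EI (dV V) mu (Ioc R p q) (fun r w => h w * kwmass r w * (X q w - X r w)).
  pose Mt t w := m t w * N t w - A t w.
  have mX' : martingale mu Flt a b Mt := mX.
  have jM : measurable_fun ((Ioc R p q) `*` setT) (fun x : TT * W => Mt x.1 x.2).
    exact: measurable_funB.
  have iM := martingale_int mX' qab.
  have iMa : mu.-integrable setT (EFin \o (fun w => B * `|Mt q w|)).
    by have := integrableZl measurableT B (integrable_abse iM); exact: eq_integrable.
  have iMq : ini (dV V) mu (Ioc R p q) (fun r w => h w * kwmass r w * (Mt q w)).
    apply: (kw_dominated ap qb iMa).
    apply: (measurable_funM jhk); apply: (jc (fun w => Mt q w)).
    exact/measurable_EFinP/(measurable_int _ iM).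
    move=> r w _; rewrite normrM [X in X * _]normrM [`|h w| * _]mulrC -mulrA ler_wpM2l//.
    by rewrite ler_wpM2r.
  have ak r : p < r <= q -> measurable_wrt (Flt r) (fun w => h w * kwmass r w).
    move=> /andP[pr rq]; have arb : a < r <= b by rewrite (le_lt_trans ap pr) (le_trans rq).
    have arb' : a <= r <= b by move/andP: arb => [/ltW -> ->].
    apply/(flt_wrtP hF arb'); apply: measurable_funM.
    apply/(flt_wrtP hF arb').
    by apply: (measurable_wrt_mono hF ap (ltW pr) _ wh); case/andP: arb.
    exact: (prog_slice kwmass_prog arb).
  have kMt := ini_fin mI iMq.
  have FM := fubini_martingale hF mX' ap qb jM jhk ak kMt.
  have fl := le_lt_trans (fubini_martingale_le hF (dV V) mX' ap qb jM jhk ak) kMt.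
  have iMr : ini (dV V) mu (Ioc R p q) (fun r w => h w * kwmass r w * (Mt r w)).
    apply: (iniP mI (measurable_funM jhk jM)).
    exact: fl.
  have iMM := iniB mI iMq iMr. have iAA := iniB mI iXX iMM.
  have pt r w : h w * kwmass r w * (A q w - A r w) = h w * kwmass r w * (X q w - X r w) -
    (h w * kwmass r w * Mt q w - h w * kwmass r w * Mt r w) by exact: mul_sub4.
  have iAA' : ini (dV V) mu (Ioc R p q) (fun r w => h w * kwmass r w * (A q w - A r w)).
    by apply: (eq_ini mI _ iAA) => r w _; rewrite pt.
  have FE := etrans (EIE mI iMr) (etrans FM (esym (EIE mI iMq))).
  have eAX : EI (dV V) mu (Ioc R p q) (fun r w => h w * kwmass r w * (X q w - X r w)) =
    EI (dV V) mu (Ioc R p q) (fun r w => h w * kwmass r w * (A q w - A r w)).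
    rewrite [RHS](_ : _ = EI (dV V) mu (Ioc R p q) (fun r w => h w * kwmass r w * (X q w - X r w) -
    (h w * kwmass r w * (Mt q w) - h w * kwmass r w * (Mt r w)))).
    by rewrite (EIB mI iXX iMM) (EIB mI iMq iMr) FE subrr subr0.
    by apply: eq_EI => r w _; exact: pt.
  rewrite eAX.
  have ihz : ini (dV V) mu (Ioc R p q) (fun r w => h w * (kwrho r w * z r w)).
    (* The factor 1 / eps comes from |kwrho z| = |kwmass| / eps. *)
    apply: (kw_dominated (G := fun=> B / eps) ap qb).
    - exact: finite_measure_integrable_cst.
    - exact: (measurable_funM jh (measurable_funM (prog_joint hF kwrho_prog ap qb) (prog_joint hF pz ap qb))).
    - move=> r w _; rewrite /kwmass /kwk !normrM normrN normrM normr_id (gtr0_norm eps0).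
    rewrite [X in _ <= X](_ : _ = B * (`|kwrho r w| * `|z r w|)).
    by rewrite ler_wpM2r// mulr_ge0.
    by rewrite -!mulrA mulrCA; field; exact: lt0r_neq0.
  have iYA : mu.-integrable setT (EFin \o (fun w => Y w * (A q w - A p w))).
    have := integrableB measurableT (iA q qab) (iA p pab).
    by apply: eq_integrable => [|w _]; [exact: measurableT|rewrite -EFinB -mulrBr].
  rewrite (EIE mI ihz) (EIE mI iAA') -(RintegralB measurableT iYA (ini_inner mI ihz)).
  rewrite -mulN1r -RintegralZl; [|exact: measurableT|exact: (ini_inner mI iAA')].
  apply: eq_Rintegral => w _.
  have irz : dV_integrable V p q (fun r => kwrho r w * z r w).
    apply: (le_integrable mI _ _ (iS ap qb (iz w))).
    apply/measurable_EFinP; exact: (measurable_funM (measurable_pathI mI w (prog_joint hF kwrho_prog ap qb))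
    (measurable_pathI mI w (prog_joint hF pz ap qb))).
    by move=> r _; rewrite lee_fin normrM; apply: ler_piMl; [exact: normr_ge0|exact: rho_norm].
  have ikA : dV_integrable V p q (fun r => kwmass r w * (A q w - A r w)).
    have ik := kwmass_int w.
    have i1 := integrableZl mI (A q w) (iS ap qb ik).
    have i2 := iS ap qb (pint_mul_integrable (iz w) ik).
    have := integrableB mI i1 i2; apply: eq_integrable => [|r _]; first exact: mI.
    by rewrite /= -EFinM -EFinB; congr (_%:E); rewrite mulrBr [kwmass r w * A q w]mulrC [kwmass r w * A r w]mulrC.
  have z1 : \int[dV V]_(r in `]p, q]) (h w * (kwrho r w * z r w)) =
    h w * \int[dV V]_(r in `]p, q]) (kwrho r w * z r w) by apply: RintegralZl; [exact: mI|exact: irz].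
  have z2 : \int[dV V]_(r in `]p, q]) (h w * kwmass r w * (A q w - A r w)) =
    h w * \int[dV V]_(r in `]p, q]) (kwmass r w * (A q w - A r w)).
    rewrite -RintegralZl; [|exact: mI|exact: ikA].
    by apply: eq_Rintegral => r _; rewrite mulrA.
  exact: (kw_lin (exp_parts natom (kwk_int w) (iz w) ap pq qb) z1 z2).
have le3 : `|EI (dV V) mu (Ioc R p q) (fun r w => h w * kwmass r w * (X q w - X r w))| <=
    B * EI (dV V) mu (Ioc R p q) (fun r w => `|kwmass r w| * `|X q w - X r w|).
  rewrite -(EIZ mI B iX1) ler_norml -mulN1r -(EIZ mI (-1) iBX).
  have iNX := iniZ mI (-1) iBX.
  have le r w : `|h w * kwmass r w * (X q w - X r w)| <= B * (`|kwmass r w| * `|X q w - X r w|).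
    by rewrite !normrM -mulrA ler_wpM2r// mulr_ge0.
  have lo r w : -1 * (B * (`|kwmass r w| * `|X q w - X r w|)) <= h w * kwmass r w * (X q w - X r w).
    by have := le r w; rewrite ler_norml mulN1r => /andP[].
  have hi r w : h w * kwmass r w * (X q w - X r w) <= B * (`|kwmass r w| * `|X q w - X r w|).
    by have := le r w; rewrite ler_norml => /andP[].
  apply/andP; split; first exact: (le_EI mI iNX iXX (fun r w _ => lo r w)).
  exact: (le_EI mI iXX iBX (fun r w _ => hi r w)).
exact: (step_arith quad cross err le3).
Qed.

End kw_step.

Lemma le_halves (R : realType) (x y e : R) : x <= e / 2 -> y <= e / 2 -> x + y <= e.
Proof. lra. Qed.

Lemma max_lipschitz (R : realType) (x y x' y' : R) :
  `|Num.max x y - Num.max x' y'| <= `|x - x'| + `|y - y'|.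
Proof.
have := lexx `|x - x'|; have := lexx `|y - y'|.
rewrite ler_norml => /andP[h1 h2]; rewrite ler_norml => /andP[h3 h4].
by rewrite /Num.max; case: (ltP x y) => h5; case: (ltP x' y') => h6; rewrite ler_norml; apply/andP; split; lra.
Qed.

Lemma measurable_fun2 d (X : measurableType d) (R : realType) (D : set X) (f g : X -> R)
  (p : R -> R -> R) : measurable D -> measurable_fun setT (fun x : R * R => p x.1 x.2) ->
  measurable_fun D f -> measurable_fun D g -> measurable_fun D (fun x => p (f x) (g x)).
Proof.
move=> mD mp /(measurable_restrictT _ mD) mf /(measurable_restrictT _ mD) mg.
apply: (eq_measurable_fun (fun x => p ((f \_ D) x) ((g \_ D) x))).
  by move=> x xD; rewrite !patchE xD.
apply: measurable_funTS; exact: (measurableT_comp mp (measurable_fun_pair mf mg)).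
Qed.

(** * Density of simple predictable processes *)

Section elementary.
Context d (W : measurableType d) (R : realType) (mu : probability W R).
Variables (Flt : R -> set (set W)) (a b : R) (V : cumulative R R).
Hypothesis us : usual mu Flt a b.
Notation TT := (measurableTypeR R).
Notation I := (Ioc R a b).
Let hF := us_flt us.
Let ab := us_le us.
Implicit Types (H G : R -> W -> R).

Let mI (s t : R) : measurable (Ioc R s t). Proof. exact: measurable_itv. Qed.

(** Simple predictable processes on the grid of level [n]: constant on each cell with a value known
    at its left end, and constrained only at grid points up to [b]. *)
Definition elem n H : Prop := exists2 h : nat -> W -> R,
  forall k, grid a n k <= b -> measurable_wrt (Flt (grid a n k)) (h k) &
  forall r w, a < r <= b -> H r w = h (lidx a n r) w.

Lemma lidx_half n r : a < r -> lidx a n r = (lidx a n.+1 r)./2.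
Proof.
move=> ar; have /andP[h1 h2] := lidxP n.+1 ar; apply: lidx_eq; rewrite -!(grid_double a n).
apply/andP; split; first by apply: le_lt_trans h1; apply: grid_mono; rewrite -{2}(odd_double_half (lidx a n.+1 r)) leq_addl.
apply: le_trans h2 _; apply: grid_mono.
by rewrite -{1}(odd_double_half (lidx a n.+1 r)) doubleS; case: odd.
Qed.

Lemma lidx_itv n r : a < r <= b -> a <= grid a n (lidx a n r) /\ grid a n (lidx a n r) < r.
Proof. by move=> /andP[ar _]; rewrite grid_ge; have /andP[-> _] := lidxP n ar. Qed.

Lemma elemS n H : elem n H -> elem n.+1 H.
Proof.
move=> [h mh eh]; exists (fun k => h k./2) => [k kb|r w /[dup] rab /andP[ar rb]]; last first.
  by rewrite -lidx_half//; exact: eh.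
have le : grid a n k./2 <= grid a n.+1 k.
  by rewrite -grid_double; apply: grid_mono; rewrite -{2}(odd_double_half k) leq_addl.
apply: (measurable_wrt_mono hF (grid_ge a n _) le kb); apply: mh; exact: le_trans kb.
Qed.

Lemma elem_le n m H : (n <= m)%N -> elem n H -> elem m H.
Proof. by move=> /subnK <-; elim: (m - n)%N => [|k IH] //= /IH; exact: elemS. Qed.

Lemma measurable_lidx n k : measurable [set r : TT | I r /\ lidx a n r = k].
Proof.
rewrite (_ : [set r | _] = I `&` `]grid a n k, grid a n k.+1]%classic).
  by apply: measurableI; exact: mI.
apply/seteqP; split => r /= [rI].
  by move=> <-; split => //; rewrite in_itv/=; apply: lidxP; move: rI; rewrite in_itv/= => /andP[].
by rewrite in_itv/= => h; split => //; exact: lidx_eq.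
Qed.

Lemma measurable_left_step d' (U : measurableType d') n (F : nat -> W -> U) :
  (forall k, grid a n k < b -> measurable_fun setT (F k)) ->
  measurable_fun (I `*` setT) (fun x : TT * W => F (lidx a n x.1) x.2).
Proof.
move=> mF; apply: (@measurable_patchwork _ _ _ TT W U I (lidx a n) F).
  exact: measurable_lidx.
move=> k [r /=]; rewrite in_itv/= => rab <-; apply: mF.
by have [_ h] := lidx_itv n rab; apply: lt_le_trans h _; case/andP: rab.
Qed.

Lemma elem_measurable n H : elem n H -> measurable_fun (I `*` setT) (fun x : TT * W => H x.1 x.2).
Proof.
move=> [h mh eh]; apply: (eq_measurable_fun (fun x : TT * W => h (lidx a n x.1) x.2)).
  by move=> [r w]; rewrite inE => -[/= + _]; rewrite in_itv/= => rab; rewrite eh.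
apply: measurable_left_step => k kb; apply: (wrt_measurable hF (t := grid a n k)); last exact: mh (ltW kb).
by rewrite grid_ge ltW.
Qed.

Lemma elem_map n H (p : R -> R) : measurable_fun setT p -> elem n H -> elem n (fun r w => p (H r w)).
Proof.
move=> mp [h mh eh]; exists (fun k w => p (h k w)) => [k kb|r w rab]; last by rewrite eh.
have tab : a <= grid a n k <= b by rewrite grid_ge.
apply/(flt_wrtP hF tab); apply: measurableT_comp => //.
by apply/(flt_wrtP hF tab); exact: mh.
Qed.

Lemma elem_map2 n m H G (p : R -> R -> R) :
  measurable_fun setT (fun x : R * R => p x.1 x.2) -> elem n H -> elem m G ->
  elem (maxn n m) (fun r w => p (H r w) (G r w)).
Proof.
move=> mp /(elem_le (leq_maxl n m))[h mh eh] /(elem_le (leq_maxr n m))[g mg eg].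
set l := maxn n m; exists (fun k w => p (h k w) (g k w)) => [k kb|r w rab]; last by rewrite eh// eg.
have tab : a <= grid a l k <= b by rewrite grid_ge.
apply/(flt_wrtP hF tab).
have m1 := (flt_wrtP hF tab _).1 (mh k kb).
have m2 := (flt_wrtP hF tab _).1 (mg k kb).
exact: (measurableT_comp mp (measurable_fun_pair m1 m2)).
Qed.

Section density.
Variable wt : R -> W -> R.
Hypothesis wt0 : forall r w, 0 <= wt r w.
Hypothesis iwt : ini (dV V) mu I wt.
Notation EE := (EI (dV V) mu I).
Notation L1 := (ini (dV V) mu I).
Notation jm H := (measurable_fun (I `*` setT) (fun x : TT * W => H x.1 x.2)).

Definition unitf H : Prop := jm H /\ forall r w, a < r <= b -> 0 <= H r w <= 1.

(** Closeness is measured in the integral weighted by [wt]. Keeping the approximants between 0 and 1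
    makes [wt] a dominant for all differences. *)
Definition approximable H : Prop := unitf H /\ forall e : R, 0 < e ->
  exists n G, [/\ elem n G, unitf G & EE (fun r w => `|H r w - G r w| * wt r w) <= e].

Lemma unit_diff_ini H G : unitf H -> unitf G -> L1 (fun r w => `|H r w - G r w| * wt r w).
Proof.
move=> [mH bH] [mG bG]; apply: (le_ini (mI a b) _ _ iwt).
  apply: measurable_funM; last exact: (ini_measurable iwt).
  by apply: measurableT_comp => //; exact: measurable_funB.
move=> r w; rewrite /= in_itv/= => rab; rewrite normrM normr_id (ger0_norm (wt0 r w)).
rewrite ler_piMl// ler_norml; have /andP[h1 h2] := bH r w rab; have /andP[h3 h4] := bG r w rab.
by apply/andP; split; lra.
Qed.

(** Operations that are 1-Lipschitz in the sum of the two distances do not enlarge the error.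
    Complement, maximum and the average used for binary expansions are of this kind. *)
Lemma approximable_combine H1 H2 (p : R -> R -> R) :
  measurable_fun setT (fun x : R * R => p x.1 x.2) ->
  (forall x y, 0 <= x <= 1 -> 0 <= y <= 1 -> 0 <= p x y <= 1) ->
  (forall x y x' y', `|p x y - p x' y'| <= `|x - x'| + `|y - y'|) ->
  approximable H1 -> approximable H2 -> approximable (fun r w => p (H1 r w) (H2 r w)).
Proof.
move=> mp bp lp [u1 h1] [u2 h2].
have up A1 A2 : unitf A1 -> unitf A2 -> unitf (fun r w => p (A1 r w) (A2 r w)).
  move=> [m1 b1] [m2 b2]; split; last by move=> r w rab; apply: bp; [exact: b1|exact: b2].
  exact: (measurable_fun2 (measurableX (mI a b) measurableT) mp m1 m2).
split; first exact: up.
move=> e e0; have e2 : 0 < e / 2 by rewrite divr_gt0.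
have [n1 [G1 [el1 v1 d1]]] := h1 _ e2; have [n2 [G2 [el2 v2 d2]]] := h2 _ e2.
exists (maxn n1 n2), (fun r w => p (G1 r w) (G2 r w)); split; [exact: elem_map2|exact: up|].
have i1 := unit_diff_ini u1 v1; have i2 := unit_diff_ini u2 v2.
apply: (@le_trans _ _ (EE (fun r w => `|H1 r w - G1 r w| * wt r w + `|H2 r w - G2 r w| * wt r w))).
  apply: (le_EI (mI a b)); [exact: unit_diff_ini (up _ _ u1 u2) (up _ _ v1 v2)|exact: (iniD (mI a b) i1 i2)|].
  by move=> r w _; rewrite -mulrDl ler_wpM2r.
by rewrite (EID (mI a b) i1 i2); exact: le_halves.
Qed.

(** Dominated convergence brings some [F N] within half the error of [H], and an approximant of
    [F N] for the other half serves for [H]. *)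
Lemma approximable_limit (F : nat -> R -> W -> R) H : (forall n, approximable (F n)) -> jm H ->
  (forall r w, a < r <= b -> F n r w @[n --> \oo] --> H r w) -> approximable H.
Proof.
move=> aF mH cF; have uF n : unitf (F n) by case: (aF n).
have uH : unitf H.
  split=> // r w rab; have c := cF r w rab; rewrite -(cvg_lim _ c)//; apply/andP; split.
    apply: limr_ge; first by apply/cvg_ex; eexists; exact: c.
    by apply: nearW => n; case/andP: ((uF n).2 r w rab).
  apply: limr_le; first by apply/cvg_ex; eexists; exact: c.
  by apply: nearW => n; case/andP: ((uF n).2 r w rab).
split=> // e e0.
have mD : measurable (I `*` setT : set (TT * W)) by apply: measurableX => //; exact: mI.
have c0 : EE (fun r w => `|F n r w - H r w| * wt r w) @[n --> \oo] --> (0 : R).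
  have [||||||_] := @Rintegral_dct _ _ _ (dV V \x mu)%E (I `*` setT)
    (fun n x => `|F n x.1 x.2 - H x.1 x.2| * wt x.1 x.2) (fun=> 0) (fun x => wt x.1 x.2).
  - exact: mD.
  - by move=> n; have := ini_measurable (unit_diff_ini (uF n) uH).
  - exact: measurable_cst.
  - apply: aeW => -[r w] [/= + _]; rewrite in_itv/= => rab.
    have c1 : F n r w - H r w @[n --> \oo] --> H r w - H r w by apply: cvgB; [exact: cF|exact: cvg_cst].
    have c2 : `|F n r w - H r w| @[n --> \oo] --> (0 : R) by rewrite -(normr0 R) -(subrr (H r w)); exact: cvg_norm.
    by rewrite -[X in _ --> X](mul0r (wt r w)); apply: (cvgM c2); exact: cvg_cst.
  - exact: iwt.
  - apply: aeW => -[r w] n [/= + _]; rewrite in_itv/= => rab.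
    rewrite normrM normr_id (ger0_norm (wt0 r w)) ler_piMl// ler_norml.
    have /andP[h1 h2] := (uF n).2 r w rab; have /andP[h3 h4] := uH.2 r w rab.
    by apply/andP; split; lra.
  - by rewrite Rintegral_cst// mul0r.
have e2 : 0 < e / 2 by rewrite divr_gt0.
have /cvgrPdist_le/(_ _ e2)[N _ /(_ N (leqnn _))] := c0.
rewrite sub0r normrN => hN; have [n [G [eG uG dG]]] := (aF N).2 _ e2.
exists n, G; split => //.
have i1 := unit_diff_ini (uF N) uH; have i2 := unit_diff_ini (uF N) uG.
apply: (@le_trans _ _ (EE (fun r w => `|F N r w - H r w| * wt r w + `|F N r w - G r w| * wt r w))).
  apply: (le_EI (mI a b)); [exact: unit_diff_ini|exact: (iniD (mI a b) i1 i2)|].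
  move=> r w _; rewrite -mulrDl ler_wpM2r// distrC.
  rewrite (_ : G r w - H r w = (F N r w - H r w) - (F N r w - G r w)); last by ring.
  exact: ler_normB.
rewrite (EID (mI a b) i1 i2); apply: le_halves dG; exact: le_trans (ler_norm _) hN.
Qed.

Lemma approximable_elem n G : elem n G -> unitf G -> approximable G.
Proof.
move=> eG uG; split=> // e e0; exists n, G; split=> //.
rewrite (@eq_EI _ _ _ _ _ (dV V) mu I _ (fun _ _ => 0)).
  by rewrite /EI Rintegral_cst ?mul0r ?ltW//; apply: measurableX => //; exact: mI.
by move=> r w _; rewrite subrr normr0 mul0r.
Qed.

Lemma approximable_eq H G : (forall r w, a < r <= b -> H r w = G r w) -> approximable H -> approximable G.
Proof.
move=> e [[mH bH] aH]; have mG : jm G.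
  apply: eq_measurable_fun mH => -[r w]; rewrite inE => -[/= + _]; rewrite in_itv/= => rab.
  exact: e.
apply: (@approximable_limit (fun _ => H)) => // r w rab; rewrite (e r w rab); exact: cvg_cst.
Qed.

Let ind (C : set (R * W)) r w : R := \1_C (r, w).

Lemma approximable_predictable C : predictable_sigma Flt a b C -> approximable (ind C).
Proof.
have a0 : approximable (fun _ _ => 0).
  apply: (@approximable_elem 0%N); last by split => [|r w _]; [exact: measurable_cst|rewrite lexx ler01].
  exists (fun _ _ => 0) => // k kb; apply/(flt_wrtP hF _); first by rewrite grid_ge.
  exact: measurable_cst.
move: C; apply: smallest_sub; first split => /=.
- by apply: approximable_eq a0 => r w _; rewrite /ind indic0.
(* The complement is a combination that ignores its second argument. *)
- move=> C aC; have := @approximable_combine (ind C) (ind C) (fun x _ => 1 - x) _ _ _ aC aC.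
  move=> h; have : approximable (fun r w => 1 - ind C r w).
    apply: h.
    + exact: measurable_funB.
    + by move=> x _ /andP[x0 x1] _; rewrite subr_ge0 x1 gerBl.
    + move=> x y x' y'; rewrite (_ : 1 - x - (1 - x') = - (x - x')); last by ring.
    by rewrite normrN lerDl.
  apply: approximable_eq => r w /andP[ar rb]; rewrite /ind !indicE.
  have [Cr|nC] := pselect (C (r, w)).
    by rewrite mem_set// memNset ?subrr// => -[_ /(_ Cr)].
  rewrite memNset// mem_set ?subr0//; split => //; split => //=.
  by rewrite in_itv/= rb ltW.
- move=> F aF.
  (* Indicators of finite unions as iterated maxima; they increase to the indicator of the countable
     union. *)
  pose U := fix U n r w := if n is n'.+1 then Num.max (U n' r w) (ind (F n') r w) else 0.
  have aU n : approximable (U n).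
    elim: n => //= n IH; apply: (@approximable_combine (U n) (ind (F n)) Num.max) => //.
    + exact: measurable_maxr.
    + move=> x y /andP[x0 x1] /andP[y0 y1]; by rewrite le_max x0 ge_max x1 y1.
    + exact: max_lipschitz.
  have U0 n r w : (forall k, ~ F k (r, w)) -> U n r w = 0.
    by move=> nF; elim: n => //= n ->; rewrite /ind indicE memNset// maxxx.
  have U1 n k r w : a < r <= b -> (k < n)%N -> F k (r, w) -> U n r w = 1.
    move=> rab; elim: n => //= n IH; rewrite ltnS leq_eqVlt => /predU1P[<-|kn] Fk.
    rewrite /ind indicE mem_set//=; apply: max_r.
    by have [[_ /(_ r w rab) /andP[]]] := aU k.
    by rewrite IH// /ind indicE; case: (_ \in _) => /=; rewrite ?maxxx// max_l ?ler01.
  have cU r w : a < r <= b -> U n r w @[n --> \oo] --> ind (\bigcup_k F k) r w.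
    move=> rab; rewrite /ind indicE; have [[k _ Fk]|nF] := pselect ((\bigcup_k F k) (r, w)).
    rewrite mem_set//; last by exists k.
    apply: cvg_near_cst; exists k.+1 => // n /= kn; exact: (U1 n k).
    rewrite memNset//; apply: cvg_near_cst; apply: nearW => n; apply: U0 => k Fk.
    by apply: nF; exists k.
  apply: (approximable_limit aU _ cU).
  apply: (@measurable_fun_cvg _ _ _ _ (fun n (x : TT * W) => U n x.1 x.2)).
    by move=> n; case: (aU n) => -[].
  by move=> [r w] [/= + _]; rewrite in_itv/= => rab; exact: cU.
(* A generator carried by the time [a] is invisible on []a, b]]. *)
- move=> C [[B FB ->]|[t [t' [B [at_ tt' t'b FB ->]]]]].
    apply: approximable_eq a0 => r w /andP[ar _]; rewrite /ind indicE memNset// => -[/= ra _].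
    by rewrite ra ltxx in ar.
  (* The ends of []t, t']] need not be grid points. The cells whose left end lies in [[t, t'[]
     converge pointwise to this interval, and [B] is known at these left ends. *)
  pose h n k w : R := if t <= grid a n k < t' then \1_B w else 0.
  pose G n r w := h n (lidx a n r) w.
  have eG n : elem n (G n).
    exists (h n) => // k kb; rewrite /h; have tab : a <= grid a n k <= b by rewrite grid_ge.
    apply/(flt_wrtP hF tab).
    case tg : (t <= grid a n k < t'); last exact: measurable_cst.
    case/andP: tg => tg _.
    apply: (measurable_indic (R := R)); apply: sub_sigma_algebra.
    exact: (flt_mono hF at_ tg kb FB).
  have uG n : unitf (G n).
    split; first exact: (elem_measurable (eG n)).
    move=> r w _; rewrite /G /h; case: ifP => _; last by rewrite lexx ler01.
    by rewrite indicE; case: (_ \in _); rewrite ?lexx ?ler01.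
  have cG r w : a < r <= b -> G n r w @[n --> \oo] --> ind (`]t, t']%classic `*` B) r w.
    move=> /[dup] rab /andP[ar rb]; have gl n : grid a n (lidx a n r) < r by case: (lidx_itv n rab).
    have cg := cvg_left_grid ar.
    have [rt|tr] := leP r t.
    apply: cvg_near_cst; apply: nearW => n.
    rewrite /G /h leNgt (lt_le_trans (gl n) rt)/= /ind indicE memNset// => -[/= + _].
    by rewrite in_itv/= ltNge rt.
    have [rt'|t'r] := leP r t'.
    have /cvgrPdist_lt/(_ (r - t)) := cg; rewrite subr_gt0 => /(_ tr) [N _ hN].
    apply: cvg_near_cst; exists N => // n /= /hN /=.
    rewrite gtr0_norm ?subr_gt0// ltrD2l ltrN2 => h1.
    rewrite /G /h (ltW h1) (lt_le_trans (gl n) rt')/= /ind !indicE.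
    have [Bw|nB] := pselect (B w); first by rewrite !mem_set//; split => //=; rewrite in_itv/= tr.
    by rewrite !memNset// => -[].
    have /cvgrPdist_lt/(_ (r - t')) := cg; rewrite subr_gt0 => /(_ t'r) [N _ hN].
    apply: cvg_near_cst; exists N => // n /= /hN /=.
    rewrite gtr0_norm ?subr_gt0// ltrD2l ltrN2 => h1.
    rewrite /G /h [_ < t']ltNge (ltW h1) andbF /ind indicE memNset// => -[/= + _].
    by rewrite in_itv/= [r <= t']leNgt t'r andbF.
  apply: (@approximable_limit G) => //.
    by move=> n; exact: approximable_elem (eG n) (uG n).
  apply: (@measurable_fun_cvg _ _ _ _ (fun n (x : TT * W) => G n x.1 x.2)).
    by move=> n; case: (uG n).
  by move=> [r w] [/= + _]; rewrite in_itv/= => rab; exact: cG.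
Qed.

(* Binary digits of a function with values in [0, 1]. *)
Let digit (f : R -> W -> R) r w : R := \1_[set x | 2^-1 <= f x.1 x.2] (r, w).
Let bits := fix bits n (f : R -> W -> R) r w : R :=
  if n is n'.+1 then 2^-1 * (digit f r w + bits n' (fun r w => 2 * f r w - digit f r w) r w) else 0.

(** Each binary digit is the indicator of a predictable set, and halving in the recursion keeps the
    partial expansions between 0 and 1 within 2^-n of [f]. *)
Lemma approximable_predictable_map (f : R -> W -> R) : predictable_map Flt a b f ->
  (forall r w, 0 <= f r w <= 1) -> approximable f.
Proof.
pose mD := @predictable_measurableD _ W R Flt a b.
have pd (g : R -> W -> R) : predictable_map Flt a b g -> predictable_map Flt a b (digit g).
  move=> pg; rewrite /predictable_map.
  have mS : measurable ((`[a, b]%classic `*` setT) `&` [set x | 2^-1 <= g x.1 x.2] :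
    set (g_sigma_algebraType (predictable_sigma Flt a b))).
    have := pg mD _ (measurable_itv `[2^-1, +oo[); congr measurable; congr (_ `&` _).
    by apply/seteqP; split => x /=; rewrite in_itv/= andbT.
  apply: (eq_measurable_fun (\1_((`[a, b]%classic `*` setT) `&` [set x | 2^-1 <= g x.1 x.2]) :
    g_sigma_algebraType (predictable_sigma Flt a b) -> R)).
    move=> [r w]; rewrite inE => Dx; rewrite /digit !indicE.
    have [gx|gx] := pselect (2^-1 <= g r w).
    by rewrite !mem_set.
    by rewrite !memNset// => -[].
  exact: measurable_indic.
have dE (g : R -> W -> R) r w : digit g r w = (2^-1 <= g r w)%R%:R.
  rewrite /digit indicE; have [h|h] := pselect (2^-1 <= g r w); first by rewrite mem_set// h.
  by rewrite memNset//; move/negP: h => /negbTE ->.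
have rem (g : R -> W -> R) : predictable_map Flt a b g -> (forall r w, 0 <= g r w <= 1) ->
    predictable_map Flt a b (fun r w => 2 * g r w - digit g r w) /\
    forall r w, 0 <= 2 * g r w - digit g r w <= 1.
  move=> pg bg; split; last first.
    by move=> r w; rewrite dE; have /andP[h1 h2] := bg r w; case: (leP (2^-1 : R) _) => h3 /=; apply/andP; split; lra.
  by apply: measurable_funB; [exact: measurable_funM|exact: pd].
have a0 : approximable (fun _ _ => 0).
  apply: (@approximable_elem 0%N); last by split => [|r w _]; [exact: measurable_cst|rewrite lexx ler01].
  exists (fun _ _ => 0) => // k kb; apply/(flt_wrtP hF _); first by rewrite grid_ge.
  exact: measurable_cst.
have ad (g : R -> W -> R) : predictable_map Flt a b g -> approximable (digit g).
  move=> pg; have mS : predictable_sigma Flt a b ((`[a, b]%classic `*` setT) `&` [set x | 2^-1 <= g x.1 x.2]).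
    have := predictable_trace ab (pg mD _ (measurable_itv `[2^-1, +oo[)).
    rewrite setIA setIid; congr predictable_sigma; congr (_ `&` _).
    by apply/seteqP; split => x /=; rewrite in_itv/= andbT.
  apply: approximable_eq (approximable_predictable mS) => r w /andP[ar rb].
  rewrite /ind /digit !indicE; have [h|h] := pselect (2^-1 <= g r w); last first.
    by rewrite !memNset// => -[].
  rewrite !mem_set//; split => //; split => //=.
  by rewrite in_itv/= rb ltW.
have ab_ n (g : R -> W -> R) : predictable_map Flt a b g -> (forall r w, 0 <= g r w <= 1) -> approximable (bits n g).
  elim: n g => [|n IH] g pg bg; first exact: a0.
  have [pr br] := rem g pg bg.
  apply: (@approximable_combine (digit g) _ (fun x y => 2^-1 * (x + y)) _ _ _ (ad g pg) (IH _ pr br)).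
  - by apply: measurable_funM => //; exact: measurable_funD.
  - by move=> x y /andP[x0 x1] /andP[y0 y1]; apply/andP; split; lra.
  - move=> x y x' y'; have := lexx `|x - x'|; have := lexx `|y - y'|.
    rewrite ler_norml => /andP[h1 h2]; rewrite ler_norml => /andP[h3 h4].
    by rewrite ler_norml; apply/andP; split; lra.
have err n (g : R -> W -> R) r w : (forall r w, 0 <= g r w <= 1) -> 0 <= g r w - bits n g r w <= 2 ^- n.
  elim: n g => [|n IH] g bg; first by rewrite /= subr0 expr0 invr1.
  have br r' w' : 0 <= 2 * g r' w' - digit g r' w' <= 1.
    by rewrite dE; have /andP[h1 h2] := bg r' w'; case: (leP (2^-1 : R) _) => h3 /=; apply/andP; split; lra.
  have /andP[h1 h2] := IH _ br; rewrite /= exprS invfM.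
  set x := 2 ^- n in h2 *; set y := bits n _ r w in h1 h2 *.
  by apply/andP; split; lra.
move=> pf bf; apply: (@approximable_limit (fun n => bits n f)).
- by move=> n; exact: ab_.
- exact: (prog_joint hF (predictable_map_prog hF ab pf) (lexx a) (lexx b)).
move=> r w _; apply: (@squeeze_cvgr _ _ _ _ (fun n => f r w - 2 ^- n) (fun=> f r w)).
- by apply: nearW => n; have /andP[h1 h2] := err n f r w bf; apply/andP; split; lra.
- rewrite -[X in _ --> X]subr0; apply: cvgB; [exact: cvg_cst|exact: cvg_mesh].
- exact: cvg_cst.
Qed.

End density.
End elementary.

Section split_EI.
Context d (W : measurableType d) (R : realType) (mu : probability W R).
Variables (a b : R) (V : cumulative R R).
Notation TT := (measurableTypeR R).
Notation EE p q := (EI (dV V) mu (Ioc R p q)).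
Notation L1 p q := (ini (dV V) mu (Ioc R p q)).
Implicit Types f : R -> W -> R.

Let mD (p q : R) : measurable ((Ioc R p q) `*` setT : set (TT * W)).
Proof. by apply: measurableX => //; exact: measurable_itv. Qed.

Lemma iniS f s t p q : s <= p -> q <= t -> L1 s t f -> L1 p q f.
Proof.
move=> sp qt; apply: integrableS; [exact: mD|exact: mD|].
move=> [r w] [/= + _]; rewrite in_itv/= => /andP[pr rq]; split => //=.
by rewrite in_itv/= (le_lt_trans sp pr) (le_trans rq).
Qed.

Lemma EI_split f p q : a <= p -> p <= q -> q <= b -> L1 a b f ->
  EE a q f = EE a p f + EE p q f.
Proof.
move=> ap pq qb i_f.
have E : ((Ioc R a q) `*` setT : set (TT * W)) =
    (`]a, p]%classic `*` setT) `|` (`]p, q]%classic `*` setT).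
  rewrite (_ : `]a, q]%classic = `]a, p]%classic `|` `]p, q]%classic); last first.
    by rewrite -itv_bndbnd_setU// bnd_simp.
  by apply/seteqP; split => [[r w] [/= [h|h] _]|[r w] [[/= h _]|[/= h _]]]; [left|right|split => //; left|split => //; right].
rewrite /EI [in LHS]E Rintegral_setU; [by []|exact: mD|exact: mD| |].
- by rewrite -E; apply: (iniS (lexx a) qb).
- apply/disj_set2P/seteqP; split => // -[r w] [[/= + _] [/= + _]].
  by rewrite !in_itv/= => /andP[_ rs] /andP[sr _]; have := lt_le_trans sr rs; rewrite ltxx.
Qed.

End split_EI.

Lemma EI_cst d (W : measurableType d) (R : realType) (mu : probability W R)
  (V : cumulative R R) p q (h : W -> R) : p <= q -> mu.-integrable setT (EFin \o h) ->
  ini (dV V) mu (Ioc R p q) (fun _ w => h w) /\ EI (dV V) mu (Ioc R p q) (fun _ w => h w) = (V q - V p) * \int[mu]_w h w.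
Proof.
move=> pq ih; have mI : measurable (Ioc R p q) by exact: measurable_itv.
have i1 : ini (dV V) mu (Ioc R p q) (fun _ w => h w).
  apply: (eq_ini mI _ (ini_const mI 1 (dV_itv_lty V p q) ih)) => r w _; exact: mul1r.
split => //; rewrite (EIE mI i1).
under eq_Rintegral do rewrite Rintegral_cst//.
rewrite -RintegralZl//; apply: eq_Rintegral => w _; rewrite mulrC; congr (_ * _).
by rewrite -[X in fine X]/(dV V `]p, q]%classic) dV_itv.
Qed.

(** Unlike in the sequential criterion for right limits, the sequence may touch [r]. *)
Lemma rcont_seq (R : realType) (F : R -> R) (u : nat -> R) r :
  F q @[q --> r^'+] --> F r -> (forall n, r <= u n) -> u n @[n --> \oo] --> r ->
  F (u n) @[n --> \oo] --> F r.
Proof.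
move=> cF ru cu; apply/cvgrPdist_lt => e e0.
have /cvgrPdist_lt/(_ e e0) := cF; rewrite near_withinE => -[dl dl0 hd].
have /cvgrPdist_lt/(_ _ dl0) := cu; apply: filterS => n hn.
have := ru n; rewrite le_eqVlt => /predU1P[<-|run]; first by rewrite subrr normr0.
exact: hd.
Qed.

Lemma step_sum (R : realType) (c B f1 F1 f2 F2 f3 F3 i1 i2 : R) :
  - 2 * F1 <= c * F2 + (i2 - i1) + 2 * B * F3 ->
  - 2 * (f1 + F1) - - 2 * f1 <= c * (f2 + F2) + i2 + 2 * B * (f3 + F3) - (c * f2 + i1 + 2 * B * f3).
Proof. lra. Qed.

Lemma gap_arith (R : realType) (x y e w : R) : x + y + e - w <= x + (y - w) + e.
Proof. lra. Qed.

Lemma approx_arith (R : realType) (c x1 x2 y1 y2 g B e dl : R) : 0 <= c ->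
  - 2 * x1 <= c * y1 + g -> x1 - x2 <= 2 * B * dl -> y1 - y2 <= 4 * B ^+ 2 * dl ->
  (4 * B + c * (4 * B ^+ 2) + 1) * dl = e -> 0 <= dl -> - 2 * x2 <= e + (c * y2 + g).
Proof.
move=> c0 h1 h2 h3 <- dl0; have : c * (y1 - y2) <= c * (4 * B ^+ 2 * dl) by rewrite ler_wpM2l.
rewrite mulrBr; set u := c * (4 * B ^+ 2 * dl) => h4.
rewrite (_ : _ * dl = 4 * B * dl + u + dl); last by rewrite /u; ring.
lra.
Qed.

Lemma sum_steps (R : realType) (x y z u v t : R) : y - x <= v - u -> z - y <= t - v -> z - x <= t - u.
Proof. lra. Qed.

(** * The estimate for simple, then for general predictable test processes *)

Section kw_elementary.
Context d (W : measurableType d) (R : realType) (mu : probability W R).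
Variables (Flt : R -> set (set W)) (a b : R) (V : cumulative R R).
Hypothesis us : usual mu Flt a b.
Hypothesis natom : no_atom V a b.
Variables (m N z : R -> W -> R) (c : R).
Hypotheses (nm : nice mu Flt a b m) (nN : nice mu Flt a b N).
Hypothesis pz : prog Flt a b z.
Hypothesis iz : forall w, dV_integrable V a b (z^~ w).
Hypothesis mX : martingale mu Flt a b (fun t w => m t w * N t w - pint V a (z^~ w) t).
Hypothesis hN : bracket_le mu Flt V a b c N.
Variable eps : R.
Hypothesis eps0 : 0 < eps.
Notation TT := (measurableTypeR R).
Notation EE p q := (EI (dV V) mu (Ioc R p q)).
Notation L1 p q := (ini (dV V) mu (Ioc R p q)).
Let hF := us_flt us.
Let ab := us_le us.
Notation rho := (kwrho a V z eps).
Notation kap := (kwmass a V z eps).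
Implicit Types H : R -> W -> R.

Let mI (p q : R) : measurable (Ioc R p q). Proof. exact: measurable_itv. Qed.

Definition kwX t w : R := m t w * N t w.
(** The error terms of all steps of level [n] in one integrand: at time [r], the product [m * N] is
    compared with its value at the right end of the cell containing [r]. *)
Definition kwerr n r w : R := `|kap r w| * `|kwX (tau a b n (lidx a n r).+1) w - kwX r w|.
Definition kwgap : R := ip mu (m b) (m b) - ip mu (m a) (m a).

Lemma rhoz_bound r w : `|rho r w * z r w| = `|kap r w| / eps.
Proof.
rewrite /kwmass /kwk !normrM normrN normrM normr_id (gtr0_norm eps0).
by field; exact: lt0r_neq0.
Qed.

Lemma rhoz_measurable : measurable_fun ((Ioc R a b) `*` setT)
  (fun x : TT * W => rho x.1 x.2 * z x.1 x.2).
Proof.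
exact: (measurable_funM (prog_joint hF (kwrho_prog us natom pz iz eps) (lexx a) (lexx b))
  (prog_joint hF pz (lexx a) (lexx b))).
Qed.

Lemma rhoz_ini : L1 a b (fun r w => rho r w * z r w).
Proof.
apply: (kw_dominated natom iz eps0 (G := fun=> eps^-1) (lexx a) (lexx b)).
- exact: finite_measure_integrable_cst.
- exact: rhoz_measurable.
- by move=> r w _; rewrite rhoz_bound.
Qed.

Lemma bounded_rhoz H (B : R) : measurable_fun ((Ioc R a b) `*` setT) (fun x : TT * W => H x.1 x.2) ->
  (forall r w, a < r <= b -> `|H r w| <= B) -> L1 a b (fun r w => H r w * (rho r w * z r w)).
Proof.
move=> mH bH; apply: (le_ini (mI a b) _ _ (iniZ (mI a b) B (ini_norm rhoz_ini))).
  exact: (measurable_funM mH rhoz_measurable).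
by move=> r w; rewrite /= in_itv/= => rab; rewrite normrM ler_wpM2r ?normr_ge0// bH.
Qed.

Lemma bounded_sqr H (B : R) : measurable_fun ((Ioc R a b) `*` setT) (fun x : TT * W => H x.1 x.2) ->
  (forall r w, a < r <= b -> `|H r w| <= B) -> L1 a b (fun r w => H r w ^+ 2).
Proof.
move=> mH bH; have [i1 _] := EI_cst V ab (finite_measure_integrable_cst mu (B ^+ 2) measurableT).
apply: (le_ini (mI a b) _ _ i1); first exact: measurable_funX.
move=> r w; rewrite /= in_itv/= => rab; have h := bH r w rab.
rewrite ger0_norm ?sqr_ge0// -(real_normK (num_real (H r w))) lerXn2r ?nnegrE//.
exact: le_trans h.
Qed.

Lemma kwX_bound : exists2 G : W -> R, mu.-integrable setT (EFin \o G) &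
  forall r t w, a <= r <= b -> a <= t <= b -> `|kwX t w - kwX r w| <= G w.
Proof.
have [G iG hG] := nice_bound nm nN; exists (fun w => 2 * G w).
  by have := integrableZl measurableT 2 iG; exact: eq_integrable.
move=> r t w rab tab; apply: le_trans (ler_normB _ _) _.
by have := hG w t t tab tab; have := hG w r r rab rab; rewrite /kwX; lra.
Qed.

Lemma kwX_prog : prog Flt a b kwX.
Proof. by move=> t tab; apply: measurable_funM; [exact: (nice_prog us nm)|exact: (nice_prog us nN)]. Qed.

Let kwX_meas t : a <= t <= b -> measurable_fun setT (kwX t).
Proof.
move=> tab; apply: measurable_funM; [exact: (nice_sqi us nm tab).1|exact: (nice_sqi us nN tab).1].
Qed.

Let tb n k : a <= tau a b n k <= b. Proof. exact: tau_bounds. Qed.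

Lemma kwerr_measurable n : measurable_fun ((Ioc R a b) `*` setT)
  (fun x : TT * W => kwerr n x.1 x.2).
Proof.
have m1 := prog_joint hF (kwmass_prog us natom pz iz eps) (lexx a) (lexx b).
have m2 := prog_joint hF kwX_prog (lexx a) (lexx b).
have m3 := @measurable_left_step _ W R a b _ R n (fun k => kwX (tau a b n k.+1)) (fun k _ => kwX_meas (tb n k.+1)).
by apply: measurable_funM; apply: measurableT_comp => //; exact: (measurable_funB m3 m2).
Qed.

Lemma kwerr_ini n : L1 a b (kwerr n).
Proof.
have [G iG hG] := kwX_bound.
apply: (kw_dominated natom iz eps0 (lexx a) (lexx b) iG (kwerr_measurable n)).
move=> r w /andP[ar rb]; rewrite /kwerr normrM !normr_id ler_wpM2l ?normr_ge0//.
by apply: hG (tb _ _); rewrite rb ltW.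
Qed.

(** The right ends of the cells decrease to [r] at the scale of the mesh and [kwX] is
    right-continuous; |kwmass| times the bound of [kwX_bound] dominates. *)
Lemma kwerr_cvg0 : EE a b (kwerr n) @[n --> \oo] --> (0 : R).
Proof.
have [G iG hG] := kwX_bound.
have mD : measurable ((Ioc R a b) `*` setT : set (TT * W)).
  by apply: measurableX => //; exact: mI.
have iG' : L1 a b (fun r w => `|kap r w| * G w).
  have G0 w : 0 <= G w.
    have aab : a <= a <= b by rewrite lexx ab.
    exact: le_trans (hG a a w aab aab).
  apply: (kw_dominated natom iz eps0 (lexx a) (lexx b) iG).
    apply: measurable_funM; first by apply: measurableT_comp => //; exact: (prog_joint hF (kwmass_prog us natom pz iz eps) (lexx a) (lexx b)).
    by apply: measurable_funTS; apply: measurableT_comp => //; exact/measurable_EFinP/(measurable_int _ iG).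
  by move=> r w _; rewrite normrM normr_id ler_wpM2l ?normr_ge0// ger0_norm.
have [||||||_] := @Rintegral_dct _ _ _ (dV V \x mu)%E ((Ioc R a b) `*` setT)
    (fun n x => kwerr n x.1 x.2) (fun=> 0) (fun x => `|kap x.1 x.2| * G x.2).
- exact: mD.
- exact: kwerr_measurable.
- exact: measurable_cst.
- apply: aeW => -[r w] [/= + _]; rewrite in_itv/= => /andP[ar rb].
  have nr n : r <= tau a b n (lidx a n r).+1.
    by rewrite /tau le_min rb /=; have /andP[_ ->] := lidxP n ar.
  have cu : tau a b n (lidx a n r).+1 @[n --> \oo] --> r.
    apply: (@squeeze_cvgr _ _ _ _ (fun=> r) (fun n => grid a n (lidx a n r) + 2 ^- n)).
    + by apply: nearW => n; rewrite nr /= /tau -gridS ge_min lexx orbT.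
    + exact: cvg_cst.
    + by rewrite -[X in _ --> X]addr0; apply: cvgD; [exact: cvg_left_grid|exact: cvg_mesh].
  have cX : kwX (tau a b n (lidx a n r).+1) w @[n --> \oo] --> kwX r w.
    move: rb; rewrite le_eqVlt => /predU1P[rE|rb].
    apply: cvg_near_cst; apply: nearW => n; congr (kwX _ w).
    by apply/eqP; rewrite eq_le nr andbT rE; have /andP[] := tb n (lidx a n b).+1.
    apply: (rcont_seq (F := kwX^~ w)) => //.
    have rab : a <= r < b by rewrite rb ltW.
    by apply: cvgM; [exact: (nice_rcont nm)|exact: (nice_rcont nN)].
  have c1 : kwX (tau a b n (lidx a n r).+1) w - kwX r w @[n --> \oo] --> kwX r w - kwX r w.
    by apply: cvgB; [exact: cX|exact: cvg_cst].
  have c2 : `|kwX (tau a b n (lidx a n r).+1) w - kwX r w| @[n --> \oo] --> (0 : R).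
    by rewrite -(normr0 R) -(subrr (kwX r w)); exact: cvg_norm.
  by rewrite -[X in _ --> X](mulr0 `|kap r w|); apply: cvgM; [exact: cvg_cst|exact: c2].
- exact: iG'.
- apply: aeW => -[r w] n [/= + _]; rewrite in_itv/= => /andP[ar rb].
  rewrite /kwerr normrM !normr_id ler_wpM2l ?normr_ge0//.
  by apply: hG (tb _ _); rewrite rb ltW.
- by rewrite Rintegral_cst// mul0r.
Qed.

Lemma kw_elem_err n H (B : R) : 0 <= B -> elem Flt a b n H ->
  (forall r w, a < r <= b -> `|H r w| <= B) ->
  - 2 * EE a b (fun r w => H r w * (rho r w * z r w)) <=
  c * EE a b (fun r w => H r w ^+ 2) + kwgap + 2 * B * EE a b (kwerr n).
Proof.
move=> B0 eH bH; have mH := elem_measurable us eH.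
pose f1 r w := H r w * (rho r w * z r w); pose f2 r w := H r w ^+ 2.
have i1 : L1 a b f1 := bounded_rhoz mH bH.
have i2 : L1 a b f2 := bounded_sqr mH bH.
have i3 := kwerr_ini n.
(* The sum over the cells telescopes: on each cell the increase of [- 2 * EE a t f1] is at most that
   of [v]. *)
pose v t := c * EE a t f2 + ip mu (m t) (m t) + 2 * B * EE a t (kwerr n).
have [h mh hE] := eH.
have step k : - 2 * EE a (tau a b n k.+1) f1 - - 2 * EE a (tau a b n k) f1 <= v (tau a b n k.+1) - v (tau a b n k).
  have [bk|kb] := leP b (grid a n k).
    have -> : tau a b n k = b by exact: min_l.
    have -> : tau a b n k.+1 = b by apply: min_l; apply: le_trans bk _; exact: grid_mono.
    by rewrite !subrr.
  have pE : tau a b n k = grid a n k by apply: tau_grid; exact: ltW.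
  have /andP[aq qb] := tb n k.+1; have pq := tau_nondecreasing a b n k.
  rewrite pE in pq *; set p := grid a n k in pE pq kb *; set q := tau a b n k.+1 in aq qb pq *.
  have ap : a <= p := grid_ge a n k.
  have lk r : p < r <= q -> lidx a n r = k.
    move=> /andP[pr rq]; apply: lidx_eq; rewrite pr /=; apply: le_trans rq _.
    by rewrite /q /tau ge_min lexx orbT.
  have pltq : p < q by rewrite /q /tau lt_min kb /p gridS ltrDl invr_gt0 exprn_gt0.
  have hk r w : p < r <= q -> H r w = h k w.
    move=> /[dup] prq /andP[pr rq]; rewrite hE ?lk//.
    by rewrite (le_lt_trans ap pr) (le_trans rq).
  (* Only [H] is assumed bounded; the cell has positive length, and [h k] is the value of [H] at its
     right end. *)
  have hB w : `|h k w| <= B.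
    rewrite -(hk q w); last by rewrite pltq lexx.
    by apply: bH; rewrite (le_lt_trans ap pltq) qb.
  have wh := mh k (ltW kb).
  have K := kw_step us natom nm nN pz iz mX hN eps0 ap pq qb B0 wh hB.
  have e1 : EE p q (fun r w => h k w * (rho r w * z r w)) = EE p q f1.
    by apply: eq_EI => r w; rewrite /= in_itv/= => prq; rewrite /f1 hk.
  have pab : a <= p <= b by rewrite ap ltW.
  have mhk : measurable_fun setT (h k) := wrt_measurable hF pab wh.
  have ih2 : mu.-integrable setT (EFin \o (fun w => h k w ^+ 2)).
    apply: (le_integrable measurableT _ _ (finite_measure_integrable_cst mu (B ^+ 2) measurableT)).
    by apply/measurable_EFinP; exact: measurable_funX.
    move=> w _; rewrite lee_fin /= !ger0_norm ?sqr_ge0//.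
    by rewrite -(real_normK (num_real (h k w))) lerXn2r ?nnegrE.
  have e2 : EE p q f2 = (V q - V p) * \int[mu]_w h k w ^+ 2.
    rewrite -(EI_cst V pq ih2).2.
    by apply: eq_EI => r w; rewrite /= in_itv/= => prq; rewrite /f2 hk.
  have e3 : EE p q (fun r w => `|kap r w| * `|kwX q w - kwX r w|) = EE p q (kwerr n).
    by apply: eq_EI => r w; rewrite /= in_itv/= => prq; rewrite /kwerr lk.
  rewrite e1 -mulrA -e2 in K.
  have {}K : - 2 * EE p q f1 <= c * EE p q f2 + (ip mu (m q) (m q) - ip mu (m p) (m p)) + 2 * B * EE p q (kwerr n).
    by rewrite -e3; exact: K.
  rewrite /v (EI_split ap pq qb i1) (EI_split ap pq qb i2) (EI_split ap pq qb i3).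
  exact: step_sum K.
have total k : - 2 * EE a (tau a b n k) f1 - - 2 * EE a a f1 <= v (tau a b n k) - v a.
  elim: k => [|k IH]; first by rewrite /tau grid0 (min_r ab) !subrr.
  exact: sum_steps IH (step k).
have := total (last_idx a b n); rewrite tau_last//.
have z0 f : EE a a f = 0.
  rewrite /EI (_ : `]a, a]%classic `*` setT = set0) ?Rintegral_set0//.
  by apply/seteqP; split => // -[r w] [/= + _]; rewrite in_itv/= => /andP[/lt_le_trans le1 /le1]; rewrite ltxx.
rewrite /v !z0 !mulr0 subr0 add0r addr0 => {}K; apply: le_trans K _.
exact: gap_arith.
Qed.

(** A process that is simple at level [n] is simple at every finer level, so the same inequality
    holds with errors that tend to 0. *)
Lemma kw_elem n H (B : R) : 0 <= B -> elem Flt a b n H ->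
  (forall r w, a < r <= b -> `|H r w| <= B) ->
  - 2 * EE a b (fun r w => H r w * (rho r w * z r w)) <=
  c * EE a b (fun r w => H r w ^+ 2) + kwgap.
Proof.
move=> B0 eH bH; set x := - 2 * _; set y := c * _ + _.
have cy : y + 2 * B * EE a b (kwerr k) @[k --> \oo] --> y.
  rewrite -[X in _ --> X]addr0; apply: cvgD; first exact: cvg_cst.
  by rewrite -[X in _ --> X](mulr0 (2 * B)); apply: cvgM; [exact: cvg_cst|exact: kwerr_cvg0].
rewrite -(cvg_lim _ cy)//; apply: limr_ge; first by apply/cvg_ex; eexists; exact: cy.
exists n => // k /= nk; exact: (kw_elem_err B0 (elem_le us nk eH) bH).
Qed.

(** The summand |rho z| controls the linear term of the inequality, the summand 1 the quadratic
    one. *)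
Definition kwwt r w : R := 1 + `|rho r w * z r w|.

Lemma kwwt_ini : L1 a b kwwt.
Proof.
have [i1 _] := EI_cst V ab (finite_measure_integrable_cst mu (1 : R) measurableT).
exact: (iniD (mI a b) i1 (ini_norm rhoz_ini)).
Qed.

Lemma kw_approx H (B : R) : 0 <= B -> 0 <= c -> approximable mu Flt a b V kwwt H ->
  - 2 * EE a b (fun r w => B * (2 * H r w - 1) * (rho r w * z r w)) <=
  c * EE a b (fun r w => (B * (2 * H r w - 1)) ^+ 2) + kwgap.
Proof.
move=> B0 c0 [uH aH].
have wt0 r w : 0 <= kwwt r w by rewrite addr_ge0.
have bnd (F : R -> W -> R) : unitf a b F -> forall r w, a < r <= b -> `|B * (2 * F r w - 1)| <= B.
  move=> [_ bF] r w rab; have /andP[h1 h2] := bF r w rab.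
  rewrite normrM (ger0_norm B0) ler_piMr// ler_norml; apply/andP; split; lra.
have ms (F : R -> W -> R) : unitf a b F ->
    measurable_fun ((Ioc R a b) `*` setT) (fun x : TT * W => B * (2 * F x.1 x.2 - 1)).
  by move=> [mF _]; apply: measurable_funM => //; apply: measurable_funB => //; exact: measurable_funM.
have j1 F (uF : unitf a b F) := bounded_rhoz (ms F uF) (bnd F uF).
have j2 F (uF : unitf a b F) := bounded_sqr (ms F uF) (bnd F uF).
apply/ler_addgt0Pl => e e0.
(* An error delta in the weighted distance costs 2 * (2 B) delta in the linear term and 4 c B^2
   delta in the quadratic one; the extra 1 keeps [K] positive. *)
pose K := 4 * B + c * (4 * B ^+ 2) + 1.
have K0 : 0 < K by rewrite ltr_pwDr// addr_ge0// mulr_ge0// mulr_ge0// sqr_ge0.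
have [n [G [eG uG dG]]] := aH _ (divr_gt0 e0 K0).
have iD := unit_diff_ini wt0 kwwt_ini uH uG.
have eB : elem Flt a b n (fun r w => B * (2 * G r w - 1)).
  apply: (elem_map us (p := fun x => B * (2 * x - 1))) eG.
  by apply: measurable_funM => //; apply: measurable_funB => //; exact: measurable_funM.
have base := kw_elem B0 eB (bnd G uG).
have d1 : EE a b (fun r w => B * (2 * G r w - 1) * (rho r w * z r w)) -
    EE a b (fun r w => B * (2 * H r w - 1) * (rho r w * z r w)) <= 2 * B * (e / K).
  rewrite -(EIB (mI a b) (j1 G uG) (j1 H uH)).
  apply: (@le_trans _ _ (EE a b (fun r w => 2 * B * (`|H r w - G r w| * kwwt r w)))).
    apply: (le_EI (mI a b)); [exact: (iniB (mI a b) (j1 G uG) (j1 H uH))|exact: (iniZ (mI a b) _ iD)|].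
    move=> r w _; rewrite -mulrBl; apply: le_trans (ler_norm _) _.
    rewrite (_ : B * _ - _ = 2 * B * (G r w - H r w)); last by ring.
    rewrite normrM [`|2 * B * _|]normrM distrC (ger0_norm (x := 2 * B)) ?mulr_ge0// -[leLHS]mulrA.
    by rewrite ler_wpM2l ?mulr_ge0// ler_wpM2l// /kwwt lerDr.
  by rewrite (EIZ (mI a b) _ iD) ler_wpM2l ?mulr_ge0.
have d2 : EE a b (fun r w => (B * (2 * G r w - 1)) ^+ 2) -
    EE a b (fun r w => (B * (2 * H r w - 1)) ^+ 2) <= 4 * B ^+ 2 * (e / K).
  rewrite -(EIB (mI a b) (j2 G uG) (j2 H uH)).
  apply: (@le_trans _ _ (EE a b (fun r w => 4 * B ^+ 2 * (`|H r w - G r w| * kwwt r w)))).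
    apply: (le_EI (mI a b)); [exact: (iniB (mI a b) (j2 G uG) (j2 H uH))|exact: (iniZ (mI a b) _ iD)|].
    move=> r w; rewrite /= in_itv/= => rab; apply: le_trans (ler_norm _) _.
    rewrite (_ : _ - _ = 4 * B ^+ 2 * ((G r w - H r w) * (G r w + H r w - 1))); last by ring.
    rewrite normrM (ger0_norm (x := 4 * B ^+ 2)) ?mulr_ge0 ?sqr_ge0// ler_wpM2l ?mulr_ge0 ?sqr_ge0//.
    rewrite normrM distrC ler_wpM2l//; apply: (@le_trans _ _ 1); last by rewrite /kwwt lerDl.
    have /andP[h1 h2] := uG.2 r w rab; have /andP[h3 h4] := uH.2 r w rab.
    by rewrite ler_norml; apply/andP; split; lra.
  by rewrite (EIZ (mI a b) _ iD) ler_wpM2l ?mulr_ge0 ?sqr_ge0.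
have eK : K * (e / K) = e by rewrite mulrC divfK// lt0r_neq0.
exact: (approx_arith c0 base d1 d2 eK (ltW (divr_gt0 e0 K0))).
Qed.

End kw_elementary.

Lemma weight_arith (R : realType) (c x y g : R) : 0 < c ->
  - 2 * (- c^-1 * x) <= c * (c ^- 2 * y) + g -> 2 * x <= y + c * g.
Proof.
move=> c0; rewrite -(ler_pM2l c0) mulrDr.
have cn : c != 0 by exact: lt0r_neq0.
rewrite (_ : c * (- 2 * _) = 2 * x); last by field.
by rewrite (_ : c * (c * _) = y); last by field.
Qed.

Section kw_estimate.
Context d (W : measurableType d) (R : realType) (mu : probability W R).
Variables (Flt : R -> set (set W)) (a b : R) (V : cumulative R R).
Hypothesis us : usual mu Flt a b.
Hypothesis natom : no_atom V a b.
Variables (m N z : R -> W -> R) (c : R).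
Hypotheses (nm : nice mu Flt a b m) (nN : nice mu Flt a b N).
Hypothesis pz : predictable_map Flt a b z.
Hypothesis iz : forall w, dV_integrable V a b (z^~ w).
Hypothesis mX : martingale mu Flt a b (fun t w => m t w * N t w - pint V a (z^~ w) t).
Hypothesis c0 : 0 < c.
Hypothesis hN : bracket_le mu Flt V a b c N.
Notation TT := (measurableTypeR R).
Notation EE := (EI (dV V) mu (Ioc R a b)).
Notation L1 := (ini (dV V) mu (Ioc R a b)).
Let hF := us_flt us.
Let ab := us_le us.
Let mI : measurable (Ioc R a b). Proof. exact: measurable_itv. Qed.
Let mD : measurable ((Ioc R a b) `*` setT : set (TT * W)).
Proof. exact: measurableX. Qed.

Let pzp : prog Flt a b z. Proof. exact: (predictable_map_prog hF ab pz). Qed.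

(** Large values are replaced by 0 rather than clipped, so that [zt * z = zt ^+ 2]. *)
Let zt n r w : R := if `|z r w| <= n.+1%:R then z r w else 0.
Let cut n (x : R) : R := if `|x| <= n.+1%:R then x else 0.

Let cut_measurable n : measurable_fun setT (cut n).
Proof.
have h : measurable_fun setT (fun x : R => \1_(`[- n.+1%:R, n.+1%:R]%classic : set R) x * x).
  by apply: measurable_funM => //; exact: measurable_indic.
apply: eq_measurable_fun h => x _; rewrite /cut indicE mem_setE in_itv/= -ler_norml.
by case: ifP => _; rewrite ?mul1r ?mul0r.
Qed.

Let cut_bound n x : `|cut n x| <= n.+1%:R.
Proof. by rewrite /cut; case: ifPn => // _; rewrite normr0. Qed.

Let jz : measurable_fun ((Ioc R a b) `*` setT) (fun x : TT * W => z x.1 x.2).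
Proof. exact: (prog_joint hF pzp (lexx a) (lexx b)). Qed.

Let jzt n : measurable_fun ((Ioc R a b) `*` setT) (fun x : TT * W => zt n x.1 x.2).
Proof. exact: (measurableT_comp (cut_measurable n) jz). Qed.

Let zt_ini n : L1 (fun r w => zt n r w ^+ 2).
Proof. by apply: (bounded_sqr V us (jzt n) (B := n.+1%:R)) => r w _; exact: (cut_bound n (z r w)). Qed.

Let weighted n eps : 0 < eps ->
  2 * EE (fun r w => kwrho a V z eps r w * zt n r w ^+ 2) <= EE (fun r w => zt n r w ^+ 2) + c * kwgap mu a b m.
Proof.
move=> e0; pose H r w := 2^-1 * (1 - n.+1%:R^-1 * zt n r w).
have n0 : 0 < n.+1%:R :> R by rewrite ltr0n.
have aH : approximable mu Flt a b V (kwwt a V z eps) H.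
  have wt0 r w : 0 <= kwwt a V z eps r w by rewrite addr_ge0.
  apply: (approximable_predictable_map us wt0 (kwwt_ini us natom pzp iz e0)).
    apply: measurable_funM => //; apply: measurable_funB => //; apply: measurable_funM => //.
    exact: (measurableT_comp (cut_measurable n) pz).
  move=> r w; have := cut_bound n (z r w); rewrite -/(zt n r w) -(ler_pM2l (x := n.+1%:R^-1)) ?invr_gt0//.
  rewrite mulVf ?lt0r_neq0// -[n.+1%:R^-1](gtr0_norm (x := n.+1%:R^-1)) ?invr_gt0// -normrM ler_norml.
  by rewrite /H -[zt n r w]/(cut n (z r w)); set q := n.+1%:R^-1 * _ => /andP[h1 h2]; apply/andP; split; lra.
have B0 : 0 <= c^-1 * n.+1%:R by rewrite mulr_ge0// ?invr_ge0 ltW.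
have := kw_approx us natom nm nN pzp iz mX hN e0 B0 (ltW c0) aH.
have HE r w : c^-1 * n.+1%:R * (2 * H r w - 1) = - (c^-1 * zt n r w).
  rewrite /H mulrA divff ?pnatr_eq0// mul1r [1 - _]addrC addrK mulrN; congr (- _).
  by rewrite -mulrA mulrA -mulrA mulVKf ?lt0r_neq0.
have zz r w : zt n r w * z r w = zt n r w ^+ 2.
  by rewrite /zt; case: ifP => _; rewrite ?mul0r ?expr0n// expr2.
have -> : EE (fun r w => (c^-1 * n.+1%:R * (2 * H r w - 1)) ^+ 2) = c ^- 2 * EE (fun r w => zt n r w ^+ 2).
  rewrite -(EIZ mI _ (zt_ini n)); apply: eq_EI => r w _.
  by rewrite HE sqrrN exprMn exprVn.
have i1 : L1 (fun r w => kwrho a V z eps r w * zt n r w ^+ 2).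
  apply: (le_ini mI _ _ (zt_ini n)).
    apply: measurable_funM; last exact: measurable_funX.
    exact: (prog_joint hF (kwrho_prog us natom pzp iz eps) (lexx a) (lexx b)).
  move=> r w _; rewrite normrM [`|_ ^+ 2|]ger0_norm ?sqr_ge0// ler_piMl ?sqr_ge0//.
  by rewrite ger0_norm ?kwrho_le1// ltW// kwrho_ge0.
have -> : EE (fun r w => c^-1 * n.+1%:R * (2 * H r w - 1) * (kwrho a V z eps r w * z r w)) =
    - c^-1 * EE (fun r w => kwrho a V z eps r w * zt n r w ^+ 2).
  rewrite -(EIZ mI _ i1); apply: eq_EI => r w _.
  by rewrite HE -zz; ring.
by move=> h; exact: (weight_arith c0 h).
Qed.

Lemma kwrho_cvg1 r w : a < r <= b -> kwrho a V z k.+1%:R^-1 r w @[k --> \oo] --> (1 : R).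
Proof.
move=> /andP[ar rb]; pose D := \int[dV V]_(q in `]a, r]) `|z q w|.
have iD := path_integrableS (iz w) (lexx a) rb.
have E k : pint V a (kwk z k.+1%:R^-1 ^~ w) r = - (k.+1%:R^-1 * D).
  rewrite -mulNr -RintegralZl; [|exact: measurable_itv|exact: (integrable_abse iD)].
  by apply: eq_Rintegral => q _; rewrite /kwk mulNr.
have c1 : k.+1%:R^-1 * D @[k --> \oo] --> (0 : R).
  by rewrite -[X in _ --> X](mul0r D); apply: cvgM; [exact: cvg_harmonic|exact: cvg_cst].
have c2 : - (k.+1%:R^-1 * D) @[k --> \oo] --> (0 : R).
  by rewrite -[X in _ --> X]oppr0; exact: cvgN.
have c3 : expR (- (k.+1%:R^-1 * D)) @[k --> \oo] --> expR (0 : R).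
  by apply: continuous_cvg c2; exact: continuous_expR.
rewrite expR0 in c3; apply: cvg_trans c3; apply: near_eq_cvg; apply: nearW => k.
by rewrite /kwrho E.
Qed.

(** As eps tends to 0 the weight tends to 1, and [weighted] becomes 2 E int zt^2 <= E int zt^2 + c
    [kwgap]; the truncation makes the common term finite, so it cancels. *)
Let truncated n : EE (fun r w => zt n r w ^+ 2) <= c * kwgap mu a b m.
Proof.
have cE : EE (fun r w => kwrho a V z k.+1%:R^-1 r w * zt n r w ^+ 2) @[k --> \oo] --> EE (fun r w => zt n r w ^+ 2).
  have [||||||_] := @Rintegral_dct _ _ _ (dV V \x mu)%E ((Ioc R a b) `*` setT)
    (fun k x => kwrho a V z k.+1%:R^-1 x.1 x.2 * zt n x.1 x.2 ^+ 2) (fun x => zt n x.1 x.2 ^+ 2)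
    (fun x => zt n x.1 x.2 ^+ 2).
  - exact: mD.
  - move=> k; apply: measurable_funM; last exact: measurable_funX.
    exact: (prog_joint hF (kwrho_prog us natom pzp iz _) (lexx a) (lexx b)).
  - exact: measurable_funX.
  - apply: aeW => -[r w] [/= + _]; rewrite in_itv/= => rab.
    rewrite -[X in _ --> X]mul1r; apply: cvgM; [exact: kwrho_cvg1|exact: cvg_cst].
  - exact: zt_ini.
  - apply: aeW => -[r w] k _; rewrite normrM [`|_ ^+ 2|]ger0_norm ?sqr_ge0// ler_piMl ?sqr_ge0//.
    by rewrite ger0_norm ?kwrho_le1 ?invr_gt0// ltW// kwrho_ge0.
  - exact.
have c2 : 2 * EE (fun r w => kwrho a V z k.+1%:R^-1 r w * zt n r w ^+ 2) @[k --> \oo] --> 2 * EE (fun r w => zt n r w ^+ 2).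
  by apply: cvgM; [exact: cvg_cst|exact: cE].
have : 2 * EE (fun r w => zt n r w ^+ 2) <= EE (fun r w => zt n r w ^+ 2) + c * kwgap mu a b m.
  rewrite -(cvg_lim _ c2)//; apply: limr_le; first by apply/cvg_ex; eexists; exact: c2.
  by apply: nearW => k; apply: weighted; rewrite invr_gt0.
by rewrite mulrDl mul1r lerD2l.
Qed.

(** A Kunita-Watanabe inequality in integrated form. The order of the limits matters: eps vanishes
    while the truncation supplies a dominant, and Fatou then lifts the truncation. *)
Lemma kw_estimate :
  (\int[mu]_w \int[dV V]_(r in `]a, b]) (z r w ^+ 2)%:E <= (c * kwgap mu a b m)%:E)%E.
Proof.
have mz : measurable_fun ((Ioc R a b) `*` setT) (fun x : TT * W => (z x.1 x.2 ^+ 2)%:E).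
  by apply/measurable_EFinP; exact: measurable_funX.
rewrite -(@prod_tonelli _ _ _ _ _ (dV V) mu _ mI (fun r w => (z r w ^+ 2)%:E))//; last first.
  by move=> r w _; rewrite lee_fin sqr_ge0.
have cz (x : TT * W) : (zt n x.1 x.2 ^+ 2)%:E @[n --> \oo] --> (z x.1 x.2 ^+ 2)%:E.
  apply: cvg_near_cst; exists (Num.truncn `|z x.1 x.2|) => // n /= nn.
  rewrite /zt ifT//; apply: ltW; apply: lt_le_trans (truncnS_gt _) _.
  by rewrite ler_nat ltnS.
under eq_integral => x _ do rewrite -(cvg_limn_einf_sup (cz x)).1.
have mzt n : measurable_fun ((Ioc R a b) `*` setT) (fun x : TT * W => (zt n x.1 x.2 ^+ 2)%:E).
  by apply/measurable_EFinP; exact: measurable_funX.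
have z0 n (x : TT * W) : ((Ioc R a b) `*` setT) x -> (0 <= (zt n x.1 x.2 ^+ 2)%:E)%E.
  by move=> _; rewrite lee_fin sqr_ge0.
apply: le_trans (fatou (dV V \x mu)%E mD mzt z0) _.
apply: limn_einf_le_cst => n.
have fi := integrable_fin_num mD (zt_ini n).
by rewrite -(fineK fi) lee_fin; exact: truncated.
Qed.

End kw_estimate.

(** * Indistinguishability, square-integrable processes, bounded brackets *)

Section cadlag_zero.
Context d (W : measurableType d) (R : realType) (mu : probability W R).

Lemma rcont_zero (a b : R) (x : R -> R) : a <= b ->
  (forall r, a <= r < b -> x q @[q --> r^'+] --> x r) ->
  (forall n k, x (tau a b n k) = 0) -> forall t, a <= t <= b -> x t = 0.
Proof.
move=> ab cx x0 t /andP[at_ ]; rewrite le_eqVlt => /predU1P[->|tb].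
  by rewrite -(tau_last 0%N ab) x0.
have tab : a <= t <= b by rewrite at_ ltW.
have c1 : x (next a b n t) @[n --> \oo] --> x t.
  apply: (@rcont_seq _ x); [by apply: cx; rewrite at_|by move=> n; exact: ltW (next_gt n at_ tb)|exact: cvg_next].
apply/eqP; rewrite eq_sym; apply/eqP; apply: (cvg_unique _ _ c1) => //.
by apply: cvg_near_cst; apply: nearW => n; exact: x0.
Qed.

Lemma indistinguishable (a b : R) (x y : R -> W -> R) : a <= b ->
  {ae mu, forall w r, a <= r < b -> x q w @[q --> r^'+] --> x r w} ->
  {ae mu, forall w r, a <= r < b -> y q w @[q --> r^'+] --> y r w} ->
  (forall t, a <= t <= b -> {ae mu, forall w, x t w = y t w}) ->
  {ae mu, forall w t, a <= t <= b -> x t w = y t w}.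
Proof.
move=> ab cx cy xy; have h : {ae mu, forall w n k, x (tau a b n k) w = y (tau a b n k) w}.
  by apply/ae_foralln => n; apply/ae_foralln => k; apply: xy; exact: tau_bounds.
move: cx cy h; apply: filterS3 => w cx cy h t tab.
apply/eqP; rewrite -subr_eq0; apply/eqP.
apply: (@rcont_zero a b (fun t => x t w - y t w)) => // [r rab|n k].
  by apply: cvgB; [exact: cx|exact: cy].
by rewrite h subrr.
Qed.

End cadlag_zero.

Lemma cs_arith (R : realType) (L S Q : R) : 0 < L ->
  0 <= L ^+ 2 * Q - 2 * L * S * S + S ^+ 2 * L -> S ^+ 2 <= L * Q.
Proof.
move=> L0; rewrite (_ : _ + _ = L * (L * Q - S ^+ 2)); last by ring.
by rewrite pmulr_rge0// subr_ge0.
Qed.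

Lemma cs_zero (R : realType) (S L Q : R) : S = 0 -> L = 0 -> S ^+ 2 <= L * Q.
Proof. by move=> -> ->; rewrite expr0n mul0r. Qed.

Lemma weighted_sub (R : realType) (y u v k : R) : 0 <= y -> u - v <= k -> y * u - y * v <= k * y.
Proof. by move=> y0 h; rewrite -mulrBr [leRHS]mulrC ler_wpM2l. Qed.

Lemma bracket_arith (R : realType) (aq ap u x y : R) : aq - ap <= u -> y - ap = x - aq ->
  x - 2 * y + y <= u.
Proof. lra. Qed.

Section l2_processes.
Context d (W : measurableType d) (R : realType) (mu : probability W R).
Variables (a b : R) (V : cumulative R R).
Notation TT := (measurableTypeR R).
Notation I := (Ioc R a b).
Notation EE := (EI (dV V) mu I).
Notation L1 := (ini (dV V) mu I).
Notation jm f := (measurable_fun (I `*` setT) (fun x : TT * W => f x.1 x.2)).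
Implicit Types f g : R -> W -> R.

Let mI : measurable I. Proof. exact: measurable_itv. Qed.

Definition l2 f : Prop := jm f /\ L1 (fun r w => f r w ^+ 2).

Lemma l2_mul f g : l2 f -> l2 g -> L1 (fun r w => f r w * g r w).
Proof.
move=> [mf sf] [mg sg]; apply: (le_ini mI _ _ (iniD mI sf sg)); first exact: measurable_funM.
move=> r w _; rewrite normrM -(real_normK (num_real (f r w))) -(real_normK (num_real (g r w))).
have := sqr_ge0 (`|f r w| - `|g r w|); rewrite sqrrB.
have := sqr_ge0 (`|f r w| + `|g r w|); rewrite sqrrD; lra.
Qed.

Lemma le_l2 f g : jm f -> (forall r w, a < r <= b -> `|f r w| <= `|g r w|) -> l2 g -> l2 f.
Proof.
move=> mf fg [mg sg]; split => //; apply: (le_ini mI _ _ sg); first exact: measurable_funX.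
move=> r w; rewrite /= in_itv/= => rab; rewrite normrX -(real_normK (num_real (g r w))).
by rewrite lerXn2r ?nnegrE// fg.
Qed.

Lemma l2D f g : l2 f -> l2 g -> l2 (fun r w => f r w + g r w).
Proof.
move=> lf lg; have h := iniD mI (iniD mI lf.2 lg.2) (iniZ mI 2 (l2_mul lf lg)).
split; first exact: measurable_funD lf.1 lg.1.
by apply: (eq_ini mI _ h) => r w _; rewrite sqrrD; ring.
Qed.

Lemma l2Z k f : l2 f -> l2 (fun r w => k * f r w).
Proof.
move=> [mf sf]; split; first exact: measurable_funM.
by apply: (eq_ini mI _ (iniZ mI (k ^+ 2) sf)) => r w _; rewrite exprMn.
Qed.

Lemma l2_norm f : l2 f -> l2 (fun r w => `|f r w|).
Proof.
move=> lf; apply: (le_l2 _ _ lf); first by apply: measurableT_comp => //; case: lf.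
by move=> r w _; rewrite normr_id.
Qed.

Lemma l2_0 : l2 (fun _ _ => 0).
Proof.
split; first exact: measurable_cst.
apply: (iniP mI); first exact: measurable_cst.
rewrite integral0_eq ?ltry// => w _; rewrite integral0_eq// => r _.
by rewrite expr0n normr0.
Qed.

Lemma l2_sum n (F : 'I_n -> R -> W -> R) : (forall i, l2 (F i)) ->
  l2 (fun r w => \sum_(i < n) F i r w).
Proof.
elim: n F => [|n IH] F hF.
  by under [X in l2 X]eq_fun do (under eq_fun do rewrite big_ord0); exact: l2_0.
under [X in l2 X]eq_fun do (under eq_fun do rewrite big_ord_recr/=).
by apply: l2D => //; exact: IH.
Qed.

Lemma EI_sum n (F : 'I_n -> R -> W -> R) : (forall i, L1 (F i)) ->
  L1 (fun r w => \sum_(i < n) F i r w) /\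
  EE (fun r w => \sum_(i < n) F i r w) = \sum_(i < n) EE (F i).
Proof.
elim: n F => [|n IH] F hF.
  have z : L1 (fun _ _ => 0) by apply: (eq_ini mI _ l2_0.2) => r w _; rewrite expr0n.
  split; first by apply: (eq_ini mI _ z) => r w _; rewrite big_ord0.
  rewrite big_ord0 (@eq_EI _ _ _ _ _ (dV V) mu I _ (fun _ _ => 0)).
    by rewrite /EI Rintegral_cst ?mul0r//; exact: measurableX.
  by move=> r w _; rewrite big_ord0.
have [i1 e1] := IH (fun i => F (widen_ord (leqnSn n) i)) (fun i => hF _).
have E r w : \sum_(i < n.+1) F i r w = \sum_(i < n) F (widen_ord (leqnSn n) i) r w + F ord_max r w.
  exact: big_ord_recr.
split; first by apply: (eq_ini mI _ (iniD mI i1 (hF ord_max))) => r w _; rewrite E.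
rewrite big_ord_recr/= -e1 -(EID mI i1 (hF ord_max)).
by apply: eq_EI => r w _; rewrite E.
Qed.

Lemma l2_iter f : jm f -> (\int[mu]_w \int[dV V]_(r in `]a, b]) (f r w ^+ 2)%:E < +oo)%E -> l2 f.
Proof.
move=> mf fin; split => //; apply: (iniP mI); first exact: measurable_funX.
by under eq_integral do under eq_integral do rewrite ger0_norm ?sqr_ge0//.
Qed.

Lemma iter_EI f : l2 f ->
  (\int[mu]_w \int[dV V]_(r in `]a, b]) (f r w ^+ 2)%:E = (EE (fun r w => f r w ^+ 2))%:E)%E.
Proof.
move=> [mf sf]; have mD : measurable (I `*` setT : set (TT * W)) by exact: measurableX.
rewrite -(@prod_tonelli _ _ _ _ _ (dV V) mu _ mI (fun r w => (f r w ^+ 2)%:E)).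
- by rewrite fineK//; exact: (integrable_fin_num mD sf).
- by apply/measurable_EFinP; exact: measurable_funX.
- by move=> r w _; rewrite lee_fin sqr_ge0.
Qed.

(** Cauchy-Schwarz on almost every path, from the nonnegative integral of ((V b - V a) f - S)^2
    where S is the integral of [f]. *)
Lemma l2_inner f : a <= b -> l2 f -> sqi mu (fun w => \int[dV V]_(r in `]a, b]) f r w).
Proof.
move=> ab [mf sf]; have mS : measurable_fun setT (fun w => \int[dV V]_(r in `]a, b]) f r w).
  exact: (measurable_inner_Rintegral _ mI mf).
have i2 := ini_inner mI sf.
have i3 : mu.-integrable setT (EFin \o (fun w => (V b - V a) * \int[dV V]_(r in `]a, b]) (f r w ^+ 2))).
  by have := integrableZl measurableT (V b - V a) i2; exact: eq_integrable.
split=> //; apply: (@le_lt_trans _ _ (\int[mu]_w ((V b - V a) * \int[dV V]_(r in `]a, b]) (f r w ^+ 2))%:E)%E); last first.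
  by rewrite -(fineK (integrable_fin_num measurableT i3)) ltry.
have L0 : 0 <= V b - V a by rewrite subr_ge0 cumulative_is_nondecreasing.
apply: ae_ge0_le_integral => //.
- by move=> w _; rewrite lee_fin sqr_ge0.
- by apply/measurable_EFinP; exact: measurable_funX.
- move=> w _; rewrite lee_fin mulr_ge0//; apply: Rintegral_ge0 => r _; exact: sqr_ge0.
- by apply/measurable_EFinP; apply: measurable_funM => //; exact/measurable_EFinP/(measurable_int _ i2).
apply: filterS (ini_path mI sf) => w jf2 _; rewrite lee_fin.
pose S := \int[dV V]_(r in `]a, b]) f r w; pose Q := \int[dV V]_(r in `]a, b]) (f r w ^+ 2).
rewrite -/S -/Q.
have mfw : measurable_fun I (f^~ w) by exact: (measurable_pathI mI w mf).
have jf : (dV V).-integrable I (EFin \o f^~ w).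
  have j1 := dV_cst_integrable V a b 1.
  apply: (le_integrable mI _ _ (integrableD mI j1 jf2)); first exact/measurable_EFinP.
  move=> r _; rewrite -EFinD lee_fin /= [leRHS]ger0_norm ?addr_ge0 ?sqr_ge0//.
  by rewrite -(real_normK (num_real (f r w))); have := sqr_ge0 (`|f r w| - 1); rewrite sqrrB; nra.
(* If [V] does not charge the interval, S is an integral over a null set; otherwise the length can
   be cancelled. *)
have [L|L] := eqVneq (V b - V a) 0.
  have S0 : S = 0.
    have z := dV_itv V ab; rewrite L in z.
    rewrite /S /Rintegral (_ : (\int[_]_(r in _) _)%E = 0%E)//.
    exact: (null_set_integral mI (measurable_int _ jf) z).
  exact: cs_zero S0 L.
have L1 : 0 < V b - V a by rewrite lt_def L L0.
have jS := dV_cst_integrable V a b (S ^+ 2).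
have j1 : (dV V).-integrable I (EFin \o (fun r => (V b - V a) ^+ 2 * f r w ^+ 2)).
  by have := integrableZl mI ((V b - V a) ^+ 2) jf2; exact: eq_integrable.
have j2 : (dV V).-integrable I (EFin \o (fun r => 2 * (V b - V a) * S * f r w)).
  by have := integrableZl mI (2 * (V b - V a) * S) jf; exact: eq_integrable.
have j12 : (dV V).-integrable I (EFin \o (fun r => (V b - V a) ^+ 2 * f r w ^+ 2 - 2 * (V b - V a) * S * f r w)).
  by have := integrableB mI j1 j2; exact: eq_integrable.
have : 0 <= \int[dV V]_(r in `]a, b]) (((V b - V a) * f r w - S) ^+ 2).
  by apply: Rintegral_ge0 => r _; exact: sqr_ge0.
rewrite (@eq_Rintegral _ _ _ (dV V) `]a, b]%classic (fun r => ((V b - V a) ^+ 2 * f r w ^+ 2 - 2 * (V b - V a) * S * f r w) + S ^+ 2)); last first.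
  by move=> r _; ring.
rewrite (RintegralD mI j12 jS) (RintegralB mI j1 j2).
rewrite RintegralZl; [|exact: mI|exact: jf2].
rewrite RintegralZl; [|exact: mI|exact: jf].
have -> : \int[dV V]_(x in `]a, b]) cst (S ^+ 2) x = S ^+ 2 * (V b - V a).
  by rewrite (Rintegral_cst _ mI); congr (_ * _); rewrite -[LHS]/(fine (dV V `]a, b]%classic)) dV_itv.
move=> h; exact: (cs_arith L1 h).
Qed.

End l2_processes.

Section bracket_bound.
Context d (W : measurableType d) (R : realType) (mu : probability W R).
Variables (Flt : R -> set (set W)) (a b : R) (V : cumulative R R).
Hypothesis us : usual mu Flt a b.
Variables (N G : R -> W -> R) (c : R).
Hypothesis nN : nice mu Flt a b N.
Hypothesis iG : forall w, dV_integrable V a b (G^~ w).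
Hypothesis bG : forall r w, a < r <= b -> `|G r w| <= c.
Hypothesis mG : martingale mu Flt a b (fun t w => N t w * N t w - pint V a (G^~ w) t).
Let hF := us_flt us.

(** The square of [N] minus the integral of [G] is a martingale, so against the known weight
    [h ^+ 2] the squared increment has the mean of the integral of [G], which is at most c (V q - V
    p). *)
Lemma bracket_bound : bracket_le mu Flt V a b c N.
Proof.
move=> p q h B ap pq qb wh hB; have aq := le_trans ap pq; have pb := le_trans pq qb.
have pab : a <= p <= b by rewrite ap. have qab : a <= q <= b by rewrite aq.
have mh : measurable_fun setT h := wrt_measurable hF pab wh.
pose Y w := h w ^+ 2.
have YB w : `|Y w| <= B ^+ 2.
  by rewrite /Y normrX lerXn2r ?nnegrE ?hB//; exact: le_trans (hB w).
have mY : measurable_fun setT Y by exact: measurable_funX.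
have wY : measurable_wrt (Flt p) Y.
  apply/(flt_wrtP hF pab); apply: measurable_funX.
  exact/(flt_wrtP hF pab).
have bnd (f : W -> R) : mu.-integrable setT (EFin \o f) -> mu.-integrable setT (fun w => (Y w * f w)%:E).
  move=> i_f; apply: (le_integrable measurableT _ _ (integrableZl measurableT (B ^+ 2) i_f)).
    apply/measurable_EFinP; apply: measurable_funM => //.
    exact/measurable_EFinP/(measurable_int _ i_f).
  by move=> w _; rewrite -EFinM lee_fin [leLHS]normrM [leRHS]normrM (ger0_norm (sqr_ge0 B)) ler_wpM2r.
have sp := nice_sqi us nN pab; have sq := nice_sqi us nN qab.
have mN : martingale mu Flt a b N by case: nN.
have wYf : measurable_wrt (Flt p) (fun w => Y w * N p w).
  apply/(flt_wrtP hF pab); apply: measurable_funM;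
    apply/(flt_wrtP hF pab); [exact: wY|exact: mN.1].
have iq := bnd _ (sqiM_integrable sq sq). have ip_ := bnd _ (sqiM_integrable sp sp).
have ic := bnd _ (sqiM_integrable sp sq).
have ic' : mu.-integrable setT (fun w => (Y w * N p w * N q w)%:E).
  by apply: eq_integrable ic => [|w _]; [exact: measurableT|rewrite mulrA].
have c1 := martingale_pull hF mN ap pq qb wYf ic'.
have c2 := martingale_pull hF mG ap pq qb wY (bnd _ (martingale_int mG qab)).
pose A t w := pint V a (G^~ w) t.
have iA t : a <= t <= b -> mu.-integrable setT (EFin \o A t).
  move=> tab; have := integrableB measurableT (sqiM_integrable (nice_sqi us nN tab) (nice_sqi us nN tab)) (martingale_int mG tab).
  by apply: eq_integrable => [|w _]; [exact: measurableT|rewrite -EFinB /=; congr (_%:E); rewrite opprB addrC subrK].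
have e t : a <= t <= b -> \int[mu]_w (Y w * (N t w * N t w - A t w)) =
    \int[mu]_w (Y w * (N t w * N t w)) - \int[mu]_w (Y w * A t w).
  move=> tab; have s := nice_sqi us nN tab.
  rewrite -(RintegralB measurableT (bnd _ (sqiM_integrable s s)) (bnd _ (iA t tab))).
  by apply: eq_Rintegral => w _; rewrite mulrBr.
have {}c2 := etrans (esym (e p pab)) (etrans c2 (e q qab)).
have -> : \int[mu]_w (h w * (N q w - N p w)) ^+ 2 =
    \int[mu]_w (Y w * (N q w * N q w)) - 2 * \int[mu]_w (Y w * N p w * N q w) + \int[mu]_w (Y w * (N p w * N p w)).
  have i2 := integrableZl measurableT 2 ic'.
  have i3 : mu.-integrable setT (EFin \o (fun w => Y w * (N q w * N q w) - 2 * (Y w * N p w * N q w))).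
    by have := integrableB measurableT iq i2; exact: eq_integrable.
  rewrite -RintegralZl; [|exact: measurableT|exact: ic'].
  rewrite -(RintegralB measurableT iq i2) -(RintegralD measurableT i3 ip_).
  by apply: eq_Rintegral => w _; rewrite /Y; ring.
rewrite -c1.
have -> : \int[mu]_w (Y w * N p w * N p w) = \int[mu]_w (Y w * (N p w * N p w)).
  by apply: eq_Rintegral => w _; rewrite mulrA.
have le : \int[mu]_w (Y w * A q w) - \int[mu]_w (Y w * A p w) <= c * (V q - V p) * \int[mu]_w h w ^+ 2.
  rewrite -(RintegralB measurableT (bnd _ (iA q qab)) (bnd _ (iA p pab))).
  have iY : mu.-integrable setT (EFin \o Y).
    have := bnd _ (finite_measure_integrable_cst mu (1 : R) measurableT).
    by apply: eq_integrable => [|w _]; [exact: measurableT|rewrite /= mulr1].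
  rewrite -RintegralZl; [|exact: measurableT|exact: iY].
  have i5 : mu.-integrable setT (EFin \o (fun w => Y w * A q w - Y w * A p w)).
    have := integrableB measurableT (bnd _ (iA q qab)) (bnd _ (iA p pab)).
    by apply: eq_integrable => [|w _]; [exact: measurableT|rewrite -EFinB].
  have i6 : mu.-integrable setT (EFin \o (fun w => c * (V q - V p) * h w ^+ 2)).
    by have := integrableZl measurableT (c * (V q - V p)) iY; exact: eq_integrable.
  apply: le_Rintegral; [exact: measurableT|exact: i5|exact: i6|].
  move=> w _; apply: (weighted_sub (sqr_ge0 (h w))).
  rewrite -(pint_sub (iG w) ap pq qb).
  have mI : measurable (Ioc R p q) by exact: measurable_itv.
  have j := path_integrableS (iG w) ap qb.
  apply: (@le_trans _ _ (\int[dV V]_(r in `]p, q]) c)).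
    apply: le_Rintegral; [exact: mI|exact: j|exact: dV_cst_integrable|].
    move=> r; rewrite /= in_itv/= => /andP[pr rq]; apply: le_trans (ler_norm _) _.
    by apply: bG; rewrite (le_lt_trans ap pr) (le_trans rq).
  by rewrite (Rintegral_cst _ mI) -[X in _ * fine X]/(dV V `]p, q]%classic) dV_itv.
move: le c2; set x1 := \int[mu]_w _; set x2 := \int[mu]_w _; set x3 := \int[mu]_w _; set x4 := \int[mu]_w _.
exact: bracket_arith.
Qed.

End bracket_bound.

Lemma shift_arith (R : realType) (x p q : R) : x - (p + q) + p = x - q.
Proof. ring. Qed.

Lemma sqr_arith (R : realType) (x S : R) (e : R) : e = x * x - S -> x * x = S + S -> x * x = 2 * e.
Proof. by move=> -> h; rewrite h; ring. Qed.

Lemma small_arith0 (R : realType) (x y c kap : R) : 0 < x -> y <= x -> 0 < c -> 0 <= kap ->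
  (x * c)^-1 * (c * kap * y) <= kap.
Proof.
move=> x0 yx c0 kap0.
have -> : (x * c)^-1 * (c * kap * y) = kap * (y / x) by field; rewrite !lt0r_neq0.
by rewrite ler_piMr// ler_pdivrMr// mul1r.
Qed.

Lemma small_arith (R : realType) (k : nat) (c kap : R) : 0 < c -> 0 <= kap ->
  (k.+1%:R * c)^-1 * ((c * kap) *+ k) <= kap.
Proof.
move=> c0 kap0; rewrite -[(c * kap) *+ k]mulr_natr; by apply: small_arith0 => //; rewrite ler_nat.
Qed.

(** Young's inequality for each component with a free parameter [e]. A large [e] leaves a small
    multiple of the squares of [z], to be absorbed by the martingale part. *)
Lemma driver_bound (R : realType) (k : nat) (K e y phi : R) (z : 'I_k -> R) : 0 <= K -> 0 < e ->
  `|phi| <= K * (`|y| + \sum_(i < k) `|z i|) ->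
  2 * (y * phi) <= (2 * K + K ^+ 2 * e * k%:R) * y ^+ 2 + e^-1 * \sum_(i < k) z i ^+ 2.
Proof.
move=> K0 e0 h; apply: (@le_trans _ _ (2 * (`|y| * (K * (`|y| + \sum_(i < k) `|z i|))))).
  rewrite ler_pM2l//; apply: le_trans (ler_norm _) _; by rewrite normrM ler_wpM2l.
have -> : 2 * (`|y| * (K * (`|y| + \sum_(i < k) `|z i|))) =
    2 * K * y ^+ 2 + \sum_(i < k) (2 * K * `|y| * `|z i|).
  by rewrite -mulr_sumr -[y ^+ 2](real_normK (num_real y)); ring.
rewrite [in leRHS]mulrDl -[leRHS]addrA lerD2l.
rewrite (_ : K ^+ 2 * e * k%:R * y ^+ 2 = \sum_(i < k) (K ^+ 2 * e * y ^+ 2)); last first.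
  by rewrite sumr_const card_ord -mulr_natr; ring.
rewrite mulr_sumr -big_split/=; apply: ler_sum => i _.
rewrite -[y ^+ 2](real_normK (num_real y)) -[z i ^+ 2](real_normK (num_real (z i))).
set x := `|y|; set u := `|z i|; rewrite -subr_ge0.
rewrite (_ : _ - _ = e^-1 * (K * e * x - u) ^+ 2); last by field; exact: lt0r_neq0.
by rewrite mulr_ge0 ?sqr_ge0// invr_ge0 ltW.
Qed.

(** * Difference of two solutions: energy identity and Gronwall *)

Section bsde_zero.
Context d (W : measurableType d) (R : realType) (mu : probability W R).
Variables (Flt : R -> set (set W)) (a b : R) (V : cumulative R R).
Hypothesis us : usual mu Flt a b.
Hypothesis natom : no_atom V a b.
Variables (k : nat) (m : R -> W -> R) (N z : 'I_k -> R -> W -> R) (c : R).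
Hypotheses (nm : nice mu Flt a b m) (nN : forall i, nice mu Flt a b (N i)).
Hypothesis pz : forall i, predictable_map Flt a b (z i).
Hypothesis iz : forall i w, dV_integrable V a b ((z i)^~ w).
Hypothesis mX : forall i, martingale mu Flt a b (fun t w => m t w * N i t w - pint V a ((z i)^~ w) t).
Hypothesis c0 : 0 < c.
Hypothesis hN : forall i, bracket_le mu Flt V a b c (N i).
Notation TT := (measurableTypeR R).
Let hF := us_flt us.
Let ab := us_le us.

Let mI (s t : R) : measurable (Ioc R s t). Proof. exact: measurable_itv. Qed.

Lemma martingale_ext (s t : R) (M M' : R -> W -> R) : filtration_on Flt s t ->
  (forall u w, s <= u <= t -> M u w = M' u w) -> martingale mu Flt s t M -> martingale mu Flt s t M'.
Proof.
move=> hFs e mM; apply: (modification_martingale hFs mM).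
  move=> u ust; rewrite (_ : M' u = M u); first exact: mM.1.
  by apply/funext => w; rewrite e.
by move=> u ust; apply: aeW => w; exact: e.
Qed.

Lemma martingale_rv (s t : R) (Y : W -> R) : filtration_on Flt s t -> measurable_wrt (Flt s) Y ->
  mu.-integrable setT (EFin \o Y) -> martingale mu Flt s t (fun _ => Y).
Proof.
move=> hFs wY iY; apply: martingaleI => //.
by move=> u /andP[su ut]; exact: (measurable_wrt_mono hFs (lexx s) su ut).
Qed.

(** By orthogonality of increments, the mean of (m b - m t)^2. *)
Let kappa t := ip mu (m b) (m b) - ip mu (m t) (m t).

(** [kw_estimate] on [[t, b]] with everything restarted at [t]. The integral of [z i] up to [t] is
    known at that time, so adding it preserves the martingale. *)
Lemma z_estimate i t : a <= t <= b ->
  l2 mu t b V (z i) /\ EI (dV V) mu (Ioc R t b) (fun r w => z i r w ^+ 2) <= c * kappa t.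
Proof.
move=> /[dup] tab /andP[at_ tb].
pose z' r w := if t < r then z i r w else 0.
have ust := usualS at_ tb us; have hFt := us_flt ust.
have pz' := predictable_restrict us at_ tb (pz i).
have ez r : t < r <= b -> z' r = z i r by move=> /andP[tr _]; rewrite /z' tr.
have iz' w : dV_integrable V t b (z'^~ w).
  apply: eq_integrable (path_integrableS (iz i w) at_ (lexx b)) => [|r]; first exact: mI.
  by rewrite inE /= in_itv/= => rtb; rewrite ez.
have natt u : t < u <= b -> dV V [set u] = 0%E.
  by move=> /andP[tu ub]; apply: natom; rewrite ub (le_lt_trans at_).
have iAt : mu.-integrable setT (EFin \o (fun w => pint V a ((z i)^~ w) t)).
  have := integrableB measurableT (sqiM_integrable (nice_sqi us nm tab) (nice_sqi us (nN i) tab)) (martingale_int (mX i) tab).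
  by apply: eq_integrable => [|w _]; [exact: measurableT|rewrite -EFinB /=; congr (_%:E); rewrite opprB addrC subrK].
have wAt : measurable_wrt (Flt t) (fun w => pint V a ((z i)^~ w) t).
  exact: (prog_pint hF V (predictable_map_prog hF ab (pz i)) tab).
have mX' : martingale mu Flt t b (fun u w => m u w * N i u w - pint V t (z'^~ w) u).
  apply: (martingale_ext hFt _ (martingaleD hFt (martingaleS at_ (mX i)) (martingale_rv hFt wAt iAt))).
  move=> u w /andP[tu ub].
  rewrite (pint_split (iz i w) at_ tu ub) /pint.
  rewrite [X in _ = _ - X](@eq_Rintegral _ _ _ (dV V) `]t, u]%classic ((z i)^~ w)); last first.
    by move=> r; rewrite inE /= in_itv/= => /andP[tr ru]; rewrite ez// tr (le_trans ru).
  exact: shift_arith.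
have hN' : bracket_le mu Flt V t b c (N i).
  by move=> p q h B tp; apply: hN; exact: le_trans tp.
have K := kw_estimate ust natt (niceS at_ nm) (niceS at_ (nN i)) pz' iz' mX' c0 hN'.
have E : (\int[mu]_w \int[dV V]_(r in `]t, b]) (z' r w ^+ 2)%:E =
    \int[mu]_w \int[dV V]_(r in `]t, b]) (z i r w ^+ 2)%:E)%E.
  apply: eq_integral => w _; apply: eq_integral => r; rewrite inE /= in_itv/= => rtb.
  by rewrite ez.
rewrite E in K.
have jz : measurable_fun ((Ioc R t b) `*` setT) (fun x : TT * W => z i x.1 x.2).
  exact: (prog_joint hF (predictable_map_prog hF ab (pz i)) at_ (lexx b)).
have lz : l2 mu t b V (z i) by apply: (l2_iter jz); apply: le_lt_trans K _; exact: ltry.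
by split => //; move: K; rewrite (iter_EI lz) lee_fin.
Qed.

Variables (y phi : R -> W -> R) (K : R).
Hypothesis ay : adapted Flt a b y.
Hypothesis py : prog Flt a b y.
Hypothesis pphi : prog Flt a b phi.
Hypothesis iphi : forall w, dV_integrable V a b (phi^~ w).
Hypothesis yE : forall t w, a <= t <= b ->
  y t w = \int[dV V]_(r in `]t, b]) phi r w - (m b w - m t w).
Hypothesis K0 : 0 <= K.
Hypothesis hphi : forall r w, a < r <= b -> `|phi r w| <= K * (`|y r w| + \sum_(i < k) `|z i r w|).
Hypothesis y2 : (\int[mu]_w \int[dV V]_(r in `]a, b]) (y r w ^+ 2)%:E < +oo)%E.

Notation EEt t := (EI (dV V) mu (Ioc R t b)).

Let jprog (H : R -> W -> R) t : prog Flt a b H -> a <= t -> measurable_fun ((Ioc R t b) `*` setT) (fun x : TT * W => H x.1 x.2).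
Proof. by move=> pH at_; exact: (prog_joint hF pH at_ (lexx b)). Qed.

Let l2S (H : R -> W -> R) t : prog Flt a b H -> a <= t -> l2 mu a b V H -> l2 mu t b V H.
Proof. by move=> pH at_ [_ h]; split; [exact: jprog|exact: (iniS at_ (lexx b) h)]. Qed.

Let y_l2 t : a <= t -> l2 mu t b V y.
Proof. by move=> at_; apply: (l2S py at_); apply: l2_iter y2; exact: jprog. Qed.

Let phi_l2 t : a <= t <= b -> l2 mu t b V phi.
Proof.
move=> tab; have /andP[at_ tb] := tab; apply: (le_l2 (jprog pphi at_) _
  (l2Z K (l2D (l2_norm (y_l2 at_)) (l2_sum (fun i => l2_norm (z_estimate i tab).1))))).
move=> r w /andP[tr rb]; rewrite [leRHS]ger0_norm.
  by apply: hphi; rewrite (le_lt_trans at_ tr).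
by rewrite mulr_ge0// addr_ge0// sumr_ge0.
Qed.

Let m_l2 t : a <= t <= b -> l2 mu t b V m /\ l2 mu t b V (fun _ w => m b w).
Proof.
move=> /andP[at_ tb]; have bb : a <= b <= b by rewrite ab lexx.
have sm : sqi mu (m b) by case: nm.
split; last first.
  split; last exact: (EI_cst V tb (sqi_sqr sm)).1.
  by apply: measurable_funTS; apply: measurableT_comp => //; case: sm.
have [_ _ _ [G iG hG]] := nm; split; first exact: (jprog (nice_prog us nm) at_).
apply: (le_ini (mI t b) _ _ (EI_cst V tb iG).1).
  by apply: measurable_funX; exact: (jprog (nice_prog us nm) at_).
move=> r w; rewrite /= in_itv/= => /andP[tr rb]; rewrite ger0_norm ?sqr_ge0//.
by apply: hG; rewrite rb (le_trans at_ (ltW tr)).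
Qed.

Let Phi t w := \int[dV V]_(r in `]t, b]) phi r w.

(** Integration by parts of the remaining integral of [phi] with itself. *)
Let Phi_sqr t w : a <= t <= b -> Phi t w * Phi t w = 2 * \int[dV V]_(r in `]t, b]) (Phi r w * phi r w).
Proof.
move=> /andP[at_ tb]; have ip_ := path_integrableS (iphi w) at_ (lexx b).
have natt u : t < u <= b -> dV V [set u] = 0%E.
  by move=> /andP[tu ub]; apply: natom; rewrite ub (le_lt_trans at_).
have PE r : t <= r <= b -> Phi r w = Phi t w - pint V t (phi^~ w) r.
  by move=> /andP[tr rb]; rewrite /Phi (pint_sub ip_ tr rb (lexx b)).
have i1 := pint_mul_integrable ip_ ip_.
have i2 : dV_integrable V t b (fun r => Phi t w * phi r w).
  by have := integrableZl (mI t b) (Phi t w) ip_; exact: eq_integrable.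
have e1 : \int[dV V]_(r in `]t, b]) (Phi r w * phi r w) = Phi t w * Phi t w -
    \int[dV V]_(r in `]t, b]) (pint V t (phi^~ w) r * phi r w).
  rewrite {3}/Phi -RintegralZl; [|exact: mI|exact: ip_].
  rewrite -(RintegralB (mI t b) i2 i1); apply: eq_Rintegral => r.
  by rewrite inE /= in_itv/= => /andP[tr rb]; rewrite PE ?(ltW tr)// mulrBl.
have e2 := pint_prod_end natt ip_ ip_.
rewrite (RintegralD (mI t b) i1 i1) in e2.
by move: e1 e2; rewrite -/(Phi t w); exact: sqr_arith.
Qed.

(** Takes the place of the Ito formula for [y ^+ 2]. The variable Phi_t = y_t + (m_b - m_t) has
    square 2 int Phi phi by [Phi_sqr]. In the mean y_t is orthogonal to m_b - m_t, and so is phi_r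
    to m_b - m_r, whence Phi may be replaced by [y] under the integral. *)
Let energy t : a <= t <= b ->
  ip mu (y t) (y t) + kappa t = 2 * EEt t (fun r w => y r w * phi r w).
Proof.
move=> tab; have /andP[at_ tb] := tab; have bb : a <= b <= b by rewrite ab lexx.
have mm : martingale mu Flt a b m by case: nm.
have sm : sqi mu (m b) by case: nm.
have sPhi : sqi mu (Phi t) := l2_inner tb (phi_l2 tab).
have smt := nice_sqi us nm tab.
have sdm := sqiB sm smt.
have sy : sqi mu (y t).
  rewrite (_ : y t = (fun w => Phi t w - (m b w - m t w))); first exact: sqiB.
  by apply/funext => w; exact: yE.
have PE r w : a <= r <= b -> Phi r w = y r w + (m b w - m r w).
  by move=> rab; rewrite yE// subrK.
have lphi := phi_l2 tab; have [lm lmb] := m_l2 tab.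
have i1 := l2_mul (y_l2 at_) lphi.
have i2 := l2_mul lphi lmb. have i3 := l2_mul lphi lm.
have i23 := iniB (mI t b) i2 i3.
have fm : EEt t (fun r w => phi r w * m r w) = EEt t (fun r w => phi r w * m b w).
  rewrite (EIE (mI t b) i3) (EIE (mI t b) i2).
  apply: (fubini_martingale hF mm at_ (lexx b) (jprog (nice_prog us nm) at_) (jprog pphi at_)).
    move=> r /andP[tr rb]; apply: (prog_slice_wrt hF pphi).
    by rewrite rb (le_lt_trans at_ tr).
  exact: (ini_fin (mI t b) i2).
have iP : ini (dV V) mu (Ioc R t b) (fun r w => Phi r w * phi r w).
  apply: (eq_ini (mI t b) _ (iniD (mI t b) i1 i23)) => r w; rewrite /= in_itv/= => /andP[tr rb].
  rewrite PE ?rb ?(le_trans at_ (ltW tr))//; ring.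
have e1 : EEt t (fun r w => Phi r w * phi r w) = EEt t (fun r w => y r w * phi r w).
  transitivity (EEt t (fun r w => y r w * phi r w + (phi r w * m b w - phi r w * m r w))).
    apply: eq_EI => r w; rewrite /= in_itv/= => /andP[tr rb].
    rewrite PE ?rb ?(le_trans at_ (ltW tr))//; ring.
  by rewrite (EID (mI t b) i1 i23) (EIB (mI t b) i2 i3) fm subrr addr0.
have e2 : ip mu (Phi t) (Phi t) = 2 * EEt t (fun r w => y r w * phi r w).
  rewrite -e1 (EIE (mI t b) iP) /ip -RintegralZl; [|exact: measurableT|exact: (ini_inner (mI t b) iP)].
  by apply: eq_Rintegral => w _; exact: Phi_sqr.
rewrite -e2 (_ : Phi t = (fun w => y t w + (m b w - m t w))); last first.
  by apply/funext => w; exact: PE.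
rewrite (ip_addsq sy sdm) (martingale_incr_sqr hF mm sm at_ tb (lexx b)).
have cross : ip mu (y t) (fun w => m b w - m t w) = 0.
  rewrite ipC (ipBl sm smt sy) (martingale_ip hF mm sm at_ tb (lexx b) (ay tab) sy).
  by rewrite subrr.
by rewrite cross mulr0 addr0.
Qed.

(** The factor in [driver_bound] for the parameter [e = k.+1 * c]. *)
Let C : R := 2 * K + K ^+ 2 * (k.+1%:R * c) * k%:R.

Let C0 : 0 <= C.
Proof.
apply: addr_ge0; first exact: mulr_ge0.
apply: mulr_ge0 => //; apply: mulr_ge0; first exact: sqr_ge0.
by apply: mulr_ge0 => //; exact: ltW.
Qed.

Let kappa_ge0 t : a <= t <= b -> 0 <= kappa t.
Proof.
move=> /andP[at_ tb]; have mm : martingale mu Flt a b m by case: nm.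
have sm : sqi mu (m b) by case: nm.
by rewrite /kappa -(martingale_incr_sqr hF mm sm at_ tb (lexx b)) ip_ge0.
Qed.

Let ineq t : a <= t <= b -> ip mu (y t) (y t) <= C * EEt t (fun r w => y r w ^+ 2).
Proof.
move=> tab; have /andP[at_ tb] := tab; have e := energy tab.
have ly := y_l2 at_.
(* The [k] integrals of squares are each at most c * kappa, so this factor makes their sum at most
   kappa, which cancels against the energy. Taking [k.+1] keeps it meaningful for [k = 0]. *)
pose dl : R := (k.+1%:R * c)^-1.
have kc0 : 0 < k.+1%:R * c by rewrite mulr_gt0.
have dl0 : 0 < dl by rewrite invr_gt0.
have iS : ini (dV V) mu (Ioc R t b) (fun r w => \sum_(i < k) z i r w ^+ 2) /\
    EEt t (fun r w => \sum_(i < k) z i r w ^+ 2) = \sum_(i < k) EEt t (fun r w => z i r w ^+ 2).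
  exact: (EI_sum (fun i => (z_estimate i tab).1.2)).
have i1 := l2_mul ly (phi_l2 tab).
have i2 := iniZ (mI t b) 2 i1.
have j1 := iniZ (mI t b) C ly.2. have j2 := iniZ (mI t b) dl iS.1.
have le : 2 * EEt t (fun r w => y r w * phi r w) <=
    C * EEt t (fun r w => y r w ^+ 2) + dl * EEt t (fun r w => \sum_(i < k) z i r w ^+ 2).
  rewrite -(EIZ (mI t b) 2 i1) -(EIZ (mI t b) C ly.2) -(EIZ (mI t b) dl iS.1) -(EID (mI t b) j1 j2).
  apply: (le_EI (mI t b) i2 (iniD (mI t b) j1 j2)) => r w; rewrite /= in_itv/= => /andP[tr rb].
  have rab : a < r <= b by rewrite rb (le_lt_trans at_ tr).
  exact: (driver_bound K0 kc0 (hphi w rab)).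
have le2 : dl * EEt t (fun r w => \sum_(i < k) z i r w ^+ 2) <= kappa t.
  rewrite iS.2; apply: (@le_trans _ _ (dl * \sum_(i < k) (c * kappa t))).
    by rewrite ler_wpM2l ?(ltW dl0)//; apply: ler_sum => i _; exact: (z_estimate i tab).2.
  rewrite sumr_const card_ord; exact: (small_arith k c0 (kappa_ge0 tab)).
rewrite -(lerD2r (kappa t)) e; apply: le_trans le _; by rewrite lerD2l.
Qed.

(** Gronwall applied to the second moment of [y] makes it vanish; the energy identity then gives
    [kappa t = 0], hence no martingale increment after [t]. *)
Lemma bsde_zero t : a <= t <= b ->
  {ae mu, forall w, y t w = 0} /\ {ae mu, forall w, m b w = m t w}.
Proof.
have aa : a <= a <= b by rewrite lexx ab.
have ly := y_l2 (lexx a).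
have hI r : ip mu (y r) (y r) = \int[mu]_w (y r w ^+ 2).
  by apply: eq_Rintegral => w _; rewrite expr2.
have ih : dV_integrable V a b (fun r => ip mu (y r) (y r)).
  have my := ini_measurable ly.2.
  have h := fubini_time_integrable (mI a b) my (ini_fin (mI a b) ly.2).
  have mh : measurable_fun (Ioc R a b) (fun r => ip mu (y r) (y r)).
    apply: (eq_measurable_fun (fun r => fine (\int[mu]_w (y r w ^+ 2)%:E)%E)).
    by move=> r _; rewrite hI.
    by apply: measurableT_comp => //; exact: (measurable_int _ h).
  apply: (le_integrable (mI a b) _ _ h); first exact/measurable_EFinP.
  move=> r _; rewrite /= hI /Rintegral.
  by case: (\int[mu]_w _)%E => [x||] /=; rewrite ?normr0 ?leey ?lexx.
have h0 : forall u, a <= u <= b -> ip mu (y u) (y u) = 0.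
  apply: (backward_gronwall natom C0 ih) => u uab; have /andP[au ub] := uab.
  rewrite ip_ge0; apply: le_trans (ineq uab) _; rewrite (EI_swap (mI u b) (y_l2 au).2).
  rewrite (@eq_Rintegral _ _ _ (dV V) `]u, b]%classic (fun r => ip mu (y r) (y r))); first exact: lexx.
  by move=> r _; rewrite hI.
have syt u : a <= u <= b -> sqi mu (y u).
  move=> uab; have /andP[au ub] := uab.
  rewrite (_ : y u = (fun w => Phi u w - (m b w - m u w))); last by apply/funext => w; exact: yE.
  apply: sqiB; first exact: (l2_inner ub (phi_l2 uab)).
  by apply: sqiB; [case: nm|exact: (nice_sqi us nm uab)].
have y0 u (uab : a <= u <= b) : {ae mu, forall w, y u w = 0} := ip0_ae (syt u uab) (h0 u uab).
move=> tab; split; first exact: y0.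
have /andP[at_ tb] := tab.
have mm : martingale mu Flt a b m by case: nm.
have sm : sqi mu (m b) by case: nm.
have k0 : kappa t = 0.
  have := energy tab; rewrite h0// add0r => ->.
  have i1 := l2_mul (y_l2 at_) (phi_l2 tab).
  rewrite (EI_swap (mI t b) i1) (@eq_Rintegral _ _ _ (dV V) `]t, b]%classic (fun=> 0)).
    by rewrite Rintegral_cst ?mul0r ?mulr0//; exact: mI.
  move=> r; rewrite inE /= in_itv/= => /andP[tr rb].
  have rab : a <= r <= b by rewrite rb (le_trans at_ (ltW tr)).
  rewrite (@ae_eq_Rintegral _ _ _ mu setT _ (fun=> 0)).
  - by rewrite Rintegral_cst ?mul0r//; exact: measurableT.
  - exact: measurableT.
  - have rtb : `]t, b]%classic r by rewrite /= in_itv/= tr.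
    exact: (measurable_sliceI (mI t b) rtb (ini_measurable i1)).
  - exact: measurable_cst.
  - by apply: filterS (y0 r rab) => w -> _; rewrite mul0r.
have := ip0_ae (sqiB sm (nice_sqi us nm tab)).
rewrite (martingale_incr_sqr hF mm sm at_ tb (lexx b)) -/(kappa t) => /(_ k0).
by apply: filterS => w /eqP; rewrite subr_eq0 => /eqP.
Qed.

End bsde_zero.

(** * Identification of the bracket by integration by parts *)

Section path_linear.
Context {R : realType} (V : cumulative R R) (a b : R).
Implicit Types k l : R -> R.
Notation pI k := (dV_integrable V a b k).

Let mI (t : R) : measurable (Ioc R a t). Proof. exact: measurable_itv. Qed.

Lemma path_intD k l : pI k -> pI l -> pI (fun r => k r + l r).
Proof. by move=> ik il; have := integrableD (mI b) ik il; exact: eq_integrable. Qed.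

Lemma path_intB k l : pI k -> pI l -> pI (fun r => k r - l r).
Proof. by move=> ik il; have := integrableB (mI b) ik il; exact: eq_integrable. Qed.

Lemma path_intZ c k : pI k -> pI (fun r => c * k r).
Proof. by move=> ik; have := integrableZl (mI b) c ik; exact: eq_integrable. Qed.

Lemma path_int_bounded k l (c : R) : measurable_fun (Ioc R a b) l ->
  (forall r, a < r <= b -> `|l r| <= c) -> pI k -> pI (fun r => l r * k r).
Proof.
move=> ml bl ik; have i1 := path_intZ c ik; apply: (le_integrable (mI b) _ _ i1).
  have mk : measurable_fun (Ioc R a b) k.
    by apply/measurable_EFinP; exact: (measurable_int _ ik).
  by apply/measurable_EFinP; exact: (measurable_funM ml mk).
move=> r; rewrite /= in_itv/= => rab; rewrite lee_fin !normrM ler_wpM2r//.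
exact: le_trans (bl r rab) (ler_norm c).
Qed.

Lemma pintD k l t : t <= b -> pI k -> pI l ->
  pint V a (fun r => k r + l r) t = pint V a k t + pint V a l t.
Proof.
move=> tb ik il; rewrite /pint RintegralD; [by []|exact: mI|exact: (path_integrableS ik (lexx a) tb)|].
exact: (path_integrableS il (lexx a) tb).
Qed.

Lemma pintB k l t : t <= b -> pI k -> pI l ->
  pint V a (fun r => k r - l r) t = pint V a k t - pint V a l t.
Proof.
move=> tb ik il; rewrite /pint RintegralB; [by []|exact: mI|exact: (path_integrableS ik (lexx a) tb)|].
exact: (path_integrableS il (lexx a) tb).
Qed.

Lemma pintZ c k t : t <= b -> pI k -> pint V a (fun r => c * k r) t = c * pint V a k t.
Proof.
by move=> tb ik; rewrite /pint RintegralZl; [|exact: mI|exact: (path_integrableS ik (lexx a) tb)].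
Qed.

Lemma eq_pint k l t : (forall r, a < r <= t -> k r = l r) -> pint V a k t = pint V a l t.
Proof. by move=> e; apply: eq_Rintegral => r; rewrite inE /= in_itv/=; exact: e. Qed.

End path_linear.

Section ae_paths.
Context d (W : measurableType d) (R : realType) (mu : probability W R).
Variables (a b : R) (V : cumulative R R).
Notation TT := (measurableTypeR R).
Notation I := (Ioc R a b).
Notation jm f := (measurable_fun (I `*` setT) (fun x : TT * W => f x.1 x.2)).

Let mI : measurable I. Proof. exact: measurable_itv. Qed.

(** Tonelli for |f - g| exchanges the quantifiers: equality almost surely at each time gives, on
    almost every path, equality at almost every time. *)
Lemma ae_time_eq (f g : R -> W -> R) : jm f -> jm g ->
  (forall r, a < r <= b -> {ae mu, forall w, f r w = g r w}) ->
  {ae mu, forall w, {ae dV V, forall r, I r -> f r w = g r w}}.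
Proof.
move=> mf mg fg.
have md : measurable_fun (I `*` setT) (fun x : TT * W => `|f x.1 x.2 - g x.1 x.2|%:E).
  by apply/measurable_EFinP; apply: measurableT_comp => //; exact: measurable_funB.
have z : (\int[mu]_w `|\int[dV V]_(r in `]a, b]) `|f r w - g r w|%:E| = 0)%E.
  under eq_integral do rewrite gee0_abs ?integral_ge0//.
  rewrite (@tonelli_iter _ _ _ _ _ (dV V) mu _ mI (fun r w => `|f r w - g r w|%:E) md)//.
  apply: integral0_eq => r; rewrite /= in_itv/= => rab.
  transitivity (\int[mu]_w (0 : \bar R))%E; last exact: integral0.
  apply: ae_eq_integral => //.
    have rI : I r by rewrite /= in_itv/=.
    exact: (measurable_sliceI (f := fun r w => `|f r w - g r w|%:E) mI rI md).
  by apply: filterS (fg r rab) => w -> _; rewrite subrr normr0.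
have mi : measurable_fun setT (fun w => \int[dV V]_(r in `]a, b]) `|f r w - g r w|%:E)%E.
  by apply: (@measurable_inner _ _ _ _ _ (dV V) _ mI (fun r w => `|f r w - g r w|%:E) md).
have := (ae_eq_integral_abs mu measurableT mi).1 z; apply: filterS => w /(_ Logic.I) zw.
have zw' : (\int[dV V]_(r in `]a, b]) `|(f r w - g r w)%:E| = 0)%E by [].
have mw : measurable_fun I (fun r => (f r w - g r w)%:E).
  apply/measurable_EFinP; apply: measurable_funB; [exact: (measurable_pathI mI w mf)|exact: (measurable_pathI mI w mg)].
have := (ae_eq_integral_abs (dV V) mI mw).1 zw'; apply: filterS => r h rI.
by have [/eqP] := h rI; rewrite subr_eq0 => /eqP.
Qed.

Lemma ae_pint_eq (f g : R -> W -> R) : jm f -> jm g ->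
  (forall r, a < r <= b -> {ae mu, forall w, f r w = g r w}) ->
  {ae mu, forall w t, t <= b -> pint V a (f^~ w) t = pint V a (g^~ w) t}.
Proof.
move=> mf mg fg; apply: filterS (ae_time_eq mf mg fg) => w h t tb.
have mt : measurable (Ioc R a t) by exact: measurable_itv.
have sub : `]a, t]%classic `<=` I by move=> r /=; rewrite !in_itv/= => /andP[-> rt]; exact: le_trans tb.
apply: ae_eq_Rintegral => //.
- exact: measurable_funS mI sub (measurable_pathI mI w mf).
- exact: measurable_funS mI sub (measurable_pathI mI w mg).
- by apply: filterS h => r hr rt; apply: hr; exact: sub.
Qed.

End ae_paths.

Section martingale_identities.
Context d (W : measurableType d) (R : realType) (mu : probability W R).
Variables (Flt : R -> set (set W)) (a b : R) (V : cumulative R R).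
Hypothesis us : usual mu Flt a b.
Hypothesis natom : no_atom V a b.
Notation TT := (measurableTypeR R).
Let hF := us_flt us.
Let ab := us_le us.
Implicit Types M k : R -> W -> R.

Let mI (s t : R) : measurable (Ioc R s t). Proof. exact: measurable_itv. Qed.

Lemma l2_sub f s t : a <= s -> t <= b -> prog Flt a b f -> l2 mu a b V f -> l2 mu s t V f.
Proof.
move=> as_ tb pf [_ h]; split; first exact: (prog_joint hF pf as_ tb).
exact: (iniS as_ tb h).
Qed.

Lemma nice_l2 M : nice mu Flt a b M -> l2 mu a b V M.
Proof.
move=> nM; have [_ _ _ [G iG hG]] := nM.
have jM := prog_joint hF (nice_prog us nM) (lexx a) (lexx b); split => //.
apply: (le_ini (mI a b) _ _ (EI_cst V ab iG).1); first exact: measurable_funX.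
move=> r w; rewrite /= in_itv/= => /andP[ar rb]; rewrite ger0_norm ?sqr_ge0//.
by apply: hG; rewrite rb ltW.
Qed.

Lemma rv_l2 s t (Y : W -> R) : s <= t -> sqi mu Y -> l2 mu s t V (fun _ => Y).
Proof.
move=> st sY; split; last exact: (EI_cst V st (sqi_sqr sY)).1.
by apply: measurable_funTS; apply: measurableT_comp => //; case: sY.
Qed.

Lemma nice_path_bounded M w : nice mu Flt a b M -> measurable_fun (Ioc R a b) (M^~ w) /\
  exists c, forall r, a <= r <= b -> `|M r w| <= c.
Proof.
move=> nM; have [_ _ _ [G iG hG]] := nM; split.
  exact: (measurable_pathI (mI a b) w (prog_joint hF (nice_prog us nM) (lexx a) (lexx b))).
exists (1 + G w) => r rab; apply: (@le_trans _ _ (1 + `|M r w| ^+ 2)).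
  by have := sqr_ge0 (`|M r w| - 1); rewrite sqrrB; nra.
by rewrite lerD2l real_normK ?num_real// hG.
Qed.

Lemma nice_mul_int M k w : nice mu Flt a b M -> dV_integrable V a b (k^~ w) ->
  dV_integrable V a b (fun r => M r w * k r w).
Proof.
move=> nM; have [mM [c hc]] := nice_path_bounded w nM.
by apply: (path_int_bounded (c := c) mM) => r /andP[ar rb]; apply: hc; rewrite rb ltW.
Qed.

(** With K the integral of [k], the increment over []p, t]] is (M_t - M_p) K_p plus the integral of
    (M_t - M_r) k_r. On a set of [Flt p] the first term has mean zero by the martingale property,
    the second by [fubini_martingale]. *)
Lemma martingale_pint M k : nice mu Flt a b M -> prog Flt a b k -> l2 mu a b V k ->
  (forall w, dV_integrable V a b (k^~ w)) ->
  martingale mu Flt a b (fun t w => M t w * pint V a (k^~ w) t - pint V a (fun r => M r w * k r w) t).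
Proof.
move=> nM pk lk ik; have mM : martingale mu Flt a b M by case: nM.
have sM : sqi mu (M b) by case: nM.
have pM := nice_prog us nM; have lM := nice_l2 nM.
have pMk : prog Flt a b (fun r w => M r w * k r w).
  by move=> t tab; apply: measurable_funM; [exact: pM|exact: pk].
have iMk w := nice_mul_int nM (ik w).
have sal t : a <= t <= b -> sqi mu (fun w => pint V a (k^~ w) t).
  by move=> /andP[at_ tb]; exact: (l2_inner at_ (l2_sub (lexx a) tb pk lk)).
have wal t (tab : a <= t <= b) := prog_pint hF V pk tab.
have iMk2 := l2_mul lM lk.
have ib t : a <= t <= b -> mu.-integrable setT (EFin \o (fun w => pint V a (fun r => M r w * k r w) t)).
  by move=> /andP[at_ tb]; exact: (ini_inner (mI a t) (iniS (lexx a) tb iMk2)).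
have ia t (tab : a <= t <= b) := sqiM_integrable (nice_sqi us nM tab) (sal t tab).
have i_ t : a <= t <= b -> mu.-integrable setT
    (EFin \o (fun w => M t w * pint V a (k^~ w) t - pint V a (fun r => M r w * k r w) t)).
  move=> tab; have := integrableB measurableT (ia t tab) (ib t tab).
  by apply: eq_integrable => [|w _]; [exact: measurableT|rewrite -EFinB].
apply: martingaleI.
- move=> t tab; apply/(flt_wrtP hF tab); apply: measurable_funB.
    apply: measurable_funM; apply/(flt_wrtP hF tab); [exact: mM.1|exact: wal].
  apply/(flt_wrtP hF tab); exact: (prog_pint hF V pMk tab).
- exact: i_.
move=> p t B ap pt tb FB; have pab : a <= p <= b by rewrite ap (le_trans pt).
have tab : a <= t <= b by rewrite tb (le_trans ap).
have mB := flt_measurable hF pab FB.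
have wB : measurable_wrt (Flt p) (\1_B : W -> R).
  apply/(flt_wrtP hF pab); apply: measurable_indic.
  exact: sub_sigma_algebra.
pose Y w := \1_B w * pint V a (k^~ w) p.
have wY : measurable_wrt (Flt p) Y.
  apply/(flt_wrtP hF pab); apply: measurable_funM; apply/(flt_wrtP hF pab).
    exact: wB.
  exact: wal.
have sY : sqi mu Y by apply: sqi_indic => //; exact: sal.
have e1 := martingale_ip hF mM sM ap pt tb wY sY.
pose k1 r w := \1_B w * k r w.
have jk1 : measurable_fun ((Ioc R p t) `*` setT) (fun x : TT * W => k1 x.1 x.2).
  apply: measurable_funM; last exact: (prog_joint hF pk ap tb).
  by apply: measurable_funTS; apply: measurableT_comp => //; exact: measurable_indic.
have lk1 : l2 mu p t V k1.
  apply: (le_l2 jk1 _ (l2_sub ap tb pk lk)) => r w _.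
  by rewrite normrM indicE; case: (_ \in _); rewrite ?normr1 ?normr0 ?mul1r ?mul0r.
have i2 := l2_mul lk1 (rv_l2 pt (nice_sqi us nM tab)).
have i3 := l2_mul lk1 (l2_sub ap tb pM lM).
have ak1 r : p < r <= t -> measurable_wrt (Flt r) (k1 r).
  move=> /andP[pr rt]; have rab : a <= r <= b by rewrite (le_trans ap (ltW pr)) (le_trans rt).
  apply/(flt_wrtP hF rab); apply: measurable_funM; apply/(flt_wrtP hF rab).
    by apply: (measurable_wrt_mono hF ap (ltW pr) _ wB); case/andP: rab.
  by apply: (prog_slice_wrt hF pk); rewrite (le_lt_trans ap pr) (le_trans rt).
have e2 := fubini_martingale hF mM ap tb (prog_joint hF pM ap tb) jk1 ak1 (ini_fin (mI p t) i2).
have j2 := ini_inner (mI p t) i2; have j3 := ini_inner (mI p t) i3.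
rewrite !(Rintegral_indic mu B).
have f1 (u : R) (ua : a <= u <= b) : mu.-integrable setT (EFin \o (fun w => \1_B w * (M u w * pint V a (k^~ w) u - pint V a (fun r => M r w * k r w) u))).
  exact: (integrable_indicM mB (i_ u ua)).
apply/eqP; rewrite eq_sym -subr_eq0 -(RintegralB measurableT (f1 t tab) (f1 p pab)); apply/eqP.
have g1 := sqiM_integrable (nice_sqi us nM tab) sY; have g2 := sqiM_integrable (nice_sqi us nM pab) sY.
have g12 : mu.-integrable setT (EFin \o (fun w => M t w * Y w - M p w * Y w)).
  have := integrableB measurableT g1 g2.
  by apply: eq_integrable => [|w _]; [exact: measurableT|rewrite -EFinB].
have j23 : mu.-integrable setT (EFin \o (fun w => \int[dV V]_(r in `]p, t]) (k1 r w * M t w) -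
    \int[dV V]_(r in `]p, t]) (k1 r w * M r w))).
  have := integrableB measurableT j2 j3.
  by apply: eq_integrable => [|w _]; [exact: measurableT|rewrite -EFinB].
transitivity (\int[mu]_w ((M t w * Y w - M p w * Y w) +
    (\int[dV V]_(r in `]p, t]) (k1 r w * M t w) - \int[dV V]_(r in `]p, t]) (k1 r w * M r w)))).
  apply: eq_Rintegral => w _; rewrite /Y /k1.
  have ikpt := path_integrableS (ik w) ap tb; have iMpt := path_integrableS (iMk w) ap tb.
  rewrite (pint_split (ik w) ap pt tb) (pint_split (iMk w) ap pt tb).
  have -> : \int[dV V]_(r in `]p, t]) (\1_B w * k r w * M t w) =
    \1_B w * M t w * \int[dV V]_(r in `]p, t]) k r w.
    rewrite -RintegralZl; [|exact: mI|exact: ikpt].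
    by apply: eq_Rintegral => r _; ring.
  have -> : \int[dV V]_(r in `]p, t]) (\1_B w * k r w * M r w) =
    \1_B w * \int[dV V]_(r in `]p, t]) (M r w * k r w).
    rewrite -RintegralZl; [|exact: mI|exact: iMpt].
    by apply: eq_Rintegral => r _; ring.
  by rewrite /pint; set x1 := \int[_]_(r in _) _; set x2 := \int[_]_(r in _) _;
    set x3 := \int[_]_(r in _) _; set x4 := \int[_]_(r in _) _; ring.
rewrite (RintegralD measurableT g12 j23) (RintegralB measurableT g1 g2) (RintegralB measurableT j2 j3).
move: e1; rewrite /ip => ->; rewrite subrr add0r.
by apply/eqP; rewrite subr_eq0 -e2.
Qed.

End martingale_identities.

Lemma bracket_ring (R : realType) (M N u0 p0 D B v x1 x2 y1 y2 : R) : D * B = x2 + y2 ->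
  (M + u0 - D) * (N + p0 + B) - (v + (x1 + u0 * B - x2) - (y1 + p0 * D + y2)) - p0 * M - u0 * N - u0 * p0
  - (M * B - x1) + (N * D - y1) = M * N - v.
Proof. by move=> h; rewrite mulrDr [(_ - D) * B]mulrBl h; ring. Qed.

Lemma g_arith (R : realType) (v M u0 D al N p0 B F : R) :
  v + (M + u0 - D) * al - (N + p0 + B) * F =
  v + (M * al + u0 * al - D * al) - (N * F + p0 * F + B * F).
Proof. ring. Qed.

Section bracket_identity.
Context d (W : measurableType d) (R : realType) (mu : probability W R).
Variables (Flt : R -> set (set W)) (a b : R) (V : cumulative R R).
Hypothesis us : usual mu Flt a b.
Hypothesis natom : no_atom V a b.
Notation TT := (measurableTypeR R).
Notation jm f := (measurable_fun ((Ioc R a b) `*` setT) (fun x : TT * W => f x.1 x.2)).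
Notation pI f := (forall w, dV_integrable V a b (f^~ w)).
Let hF := us_flt us.
Let ab := us_le us.
Variables (M N F al v U Psi : R -> W -> R) (u0 p0 : R).
Hypotheses (nM : nice mu Flt a b M) (nN : nice mu Flt a b N).
Hypotheses (pF : prog Flt a b F) (pal : prog Flt a b al) (pv : prog Flt a b v).
Hypotheses (lF : l2 mu a b V F) (lal : l2 mu a b V al).
Hypotheses (iF : pI F) (ial : pI al) (iv : pI v).
Hypotheses (jU : jm U) (jPsi : jm Psi).
Hypothesis hU : forall t, a <= t <= b -> {ae mu, forall w, U t w = M t w + u0 - pint V a (F^~ w) t}.
Hypothesis hPsi : forall t, a <= t <= b -> {ae mu, forall w, Psi t w = N t w + p0 + pint V a (al^~ w) t}.
Hypothesis mL : martingale mu Flt a b (fun t w => U t w * Psi t w -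
  pint V a (fun r => v r w + U r w * al r w - Psi r w * F r w) t).

(* Integration by parts for [U * Psi], where [U = M + u0 - int F] and [Psi = N + p0 + int al]. *)
Lemma bracket_identity : martingale mu Flt a b (fun t w => M t w * N t w - pint V a (v^~ w) t).
Proof.
pose D t w := pint V a (F^~ w) t. pose B t w := pint V a (al^~ w) t.
pose U' t w := M t w + u0 - D t w. pose P' t w := N t w + p0 + B t w.
pose f r w := v r w + U r w * al r w - Psi r w * F r w.
pose g r w := v r w + U' r w * al r w - P' r w * F r w.
have pD : prog Flt a b D.
  apply: (rcont_prog hF) => [t tab|w r rab]; first exact: (prog_pint hF V pF tab).
  exact: (pint_cadlag natom (iF w)).1.
have pB : prog Flt a b B.
  apply: (rcont_prog hF) => [t tab|w r rab]; first exact: (prog_pint hF V pal tab).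
  exact: (pint_cadlag natom (ial w)).1.
have pM := nice_prog us nM. have pN := nice_prog us nN.
have pU' : prog Flt a b U'.
  move=> t tab; apply: (measurable_funB _ (pD t tab)); apply: (measurable_funD (pM t tab)); exact: measurable_cst.
have pP' : prog Flt a b P'.
  move=> t tab; apply: (measurable_funD _ (pB t tab)); apply: (measurable_funD (pN t tab)); exact: measurable_cst.
have pg : prog Flt a b g.
  move=> t tab; apply: measurable_funB; last exact: (measurable_funM (pP' t tab) (pF tab)).
  exact: (measurable_funD (pv tab) (measurable_funM (pU' t tab) (pal tab))).
have jg := prog_joint hF pg (lexx a) (lexx b).
have jf : jm f.
  have jF := prog_joint hF pF (lexx a) (lexx b). have jal := prog_joint hF pal (lexx a) (lexx b).
  have jv := prog_joint hF pv (lexx a) (lexx b).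
  exact: (measurable_funB (measurable_funD jv (measurable_funM jU jal)) (measurable_funM jPsi jF)).
have fg : {ae mu, forall w t, t <= b -> pint V a (f^~ w) t = pint V a (g^~ w) t}.
  apply: (ae_pint_eq V jf jg) => r /andP[ar rb]; have rab : a <= r <= b by rewrite rb ltW.
  by move: (hU rab) (hPsi rab); apply: filterS2 => w e1 e2; rewrite /f /g e1 e2.
(* [U] and [Psi] are given up to modification; [U'] and [P'] have the decompositions as their very
   paths, so that the algebra below is exact for every [w]. *)
pose L' t w := U' t w * P' t w - pint V a (g^~ w) t.
have wD t (tab : a <= t <= b) : measurable_wrt (Flt t) (D t) := prog_pint hF V pF tab.
have wB t (tab : a <= t <= b) : measurable_wrt (Flt t) (B t) := prog_pint hF V pal tab.
have mM : martingale mu Flt a b M by case: nM.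
have mN : martingale mu Flt a b N by case: nN.
have mL' : martingale mu Flt a b L'.
  apply: (modification_martingale hF mL).
    move=> t tab; have sg := measurable_wrtP (flt_sigma hF tab); apply/sg.
    apply: measurable_funB; last by apply/sg; exact: (prog_pint hF V pg tab).
    apply: measurable_funM.
    apply: measurable_funB; last by apply/sg; exact: wD.
    by apply: measurable_funD; [apply/sg; exact: mM.1|exact: measurable_cst].
    apply: measurable_funD; last by apply/sg; exact: wB.
    by apply: measurable_funD; [apply/sg; exact: mN.1|exact: measurable_cst].
  move=> t tab; have /andP[_ tb] := tab; move: (hU tab) (hPsi tab) fg.
  by apply: filterS3 => w e1 e2 e3; rewrite /L' -(e3 t tb) e1 e2.
(* In the product (M + u0 - D)(N + p0 + B) the terms other than [M * N] are multiples of [M] and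
   [N], a constant, the products treated by [martingale_pint], and [D * B], which is the integral of
   its own parts. *)
have m1 := martingale_pint us nM pal lal ial.
have m2 := martingale_pint us nN pF lF iF.
have m3 := martingaleB hF mL' (martingaleZ hF p0 mM).
have m4 := martingaleB hF m3 (martingaleZ hF u0 mN).
have m5 := martingaleB hF m4 (martingale_cst mu hF (u0 * p0)).
have m6 := martingaleD hF (martingaleB hF m5 m1) m2.
apply: (martingale_ext hF _ m6) => t w /andP[at_ tb].
have i1 := nice_mul_int us nM (ial w). have i2 := nice_mul_int us nN (iF w).
have i3 : dV_integrable V a b (fun r => D r w * al r w).
  exact: (pint_mul_integrable (iF w) (ial w)).
have i4 : dV_integrable V a b (fun r => B r w * F r w).
  exact: (pint_mul_integrable (ial w) (iF w)).
have iu := path_intZ u0 (ial w). have ip_ := path_intZ p0 (iF w).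
have i5 := path_intB (path_intD i1 iu) i3.
have i6 := path_intD (path_intD i2 ip_) i4.
have e : pint V a (g^~ w) t = pint V a (v^~ w) t +
    (pint V a (fun r => M r w * al r w) t + u0 * B t w - pint V a (fun r => D r w * al r w) t) -
    (pint V a (fun r => N r w * F r w) t + p0 * D t w + pint V a (fun r => B r w * F r w) t).
  rewrite -(pintZ u0 tb (ial w)) -(pintZ p0 tb (iF w)).
  rewrite -(pintD tb i1 iu) -(pintB tb (path_intD i1 iu) i3) -(pintD tb i2 ip_) -(pintD tb (path_intD i2 ip_) i4).
  rewrite -(pintD tb (iv w) i5) -(pintB tb (path_intD (iv w) i5) i6).
  by apply: eq_pint => r _; exact: g_arith.
rewrite /L' e; apply: bracket_ring.
by rewrite /D /B (pint_prod natom tb (iF w) (ial w)) (pintD tb i3 i4).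
Qed.

End bracket_identity.

(** * Metric spaces: real functions detecting open sets, and jump times *)

Definition metrizes (R : realType) (E : topologicalType) (dist : E -> E -> R) : Prop :=
  [/\ forall x y, dist x y = 0 <-> x = y, forall x y, dist x y = dist y x,
  forall x y z, dist x z <= dist x y + dist y z &
  forall x (A : set E), nbhs x A <-> exists2 e : R, 0 < e & [set y | dist x y < e] `<=` A].

Section separating_functions.
Context {R : realType} (E : topologicalType) (dist : E -> E -> R).
Hypothesis hdist : metrizes dist.

Let dist0 x y : dist x y = 0 <-> x = y. Proof. by case: hdist. Qed.
Let distC x y : dist x y = dist y x. Proof. by case: hdist. Qed.
Let distD x y z : dist x z <= dist x y + dist y z. Proof. by case: hdist. Qed.
Let dist_nbhs x A : nbhs x A <-> exists2 e : R, 0 < e & [set y | dist x y < e] `<=` A.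
Proof. by case: hdist => _ _ _; exact. Qed.

Lemma dist_ge0 x y : 0 <= dist x y.
Proof.
have := distD x y x; rewrite (distC y x) (proj2 (dist0 x x) erefl) -mulr2n.
by rewrite pmulrn_lge0.
Qed.

(** The minimum of 1 and the distance to the complement of [U]; the element 1 keeps the set nonempty
    when [U] is the whole space. Being Lipschitz and positive exactly on [U], these functions reduce
    measurability and limits in [E] to real ones. *)
Definition sepfun (U : set E) (y : E) : R :=
  inf ([set 1] `|` [set e | exists2 z, ~ U z & e = dist y z]).

Let sup_set U y := [set 1] `|` [set e | exists2 z, ~ U z & e = dist y z].

Let sep_lb U y : lbound (sup_set U y) 0.
Proof. by move=> e [->|[z _ ->]]; [exact: ler01|exact: dist_ge0]. Qed.

Lemma sepfun_ge0 U y : 0 <= sepfun U y.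
Proof. by apply: lb_le_inf; [exists 1; left|exact: sep_lb]. Qed.

Lemma sepfun_le1 U y : sepfun U y <= 1.
Proof. by apply: ge_inf; [exists 0; exact: sep_lb|left]. Qed.

Lemma sepfun_gt0 U y : open U -> (0 < sepfun U y) <-> U y.
Proof.
move=> oU; split => [h|Uy].
  apply: contrapT => nU; move: h; apply/negP; rewrite -leNgt.
  by apply: ge_inf; [exists 0; exact: sep_lb|right; exists y => //; apply/esym/dist0].
have /dist_nbhs[e e0 he] : nbhs y U by exact: open_nbhs_nbhs.
apply: (@lt_le_trans _ _ (Num.min 1 e)); first by rewrite lt_min ltr01.
apply: lb_le_inf; first by exists 1; left.
move=> r [->|[z nUz ->]]; first by rewrite ge_min lexx.
by rewrite ge_min; apply/orP; right; rewrite leNgt; apply/negP => /he.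
Qed.

Lemma sepfun_lipschitz U y z : sepfun U y <= sepfun U z + dist y z.
Proof.
rewrite -lerBlDr; apply: lb_le_inf; first by exists 1; left.
move=> r [->|[q nUq ->]].
  by rewrite lerBlDr (le_trans (sepfun_le1 U y))// lerDl dist_ge0.
rewrite lerBlDr; apply: (@le_trans _ _ (dist y q)).
  by apply: ge_inf; [exists 0; exact: sep_lb|right; exists q].
by rewrite addrC.
Qed.

Lemma sepfun_cvg (I : Type) (F : set_system I) (FF : Filter F) (x : I -> E) l U :
  x q @[q --> F] --> l -> sepfun U (x q) @[q --> F] --> sepfun U l.
Proof.
move=> c; apply/cvgrPdist_lt => e e0.
have : nbhs l [set y | dist l y < e] by apply/dist_nbhs; exists e.
move=> /c; rewrite /nbhs/=; apply: filterS => q /= hq.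
rewrite ltr_norml ltrBlDr ltrNl opprB ltrBlDr.
have h1 := sepfun_lipschitz U l (x q); have h2 := sepfun_lipschitz U (x q) l.
rewrite distC in h2; apply/andP; split.
  by apply: le_lt_trans h2 _; rewrite [_ + sepfun U l]addrC ltrD2l.
by apply: le_lt_trans h1 _; rewrite addrC ltrD2r.
Qed.

Lemma sepfun_indic U y : open U -> Num.min 1 (n%:R * sepfun U y) @[n --> \oo] --> (\1_U y : R).
Proof.
move=> oU; rewrite indicE; have [Uy|nU] := pselect (U y); last first.
  rewrite memNset//; apply: cvg_near_cst; apply: nearW => n.
  have -> : sepfun U y = 0.
    by apply/eqP; rewrite eq_le sepfun_ge0 andbT leNgt; apply/negP => /(sepfun_gt0 _ oU).
  by rewrite mulr0; apply: min_r.
rewrite mem_set//; have s0 := proj2 (sepfun_gt0 y oU) Uy.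
apply: cvg_near_cst; exists (Num.truncn (sepfun U y)^-1).+1 => // n /= nn.
apply: min_l; rewrite -ler_pdivrMr// mul1r; apply: ltW; apply: lt_le_trans (truncnS_gt _) _.
by rewrite ler_nat.
Qed.

(** For jumps of size at least 1 / n.+1, choose a rational before [r] after which the path stays
    close to its left limit at [r]. Two such times cannot share a rational: the earlier jump would
    lie in the calm period before the later one. *)
Lemma left_jumps_countable (x : R -> E) (a b : R) (l : R -> E) :
  (forall r, a < r <= b -> x q @[q --> r^'-] --> l r) ->
  countable [set r | a < r <= b /\ l r <> x r].
Proof.
move=> cl; pose J n := [set r | a < r <= b /\ n.+1%:R^-1 <= dist (l r) (x r)].
have -> : [set r | a < r <= b /\ l r <> x r] = \bigcup_n J n.
  apply/seteqP; split => [r [rab lr]|r [n _ [rab h]]]; last first.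
    split => // /dist0 z; move: h; rewrite z; apply/negP; rewrite -ltNge invr_gt0 ltr0n//.
  have d0 : 0 < dist (l r) (x r).
    by rewrite lt_def dist_ge0 andbT; apply/eqP => /dist0.
  have [n _ hn] := near_infty_natSinv_lt (PosNum d0).
  by exists n => //; split => //; apply: ltW; exact: (hn n (leqnn n)).
apply: bigcup_countable => // n _.
(* The triangle inequality uses three errors [e], which must stay below the size of the jump. *)
pose e : R := n.+1%:R^-1 / 4.
have e0 : 0 < e by rewrite divr_gt0 ?invr_gt0.
have near_left r : a < r <= b -> {q : rat | ratr q < r & forall p, ratr q <= p < r -> dist (l r) (x p) < e}.
  move=> /cl c; apply/cid2; have : nbhs (l r) [set y | dist (l r) y < e] by apply/dist_nbhs; exists e.
  move=> /c; rewrite /nbhs/= => -[dl dl0 hd].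
  have /rat_in_itvoo[q] : r - dl < r by rewrite ltrBlDr ltrDl.
  rewrite in_itv/= => /andP[q1 q2]; exists q => // p /andP[p1 p2].
  apply: hd => //=; rewrite gtr0_norm ?subr_gt0// ltrBlDr -ltrBlDl.
  exact: lt_le_trans q1 p1.
pose q r : rat := if pselect (a < r <= b) is left h then sval (near_left r h) else 0.
have qP r : a < r <= b -> ratr (q r) < r /\ forall p, ratr (q r) <= p < r -> dist (l r) (x p) < e.
  by move=> rab; rewrite /q; case: pselect => // h; case: (near_left r h).
apply/countable_injP; exists (fun r => pickle (q r)).
suff key r r' : J n r -> J n r' -> q r = q r' -> ~ r < r'.
  move=> r r' /set_mem jr /set_mem jr' /(pcan_inj pickleK) qE; apply: contrapT => /eqP.
  by rewrite neq_lt => /orP[]; [exact: key|exact: (key r' r)].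
move=> [rab jr] [rab' jr'] qE rr'.
have [q1 q2] := qP _ rab; have [q1' q2'] := qP _ rab'; rewrite -qE in q1' q2'.
have h1 := q2' r; have h2 := q2 (ratr (q r)); have h3 := q2' (ratr (q r)).
have {}h1 : dist (l r') (x r) < e by apply: h1; rewrite (ltW q1).
have {}h2 : dist (l r) (x (ratr (q r))) < e by apply: h2; rewrite lexx.
have {}h3 : dist (l r') (x (ratr (q r))) < e by apply: h3; rewrite lexx.
have d1 := distD (l r) (x (ratr (q r))) (x r).
have d2 := distD (x (ratr (q r))) (l r') (x r).
rewrite [dist _ (l r')]distC in d2.
have e4 : e * 4 = n.+1%:R^-1 by rewrite /e mulfVK.
move: jr; rewrite /= -e4; lra.
Qed.

End separating_functions.

(** * Points and countable sets are null for [dV] away from 0 *)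

Section no_atoms.
Context {R : realType} (V : cumulative R R) (T : R).

(** The point is contained in []q, t]] of mass V t - V q, so left continuity at [t] suffices, and at
    [T] this is what continuity within the interval gives. *)
Lemma continuous_no_atom t : {within `[0, T], continuous V} -> 0 < t <= T -> dV V [set t] = 0%E.
Proof.
move=> hV /andP[t0 tT]; have T0 : 0 < T := lt_le_trans t0 tT.
have [c1 _ c3] := (continuous_within_itvP _ T0).1 hV.
have c : V q @[q --> t^'-] --> V t.
  move: tT; rewrite le_eqVlt => /predU1P[->//|tT].
  by apply: cvg_at_left_filter; apply: c1; rewrite in_itv/= t0.
apply/eqP; rewrite eq_le measure_ge0 andbT; apply/lee_addgt0Pr => e e0; rewrite add0e.
have /cvgrPdist_lt/(_ e e0) h := c.
near (t^'-) => q.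
have qt : q < t by near: q; exact: nbhs_left_lt.
have hq : `|V t - V q| < e by near: q; exact: h.
apply: (@le_trans _ _ (dV V `]q, t]%classic)).
  apply: le_measure; rewrite ?inE; [exact: measurable_set1|exact: measurable_itv|].
  by move=> _ ->; rewrite /= in_itv/= qt lexx.
have -> := dV_itv V (ltW qt); rewrite lee_fin; apply: ltW; apply: le_lt_trans hq; exact: ler_norm.
Unshelve. all: by end_near. Qed.

Lemma countable_null (J : set R) (s : R) : (no_atom V s T) ->
  J `<=` [set t | s < t <= T] -> countable J -> (dV V).-negligible J.
Proof.
move=> nat sub /countable_injP[f fi].
pose K k := J `&` f @^-1` [set k].
have -> : J = \bigcup_k K k by apply/seteqP; split => [t Jt|t [k _ []]//]; exists (f t).
apply: negligible_bigcup => k.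
have [[t [Jt ft]]|nK] := pselect (exists t, K k t); last first.
  have -> : K k = set0 by apply/seteqP; split => // t Kt; apply: nK; exists t.
  exact: negligible_set0.
exists [set t]; split; [exact: measurable_set1|exact: nat (sub _ Jt)|].
by move=> t' [Jt' ft'] /=; apply: fi; rewrite ?inE// ft ft'.
Qed.

End no_atoms.

(** * Completion of the probability and of the filtration *)

Section completed_probability.
Context d (W : measurableType d) (R : realType) (P : probability W R).
Notation CW := (caratheodory_type (P^*)%mu).

Let completionT : @completed_measure_extension _ _ _ P setT = 1%E.
Proof.
exact: etrans (@measurable_mu_extE _ _ _ P setT measurableT) (probability_setT P).
Qed.

HB.instance Definition _ :=
  Measure_isProbability.Build _ _ _ (@completed_measure_extension _ _ _ P) completionT.

Definition cprob : probability CW R := @completed_measure_extension _ _ _ P.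

Lemma cprobE : completion P = cprob :> {measure set CW -> \bar R}.
Proof. by []. Qed.

Lemma completed_measurable (A : set W) : measurable A -> measurable (A : set CW).
Proof. by move=> mA; apply: sub_caratheodory; exact: sub_sigma_algebra. Qed.

Lemma cprob_ext (A : set W) : measurable A -> cprob A = P A.
Proof. by move=> mA; rewrite /cprob/= /completed_measure_extension measurable_mu_extE. Qed.

Lemma compl_negligible (A : set W) : P.-negligible A -> cprob.-negligible (A : set CW).
Proof.
by move=> [B [mB B0 AB]]; exists B; split; [exact: completed_measurable|rewrite cprob_ext|].
Qed.

(** The outer measure of a null set of the completion vanishes, so it has measurable covers of
    measure at most 1 / n.+1; their intersection is a measurable null cover. *)
Lemma negligible_compl (A : set W) : cprob.-negligible (A : set CW) -> P.-negligible A.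
Proof.
move=> [B [mB B0 AB]].
have h n : exists C : set W, [/\ measurable C, A `<=` C & (P C <= n.+1%:R^-1%:E)%E].
  have : (cprob B < n.+1%:R^-1%:E)%E by rewrite B0 lte_fin invr_gt0 ltr0n.
  move=> /ereal_inf_lt[_ [F [mF BF] <-]] hF; exists (\bigcup_k F k); split.
  - exact: bigcup_measurable.
  - exact: subset_trans AB BF.
  - apply: le_trans (ltW hF); apply: measure_sigma_subadditive => //.
    exact: bigcup_measurable.
have {}h n := cid (h n).
exists (\bigcap_n (sval (h n))); split.
- by apply: bigcap_measurable => // n _; case: (svalP (h n)).
- apply/eqP; rewrite eq_le measure_ge0 andbT; apply/lee_addgt0Pr => e e0; rewrite add0e.
  have [n _ hn] := near_infty_natSinv_lt (PosNum e0).
  have [mC _ hC] := svalP (h n).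
  apply: (@le_trans _ _ (n.+1%:R^-1%:E)%E); last by rewrite lee_fin ltW//; exact: (hn n (leqnn n)).
  apply: le_trans hC; apply: le_measure; rewrite ?inE//; last exact: bigcap_inf.
  by apply: bigcap_measurable => // m _; case: (svalP (h m)).
- by move=> w Aw n _; have [_ + _] := svalP (h n); exact.
Qed.

Lemma ae_compl (A : set W) : {ae P, forall w, A w} -> {ae cprob, forall w : CW, A w}.
Proof. exact: compl_negligible. Qed.

Lemma measurable_idc : measurable_fun setT (id : CW -> W).
Proof. by move=> _ B mB; rewrite setTI; exact: completed_measurable. Qed.

Lemma ge0_integral_compl (D : set W) (f : W -> \bar R) : measurable D ->
  measurable_fun D f -> (forall w, D w -> (0 <= f w)%E) ->
  (\int[cprob]_(w in D) f w = \int[P]_(w in D) f w)%E.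
Proof.
move=> mD mf f0.
rewrite -(@ge0_integral_pushforward _ _ _ _ _ _ measurable_idc cprob D f mD mf); last by move=> w /set_mem; exact: f0.
apply: (eq_measure_integral P) => [|? A mA _]; first exact: measurable_idc.
exact: cprob_ext.
Qed.

Lemma integrable_compl (f : W -> \bar R) :
  P.-integrable setT f -> cprob.-integrable setT f.
Proof.
move=> /integrableP[mf fi]; apply/integrableP; split.
  exact: measurableT_comp mf measurable_idc.
rewrite ge0_integral_compl//; exact: measurableT_comp.
Qed.

Lemma integral_compl (D : set W) (f : W -> \bar R) : measurable D ->
  P.-integrable setT f -> (\int[cprob]_(w in D) f w = \int[P]_(w in D) f w)%E.
Proof.
move=> mD fi; rewrite integralE [RHS]integralE.
have mf : measurable_fun D f by apply: measurable_funTS; exact: (measurable_int _ fi).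
by congr (_ - _)%E; apply: ge0_integral_compl => //; [exact: measurable_funepos|exact: measurable_funeneg].
Qed.

Lemma compl_integrable (f : W -> \bar R) : measurable_fun setT f ->
  cprob.-integrable setT f -> P.-integrable setT f.
Proof.
move=> mf /integrableP[_ fi]; apply/integrableP; split => //.
by move: fi; rewrite ge0_integral_compl//; exact: measurableT_comp.
Qed.

(** A set of the completed filtration differs by a null set from one of the raw filtration; the
    Markov property is stated for the latter. *)
Lemma Rintegral_compl_null (B B' : set W) (f : W -> R) : measurable B' ->
  P.-negligible (B `+` B') -> P.-integrable setT (EFin \o f) ->
  \int[cprob]_(w in B) f w = \int[P]_(w in B') f w.
Proof.
move=> mB' nB fi; have mf : measurable_fun setT (f : CW -> R).
  by apply/measurable_EFinP; exact: measurable_int (integrable_compl fi).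
have cB' : measurable (B' : set CW) by exact: completed_measurable.
have cB : measurable (B : set CW).
  rewrite (_ : B = B' `+` (B `+` B')); last by rewrite setYC -setYA setYK setY0.
  have cY : measurable ((B `+` B') : set CW).
    by apply: measure_is_complete_caratheodory; exact: compl_negligible.
  by rewrite setY_def; apply: measurableU; exact: measurableD.
transitivity (\int[cprob]_(w in B') f w); last by rewrite /Rintegral integral_compl.
have m1 (C : set CW) : measurable C -> measurable_fun setT (fun w : CW => \1_C w * f w).
  by move=> mC; apply: measurable_funM mf; exact: measurable_indic.
apply: (etrans (@Rintegral_indic _ CW _ cprob B f)); apply: (etrans _ (esym (@Rintegral_indic _ CW _ cprob B' f))).
apply: (@ae_eq_Rintegral _ CW _ cprob setT _ _ measurableT (m1 _ cB) (m1 _ cB')).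
have : cprob.-negligible (B `+` B' : set CW) by exact: compl_negligible.
apply: negligibleS => w /= h; apply: contrapT => nw; apply: h => _; congr (_ * _).
rewrite !indicE; have [Bw|nBw] := pselect (B w); have [Bw'|nBw'] := pselect (B' w).
- by rewrite !mem_set.
- by case: nw; left.
- by case: nw; right.
- by rewrite !memNset.
Qed.

End completed_probability.

Section completed_filtration.
Context d (W : measurableType d) (R : realType) (P : probability W R).
Variables (Flt : R -> set (set W)) (a b : R).
Hypothesis ab : a <= b.
Hypothesis hF : filtration_on Flt a b.
Hypothesis right_continuous : forall t B, a <= t -> t < b ->
  (forall u, t < u <= b -> Flt u B) -> Flt t B.

Lemma sub_completed t : Flt t `<=` completed_sub P (Flt t).
Proof. by move=> B hB; exists B => //; rewrite setYK; exact: negligible_set0. Qed.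

Lemma usual_completed : usual (cprob P) (fun t => completed_sub P (Flt t)) a b.
Proof.
have sub t : a <= t <= b -> completed_sub P (Flt t) `<=` @measurable _ (caratheodory_type (P^*)%mu).
  move=> tab A [B hB nAB].
  have mB : measurable (B : set (caratheodory_type (P^*)%mu)).
    by apply: completed_measurable; exact: flt_sub hF _ _ _ hB.
  have mAB : measurable ((A `+` B) : set (caratheodory_type (P^*)%mu)).
    by apply: measure_is_complete_caratheodory; exact: compl_negligible.
  rewrite (_ : A = B `+` (A `+` B)); last by rewrite setYC -setYA setYK setY0.
  rewrite setY_def; apply: measurableU; exact: measurableD.
split => //.
- split => //.
  + move=> t tab; have [F0 FC FU] := flt_sigma hF tab; split.
    * exact: sub_completed.
    * move=> A [B hB nAB]; exists (setT `\` B); first exact: FC.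
    apply: negligibleS nAB => w [[[_ Aw] Bw]|[[_ Bw] Aw]].
    by right; split => //; apply: contrapT => nB; exact: Bw.
    by left; split => //; apply: contrapT => nA; exact: Aw.
    * move=> A hA; pose B n := sval (cid2 (hA n)).
    have hB n : Flt t (B n) by rewrite /B; case: cid2.
    have nB n : P.-negligible (A n `+` B n) by rewrite /B; case: cid2.
    exists (\bigcup_n B n); first exact: FU.
    apply: negligibleS (negligible_bigcup nB) => w [[[n _ An] nBw]|[[n _ Bn] nAw]].
    by exists n => //; left; split => // Bn; apply: nBw; exists n.
    by exists n => //; right; split => // An; apply: nAw; exists n.
  + move=> s t as_ st tb A [B hB nAB]; exists B => //; exact: flt_mono hF _ _ as_ st tb _ hB.
- move=> t B tab /negligible_compl nB; exists set0; first by have [] := flt_sigma hF tab.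
  by rewrite setYC set0Y.
- move=> t A at_ tb hA.
  pose u n : R := t + (b - t) / n.+1%:R.
  have tu n : t < u n <= b.
    rewrite ltrDl divr_gt0 ?subr_gt0// -lerBrDl ler_pdivrMr ?ltr0n// ler_peMr ?subr_ge0 ?(ltW tb)//.
    by rewrite ler1n.
  pose B n := sval (cid2 (hA (u n) (tu n))).
  have hB n : Flt (u n) (B n) by rewrite /B; case: cid2.
  have nB n : P.-negligible (A `+` B n) by rewrite /B; case: cid2.
  (* The upper limit of the approximants. It depends only on tails, which lie in [Flt v] for any
     given [v > t], so right continuity of the raw filtration puts it in [Flt t]; outside the
     countably many null differences it is [A]. *)
  exists [set w | forall n, exists2 k, (n <= k)%N & B k w].
    apply: right_continuous => // v /andP[tv vb].
    have vt0 : 0 < (v - t) / (b - t) by rewrite divr_gt0 ?subr_gt0.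
    have [N _ hN] := near_infty_natSinv_lt (PosNum vt0).
    have uv k : (N <= k)%N -> u k <= v.
    move=> /hN/= h; rewrite -lerBrDl mulrC -ler_pdivlMr ?subr_gt0//; exact: ltW.
    have av : a <= v <= b by rewrite vb (le_trans at_ (ltW tv)).
    have [F0 FC FU] := flt_sigma hF av.
    have FI (D : nat -> set W) : (forall n, Flt v (D n)) -> Flt v (\bigcap_n D n).
    move=> hD; rewrite -[X in Flt v X]setCK setC_bigcap -setTD; apply: (FC); apply: (FU) => n.
    by rewrite -setTD; exact: FC.
    rewrite (_ : [set w | _] = \bigcap_n \bigcup_k B (k + (n + N))%N).
    apply: (FI) => n; apply: (FU) => k; apply: (flt_mono hF _ (uv _ _) vb).
    - by have /andP[/ltW tu' _] := tu (k + (n + N))%N; exact: le_trans at_ tu'.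
    - by rewrite addnA leq_addl.
    - exact: hB.
    apply/seteqP; split => [w hw n _|w hw n].
    have [k nk Bk] := hw (n + N)%N; exists (k - (n + N))%N => //=; by rewrite subnK.
    have [k _ Bk] := hw n I; exists (k + (n + N))%N => //.
    by rewrite addnCA leq_addr.
  apply: negligibleS (negligible_bigcup nB) => w [[Aw nBw]|[Bw nAw]].
    move/existsNP: nBw => [n hn]; exists n => //; left; split => // Bn; apply: hn; by exists n.
  by have [k _ Bk] := Bw 0%N; exists k => //; right.
Qed.

End completed_filtration.

(** * The canonical process: measurability, left limits *)

Section borel_maps.
Context {R : realType} (E : ptopologicalType) (dist : E -> E -> R).
Hypothesis hdist : metrizes dist.
Notation sep := (sepfun dist).

Lemma measurable_sepfun O : measurable_fun setT (sep O : borel E -> R).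
Proof.
apply: (measurability _ (RGenOInfty.measurableE R)) => _ [_ [c ->] <-]; rewrite setTI.
apply: sub_sigma_algebra.
have -> : sep O @^-1` `]c, +oo[%classic = sep O @^-1` [set z | c < z].
  by apply/seteqP; split => y; rewrite /= in_itv/= andbT.
apply: open_comp; last exact: open_gt.
move=> y _; exact: (sepfun_cvg hdist (F := nbhs y)).
Qed.

Lemma measurable_sepfun_comp d (U : measurableType d) (h : U -> borel E) O :
  measurable_fun setT h -> measurable_fun setT (fun u => sep O (h u)).
Proof. by move=> mh; apply: measurableT_comp mh; exact: measurable_sepfun. Qed.

(** The preimage of an open set is the set where its [sepfun] is positive along [h]. *)
Lemma measurable_to_borel d (U : measurableType d) (D : set U) (h : U -> borel E) :
  (forall O : set E, open O -> measurable_fun D (fun u => sep O (h u))) -> measurable_fun D h.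
Proof.
move=> mh mD; apply: (@measurability _ _ _ _ D h (@open E)) => // _ [Q oQ <-].
rewrite (_ : h @^-1` Q = (fun u => sep Q (h u)) @^-1` `]0, +oo[%classic).
  exact: mh.
apply/seteqP; split => u; rewrite /= in_itv/= andbT => /(sepfun_gt0 hdist _ oQ); exact.
Qed.

Lemma measurable_fun_pairD d1 d2 d3 (U : measurableType d1) (U2 : measurableType d2) (U3 : measurableType d3)
  (D : set U) (f : U -> U2) (g : U -> U3) :
  measurable_fun D f -> measurable_fun D g -> measurable_fun D (fun u => (f u, g u)).
Proof.
move=> mf mg mD; apply: (@measurability _ _ _ _ D (fun u => (f u, g u))
  (preimage_set_system setT fst measurable `|` preimage_set_system setT snd measurable)) => //.
move=> _ [_ [[B mB <-]|[B mB <-]] <-]; rewrite setTI; [exact: mf|exact: mg].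
Qed.

End borel_maps.

Section canonical_filtration.
Context {R : realType} (T : R) (E : ptopologicalType).
Hypothesis T0 : 0 <= T.
Notation W := (Omega T E).
Notation cyl := (@cylinders R T E).

Lemma X_cadlag (w : W) : cadlag_on 0 T (fun t => X t w : E).
Proof. by have [] := set_valP w. Qed.

Lemma cylinders_mono u v : u <= v -> cyl u `<=` cyl v.
Proof.
by move=> uv A [r [B [/andP[r0 ru] mB ->]]]; exists r, B; split => //; rewrite r0 (le_trans ru).
Qed.

Lemma cylinders_measurable u : u <= T -> <<s cyl u >> `<=` @measurable _ W.
Proof. by move=> uT; apply: sub_sigma_algebra2; exact: cylinders_mono. Qed.

Lemma filtration_onS s : 0 <= s -> filtration_on (@filtration R T E) s T.
Proof.
move=> s0; split.
- move=> t /andP[st tT]; rewrite /filtration; case: ltP => _; last first.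
    exact: (@sigma_algebra_measurable _ W).
  split => [u utT|A hA u utT|F hF u utT].
  + by have [] := smallest_sigma_algebra setT (cyl u).
  + by have [_ h _] := smallest_sigma_algebra setT (cyl u); apply: h; exact: hA.
  + by have [_ _ h] := smallest_sigma_algebra setT (cyl u); apply: h => n; exact: hF.
- move=> t /andP[st tT] A; rewrite /filtration/=; case: ifPn => // tT' h.
  by apply: (@cylinders_measurable T) => //; apply: h; rewrite tT' lexx.
- move=> t u st tu uT A; rewrite /filtration/=; case: (ltP t T) => tT; last first.
    by move=> mA; rewrite ltNge (le_trans tT tu).
  move=> h; case: ifPn => uT'; last by apply: (@cylinders_measurable T) => //; apply: h; rewrite tT lexx.
  by move=> v /andP[uv vT]; apply: h; rewrite (le_lt_trans tu uv).
Qed.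

Lemma filtration_right t (A : set W) : t < T -> (forall u, t < u <= T -> filtration u A) ->
  filtration t A.
Proof.
move=> tT h; rewrite /filtration/= tT => u /andP[tu uT].
have m1 : t < (t + u) / 2 by rewrite midf_lt.
have m2 : (t + u) / 2 < u by rewrite midf_lt.
have := h ((t + u) / 2); rewrite m1 (le_trans (ltW m2) uT) => /(_ isT).
by rewrite /filtration/= (lt_le_trans m2 uT); apply; rewrite m2.
Qed.

Lemma X_filtration r t (B : set (borel E)) : 0 <= r -> r <= t -> t <= T -> measurable B ->
  filtration t (X r @^-1` B : set W).
Proof.
move=> r0 rt tT mB.
have h u : t <= u -> <<s cyl u >> (X r @^-1` B : set W).
  move=> tu; apply: sub_sigma_algebra; exists r, B; split => //.
  by rewrite r0 (le_trans rt).
by rewrite /filtration/=; case: ifPn => _; [move=> u /andP[/ltW tu _]|]; exact: h.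
Qed.

Lemma measurable_X r : 0 <= r <= T -> measurable_fun setT (X r : W -> borel E).
Proof.
move=> /andP[r0 rT] _ B mB; rewrite setTI.
have := X_filtration r0 rT (lexx T) mB; by rewrite /filtration/= ltxx.
Qed.

End canonical_filtration.

Section canonical_process.
Context {R : realType} (T : R) (E : ptopologicalType) (dist : E -> E -> R).
Hypothesis T0 : 0 <= T.
Hypothesis hdist : metrizes dist.
Notation sep := (sepfun dist).
Notation TT := (measurableTypeR R).
Variables (PP : R -> borel E -> probability (Omega T E) R) (s : R) (x : borel E).
Hypothesis sT : 0 <= s <= T.
Notation Flt := (F_compl PP s x).
Notation CW := (caratheodory_type ((PP s x)^*)%mu).
Notation gst G := (g_sigma_algebraType G).

Lemma usual_canonical : usual (cprob (PP s x)) Flt s T.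
Proof.
have /andP[s0 sT'] := sT.
have rc (t : R) (B : set (Omega T E)) : s <= t -> t < T -> (forall u, t < u <= T -> filtration u B) -> filtration t B.
  by move=> _; exact: filtration_right.
have fo : filtration_on (@filtration R T E) s T by exact: filtration_onS.
exact: (@usual_completed _ (Omega T E) _ (PP s x) (@filtration R T E) s T sT' fo rc).
Qed.

Let hF := us_flt usual_canonical.
Let sT' : s <= T. Proof. by have /andP[] := sT. Qed.

Lemma X_rcont (w : Omega T E) r : 0 <= r < T -> X q w @[q --> r^'+] --> (X r w : E).
Proof. by have [+ _] := X_cadlag w; exact. Qed.

Lemma F_compl_X r t (B : set (borel E)) : s <= r -> r <= t -> t <= T -> measurable B ->
  Flt t (X r @^-1` B).
Proof.
move=> sr rt tT mB; apply: sub_completed; apply: X_filtration => //.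
by have /andP[s0 _] := sT; exact: le_trans s0 sr.
Qed.

Lemma measurable_X_flt r t : s <= r -> r <= t -> t <= T ->
  measurable_fun setT (X r : g_sigma_algebraType (Flt t : set (set CW)) -> borel E).
Proof.
by move=> sr rt tT _ B mB; rewrite setTI; apply: sub_sigma_algebra; exact: F_compl_X.
Qed.

Lemma measurable_sep_X r t O : s <= r -> r <= t -> t <= T ->
  measurable_fun setT (fun w : g_sigma_algebraType (Flt t : set (set CW)) => sep O (X r w)).
Proof.
move=> sr rt tT.
exact: (@measurable_sepfun_comp R E dist hdist _ (g_sigma_algebraType (Flt t : set (set CW))) (X r) O (measurable_X_flt sr rt tT)).
Qed.

Let sep_cvg := sepfun_cvg hdist.

Lemma prog_X : prog Flt s T (X : R -> CW -> borel E).
Proof.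
move=> t tsT; apply: (measurable_to_borel hdist) => O oO.
have : prog Flt s T (fun r (w : CW) => sep O (X r w)).
  apply: (rcont_prog hF) => //.
    move=> r /andP[sr rT]; have srT : s <= r <= T by rewrite sr.
    apply/(flt_wrtP hF srT).
    exact: (measurable_sep_X O sr (lexx r) rT).
  move=> w r /andP[sr rT]; apply: sep_cvg; apply: X_rcont; rewrite rT andbT.
  by have /andP[s0 _] := sT; exact: le_trans s0 sr.
exact.
Qed.

Lemma prog_comp (phi : R * borel E -> R) : borel_on_time_space T phi ->
  prog Flt s T (fun r (w : CW) => phi (r, X r w)).
Proof.
move=> mphi t /andP[st tT].
have mI : measurable (Ioc R s t) by exact: measurable_itv.
apply: (@measurable_comp _ _ _ _ _ _ (time_space T E) phi _ (fun z : TT * gst (Flt t) => ((z.1 : R), X z.1 z.2))) => //.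
- by apply: measurableX => //; exact: measurable_itv.
- move=> _ [[r w] [/= + _] <-]; rewrite in_itv/= => /andP[sr rt]; split => //=.
  by rewrite in_itv/= (le_trans rt tT) andbT; have /andP[s0 _] := sT; exact: le_trans s0 (ltW sr).
- apply: measurable_fun_pairD; last by apply: prog_X; rewrite st.
  by apply: measurable_funTS; exact: measurable_fst.
Qed.

(** Outside []s, T]] it is the process itself; at [s] this agrees with the left-grid approximations,
    which are frozen at [X s] there. *)
Definition left_lim (r : R) (w : CW) : borel E :=
  if pselect (s < r <= T) is left h
  then xget point [set l : E | X q w @[q --> r^'-] --> l] else X r w.

Lemma left_limP r w : s < r <= T -> X q w @[q --> r^'-] --> (left_lim r w : E).
Proof.
move=> /[dup] h /andP[sr rT]; rewrite /left_lim; case: pselect => // _.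
have [_ /(_ r)] := X_cadlag w; have /andP[s0 _] := sT.
rewrite (le_lt_trans s0 sr) rT => /(_ isT)[l hl].
by apply: (@xgetPex _ point [set l : E | X q w @[q --> r^'-] --> l]); exists l.
Qed.

Lemma predictable_left_lim : predictable_map Flt s T left_lim.
Proof.
apply: (measurable_to_borel hdist) => O oO.
apply: (@predictable_limit _ _ _ _ _ _ (fun n r w => sep O (X (grid s n (lidx s n r)) w)) (fun r w => sep O (left_lim r w))).
  move=> n; apply: (@predictable_left_grid _ _ _ _ _ _ hF sT' _ _ (fun q w => sep O (X q w) : R)) => q /andP[sq qT].
  exact: (measurable_sep_X O sq (lexx q) qT).
move=> r w /andP[sr rT]; move: sr; rewrite le_eqVlt => /predU1P[<-|sr].
  apply: cvg_near_cst; apply: nearW => n.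
  rewrite /lidx subrr mul0r truncn0 eqxx grid0 /left_lim; case: pselect => //.
  by rewrite ltxx.
apply: (left_limit_grid (x := fun q => sep O (X q w))) => //.
by apply: sep_cvg; apply: left_limP; rewrite sr.
Qed.

Lemma predictable_comp (phi : R * borel E -> R) : borel_on_time_space T phi ->
  predictable Flt s T (fun r w => phi (r, left_lim r w)).
Proof.
move=> mphi; have pid : predictable_map Flt s T (fun r (_ : Omega T E) => r).
  apply: (@predictable_limit _ _ _ _ _ _ (fun n r (_ : Omega T E) => grid s n (lidx s n r)) (fun r (_ : Omega T E) => r)).
    move=> n; apply: (@predictable_left_grid _ _ _ _ _ _ hF sT' _ _ (fun q _ => q : R)) => q _.
    exact: measurable_cst.
  move=> r w /andP[sr rT]; move: sr; rewrite le_eqVlt => /predU1P[<-|sr]; last exact: cvg_left_grid.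
  apply: cvg_near_cst; apply: nearW => n.
  by rewrite /lidx subrr mul0r truncn0 eqxx grid0.
apply/(predictableP _ sT').
have /andP[s0 _] := sT.
apply: (@measurable_comp _ _ _ _ _ _ (time_space T E) phi _ (fun z : g_sigma_algebraType (predictable_sigma (Flt : R -> set (set CW)) s T) => ((z.1 : R), left_lim z.1 z.2))) => //.
- by apply: measurableX => //; exact: measurable_itv.
- move=> _ [[r w] [/= + _] <-]; rewrite in_itv/= => /andP[sr rt]; split => //=.
  by rewrite in_itv/= rt (le_trans s0).
- apply: measurable_fun_pairD; last exact: predictable_left_lim.
  exact: pid.
Qed.

Lemma left_lim_null (V : cumulative R R) w : {within `[0, T], continuous V} ->
  (dV V).-negligible [set r : TT | s < r <= T /\ left_lim r w <> X r w].
Proof.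
move=> hV; apply: (@countable_null _ V T _ s).
- move=> t /andP[st tT]; apply: (continuous_no_atom hV); rewrite tT andbT.
  by have /andP[s0 _] := sT; exact: le_lt_trans s0 st.
- by move=> r [].
- apply: (left_jumps_countable hdist (x := fun r => X r w : E) (l := left_lim^~ w)).
  by move=> r; exact: left_limP.
Qed.

End canonical_process.

Lemma cvg_min1 (R : realType) (I : Type) (F : set_system I) (FF : Filter F) (x : I -> R) (l : R) :
  x i @[i --> F] --> l -> Num.min 1 (x i) @[i --> F] --> Num.min 1 l.
Proof.
move=> /cvgrPdist_lt c; apply/cvgrPdist_lt => e /c; apply: filterS => i.
rewrite !ltr_norml => /andP[h1 h2]; apply/andP.
by case: (leP 1 l) => h3; case: (leP 1 (x i)) => h4; split; lra.
Qed.

(** * Transition kernels: integrals and joint measurability *)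

Section kernel_integrals.
Context d d' (W : measurableType d) (Y : measurableType d') (R : realType).
Variables (mu : {measure set W -> \bar R}) (k : W -> {measure set Y -> \bar R}).
Variables (B : set W) (Phi : W -> Y).
Hypothesis mB : measurable B.
Hypothesis mPhi : measurable_fun setT Phi.
Hypothesis mk : forall A, measurable A -> measurable_fun setT (fun w => k w A).
Hypothesis kE : forall A, measurable A ->
  mu (B `&` Phi @^-1` A) = (\int[mu]_(w in B) k w A)%E.
Import HBNNSimple.

Let mkint (q : Y -> \bar R) : (forall y, 0 <= q y)%E -> measurable_fun setT q ->
  measurable_fun B (fun w => \int[k w]_y q y)%E.
Proof. by move=> q0 mq; apply: measurable_funTS; exact: measurable_fun_integral_kernel. Qed.

Let indic_case A : measurable A ->
  (\int[mu]_(w in B) (\1_A (Phi w))%:E = \int[mu]_(w in B) \int[k w]_y (\1_A y)%:E)%E.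
Proof.
move=> mA; transitivity (\int[mu]_(w in B) k w A)%E; last first.
  by apply: eq_integral => w _; rewrite integral_indic// setIT.
rewrite -kE// setIC.
have mPA : measurable (Phi @^-1` A) by rewrite -[X in measurable X]setTI; exact: mPhi.
by rewrite -integral_indic.
Qed.

Let simple_case (f : {nnsfun Y >-> R}) :
  (\int[mu]_(w in B) (f (Phi w))%:E = \int[mu]_(w in B) \int[k w]_y (f y)%:E)%E.
Proof.
(* The absolute value makes the term nonnegative for every real [c]; on the range of [f] it changes
   nothing. *)
pose t c y : \bar R := (`|c| * \1_(f @^-1` [set c]) y)%:E.
have ft y : (f y)%:E = (\sum_(c \in range f) t c y)%E.
  rewrite fsumEFin// fimfunE; congr EFin; apply: eq_fsbigr => c _; rewrite indicE.
  case: (boolP (y \in _)) => [/set_mem/= yc|_]; last by rewrite !mulr0.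
  by rewrite -yc [in RHS]ger0_norm.
have mf c : measurable (f @^-1` [set c]) by exact: measurable_sfunP.
have t0 c y : (0 <= t c y)%E by rewrite lee_fin mulr_ge0.
have mt c : measurable_fun setT (t c).
  by apply/measurable_EFinP; apply: measurable_funM => //; exact: measurable_indic.
have m1 A : measurable A -> measurable_fun setT (fun y : Y => (\1_A y : R)%:E).
  by move=> mA; apply/measurable_EFinP; exact: measurable_indic.
have i0 (A : set Y) y : (0 <= (\1_A y : R)%:E)%E by rewrite lee_fin.
have fin : finite_set (range f) by exact: fimfunP.
transitivity (\sum_(c \in range f) \int[mu]_(w in B) t c (Phi w))%E.
  rewrite -ge0_integral_fsum//; first by apply: eq_integral => w _; exact: ft.
  by move=> c; apply: measurable_funTS; exact: measurableT_comp.
transitivity (\sum_(c \in range f) \int[mu]_(w in B) \int[k w]_y t c y)%E; last first.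
  rewrite -ge0_integral_fsum//.
  - by apply: eq_integral => w _; rewrite -ge0_integral_fsum//; apply: eq_integral => y _; exact/esym/ft.
  - by move=> c; exact: mkint.
  - by move=> c w _; exact: integral_ge0.
apply: eq_fsbigr => c _; rewrite /t.
under eq_integral do rewrite EFinM.
rewrite ge0_integralZl//; last first.
  by apply: measurable_funTS; exact: (measurableT_comp (m1 _ (mf c)) mPhi).
rewrite indic_case// -ge0_integralZl//.
- apply: eq_integral => w _; rewrite -ge0_integralZl//; last exact: m1.
- by apply: mkint => //; exact: m1.
- by move=> w _; exact: integral_ge0.
Qed.

Lemma ge0_integral_kernel (q : Y -> \bar R) : (forall y, 0 <= q y)%E -> measurable_fun setT q ->
  (\int[mu]_(w in B) q (Phi w) = \int[mu]_(w in B) \int[k w]_y q y)%E.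
Proof.
move=> q0 mq; pose q_ := nnsfun_approx measurableT mq.
have q_nd y : {homo (fun n => (q_ n y)%:E) : n m / (n <= m)%N >-> (n <= m)%E}.
  by move=> n m nm; rewrite lee_fin; have /lefP := nd_nnsfun_approx measurableT mq nm; exact.
have q_lim y : limn (fun n => (q_ n y)%:E) = q y.
  by apply/cvg_lim => //; exact: (cvg_nnsfun_approx measurableT mq (fun y _ => q0 y) I).
have q_int w : (\int[k w]_y (q_ n y)%:E)%E @[n --> \oo] --> (\int[k w]_y q y)%E.
  rewrite -(eq_integral _ _ (fun y _ => q_lim y)).
  apply: cvg_monotone_convergence => //; first by move=> n; exact/measurable_EFinP.
  by move=> n y _; rewrite lee_fin.
have c1 : (\int[mu]_(w in B) (q_ n (Phi w))%:E)%E @[n --> \oo] --> (\int[mu]_(w in B) q (Phi w))%E.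
  rewrite -(eq_integral _ _ (fun w _ => q_lim (Phi w))).
  apply: cvg_monotone_convergence => //.
  - by move=> n; apply: measurable_funTS; apply/measurable_EFinP; exact: measurableT_comp.
  - by move=> n w _; rewrite lee_fin.
have c2 : (\int[mu]_(w in B) \int[k w]_y (q_ n y)%:E)%E @[n --> \oo] --> (\int[mu]_(w in B) \int[k w]_y q y)%E.
  rewrite -(eq_integral _ _ (fun w _ => cvg_lim (@ereal_hausdorff R) (q_int w))).
  apply: cvg_monotone_convergence => //.
  - move=> n; apply: mkint; first by move=> y; rewrite lee_fin.
    exact/measurable_EFinP.
  - by move=> n w _; apply: integral_ge0 => y _; rewrite lee_fin.
  - move=> w _ n m nm; apply: ge0_le_integral => //.
    + by move=> y _; rewrite lee_fin.
    + exact/measurable_EFinP.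
    + exact/measurable_EFinP.
    + by move=> y _; exact: q_nd.
apply: cvg_unique c1 _ => //; apply: cvg_trans c2; apply: near_eq_cvg; apply: nearW => n.
by rewrite simple_case.
Qed.

End kernel_integrals.

Section transition_measurability.
Context {R : realType} (T : R) (E : ptopologicalType) (dist : E -> E -> R).
Hypothesis T0 : 0 <= T.
Hypothesis hdist : metrizes dist.
Notation sep := (sepfun dist).
Notation TT := (measurableTypeR R).
Variables (P : R -> R -> R.-pker borel E ~> borel E).
Variables (PP : R -> borel E -> probability (Omega T E) R).
Hypothesis hPP : canonical_markov_class P PP.

Lemma joint_X s : 0 <= s ->
  measurable_fun ((Ioc R s T) `*` setT) (fun z : TT * Omega T E => X z.1 z.2).
Proof.
move=> s0; apply: (measurable_to_borel hdist) => Q oQ.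
apply: (@measurable_rcont _ _ (Omega T E) (fun r w => sep Q (X r w))).
- move=> r /andP[sr rT]; apply: (measurable_sepfun_comp hdist).
  by apply: measurable_X => //; rewrite rT (le_trans s0).
- move=> w r /andP[sr rT]; apply: (sepfun_cvg hdist).
  by apply: X_rcont; rewrite rT (le_trans s0).
Qed.

Lemma law_X t y r (q : borel E -> \bar R) : 0 <= t <= T -> 0 <= r <= T ->
  measurable_fun setT q -> (forall z, 0 <= q z)%E ->
  (\int[P t r y]_z q z = \int[PP t y]_w q (X r w))%E.
Proof.
move=> tT rT mq q0; have mX := @measurable_X R T E r rT.
rewrite -(ge0_integral_pushforward mX (PP t y) measurableT mq); last by move=> z _; exact: q0.
apply: eq_measure_integral => A mA _; have [h _] := hPP y tT.
by rewrite -h.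
Qed.

(** Joint measurability in the final time and the starting point. For a bounded continuous function,
    its integral against P t r y is the mean of its value at X_r under [PP t y], right-continuous in
    [r] because paths are. Increasing limits give open sets, and Dynkin's theorem all Borel sets. *)
Lemma joint_kernel t A : 0 <= t <= T -> measurable A ->
  measurable_fun ((Ioc R t T) `*` setT) (fun z : TT * borel E => P t z.1 z.2 A).
Proof.
move=> tT; have /andP[t0 tT'] := tT.
have mI : measurable (Ioc R t T) by exact: measurable_itv.
have mD : measurable ((Ioc R t T) `*` (setT : set (borel E))) by exact: measurableX.
have finP r y A' : measurable A' -> P t r y A' \is a fin_num.
  move=> mA'; rewrite ge0_fin_numE//; apply: (@le_lt_trans _ _ 1%E); last exact: ltry.
  by rewrite -(@prob_kernel _ _ _ _ _ (P t r) y); apply: le_measure; rewrite ?inE.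
have open_case (Q : set E) : open Q -> measurable_fun ((Ioc R t T) `*` setT) (fun z : TT * borel E => P t z.1 z.2 (Q : set (borel E))).
  move=> oQ; have mQ : measurable (Q : set (borel E)) by exact: sub_sigma_algebra.
  pose phi n (y : borel E) : R := Num.min 1 (n%:R * sep Q y).
  have phi0 n y : 0 <= phi n y by rewrite le_min ler01 mulr_ge0// sepfun_ge0.
  have phi1 n y : `|phi n y| <= cst 1 y by rewrite ger0_norm// ge_min lexx.
  have mphi n : measurable_fun setT (phi n).
    apply: measurable_minr => //; apply: measurable_funM => //.
    exact: measurable_sepfun.
  pose M n r y := \int[P t r y]_z phi n z.
  have i1 r y : (P t r y).-integrable setT (EFin \o (cst 1 : borel E -> R)).
    apply/integrableP; split; first exact/measurable_EFinP.
    under eq_integral do rewrite /= normr1.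
    by rewrite integral_cst// mul1e prob_kernel ltry.
  have cphi : measurable_fun ((Ioc R t T) `*` setT) (fun z : TT * borel E => fine (P t z.1 z.2 (Q : set (borel E)))).
    apply: (@measurable_fun_cvg _ (TT * borel E)%type R _ (fun n (z : TT * borel E) => M n z.1 z.2)).
    move=> n; apply: (@measurable_rcont _ _ (borel E) (M n)).
    move=> r _; apply: (measurableT_comp (f := fine)) => //.
    apply: measurable_fun_integral_kernel; last exact/measurable_EFinP.
    by move=> A' mA'; exact: measurable_kernel.
    by move=> y; rewrite lee_fin.
    move=> y r /andP[tr rT]; have rT' : 0 <= r <= T by rewrite (le_trans t0 tr) ltW.
    have ME q : 0 <= q <= T -> M n q y = \int[PP t y]_w phi n (X q w).
    move=> qT; rewrite /M /Rintegral (law_X _ tT qT)//; first exact/measurable_EFinP.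
    by move=> z; rewrite lee_fin.
    apply/cvg_at_rightP => q [qr qc]; rewrite (ME r rT').
    have qT : \forall k \near \oo, q k <= T.
    have /cvgrPdist_lt/(_ (T - r)) h := qc.
    have {}h : \forall k \near \oo, `|r - q k| < T - r by apply: h; rewrite subr_gt0.
    apply: filterS h => k; rewrite distrC ltr_norml ltrD2r => /andP[_ /ltW]; exact.
    (* [law_X] needs times in [[0, T]]; since [r < T] the cut is eventually inactive. *)
    pose p k := Num.min T (q k).
    have pT k : 0 <= p k <= T.
    by rewrite le_min T0 ge_min lexx/= (le_trans t0 (le_trans tr (ltW (qr k)))).
    have pc : p k @[k --> \oo] --> r.
    apply: cvg_trans qc; apply: near_eq_cvg; apply: filterS qT => k h; exact/esym/min_r.
    have : \int[PP t y]_w phi n (X (p k) w) @[k --> \oo] --> \int[PP t y]_w phi n (X r w).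
    have mc v : 0 <= v <= T -> measurable_fun setT (fun w : Omega T E => phi n (X v w)).
    by move=> vT; apply: (measurableT_comp (mphi n)); exact: measurable_X.
    apply: (proj2 (Rintegral_dct (g := cst 1) measurableT _ _ _ _ _)).
    - by move=> k; exact: mc.
    - exact: mc.
    - apply: aeW => w _; apply: cvg_min1.
    apply: cvgM; first exact: cvg_cst.
    have xc : X v w @[v --> r^'+] --> (X r w : E).
    by apply: X_rcont; rewrite rT (le_trans t0 tr).
    have xs : sep Q (X v w) @[v --> r^'+] --> sep Q (X r w).
    exact: (sepfun_cvg hdist _ xc).
    by move/cvg_at_rightP: xs; apply; split => // k; rewrite lt_min rT qr.
    - exact: finite_measure_integrable_cst.
    - by apply: aeW => w k _; exact: phi1.
    apply: cvg_trans; apply: near_eq_cvg; apply: filterS qT => k h.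
    by rewrite -ME// /p min_r.
    move=> [r y] [/= rtT _].
    have -> : fine (P t r y (Q : set (borel E))) = \int[P t r y]_z (\1_Q z : R).
    by rewrite /Rintegral integral_indic// setIT.
    apply: (proj2 (Rintegral_dct (g := cst 1) measurableT _ _ _ _ _)) => //.
    - apply: aeW => z _; exact: sepfun_indic.
    - by apply: aeW => z n _; exact: phi1.
  apply: (eq_measurable_fun (fun z : TT * borel E => (fine (P t z.1 z.2 (Q : set (borel E))))%:E)).
    by move=> z _; rewrite fineK// finP.
  exact/measurable_EFinP.
apply: (@dynkin_induction _ (borel E) (@open E) (fun A : set (borel E) => measurable_fun ((Ioc R t T) `*` (setT : set (borel E))) (fun z : TT * borel E => P t z.1 z.2 A))) => //.
- by move=> A1 A2; exact: openI.
- apply: (eq_measurable_fun (fun=> 1%E)); last exact: measurable_cst.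
  by move=> z _; rewrite prob_kernel.
- move=> S mS hS; apply: (eq_measurable_fun (fun z : TT * borel E => 1 - P t z.1 z.2 S)%E).
    move=> z _; have : P t z.1 z.2 setT = (P t z.1 z.2 S + P t z.1 z.2 (~` S))%E.
    by rewrite -measureU ?setUv ?setICr//; exact: measurableC.
    rewrite prob_kernel => ->; by rewrite addeAC subee ?finP// add0e.
  exact: emeasurable_funB.
- move=> F mF tF hF; apply: (eq_measurable_fun (fun z : TT * borel E => \sum_(0 <= n <oo) P t z.1 z.2 (F n))%E).
    by move=> z _; rewrite measure_bigcup//; apply: eq_eseriesl => n; rewrite in_setT.
  by apply: ge0_emeasurable_sum => //.
Qed.

Section extended_kernel.
Variable t : R.
Hypothesis tT : 0 <= t <= T.
Notation D := ((Ioc R t T) `*` (setT : set (borel E))).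

Let mD : measurable D.
Proof. by apply: measurableX => //; exact: measurable_itv. Qed.

(** Final times outside []t, T]] are reset to [T], which gives a probability kernel on the whole
    product of times and states. *)
Definition extended_kernel (z : TT * borel E) : {measure set borel E -> \bar R} :=
  P t (if t < z.1 <= T then z.1 else T) z.2.

Notation K := extended_kernel.

Let mK A : measurable A -> measurable_fun setT (fun z => K z A).
Proof.
move=> mA; rewrite -(setUv D); apply/(measurable_funU _ mD (measurableC mD)); split.
  apply: eq_measurable_fun (joint_kernel tT mA) => z /set_mem[/= + _].
  by rewrite in_itv/= /extended_kernel => ->.
apply: (eq_measurable_fun (fun z : TT * borel E => P t T z.2 A)).
  move=> z /set_mem/= nD; rewrite /extended_kernel; case: ifPn => // h; by case: nD; split.
apply: measurable_funTS; apply: (measurableT_comp (f := fun y => P t T y A)) measurable_snd.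
exact: measurable_kernel.
Qed.

HB.instance Definition _ := isKernel.Build _ _ _ _ _ K mK.

Let K1 z : K z setT = 1%E. Proof. by rewrite /extended_kernel prob_kernel. Qed.

HB.instance Definition _ := Kernel_isProbability.Build _ _ _ _ _ K K1.

Lemma joint_kernel_integral (h : TT * borel E -> \bar R) : measurable_fun D h ->
  (forall z, 0 <= h z)%E ->
  measurable_fun D (fun z => \int[P t z.1 z.2]_y h (z.1, y))%E.
Proof.
move=> mh h0; have mh' : measurable_fun setT (h \_ D) by apply/(measurable_restrictT _ mD).
pose q (z : (TT * borel E) * borel E) := (h \_ D) (z.1.1, z.2).
have mq : measurable_fun setT q.
  apply: (measurableT_comp mh'); apply/measurable_fun_pairP; split.
    exact: measurableT_comp measurable_fst measurable_fst.
  exact: measurable_snd.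
have q0 z : (0 <= q z)%E by rewrite /q patchE; case: ifPn.
apply: (eq_measurable_fun (fun z => \int[K z]_y q (z, y))%E).
  move=> z /set_mem[/= + _]; rewrite in_itv/= /extended_kernel => zI; rewrite zI.
  by apply: eq_integral => y _; rewrite /q patchE mem_set.
have h2 := @measurable_fun_integral_finite_kernel _ _ _ _ _ q K q0 mq.
apply: measurable_funTS.
exact: h2.
Qed.

Lemma joint_kint (h : TT * borel E -> R) : measurable_fun D h ->
  measurable_fun D (fun z => kint P t z.1 (fun y => h (z.1, y)) z.2).
Proof.
move=> mh; have mh' : measurable_fun D (EFin \o h) by exact/measurable_EFinP.
apply: (measurableT_comp (f := fine)) => //.
apply: (eq_measurable_fun (fun z => \int[P t z.1 z.2]_y (EFin \o h)^\+ (z.1, y) - \int[P t z.1 z.2]_y (EFin \o h)^\- (z.1, y))%E).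
  move=> z _ /=; rewrite [RHS]integralE; congr (_ - _)%E; apply: eq_integral => y _.
    by rewrite !funeposE.
  by rewrite !funenegE.
apply: emeasurable_funB; apply: joint_kernel_integral => //.
- exact: measurable_funepos.
- exact: measurable_funeneg.
Qed.

End extended_kernel.

End transition_measurability.

(** * From the equations of IP to martingales by the Markov property *)

Section linear_combination.
Context d (W : measurableType d) (R : realType) (mu : {measure set W -> \bar R}).
Variables (f1 f2 f3 : W -> R) (c : R).
Hypothesis i1 : mu.-integrable setT (EFin \o f1).
Hypothesis i2 : mu.-integrable setT (EFin \o f2).
Hypothesis i3 : mu.-integrable setT (EFin \o f3).

Let i23 : mu.-integrable setT (fun w => (c * (f2 w + f3 w))%:E).
Proof. by have := integrableZl measurableT c (integrableD measurableT i2 i3); exact: eq_integrable. Qed.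

Lemma comb_integrable : mu.-integrable setT (fun w => (f1 w + c * (f2 w + f3 w))%:E).
Proof. by have := integrableD measurableT i1 i23; exact: eq_integrable. Qed.

Lemma Rintegral_comb B : measurable B ->
  \int[mu]_(w in B) (f1 w + c * (f2 w + f3 w)) =
  \int[mu]_(w in B) f1 w + c * (\int[mu]_(w in B) f2 w + \int[mu]_(w in B) f3 w).
Proof.
move=> mB; rewrite RintegralD//; [|exact: integrableS i1|exact: integrableS i23].
rewrite RintegralZl//; last by apply: integrableS (integrableD measurableT i2 i3).
by rewrite RintegralD//; [exact: integrableS i2|exact: integrableS i3].
Qed.

End linear_combination.

Section time_inner.
Context d (W : measurableType d) (R : realType) (mu : probability W R).
Variables (V : cumulative R R) (p q : R) (f : R -> W -> R) (B : set W).
Notation I := (Ioc R p q).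
Hypothesis mB : measurable B.
Hypothesis fi : ini (dV V) mu I f.

Let mI : measurable I. Proof. exact: measurable_itv. Qed.

Let f' r w := \1_B w * f r w.

Let fi' : ini (dV V) mu I f'.
Proof.
apply: (le_ini mI _ _ (ini_norm fi)).
  apply: measurable_funM; last exact: ini_measurable fi.
  by apply: measurable_funTS; apply: measurableT_comp measurable_snd; exact: measurable_indic.
by move=> r w _; rewrite /f' normrM ler_piMl// indicE; case: (_ \in _); rewrite ?normr1 ?normr0.
Qed.

Lemma inner_measurable : measurable_fun I (fun r => \int[mu]_(w in B) f r w).
Proof.
apply: (eq_measurable_fun (fun r => fine (\int[mu]_w (f' r w)%:E)%E)).
  by move=> r _; rewrite [RHS]Rintegral_indic.
apply: measurableT_comp => //.
exact: measurable_int (fubini_time_integrable mI (ini_measurable fi') (ini_fin mI fi')).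
Qed.

Lemma inner_swap : \int[mu]_(w in B) (\int[dV V]_(r in I) f r w) =
  \int[dV V]_(r in I) (\int[mu]_(w in B) f r w).
Proof.
rewrite Rintegral_indic; transitivity (EI (dV V) mu I f').
  rewrite EIE//; apply: eq_Rintegral => w _; rewrite /f' indicE; case: (_ \in _).
    by rewrite mul1r; apply: eq_Rintegral => r _; rewrite mul1r.
  rewrite mul0r; apply/esym; transitivity (\int[dV V]_(r in I) (cst 0 r : R)).
    by apply: eq_Rintegral => r _; rewrite mul0r.
  by rewrite Rintegral_cst// mul0r.
rewrite EI_swap//; apply: eq_Rintegral => r _.
by rewrite [RHS]Rintegral_indic.
Qed.

End time_inner.

Section joint_composition.
Context d d' (W : measurableType d) (Y : measurableType d') (R : realType).
Notation TT := (measurableTypeR R).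

Lemma joint_comp (D : set TT) (k : R -> Y -> R) (phi : W -> Y) : measurable D ->
  measurable_fun setT phi -> measurable_fun (D `*` setT) (fun z : TT * Y => k z.1 z.2) ->
  measurable_fun (D `*` setT) (fun z : TT * W => k z.1 (phi z.2)).
Proof.
move=> mD mphi mk.
apply: (@measurable_comp _ _ _ _ _ _ (D `*` (setT : set Y)) _ _ (fun z : TT * W => (z.1, phi z.2)) _ _ mk).
- exact: measurableX.
- by move=> _ [z [zD _] <-].
- have a1 : measurable_fun setT (fun z : TT * W => phi z.2) by exact: measurableT_comp mphi measurable_snd.
  exact: measurable_fun_pairD (measurable_funTS measurable_fst) (measurable_funTS a1).
Qed.

End joint_composition.

(* [kg t] and [kk t r] stand for the conditional expectations of [gT] and [hh r] given Flt t. *)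
Section representation.
Context d (W : measurableType d) (R : realType) (mu : probability W R).
Variables (Flt : R -> set (set W)) (s T : R) (V : cumulative R R) (c : R).
Variables (U : R -> W -> R) (hh : R -> W -> R) (gT : W -> R).
Variables (kg : R -> W -> R) (kk : R -> R -> W -> R).
Notation TT := (measurableTypeR R).
Notation la := (dV V).
Hypothesis hF : filtration_on Flt s T.
Hypothesis mU : forall t, s <= t -> t <= T -> measurable_wrt (Flt t) (U t).
Hypothesis ph : prog Flt s T hh.
Hypothesis ig : mu.-integrable setT (EFin \o gT).
Hypothesis ih : ini la mu `]s, T]%classic hh.
Hypothesis UE : forall t w, s <= t -> t <= T ->
  U t w = kg t w + c * \int[la]_(r in `]t, T]) kk t r w.
Hypothesis ikg : forall t, s <= t -> t <= T -> mu.-integrable setT (EFin \o kg t).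
Hypothesis kgE : forall t B, s <= t -> t <= T -> Flt t B ->
  \int[mu]_(w in B) kg t w = \int[mu]_(w in B) gT w.
Hypothesis jkk : forall t, s <= t -> t <= T ->
  measurable_fun ((Ioc R t T) `*` setT) (fun z : TT * W => kk t z.1 z.2).
Hypothesis kk_le : forall t r, s <= t -> t <= r -> r <= T ->
  (\int[mu]_w `|kk t r w|%:E <= \int[mu]_w `|hh r w|%:E)%E.
(** Restricted to times at which [hh r] is integrable: Fubini guarantees this for almost every [r],
    which suffices under the integral in [r]. *)
Hypothesis kkE : forall t r B, s <= t -> t <= r -> r <= T -> mu.-integrable setT (EFin \o hh r) ->
  Flt t B -> \int[mu]_(w in B) kk t r w = \int[mu]_(w in B) hh r w.

Let mI p q : measurable (Ioc R p q). Proof. exact: measurable_itv. Qed.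

Let iS p q : s <= p -> q <= T -> ini la mu `]p, q]%classic hh.
Proof.
move=> sp qT; apply: integrableS ih.
- exact: measurableX.
- exact: measurableX.
- by move=> [r w] [/= + _]; rewrite !in_itv/= => /andP[pr rq]; split => //=; apply/andP; split; [exact: le_lt_trans sp pr|exact: le_trans rq qT].
Qed.

Let ip t : s <= t -> t <= T -> mu.-integrable setT (fun w => (pint V s (hh^~ w) t)%:E).
Proof. by move=> st tT; exact: (ini_inner (mI s t) (iS (lexx s) tT)). Qed.

Section one_time.
Variable t : R.
Hypotheses (st : s <= t) (tT : t <= T).
Notation D := (Ioc R t T).

Let tsT : s <= t <= T. Proof. by rewrite st. Qed.

Let rb r : D r -> t <= r /\ r <= T.
Proof. by rewrite /= in_itv/= => /andP[/ltW tr rT]. Qed.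

Let ik : ini la mu D (kk t).
Proof.
have jh := prog_joint hF ph st (lexx T); have jk := jkk st tT.
have n1 (f : TT -> W -> R) : measurable_fun (D `*` setT) (fun z : TT * W => f z.1 z.2) -> measurable_fun (D `*` setT) (fun z : TT * W => `|f z.1 z.2|%:E).
  by move=> mf; apply/measurable_EFinP; exact: measurableT_comp.
apply: (iniP (mI t T) jk).
rewrite (tonelli_iter la mu (mI t T) (f := fun r w => `|kk t r w|%:E) (n1 _ jk))//.
apply: (@le_lt_trans _ _ (\int[la]_(r in D) \int[mu]_w `|hh r w|%:E)%E).
  apply: ge0_le_integral => //.
  - by move=> r _; exact: integral_ge0.
  - by apply: (measurable_outer mu (mI t T) (f := fun r w => `|kk t r w|%:E) (n1 _ jk)).
  - by apply: (measurable_outer mu (mI t T) (f := fun r w => `|hh r w|%:E) (n1 _ jh)).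
  - by move=> r Dr; have [tr rT] := rb Dr; exact: kk_le.
have e := tonelli_iter la mu (mI t T) (f := fun r w => `|hh r w|%:E) (n1 _ jh).
rewrite /= in e; rewrite -e//.
exact: (ini_fin (mI t T) (iS st (lexx T))).
Qed.

Let key B : Flt t B -> \int[mu]_(w in B) (\int[la]_(r in D) kk t r w) =
  \int[mu]_(w in B) (\int[la]_(r in D) hh r w).
Proof.
move=> FB; have mB : measurable B by exact: (flt_sub hF tsT FB).
have iD := iS st (lexx T).
rewrite (inner_swap mB ik) (inner_swap mB iD).
apply: ae_eq_Rintegral (mI t T) (inner_measurable mB ik) (inner_measurable mB iD) _.
have := fubini_ae_time (mI t T) (ini_measurable iD) (ini_fin (mI t T) iD).
apply: filterS => r + Dr => /(_ Dr) ir; have [tr rT] := rb Dr.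
exact: kkE.
Qed.

Let mt w := U t w + c * pint V s (hh^~ w) t.
Let xi w := gT w + c * pint V s (hh^~ w) T.
(** The terminal variable with its integral split at [t]. The splitting is valid on integrable
    paths, hence almost surely. *)
Let xi' w := gT w + c * (\int[la]_(r in D) hh r w + pint V s (hh^~ w) t).

Let mtE : mt = fun w => kg t w + c * (\int[la]_(r in D) kk t r w + pint V s (hh^~ w) t).
Proof. by apply/funext => w; rewrite /mt UE// mulrDr addrA. Qed.

Let xiE : {ae mu, forall w, xi w = xi' w}.
Proof.
apply: filterS (ini_path (mI s T) ih) => w iw; rewrite /xi /xi'.
by rewrite (pint_split iw st tT (lexx T)) (addrC (pint V s (hh^~ w) t)).
Qed.

Let iih := ini_inner (mI t T) (iS st (lexx T)).
Let iik := ini_inner (mI t T) ik.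

(** The process at time [t] and the fixed terminal variable [xi] have the same integrals over
    [Flt t]: the conditional expectations [kg t] and [kk t] supply the part after [t]. The process
    is thus a martingale closed by [xi]. *)
Lemma representation_time : mu.-integrable setT (EFin \o mt) /\
  forall B, Flt t B -> \int[mu]_(w in B) mt w = \int[mu]_(w in B) xi w.
Proof.
have sT : s <= T := le_trans st tT.
split; first by rewrite mtE; exact: comb_integrable (ikg st tT) iik (ip st tT).
move=> B FB; have mB : measurable B by exact: (flt_sub hF tsT FB).
have mxi : measurable_fun setT xi.
  apply: measurable_funD; first by apply/measurable_EFinP; exact: (measurable_int _ ig).
  by apply: measurable_funM => //; apply/measurable_EFinP; exact: (measurable_int _ (ip sT (lexx T))).
have mxi' : measurable_fun setT xi'.
  by apply/measurable_EFinP; exact: (measurable_int _ (comb_integrable c ig iih (ip st tT))).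
rewrite (ae_eq_Rintegral mB (measurable_funTS mxi) (measurable_funTS mxi')); last first.
  by apply: filterS xiE => w + _.
rewrite mtE (Rintegral_comb c (ikg st tT) iik (ip st tT) mB) (Rintegral_comb c ig iih (ip st tT) mB).
by rewrite (key FB) kgE.
Qed.

End one_time.

Lemma representation_martingale :
  martingale mu Flt s T (fun t w => U t w + c * pint V s (hh^~ w) t).
Proof.
apply: martingaleI.
- move=> t /[dup] tsT /andP[st tT]; apply/(flt_wrtP hF tsT).
  apply: measurable_funD; first by apply/(flt_wrtP hF tsT); exact: mU.
  apply: measurable_funM => //; apply/(flt_wrtP hF tsT).
  exact: (prog_pint hF V ph tsT).
- by move=> t /andP[st tT]; have [] := representation_time st tT.
- move=> u t B su ut tT FB; have st := le_trans su ut; have uT := le_trans ut tT.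
  have [_ e1] := representation_time su uT; have [_ e2] := representation_time st tT.
  by rewrite (e1 B FB) (e2 B)//; exact: (flt_mono hF su ut tT).
Qed.

End representation.

Section markov_property.
Context {R : realType} (T : R) (E : ptopologicalType) (dist : E -> E -> R).
Hypothesis T0 : 0 <= T.
Hypothesis hdist : metrizes dist.
Notation TT := (measurableTypeR R).
Variables (P : R -> R -> R.-pker borel E ~> borel E).
Variables (PP : R -> borel E -> probability (Omega T E) R).
Hypothesis hPP : canonical_markov_class P PP.
Variables (s : R) (x : borel E).
Hypothesis sT : 0 <= s <= T.
Notation Flt := (F_compl PP s x).
Notation CW := (caratheodory_type ((PP s x)^*)%mu).
Notation mu := (cprob (PP s x)).

Let us := usual_canonical PP x sT.
Let hF := us_flt us.

Let s0 : 0 <= s. Proof. by have /andP[] := sT. Qed.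

Let bounds t : s <= t -> t <= T -> 0 <= t <= T.
Proof. by move=> st ->; rewrite (le_trans s0 st). Qed.

Let mX t : s <= t -> t <= T -> measurable_fun setT (X t : Omega T E -> borel E).
Proof. by move=> st tT; apply: measurable_X => //; exact: bounds. Qed.

Let mXc t : s <= t -> t <= T -> measurable_fun setT (X t : CW -> borel E).
Proof.
move=> st tT _ B mB; rewrite setTI; apply: completed_measurable.
by rewrite -[X in measurable X]setTI; exact: mX.
Qed.

Let mker t r : forall A, measurable A -> s <= t -> t <= T ->
  measurable_fun setT (fun w : Omega T E => P t r (X t w) A).
Proof.
move=> A mA st tT; apply: (measurableT_comp (f := fun y => P t r y A)) (mX st tT).
exact: measurable_kernel.
Qed.

(** The Markov property on sets is the hypothesis [kE] of [ge0_integral_kernel], with [B] fixed. *)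
Lemma markov_ge0 t r B (q : borel E -> \bar R) : s <= t -> t <= r -> r <= T -> filtration t B ->
  (forall y, 0 <= q y)%E -> measurable_fun setT q ->
  (\int[PP s x]_(w in B) q (X r w) = \int[PP s x]_(w in B) \int[P t r (X t w)]_y q y)%E.
Proof.
move=> st tr rT FB q0 mq; have tT := le_trans tr rT; have sr := le_trans st tr.
have mB : measurable B by apply: (flt_sub (@filtration_onS R T E s s0)) FB; rewrite st.
apply: ge0_integral_kernel => //; [exact: mX|by move=> A mA; exact: mker|move=> A mA].
have [_ /(_ t r A st tr rT mA)[iY iZ _ h]] := hPP x sT.
have mXA : measurable (X r @^-1` A : set (Omega T E)) by rewrite -[X in measurable X]setTI; exact: mX.
have finP y : P t r y A \is a fin_num.
  rewrite ge0_fin_numE//; apply: (@le_lt_trans _ _ 1%E); last exact: ltry.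
  by rewrite -(@prob_kernel _ _ _ _ _ (P t r) y); apply: le_measure; rewrite ?inE.
have e1 : (\int[PP s x]_(w in B) (\1_(X r @^-1` A) w : R)%:E = PP s x (B `&` X r @^-1` A))%E.
  by rewrite integral_indic// setIC.
have e2 : (\int[PP s x]_(w in B) (fine (P t r (X t w) A))%:E = \int[PP s x]_(w in B) P t r (X t w) A)%E.
  by apply: eq_integral => w _; rewrite fineK.
have f1 : (\int[PP s x]_(w in B) (\1_(X r @^-1` A) w : R)%:E)%E \is a fin_num.
  by apply: integrable_fin_num => //; apply: integrableS iY.
have f2 : (\int[PP s x]_(w in B) (fine (P t r (X t w) A))%:E)%E \is a fin_num.
  by apply: integrable_fin_num => //; apply: integrableS iZ.
have := h B FB; rewrite /Rintegral => e.
apply: etrans (esym e1) (etrans _ e2).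
by rewrite -(fineK f1) -(fineK f2) e.
Qed.

Lemma measurable_kint t r (q : borel E -> R) : measurable_fun setT q ->
  measurable_fun setT (kint P t r q).
Proof.
move=> mq; have mq' : measurable_fun setT (EFin \o q) by exact/measurable_EFinP.
apply: (measurableT_comp (f := fine)) => //.
apply: (eq_measurable_fun (fun y => \int[P t r y]_z (EFin \o q)^\+ z - \int[P t r y]_z (EFin \o q)^\- z)%E).
  by move=> y _; rewrite [in RHS]integralE.
by apply: emeasurable_funB; apply: measurable_fun_integral_kernel => //;
  try exact: measurable_kernel; [exact: measurable_funepos|exact: measurable_funeneg].
Qed.

Lemma kint_le t r (q : borel E -> R) y : measurable_fun setT q ->
  (`|kint P t r q y|%:E <= \int[P t r y]_z `|q z|%:E)%E.
Proof.
move=> mq; have mq' : measurable_fun setT (EFin \o q) by exact/measurable_EFinP.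
apply: le_trans (le_abse_integral (P t r y) measurableT mq').
by rewrite /kint /Rintegral; case: (\int[_]_z _)%E => [z| |] //=; rewrite ?normr0 ?leey.
Qed.

Section fixed_time.
Variables (t r : R) (q : borel E -> R).
Hypotheses (st : s <= t) (tr : t <= r) (rT : r <= T).
Hypothesis mq : measurable_fun setT q.
Let tT := le_trans tr rT.
Let sr := le_trans st tr.

Let FT : filtration t (setT : set (Omega T E)).
Proof.
have := X_filtration (E := E) (le_trans s0 st) (lexx t) tT measurableT.
by rewrite preimage_setT.
Qed.

Let mint (p : borel E -> \bar R) : measurable_fun setT p -> (forall y, 0 <= p y)%E ->
  measurable_fun setT (fun w : Omega T E => \int[P t r (X t w)]_y p y)%E.
Proof.
move=> mp p0; apply: (measurableT_comp (f := fun y => \int[P t r y]_z p z)%E) (mX st tT).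
by apply: measurable_fun_integral_kernel => // A mA; exact: measurable_kernel.
Qed.

Let mk : measurable_fun setT (fun w : Omega T E => kint P t r q (X t w)).
Proof. exact: measurableT_comp (measurable_kint t r mq) (mX st tT). Qed.

Lemma kint_abs_le :
  (\int[PP s x]_w `|kint P t r q (X t w)|%:E <= \int[PP s x]_w `|q (X r w)|%:E)%E.
Proof.
have mnq : measurable_fun setT (fun y => `|q y|%:E) by apply/measurable_EFinP; exact: measurableT_comp.
have e := @markov_ge0 t r setT (fun y => `|q y|%:E) st tr rT FT (fun y => normr_ge0 (q y)) mnq.
apply: (@le_trans _ _ (\int[PP s x]_w \int[P t r (X t w)]_y `|q y|%:E)%E); last by rewrite -e.
apply: ge0_le_integral => //.
- by apply/measurable_EFinP; exact: measurableT_comp.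
- exact: mint.
- by move=> w _; exact: kint_le.
Qed.

Hypothesis iq : (PP s x).-integrable setT (fun w => (q (X r w))%:E).

Lemma kint_integrable : (PP s x).-integrable setT (fun w => (kint P t r q (X t w))%:E).
Proof.
apply/integrableP; split; first exact/measurable_EFinP.
by have /integrableP[_] := iq; apply: le_lt_trans; exact: kint_abs_le.
Qed.

Lemma markov_kint B : filtration t B ->
  \int[PP s x]_(w in B) kint P t r q (X t w) = \int[PP s x]_(w in B) q (X r w).
Proof.
move=> FB; have mB : measurable B by apply: (flt_sub (@filtration_onS R T E s s0)) FB; rewrite st.
have mq' : measurable_fun setT (EFin \o q) by exact/measurable_EFinP.
have mp : measurable_fun setT (EFin \o q)^\+%E by exact: measurable_funepos.
have mn : measurable_fun setT (EFin \o q)^\-%E by exact: measurable_funeneg.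
pose Ip (w : Omega T E) := (\int[P t r (X t w)]_y (EFin \o q)^\+ y)%E.
pose In (w : Omega T E) := (\int[P t r (X t w)]_y (EFin \o q)^\- y)%E.
have iI (p : borel E -> \bar R) : measurable_fun setT p -> (forall y, 0 <= p y)%E ->
    (forall y, p y <= `|q y|%:E)%E ->
    (PP s x).-integrable setT (fun w => \int[P t r (X t w)]_y p y)%E.
  move=> mp' p0 pq; apply/integrableP; split; first exact: mint.
  have /integrableP[_] := iq; apply: le_lt_trans.
  under eq_integral => w _ do rewrite gee0_abs ?integral_ge0//.
  rewrite -(markov_ge0 st tr rT FT p0 mp'); apply: ge0_le_integral => //.
  - by apply: measurableT_comp mp' (mX sr rT).
  - apply/measurable_EFinP; apply: measurableT_comp => //.
    exact: measurableT_comp mq (mX sr rT).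
have ip : (PP s x).-integrable setT Ip.
  by apply: iI => // y; rewrite funeposE/= ge_max !lee_fin ler_norm normr_ge0.
have in_ : (PP s x).-integrable setT In.
  by apply: iI => // y; rewrite funenegE/= ge_max !lee_fin normr_ge0 -normrN ler_norm.
rewrite /Rintegral; congr fine.
(* [kint] is [fine] of the integral; it equals the difference of the two parts where both are
   finite, that is almost everywhere. *)
transitivity (\int[PP s x]_(w in B) (Ip w - In w))%E.
  apply: ae_eq_integral => //.
  - by apply: measurable_funTS; exact/measurable_EFinP.
  - by apply: measurable_funTS; apply: emeasurable_funB; [exact: measurable_int ip|exact: measurable_int in_].
  - have := integrable_ae measurableT ip; have := integrable_ae measurableT in_.
    apply: filterS2 => w /(_ I) fn /(_ I) fp _.
    by rewrite /kint /Rintegral integralE fineK// fin_numB fp fn.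
rewrite integralB//; [|exact: integrableS ip|exact: integrableS in_].
rewrite -(markov_ge0 st tr rT FB (fun y => funepos_ge0 _ y) mp).
rewrite -(markov_ge0 st tr rT FB (fun y => funeneg_ge0 _ y) mn).
rewrite [RHS]integralE; congr (_ - _)%E; apply: eq_integral => w _.
  by rewrite !funeposE.
by rewrite !funenegE.
Qed.

Lemma markov_kint_compl (B : set CW) : Flt t B ->
  \int[mu]_(w in B) kint P t r q (X t w) = \int[mu]_(w in B) q (X r w).
Proof.
move=> [B' FB' nB].
have mB' : measurable B' by apply: (flt_sub (@filtration_onS R T E s s0)) FB'; rewrite st.
rewrite (Rintegral_compl_null mB' nB kint_integrable) (Rintegral_compl_null mB' nB iq).
exact: markov_kint.
Qed.

End fixed_time.

Section martingale.
Variables (V : cumulative R R) (U : R -> borel E -> R) (h : R * borel E -> R) (g : borel E -> R) (c : R).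
Notation la := (dV V).
Hypothesis mU : forall t, 0 <= t <= T -> measurable_fun setT (U t).
Hypothesis mh : borel_on_time_space T h.
Hypothesis mg : measurable_fun setT g.
Hypothesis ig : mu.-integrable setT (fun w => (g (X T w))%:E).
Hypothesis ih : ini (dV V) mu `]s, T]%classic (fun r (w : CW) => h (r, X r w)).
Hypothesis UE : forall t y, 0 <= t <= T ->
  U t y = kint P t T g y + c * \int[dV V]_(r in `]t, T]) kint P t r (fun z => h (r, z)) y.

Let hh r (w : CW) := h (r, X r w).
Let ph : prog Flt s T hh. Proof. exact: (prog_comp hdist). Qed.

Let mslice r : 0 <= r <= T -> measurable_fun setT (fun z => h (r, z)).
Proof.
move=> rT; apply: (@measurable_comp _ _ _ _ _ _ (time_space T E) h setT (fun z : borel E => ((r : R), z))) => //.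
- by apply: measurableX => //; exact: measurable_itv.
- by move=> _ [z _ <-]; split => //=; rewrite in_itv.
- exact: pair1_measurable.
Qed.

Let mhX r : s <= r -> r <= T -> measurable_fun setT (fun w : Omega T E => h (r, X r w)).
Proof.
move=> sr rT; apply: (measurableT_comp (f := fun z => h (r, z))); last exact: mX.
by apply: mslice; exact: bounds.
Qed.

Let kk t r (w : CW) := kint P t r (fun z => h (r, z)) (X t w).

Let jkk t : s <= t -> t <= T ->
  measurable_fun ((Ioc R t T) `*` setT) (fun z : TT * CW => kk t z.1 z.2).
Proof.
move=> st tT; have tT' : 0 <= t <= T by exact: bounds.
have mI : measurable (Ioc R t T) by exact: measurable_itv.
have mh' : measurable_fun ((Ioc R t T) `*` (setT : set (borel E))) (h : TT * borel E -> R).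
  apply: measurable_funS mh.
  - by apply: measurableX => //; exact: measurable_itv.
  - move=> [r z] [/= + _]; rewrite in_itv/= => /andP[tr rT]; split => //=.
    by rewrite in_itv/= rT andbT ltW// (le_lt_trans _ tr)//; have /andP[] := tT'.
have jK := joint_kint T0 hdist hPP tT' mh'.
exact: (@joint_comp _ _ CW (borel E) R _ (fun r y => kint P t r (fun z => h (r, z)) y) (X t) mI (mXc st tT) jK).
Qed.

Let igP : (PP s x).-integrable setT (fun w => (g (X T w))%:E).
Proof.
have sT' : s <= T by have /andP[] := sT.
apply: compl_integrable ig; apply/measurable_EFinP.
exact: measurableT_comp mg (mX sT' (lexx T)).
Qed.

Let mUX t : s <= t -> t <= T -> measurable_wrt (Flt t) (fun w : CW => U t (X t w)).
Proof.
move=> st tT B mB; have mUB : measurable (U t @^-1` B).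
  by rewrite -[X in measurable X]setTI; exact: mU (bounds st tT) _ B mB.
exact: (F_compl_X PP x sT st (lexx t) tT mUB).
Qed.

Let kk_le t r : s <= t -> t <= r -> r <= T ->
  (\int[mu]_w `|kk t r w|%:E <= \int[mu]_w `|hh r w|%:E)%E.
Proof.
move=> st tr rT; have sr := le_trans st tr; have tT := le_trans tr rT.
have := kint_abs_le st tr rT (mslice (bounds sr rT)).
have m1 : measurable_fun setT (fun w : Omega T E => `|kk t r w|%:E).
  apply/measurable_EFinP; apply: measurableT_comp => //.
  exact: (measurableT_comp (measurable_kint t r (mslice (bounds sr rT))) (mX st tT)).
have m2 : measurable_fun setT (fun w : Omega T E => `|hh r w|%:E).
  by apply/measurable_EFinP; apply: measurableT_comp => //; exact: mhX.
have e1 := @ge0_integral_compl _ _ _ (PP s x) setT (fun w => `|kk t r w|%:E) measurableT m1 (fun w _ => normr_ge0 (kk t r w)).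
have e2 := @ge0_integral_compl _ _ _ (PP s x) setT (fun w => `|hh r w|%:E) measurableT m2 (fun w _ => normr_ge0 (hh r w)).
by rewrite -e1 -e2.
Qed.

(** Both equations of IP have the form [UE]: the one for [u] with [c = 1], the one for the product
    with [psi i] with [c = -1]. *)
Lemma markov_martingale :
  martingale mu Flt s T (fun t w => U t (X t w) + c * pint V s (fun r => h (r, X r w)) t).
Proof.
have ikg t : s <= t -> t <= T -> mu.-integrable setT (fun w : CW => (kint P t T g (X t w))%:E).
  by move=> st tT; exact: integrable_compl (kint_integrable st tT (lexx T) mg igP).
have kgE t B : s <= t -> t <= T -> Flt t B ->
    \int[mu]_(w in B) kint P t T g (X t w) = \int[mu]_(w in B) g (X T w).
  by move=> st tT FB; exact: (markov_kint_compl st tT (lexx T) mg igP FB).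
have kkE t r B : s <= t -> t <= r -> r <= T -> mu.-integrable setT (EFin \o hh r) -> Flt t B ->
    \int[mu]_(w in B) kk t r w = \int[mu]_(w in B) hh r w.
  move=> st tr rT ir FB; have sr := le_trans st tr.
  have irP : (PP s x).-integrable setT (fun w => (h (r, X r w))%:E).
    by apply: compl_integrable ir; apply/measurable_EFinP; exact: mhX.
  exact: (markov_kint_compl st tr rT (mslice (bounds sr rT)) irP FB).
have UE' t (w : CW) : s <= t -> t <= T ->
    U t (X t w) = kint P t T g (X t w) + c * \int[la]_(r in `]t, T]) kk t r w.
  by move=> st tT; exact: UE (bounds st tT).
exact: (@representation_martingale _ CW R mu Flt s T V c (fun t w => U t (X t w)) hh
  (fun w => g (X T w)) (fun t w => kint P t T g (X t w)) kk hF mUX ph ig ih UE' ikg kgE jkk kk_le kkE).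
Qed.

End martingale.

End markov_property.

(** * Existence: building the solution from the martingales of IP *)

Section regular_paths.
Context d (W : measurableType d) (R : realType) (mu : probability W R).
Variables (Flt : R -> set (set W)) (a b : R) (V : cumulative R R).
Hypothesis us : usual mu Flt a b.
Notation TT := (measurableTypeR R).
Notation I := (Ioc R a b).
Notation pI f w := (dV_integrable V a b (f^~ w)).
Let hF := us_flt us.
Let ab := us_le us.
Let mI : measurable I. Proof. exact: measurable_itv. Qed.

(** Set to zero on the paths where [f] is not integrable, so that integration by parts can be used
    on every path. *)
Definition regular_part (f : R -> W -> R) r w : R := \1_[set w | pI f w] w * f r w.

Lemma regular_int f w : pI (regular_part f) w.
Proof.
rewrite /regular_part indicE; have [h|h] := pselect (pI f w).
  by rewrite mem_set//; apply: eq_integrable h => // r _; rewrite /= mul1r.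
rewrite memNset//; apply: (eq_integrable mI (cst 0%E)) (integrable0 _ _) => r _ /=.
by rewrite mul0r.
Qed.

Lemma regular_ae f : {ae mu, forall w, pI f w} ->
  {ae mu, forall w, forall r, regular_part f r w = f r w}.
Proof. by apply: filterS => w h r; rewrite /regular_part indicE mem_set// mul1r. Qed.

Lemma prog_null (f : R -> W -> R) (A : set W) : {ae mu, forall w, A w} -> prog Flt a b f ->
  prog Flt a b (fun r w => \1_A w * f r w).
Proof.
move=> hA pf t tab; apply: measurable_funM; last exact: pf.
apply: measurable_funTS.
apply: (measurableT_comp (f := \1_A : g_sigma_algebraType (Flt t) -> R)) measurable_snd.
exact: (flt_indic us tab hA).
Qed.

Lemma regular_prog f : {ae mu, forall w, pI f w} -> prog Flt a b f -> prog Flt a b (regular_part f).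
Proof. exact: prog_null. Qed.

Lemma l2_path f : l2 mu a b V f -> {ae mu, forall w, pI f w}.
Proof.
move=> lf; have h := l2_mul lf (rv_l2 V ab (sqi_cst mu 1)).
apply: filterS (ini_path mI h) => w; apply: eq_integrable => // r _ /=.
by rewrite mulr1.
Qed.

Lemma regular_l2 f : prog Flt a b f -> l2 mu a b V f -> l2 mu a b V (regular_part f).
Proof.
move=> pf lf; apply: (le_l2 _ _ lf); last first.
  by move=> r w _; rewrite /regular_part normrM ler_piMl// indicE; case: (_ \in _); rewrite ?normr1 ?normr0.
exact: (prog_joint hF (regular_prog (l2_path lf) pf) (lexx a) (lexx b)).
Qed.

Lemma wrt_ae t (f g : W -> R) : a <= t <= b -> {ae mu, forall w, f w = g w} ->
  measurable_wrt (Flt t) f -> measurable_wrt (Flt t) g.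
Proof.
move=> tab fg mf B mB; have [F0 FC FU] := flt_sigma hF tab.
have := flt_ae us tab fg; set A := [set w | f w = g w] => FA.
have FI C D : Flt t C -> Flt t D -> Flt t (C `&` D).
  move=> hC hD; have sF := flt_sigma hF tab; apply: (g_sigma_measurable sF).
  by apply: measurableI; apply: sub_sigma_algebra.
have FUn C D : Flt t C -> Flt t D -> Flt t (C `|` D).
  move=> hC hD; have sF := flt_sigma hF tab; apply: (g_sigma_measurable sF).
  by apply: measurableU; apply: sub_sigma_algebra.
rewrite (_ : g @^-1` B = (f @^-1` B `&` A) `|` (g @^-1` B `&` ~` A)).
  apply: FUn; first by apply: FI => //; exact: mf.
  apply: (us_complete us tab); apply: negligibleS fg => w [_ nA] e; exact: nA.
apply/seteqP; split => [w /= Bw|w [[/= Bw e]|[]//]]; last by rewrite /A/= in e; rewrite /= -e.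
have [Aw|nA] := pselect (A w); [left; split => //=; by rewrite /A/= in Aw; rewrite Aw|by right].
Qed.

Lemma martingale_ae M M' : martingale mu Flt a b M ->
  (forall t, a <= t <= b -> {ae mu, forall w, M t w = M' t w}) -> martingale mu Flt a b M'.
Proof.
move=> mM e; apply: (modification_martingale hF mM _ e) => t tab.
apply: (wrt_ae tab (e t tab)); exact: mM.1.
Qed.

Lemma sqi_ae (f g : W -> R) : measurable_fun setT g -> {ae mu, forall w, f w = g w} ->
  sqi mu f -> sqi mu g.
Proof.
move=> mg fg [mf fi]; split => //.
have <- : (\int[mu]_w (f w ^+ 2)%:E = \int[mu]_w (g w ^+ 2)%:E)%E; last by [].
apply: ae_eq_integral => //.
- by apply/measurable_EFinP; exact: measurable_funX.
- by apply/measurable_EFinP; exact: measurable_funX.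
- by apply: filterS fg => w -> _.
Qed.

Lemma pint_ae_eq (k l : R -> R) t : t <= b -> measurable_fun I k -> measurable_fun I l ->
  {ae dV V, forall r, I r -> k r = l r} -> pint V a k t = pint V a l t.
Proof.
move=> tb mk ml e; have mt : measurable (Ioc R a t) by exact: measurable_itv.
have sub : (Ioc R a t) `<=` I.
  by move=> r /=; rewrite !in_itv/= => /andP[-> rt]; exact: le_trans tb.
apply: (ae_eq_Rintegral mt (measurable_funS mI sub mk) (measurable_funS mI sub ml)).
by apply: filterS e => r h /sub; exact: h.
Qed.

Lemma cadlag_addB (x y : R -> R) (c : R) : cadlag_on a b x -> cadlag_on a b y ->
  cadlag_on a b (fun t => x t + c - y t).
Proof.
move=> [x1 x2] [y1 y2]; split => t tab.
  by apply: cvgB; [apply: cvgD; [exact: x1|exact: cvg_cst]|exact: y1].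
have [l1 h1] := x2 t tab; have [l2 h2] := y2 t tab.
by exists (l1 + c - l2); apply: cvgB => //; apply: cvgD => //; exact: cvg_cst.
Qed.

Hypothesis natom : no_atom V a b.

Lemma predictable_pint z : prog Flt a b z -> (forall w, pI z w) ->
  predictable_map Flt a b (fun t w => pint V a (z^~ w) t).
Proof.
move=> pz iz.
apply: (@predictable_limit _ _ _ _ _ _ (fun n r w => pint V a (z^~ w) (grid a n (lidx a n r)))).
  move=> n; apply: (@predictable_left_grid _ _ _ _ _ _ hF ab _ _ (fun q w => pint V a (z^~ w) q : R)) => q qab.
  apply/(flt_wrtP hF qab); exact: (prog_pint hF V pz qab).
move=> r w /andP[ar rb]; move: ar; rewrite le_eqVlt => /predU1P[<-|ar].
  apply: cvg_near_cst; apply: nearW => n.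
  by rewrite /lidx subrr mul0r truncn0 eqxx grid0.
apply: (pint_cvg natom (iz w)) => //; last exact: cvg_left_grid.
by move=> n; have /andP[/ltW h _] := lidxP n ar; exact: le_trans rb.
Qed.

Lemma angle_pint M N z : predictable_map Flt a b z -> (forall w, pI z w) ->
  martingale mu Flt a b (fun t w => M t w * N t w - pint V a (z^~ w) t) ->
  angle_bracket mu Flt a b M N (fun t w => pint V a (z^~ w) t).
Proof.
move=> pz iz mz; split => //.
- apply/(predictableP _ ab); apply: predictable_pint => //; exact: predictable_map_prog.
- apply: aeW => w; split; [exact: pint_start|exact: (pint_cadlag natom (iz w))|exact: (pint_bounded_variation (iz w) ab)].
Qed.

Lemma pint_density (z : R -> W -> R) w : pI z w -> RN_density V a b (pint V a (z^~ w)) (z^~ w).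
Proof.
move=> iz; split => // t /andP[at_ tb].
by rewrite pint_start subr0.
Qed.

End regular_paths.

Section bsde_existence.
Context d (W : measurableType d) (R : realType) (mu : probability W R).
Variables (Flt : R -> set (set W)) (a b : R) (V : cumulative R R).
Hypothesis us : usual mu Flt a b.
Hypothesis natom : no_atom V a b.
Notation TT := (measurableTypeR R).
Notation I := (Ioc R a b).
Notation jm f := (measurable_fun (I `*` setT) (fun x : TT * W => f x.1 x.2)).
Notation pI f w := (dV_integrable V a b (f^~ w)).
Let hF := us_flt us.
Let ab := us_le us.
Let mI : measurable I. Proof. exact: measurable_itv. Qed.

Variables (k : nat) (u F : R -> W -> R) (xi : W -> R) (u0 : R).
Variables (v Z Psi al N : 'I_k -> R -> W -> R) (p0 : 'I_k -> R).
Hypotheses (lu : l2 mu a b V u) (pF : prog Flt a b F) (lF : l2 mu a b V F).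
Hypothesis uM : martingale mu Flt a b (fun t w => u t w + pint V a (F^~ w) t).
Hypotheses (uT : {ae mu, forall w, u b w = xi w}) (sxi : sqi mu xi).
Hypothesis ua : {ae mu, forall w, u a w = u0}.
Hypotheses (pv : forall i, prog Flt a b (v i)) (lv : forall i, l2 mu a b V (v i)).
Hypothesis pZ : forall i, predictable_map Flt a b (Z i).
Hypothesis vZ : forall i w, {ae dV V, forall r, I r -> v i r w = Z i r w}.
Hypothesis jPsi : forall i, jm (Psi i).
Hypotheses (pal : forall i, prog Flt a b (al i)) (lal : forall i, l2 mu a b V (al i)).
Hypothesis NE : forall i t w, N i t w = Psi i t w - p0 i - pint V a ((al i)^~ w) t.
Hypothesis mN : forall i, martingale mu Flt a b (N i).
Hypothesis sN : forall i, sqi mu (N i b).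
Hypothesis cN : forall i, ae_cadlag mu a b (N i).
Hypothesis mL : forall i, martingale mu Flt a b (fun t w => u t w * Psi i t w -
  pint V a (fun r => v i r w + u r w * al i r w - Psi i r w * F r w) t).

(** [M] is a regular modification of the martingale given by [u], and [Y] is defined from [M] by the
    equation. [Y] is cadlag and solves it for that reason, and it modifies [u] because [M] modifies
    the original martingale. *)
Lemma bsde_existence : exists Y M : R -> W -> R,
  [/\ forall t, a <= t <= b -> {ae mu, forall w, Y t w = u t w},
  forall t, a <= t <= b -> {ae mu, forall w, M t w = u t w - u0 + pint V a (F^~ w) t},
  adapted Flt a b Y /\ (forall w, cadlag_on a b (Y^~ w)),
  nice mu Flt a b M /\ {ae mu, forall w, M a w = 0} &
  [/\ forall i, exists2 Z', predictable_map Flt a b Z' /\ {ae mu, forall w r, Z' r w = Z i r w} &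
  angle_bracket mu Flt a b M (N i) (fun t w => pint V a (Z'^~ w) t) /\
  forall w, pI Z' w,
  {ae mu, forall w, {ae dV V, forall r, I r -> Y r w = u r w}} &
  {ae mu, forall w, pI F w /\ forall t, a <= t <= b ->
  Y t w = xi w + \int[dV V]_(r in `]t, b]) F r w - (M b w - M t w)}]].
Proof.
have aab : a <= a <= b by rewrite lexx.
have bab : a <= b <= b by rewrite lexx ab.
pose M0 t w := u t w + pint V a (F^~ w) t + - u0.
have mM0 : martingale mu Flt a b M0.
  exact: (martingaleD hF uM (martingale_cst mu hF (- u0))).
have sM0 : sqi mu (M0 b).
  have sq : sqi mu (fun w => xi w + pint V a (F^~ w) b + - u0).
    apply: sqiD; last exact: sqi_cst.
    by apply: sqiD => //; exact: (l2_inner ab lF).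
  apply: (sqi_ae (martingale_measurable hF mM0 bab) _ sq).
  by apply: filterS uT => w e; rewrite /M0 e.
(* No path regularity of [u] is available, so agreement with [M0] is at each fixed time. *)
have [M nM eM] := nice_modification us mM0 sM0.
pose F' := regular_part a b V F.
have eF : {ae mu, forall w, forall r, F' r w = F r w} by exact: regular_ae (l2_path us lF).
have pF' : prog Flt a b F' by exact: (regular_prog us (l2_path us lF) pF).
have iF' w : pI F' w by exact: regular_int.
have lF' := regular_l2 us pF lF.
have epF : {ae mu, forall w t, pint V a (F'^~ w) t = pint V a (F^~ w) t}.
  by apply: filterS eF => w e t; apply: eq_pint => r _; exact: e.
have mZ i w : measurable_fun I ((Z i)^~ w).
  have gZ : prog Flt a b (Z i) by exact: predictable_map_prog.
  apply: (measurable_pathI mI (f := Z i)); exact: (prog_joint hF gZ (lexx a) (lexx b)).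
pose Y t w := M t w + u0 - pint V a (F'^~ w) t.
have uE t : a <= t <= b -> {ae mu, forall w, u t w = Y t w}.
  move=> tab; move: (eM t tab) epF; apply: filterS2 => w e1 e2.
  by rewrite /Y -e1 e2 /M0; ring.
have aY : adapted Flt a b Y.
  move=> t tab; apply/(flt_wrtP hF tab); apply: measurable_funB.
    apply: measurable_funD => //; apply/(flt_wrtP hF tab).
    by case: nM => -[+ _] _ _ _; exact.
  by apply/(flt_wrtP hF tab); exact: (prog_pint hF V pF' tab).
have cY w : cadlag_on a b (Y^~ w).
  apply: cadlag_addB; last exact: (pint_cadlag natom (iF' w)).
  by case: nM.
have pY : prog Flt a b Y by apply: (rcont_prog hF aY) => w r; have [+ _] := cY w; exact.
exists Y, M; split.
- by move=> t tab; apply: filterS (uE t tab) => w ->.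
- by move=> t tab; apply: filterS (eM t tab) => w <-; rewrite /M0; ring.
- by [].
- split => //; move: (eM a aab) ua; apply: filterS2 => w <- e.
  by rewrite /M0 e pint_start; ring.
- split.
  + move=> i; pose Z' := regular_part a b V (Z i).
    have aZ : {ae mu, forall w, pI (Z i) w}.
    apply: filterS (l2_path us (lv i)) => w; apply: (ae_eq_integrable mI (mZ i w)).
    exact: vZ.
    have eZ := regular_ae aZ.
    have pZ' : predictable_map Flt a b Z' by apply: (predictable_null us) => //; exact: aZ.
    pose v' := regular_part a b V (v i). pose al' := regular_part a b V (al i).
    have pv' : prog Flt a b v' by exact: (regular_prog us (l2_path us (lv i)) (pv i)).
    have pal' : prog Flt a b al' by exact: (regular_prog us (l2_path us (lal i)) (pal i)).
    have ev := regular_ae (l2_path us (lv i)).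
    have eal := regular_ae (l2_path us (lal i)).
    have [N' nN' eN] := nice_version us (mN i) (sN i) (cN i).
    have hPsi t : a <= t <= b -> {ae mu, forall w, Psi i t w = N' t w + p0 i + pint V a (al'^~ w) t}.
    move=> tab; move: eN eal; apply: filterS2 => w e1 e2.
    have e3 : pint V a (al'^~ w) t = pint V a ((al i)^~ w) t by apply: eq_pint => r _; exact: e2.
    by rewrite -e1 NE e3; ring.
    have mLi : martingale mu Flt a b (fun t w => u t w * Psi i t w -
    pint V a (fun r => v' r w + u r w * al' r w - Psi i r w * F' r w) t).
    apply: (martingale_ae us (mL i)) => t /andP[_ tb]; move: eF ev eal.
    apply: filterS3 => w e1 e2 e3; congr (_ - _); apply: eq_pint => r _.
    by rewrite /v' /al' e1 e2 e3.
    have lal' : l2 mu a b V al' by exact: (regular_l2 us (pal i) (lal i)).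
    have ial' w : pI al' w by exact: regular_int.
    have iv' w : pI v' w by exact: regular_int.
    have ju : jm u by case: lu.
    have bi : martingale mu Flt a b (fun t w => M t w * N' t w - pint V a (v'^~ w) t).
    exact: (@bracket_identity _ W R mu Flt a b V us natom M N' F' al' v' u (Psi i) u0 (p0 i)
    nM nN' pF' pal' pv' lF' lal' iF' ial' iv' ju (jPsi i) uE hPsi mLi).
    have iZ' w : pI Z' w by exact: regular_int.
    (* Passage from the progressive [v] to the predictable [Z]: on each path they agree at almost
       every time, so their integrals coincide. *)
    have bZ : martingale mu Flt a b (fun t w => M t w * N i t w - pint V a (Z'^~ w) t).
    apply: (martingale_ae us bi) => t /andP[_ tb]; move: eN ev eZ.
    apply: filterS3 => w e1 e2 e3; rewrite e1; congr (_ - _).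
    rewrite (eq_pint V (l := (v i)^~ w)); last by move=> r _; exact: e2.
    rewrite [RHS](eq_pint V (l := (Z i)^~ w)); last by move=> r _; exact: e3.
    apply: (pint_ae_eq tb _ (mZ i w) (vZ i w)).
    apply: (measurable_pathI mI (f := v i)).
    exact: (prog_joint hF (pv i) (lexx a) (lexx b)).
    by exists Z'; split; [exact: pZ'|exact: eZ|exact: (angle_pint us natom pZ' iZ' bZ)|exact: iZ'].
  + apply: ae_time_eq; [|by case: lu|].
    exact: (prog_joint hF pY (lexx a) (lexx b)).
    by move=> t /andP[at_ tb]; apply: filterS (uE t _) => [w ->//|]; rewrite ltW.
  + have h4 : {ae mu, forall w, M0 b w = M b w /\ u b w = xi w}.
    by move: (eM b bab) uT; apply: filterS2 => w.
    move: h4 epF (l2_path us lF); apply: filterS3 => w [e1 e2] e3 iFw; split => //.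
    move=> t /andP[at_ tb]; have sp := pint_split iFw at_ tb (lexx b).
    rewrite /Y e3 -e1 /M0 e2 sp; ring.
Qed.

End bsde_existence.

(** Monotonicity without measurability, from the supremum over simple functions. The process [Y] of
    a solution is cadlag only almost surely, hence not known to be jointly measurable. *)
Lemma le_nonneg_integral d (W : measurableType d) (R : realType) (mu : {measure set W -> \bar R})
  (f g : W -> \bar R) : (forall w, 0 <= f w)%E -> (forall w, f w <= g w)%E ->
  (\int[mu]_w f w <= \int[mu]_w g w)%E.
Proof.
move=> f0 fg; have g0 w : (0 <= g w)%E by exact: le_trans (f0 w) (fg w).
rewrite !ge0_integralTE//; apply: le_ereal_sup => _ [h hf <-]; exists h => // w.
exact: le_trans (hf w) (fg w).
Qed.

(** * Uniqueness under a Lipschitz driver *)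

Section bsde_uniqueness.
Context d (W : measurableType d) (R : realType) (mu : probability W R).
Variables (Flt : R -> set (set W)) (a b : R) (V : cumulative R R).
Hypothesis us : usual mu Flt a b.
Hypothesis natom : no_atom V a b.
Notation TT := (measurableTypeR R).
Notation I := (Ioc R a b).
Notation pI f w := (dV_integrable V a b (f^~ w)).
Let hF := us_flt us.
Let ab := us_le us.
Let mI : measurable I. Proof. exact: measurable_itv. Qed.

Lemma nice_null (M : R -> W -> R) (A : set W) : {ae mu, forall w, A w} -> nice mu Flt a b M ->
  nice mu Flt a b (fun t w => \1_A w * M t w).
Proof.
move=> hA [mM sM cM [G iG bG]]; split.
- exact: (martingale_null us hA mM).
- exact: (sqi_null us hA sM).
- by move=> w; apply: cadlag_null => _; exact: cM.
- exists G => // w t tab; apply: le_trans (bG w t tab).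
  rewrite indicE; case: (_ \in _); rewrite ?mul1r// mul0r expr0n/=; exact: sqr_ge0.
Qed.

(** [G] is bounded at almost every time of almost every path. Clipping to [- c, c] leaves the
    integrals unchanged there and gives a density bounded everywhere, as [bracket_bound]
    requires. *)
Lemma bounded_density (N G : R -> W -> R) (B : R -> W -> R) (c : R) : 0 <= c ->
  martingale mu Flt a b N -> sqi mu (N b) -> ae_cadlag mu a b N -> prog Flt a b G ->
  {ae mu, forall w, {ae dV V, forall r, I r -> `|G r w| <= c}} ->
  angle_bracket mu Flt a b N N B ->
  {ae mu, forall w, RN_density V a b (B^~ w) (G^~ w)} ->
  exists2 N', nice mu Flt a b N' /\ {ae mu, forall w t, N t w = N' t w} &
  bracket_le mu Flt V a b c N'.
Proof.
move=> c0 mN sN cN pG bG [_ B0 mB] dB.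
have [N' nN' eN] := nice_version us mN sN cN.
exists N'; first by split.
pose Gc r w := Num.max (- c) (Num.min c (G r w)).
have mc : measurable_fun setT (fun x : R => Num.max (- c) (Num.min c x)).
  by apply: measurable_maxr => //; exact: measurable_minr.
have pGc : prog Flt a b Gc by move=> t tab; exact: measurableT_comp mc (pG t tab).
have bGc r w : `|Gc r w| <= c.
  rewrite /Gc ler_norml le_max lexx/= ge_max ge_min lexx/= andbT.
  by apply: (@le_trans _ _ 0) => //; rewrite oppr_le0.
have mGw (g : R -> W -> R) w : prog Flt a b g -> measurable_fun I (g^~ w).
  move=> pg; apply: (measurable_pathI mI (f := g)); exact: (prog_joint hF pg (lexx a) (lexx b)).
have iGc w : pI Gc w.
  apply: measurable_bounded_integrable => //; [exact: dV_itv_lty|exact: mGw|].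
  by exists c; split; [exact: num_real|move=> z cz r _; apply: le_trans (bGc r w) (ltW cz)].
apply: (bracket_bound us nN' iGc (fun r w _ => bGc r w)).
apply: (martingale_ae us mB) => t /[dup] tab /andP[at_ tb].
have h1 : {ae mu, forall w, B t w = pint V a (Gc^~ w) t}.
  move: B0 dB bG; apply: filterS3 => w [b0 _ _] [_ e] hb.
  have := e t tab; rewrite b0 subr0 => ->.
  apply: (pint_ae_eq tb (mGw _ w pG) (mGw _ w pGc)).
  apply: filterS hb => r h /h; rewrite ler_norml => /andP[h2 h3].
  by rewrite /Gc min_r// max_r.
by move: eN h1; apply: filterS2 => w e1 e2; rewrite e1 e2.
Qed.

Variables (k : nat) (N : 'I_k -> R -> W -> R) (xi : W -> R) (K : R).
Variable ff : R -> W -> R -> ('I_k -> R) -> R.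
Hypothesis mN : forall i, martingale mu Flt a b (N i).
Hypothesis pff : forall y (z : 'I_k -> R -> W -> R), prog Flt a b y -> (forall i, prog Flt a b (z i)) ->
  prog Flt a b (fun r w => ff r w (y r w) (fun i => z i r w)).
Hypothesis K0 : 0 <= K.
Hypothesis lip : forall r w y y' z z', a < r <= b ->
  `|ff r w y z - ff r w y' z'| <= K * (`|y - y'| + \sum_(i < k) `|z i - z' i|).

(** [BSDE_solution] over an arbitrary filtered space, the driver being a random field [ff]. *)
Definition abstract_solution (Y M : R -> W -> R) : Prop :=
  [/\ adapted Flt a b Y, ae_cadlag mu a b Y,
  (\int[mu]_w \int[dV V]_(r in `]a, b]) (Y r w ^+ 2)%:E < +oo)%E,
  sqint_martingale mu Flt a b M /\ {ae mu, forall w, M a w = 0} &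
  exists A Z : 'I_k -> R -> W -> R,
  [/\ forall i, angle_bracket mu Flt a b M (N i) (A i),
  forall i, predictable Flt a b (Z i),
  forall i, {ae mu, forall w, RN_density V a b (A i ^~ w) (Z i ^~ w)} &
  {ae mu, forall w, pI (fun r w => ff r w (Y r w) (fun i => Z i r w)) w /\
  forall t, a <= t <= b -> Y t w = xi w +
  \int[dV V]_(r in `]t, b]) ff r w (Y r w) (fun i => Z i r w) - (M b w - M t w)}]].

(** The bracket is here replaced by the martingale property it encodes, and regularity is required
    on every path. *)
Definition regular_solution (Y M : R -> W -> R) : Prop :=
  [/\ adapted Flt a b Y, forall w, cadlag_on a b (Y^~ w), l2 mu a b V Y,
  nice mu Flt a b M /\ {ae mu, forall w, M a w = 0} &
  exists2 Z : 'I_k -> R -> W -> R, forall i, [/\ predictable_map Flt a b (Z i),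
  forall w, pI (Z i) w & martingale mu Flt a b (fun t w => M t w * N i t w - pint V a ((Z i)^~ w) t)] &
  {ae mu, forall w, pI (fun r w => ff r w (Y r w) (fun i => Z i r w)) w /\
  forall t, a <= t <= b -> Y t w = xi w +
  \int[dV V]_(r in `]t, b]) ff r w (Y r w) (fun i => Z i r w) - (M b w - M t w)}].

Lemma regularize Y M : abstract_solution Y M -> exists Y' M',
  regular_solution Y' M' /\ {ae mu, forall w t, Y t w = Y' t w /\ M t w = M' t w}.
Proof.
move=> [aY cY Y2 [[mM cM M2] Ma] [A [Z [hA hZ hD hE]]]].
pose D := [set w | cadlag_on a b (Y^~ w)].
pose Y' t w := \1_D w * Y t w.
have eY : {ae mu, forall w t, Y t w = Y' t w} by exact: indic_null cY.
have aY' : adapted Flt a b Y' by exact: (adapted_null us cY aY).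
have cY' w : cadlag_on a b (Y'^~ w) by exact: cadlag_null.
have pY' : prog Flt a b Y' by apply: (rcont_prog hF aY') => w r; have [+ _] := cY' w; exact.
have bab : a <= b <= b by rewrite lexx ab.
have sM : sqi mu (M b) by split; [exact: (martingale_measurable hF mM bab)|exact: M2].
have [M' nM' eM] := nice_version us mM sM cM.
have pZ i : predictable_map Flt a b (Z i) by apply/(predictableP _ ab); exact: hZ.
pose Z' i := regular_part a b V (Z i).
have aZ i : {ae mu, forall w, pI (Z i) w} by apply: filterS (hD i) => w [].
have eZ i : {ae mu, forall w r, Z' i r w = Z i r w} by exact: regular_ae (aZ i).
have eZa : {ae mu, forall w, forall i r, Z' i r w = Z i r w}.
  by apply: filter_forall => i; exact: eZ.
exists Y', M'; split; last by move: eY eM; apply: filterS2 => w e1 e2 t; split.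
split => //.
- apply: l2_iter; first exact: (prog_joint hF pY' (lexx a) (lexx b)).
  apply: le_lt_trans Y2; apply: le_nonneg_integral => w.
    by apply: integral_ge0 => r _; rewrite lee_fin sqr_ge0.
  rewrite /Y' indicE; case: (_ \in _); first by under eq_integral do rewrite mul1r.
  rewrite integral0_eq; last by move=> r _; rewrite mul0r expr0n.
  by apply: integral_ge0 => r _; rewrite lee_fin sqr_ge0.
- split => //; move: Ma eM; apply: filterS2 => w e1 e2.
  by rewrite -e2.
- exists Z'.
    move=> i; split.
    + by apply: (predictable_null us) => //; exact: aZ.
    + by move=> w; exact: regular_int.
    + have [_ A0 mA] := hA i.
    apply: (martingale_ae us mA) => t tab; have /andP[_ tb] := tab.
    have h1 : {ae mu, forall w, A i t w = pint V a ((Z' i)^~ w) t}.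
    move: A0 (hD i) (eZ i); apply: filterS3 => w [b0 _ _] [_ e] ez.
    have := e t tab; rewrite b0 subr0 => ->.
    by apply: eq_pint => r _; rewrite ez.
    by move: eM h1; apply: filterS2 => w e1 e2; rewrite e1 e2.
  have eP : {ae mu, forall w r, ff r w (Y r w) (fun i => Z i r w) = ff r w (Y' r w) (fun i => Z' i r w)}.
    move: eY eZa; apply: filterS2 => w e1 e2 r; rewrite -e1; congr (ff _ _ _ _).
    by apply/funext => i; rewrite e2.
  have eYM : {ae mu, forall w t, Y t w = Y' t w /\ M t w = M' t w}.
    by move: eY eM; apply: filterS2 => w e1 e2 t; split.
  move: eP eYM hE; apply: filterS3 => w e1 e2 [h1 h2]; split.
    by apply: (eq_integrable mI) h1 => r _; rewrite /= e1.
  move=> t tab; have [<- <-] := e2 t; have [_ <-] := e2 b; rewrite h2//.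
  congr (_ + _ - _); apply: (@eq_Rintegral _ _ _ (dV V) `]t, b]%classic (fun r => ff r w (Y' r w) (fun i => Z' i r w))) => r _.
  exact: e1.
Qed.

Variable c : R.
Hypothesis c0 : 0 < c.
Hypothesis hN : forall i, exists2 N', nice mu Flt a b N' /\ {ae mu, forall w t, N i t w = N' t w} &
  bracket_le mu Flt V a b c N'.

(** The difference satisfies an equation with terminal value 0 and a driver of linear growth in the
    differences, to which [bsde_zero] applies. The constant value of the martingale difference is 0
    because both start at 0. *)
Lemma regular_unique Y1 M1 Y2 M2 : regular_solution Y1 M1 -> regular_solution Y2 M2 ->
  {ae mu, forall w t, a <= t <= b -> Y1 t w = Y2 t w /\ M1 t w = M2 t w}.
Proof.
move=> [aY1 cY1 l1 [nM1 M1a] [Z1 hZ1 hE1]] [aY2 cY2 l2' [nM2 M2a] [Z2 hZ2 hE2]].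
pose N' i := sval (cid2 (hN i)).
have nN' i : nice mu Flt a b (N' i) by rewrite /N'; case: cid2 => ? [].
have eN i : {ae mu, forall w t, N i t w = N' i t w} by rewrite /N'; case: cid2 => ? [].
have bN i : bracket_le mu Flt V a b c (N' i).
  by rewrite /N'; case: cid2 => ? ? hb; exact: hb.
pose Phi1 r w := ff r w (Y1 r w) (fun i => Z1 i r w).
pose Phi2 r w := ff r w (Y2 r w) (fun i => Z2 i r w).
(* The paths on which both equations hold at all times. Multiplication by its indicator makes the
   equation of the difference true for every [w]. *)
pose D := [set w | (pI Phi1 w /\ forall t, a <= t <= b -> Y1 t w = xi w +
    \int[dV V]_(r in `]t, b]) Phi1 r w - (M1 b w - M1 t w)) /\
  (pI Phi2 w /\ forall t, a <= t <= b -> Y2 t w = xi w +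
    \int[dV V]_(r in `]t, b]) Phi2 r w - (M2 b w - M2 t w))].
have hD : {ae mu, forall w, D w} by move: hE1 hE2; apply: filterS2.
pose y t w := \1_D w * (Y1 t w - Y2 t w).
pose m t w := \1_D w * (-1 * M2 t w + M1 t w).
pose z i r w := Z1 i r w - Z2 i r w.
pose phi r w := \1_D w * (Phi1 r w - Phi2 r w).
have pY1 : prog Flt a b Y1 by apply: (rcont_prog hF aY1) => w r; have [+ _] := cY1 w; exact.
have pY2 : prog Flt a b Y2 by apply: (rcont_prog hF aY2) => w r; have [+ _] := cY2 w; exact.
have pz i : predictable_map Flt a b (z i).
  by have [p1 _ _] := hZ1 i; have [p2 _ _] := hZ2 i; exact: measurable_funB.
have iz i w : pI (z i) w.
  by have [_ i1 _] := hZ1 i; have [_ i2 _] := hZ2 i; exact: path_intB.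
have nm : nice mu Flt a b m by apply: nice_null => //; exact: nice_linear.
have mX i : martingale mu Flt a b (fun t w => m t w * N' i t w - pint V a ((z i)^~ w) t).
  have [_ i1 x1] := hZ1 i; have [_ i2 x2] := hZ2 i.
  apply: (martingale_ae us (martingaleB hF x1 x2)) => t /andP[_ tb].
  move: hD (eN i); apply: filterS2 => w Dw e.
  rewrite /m indicE (mem_set Dw) mul1r e (pintB tb (i1 w) (i2 w)); ring.
have ay : adapted Flt a b y.
  apply: (adapted_null us hD (M := fun t w => Y1 t w - Y2 t w)) => t tab.
  apply/(flt_wrtP hF tab); apply: measurable_funB.
    by apply/(flt_wrtP hF tab); exact: aY1.
  by apply/(flt_wrtP hF tab); exact: aY2.
have py : prog Flt a b y.
  by apply: (prog_null us hD (f := fun t w => Y1 t w - Y2 t w)) => t tab; apply: measurable_funB; [exact: pY1|exact: pY2].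
have pP1 : prog Flt a b Phi1.
  by apply: pff => // i; have [p1 _ _] := hZ1 i; exact: predictable_map_prog.
have pP2 : prog Flt a b Phi2.
  by apply: pff => // i; have [p1 _ _] := hZ2 i; exact: predictable_map_prog.
have pphi : prog Flt a b phi.
  by apply: (prog_null us hD (f := fun t w => Phi1 t w - Phi2 t w)) => t tab; apply: measurable_funB; [exact: pP1|exact: pP2].
have iphi w : pI phi w.
  have [Dw|nD] := pselect (D w).
    have [[i1 _] [i2 _]] := Dw.
    apply: (eq_integrable mI) (path_intB i1 i2) => r _.
    by rewrite /phi /= indicE mem_set// mul1r.
  apply: (eq_integrable mI (cst 0%E)) (integrable0 _ _) => r _.
  by rewrite /phi /= indicE memNset// mul0r.
have yE t w : a <= t <= b -> y t w = \int[dV V]_(r in `]t, b]) phi r w - (m b w - m t w).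
  move=> tab; have /andP[at_ tb] := tab; have [Dw|nD] := pselect (D w).
    have [[i1 e1] [i2 e2]] := Dw.
    have -> : \int[dV V]_(r in `]t, b]) phi r w =
    \int[dV V]_(r in `]t, b]) Phi1 r w - \int[dV V]_(r in `]t, b]) Phi2 r w.
    rewrite -RintegralB; [|exact: measurable_itv|exact: (path_integrableS i1 at_ (lexx b))|exact: (path_integrableS i2 at_ (lexx b))].
    apply: (@eq_Rintegral _ _ _ (dV V) `]t, b]%classic (fun r => Phi1 r w - Phi2 r w)) => r _.
    by rewrite /phi indicE mem_set// mul1r.
    rewrite /y /m indicE mem_set// !mul1r (e1 t tab) (e2 t tab); ring.
  have -> : \int[dV V]_(r in `]t, b]) phi r w = \int[dV V]_(r in `]t, b]) (cst 0 r : R).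
    apply: (@eq_Rintegral _ _ _ (dV V) `]t, b]%classic (cst 0)) => r _.
    by rewrite /phi indicE memNset// mul0r.
  by rewrite Rintegral_cst//= mul0r /y /m indicE memNset// !mul0r !subr0.
have hphi r w : a < r <= b -> `|phi r w| <= K * (`|y r w| + \sum_(i < k) `|z i r w|).
  move=> rab; have [Dw|nD] := pselect (D w).
    by rewrite /phi /y indicE mem_set// !mul1r; exact: lip.
  rewrite /phi /y indicE memNset// !mul0r normr0 add0r mulr_ge0// sumr_ge0//.
have ly : l2 mu a b V y.
  apply: (le_l2 _ _ (l2D l1 (l2Z (-1) l2'))).
    exact: (prog_joint hF py (lexx a) (lexx b)).
  move=> r w _; rewrite /y normrM mulN1r ler_piMl// indicE.
  by case: (_ \in _); rewrite ?normr1 ?normr0.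
have y2 : (\int[mu]_w \int[dV V]_(r in `]a, b]) (y r w ^+ 2)%:E < +oo)%E.
  by rewrite (iter_EI ly) ltry.
have zero t := bsde_zero us natom nm nN' pz iz mX c0 bN ay py pphi iphi yE K0 hphi y2 (t := t).
have aab : a <= a <= b by rewrite lexx.
have Yt t : a <= t <= b -> {ae mu, forall w, Y1 t w = Y2 t w}.
  move=> tab; have [h _] := zero t tab; move: hD h; apply: filterS2 => w Dw.
  by rewrite /y indicE mem_set// mul1r => /eqP; rewrite subr_eq0 => /eqP.
have mb : {ae mu, forall w, m b w = 0}.
  have [_ h] := zero a aab.
  have h0 : {ae mu, forall w, m a w = 0}.
    by move: M1a M2a; apply: filterS2 => w e1 e2; rewrite /m e1 e2; ring.
  by move: h h0; apply: filterS2 => w ->.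
have Mt t : a <= t <= b -> {ae mu, forall w, M1 t w = M2 t w}.
  move=> tab; have [_ h] := zero t tab; move: hD h mb; apply: filterS3 => w Dw e1.
  by rewrite e1 /m indicE mem_set// mul1r mulN1r addrC => /eqP; rewrite subr_eq0 => /eqP.
have rc (x : R -> W -> R) : (forall w, cadlag_on a b (x^~ w)) ->
    {ae mu, forall w r, a <= r < b -> x q w @[q --> r^'+] --> x r w}.
  by move=> cx; apply: aeW => w r; have [+ _] := cx w; exact.
have cM1 w : cadlag_on a b (M1^~ w) by case: nM1.
have cM2 w : cadlag_on a b (M2^~ w) by case: nM2.
have h1 := indistinguishable ab (rc _ cY1) (rc _ cY2) Yt.
have h2 := indistinguishable ab (rc _ cM1) (rc _ cM2) Mt.
by move: h1 h2; apply: filterS2 => w e1 e2 t tab; split; [exact: e1|exact: e2].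
Qed.

Lemma abstract_unique Y1 M1 Y2 M2 : abstract_solution Y1 M1 -> abstract_solution Y2 M2 ->
  {ae mu, forall w t, a <= t <= b -> Y1 t w = Y2 t w /\ M1 t w = M2 t w}.
Proof.
move=> /regularize[Y1' [M1' [s1 e1]]] /regularize[Y2' [M2' [s2 e2]]].
move: (regular_unique s1 s2) e1 e2; apply: filterS3 => w h h1 h2 t tab.
by have [-> ->] := h1 t; have [-> ->] := h2 t; exact: h.
Qed.

End bsde_uniqueness.

Lemma measurable_time_pair d1 d2 (W : measurableType d1) (Y : measurableType d2) (R : realType)
  (D : set (measurableTypeR R * W)) (h : measurableTypeR R * W -> Y) : measurable_fun D h ->
  measurable_fun D (fun q : measurableTypeR R * W => ((q.1 : R), h q)).
Proof. by move=> mh; apply: measurable_fun_pairD mh; apply: measurable_funTS; exact: measurable_fst. Qed.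

Lemma euclidean_norm_le_sum (R : realType) (k : nat) (z : 'I_k -> R) :
  euclidean_norm z <= \sum_(i < k) `|z i|.
Proof.
rewrite /euclidean_norm -(ger0_norm (sumr_ge0 _ (fun i _ => normr_ge0 (z i)))) -sqrtr_sqr.
apply: ler_wsqrtr; elim: k z => [|k IH] z; first by rewrite !big_ord0 expr0n.
rewrite !big_ord_recl; have := IH (fun i => z (lift ord0 i)).
have : 0 <= \sum_(i < k) `|z (lift ord0 i)| by exact: sumr_ge0.
have := normr_ge0 (z ord0); rewrite -(real_normK (num_real (z ord0))).
set s1 := \sum_(i < k) _ ^+ 2; set s2 := \sum_(i < k) `|_|; set x := `|z ord0|.
by move=> *; rewrite sqrrD; nra.
Qed.

Lemma measurable_driver (R : realType) (T : R) (E : ptopologicalType) (k : nat)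
  (f : R * borel E * R * k.-tuple R -> R) d (W : measurableType d) (D : set W)
  (p : W -> R * borel E) (y : W -> R) (z : 'I_k -> W -> R) : measurable D ->
  measurable_fun [set q | 0 <= q.1.1.1 <= T] f ->
  measurable_fun D p -> measurable_fun D y -> (forall i, measurable_fun D (z i)) ->
  (forall w, D w -> 0 <= (p w).1 <= T) ->
  measurable_fun D (fun w => f (p w, y w, [tuple z i w | i < k])).
Proof.
move=> mD mf mp my mz pD.
have mS : measurable [set q : R * borel E * R * k.-tuple R | 0 <= q.1.1.1 <= T].
  have m3 : measurable_fun setT (fun q : R * borel E * R * k.-tuple R => q.1.1.1).
    by apply: measurableT_comp measurable_fst _; apply: measurableT_comp measurable_fst measurable_fst.
  rewrite (_ : [set q | _] = setT `&` (fun q : R * borel E * R * k.-tuple R => q.1.1.1) @^-1` `[0, T]%classic).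
    by apply: m3 => //; exact: measurable_itv.
  by rewrite setTI; apply/seteqP; split => q; rewrite /= in_itv.
have mtup : measurable_fun D (fun w => [tuple z i w | i < k]).
  apply: (eq_measurable_fun (fun w => [tuple (z i \_ D) w | i < k])).
    by move=> w wD; apply: eq_from_tnth => i; rewrite !tnth_mktuple patchE wD.
  apply: measurable_funTS; apply/measurable_fun_tnthP => i.
  apply: (eq_measurable_fun (z i \_ D)); first by move=> w _; rewrite /= tnth_mktuple.
  exact/(measurable_restrictT _ mD).
apply: (measurable_comp mS _ mf).
  by move=> _ [w wD <-]; exact: pD.
exact: measurable_fun_pairD (measurable_fun_pairD mp my) mtup.
Qed.

Lemma l2_ae d (W : measurableType d) (R : realType) (mu : probability W R) (a b : R)
  (V : cumulative R R) (f g : R -> W -> R) :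
  measurable_fun ((Ioc R a b) `*` setT) (fun x : measurableTypeR R * W => f x.1 x.2) ->
  l2 mu a b V g ->
  {ae mu, forall w, {ae dV V, forall r, (Ioc R a b) r -> f r w = g r w}} -> l2 mu a b V f.
Proof.
move=> jf lg fg; have mI : measurable (Ioc R a b) by exact: measurable_itv.
have [jg _] := lg; apply: l2_iter => //.
have fin : (\int[mu]_w \int[dV V]_(r in `]a, b]) (g r w ^+ 2)%:E < +oo)%E by rewrite (iter_EI lg) ltry.
have sq (h : R -> W -> R) : measurable_fun ((Ioc R a b) `*` setT) (fun x : measurableTypeR R * W => h x.1 x.2) ->
    measurable_fun ((Ioc R a b) `*` setT) (fun x : measurableTypeR R * W => (h x.1 x.2 ^+ 2)%:E).
  by move=> mh; apply/measurable_EFinP; exact: measurable_funX.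
have mo (h : R -> W -> R) mh := measurable_inner (dV V) mI (f := fun r w => (h r w ^+ 2)%:E) (sq h mh) (fun r w _ => sqr_ge0 (h r w)).
suff -> : (\int[mu]_w \int[dV V]_(r in `]a, b]) (f r w ^+ 2)%:E =
  \int[mu]_w \int[dV V]_(r in `]a, b]) (g r w ^+ 2)%:E)%E by [].
apply: ae_eq_integral => //; [exact: mo|exact: mo|].
apply: filterS fg => w e _.
have e2 : {ae dV V, forall r, (Ioc R a b) r -> (f r w ^+ 2)%:E = (g r w ^+ 2)%:E}.
  by apply: filterS e => r h /h ->.
apply: ae_eq_integral => //.
- by apply: (measurable_pathI mI (f := fun r w => (f r w ^+ 2)%:E)); exact: sq.
- by apply: (measurable_pathI mI (f := fun r w => (g r w ^+ 2)%:E)); exact: sq.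
Qed.

Lemma ae_ae0 d (W : measurableType d) (R : realType) (mu : probability W R) (a b : R)
  (V : cumulative R R) (f : R -> W -> R) : (forall r w, 0 <= f r w) ->
  measurable_fun ((Ioc R a b) `*` setT) (fun x : measurableTypeR R * W => f x.1 x.2) ->
  (\int[mu]_w \int[dV V]_(r in `]a, b]) (f r w)%:E = 0)%E ->
  {ae mu, forall w, {ae dV V, forall r, (Ioc R a b) r -> f r w = 0}}.
Proof.
move=> f0 jf e; have mI : measurable (Ioc R a b) by exact: measurable_itv.
have jf' : measurable_fun ((Ioc R a b) `*` setT) (fun x : measurableTypeR R * W => (f x.1 x.2)%:E).
  exact/measurable_EFinP.
have mo := measurable_inner (dV V) mI (f := fun r w => (f r w)%:E) jf' (fun r w _ => f0 r w).
have i0 w : (0 <= \int[dV V]_(r in `]a, b]) (f r w)%:E)%E by apply: integral_ge0 => r _; rewrite lee_fin.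
have e1 : (\int[mu]_w `|\int[dV V]_(r in `]a, b]) (f r w)%:E| = 0)%E.
  by rewrite -[RHS]e; apply: eq_integral => w _; rewrite gee0_abs.
have /(ae_eq_integral_abs mu measurableT mo) := e1.
apply: filterS => w /= /(_ I) ew.
have mw : measurable_fun (Ioc R a b) (fun r => (f r w)%:E).
  exact: (measurable_pathI mI (f := fun r w => (f r w)%:E)).
have ew1 : (\int[dV V]_(r in `]a, b]) `|(f r w)%:E| = 0)%E.
  by rewrite -[RHS]ew; apply: eq_integral => r _; rewrite gee0_abs// lee_fin.
have /(ae_eq_integral_abs (dV V) mI mw) := ew1.
by apply: filterS => r /= h Ir; have [] := h Ir.
Qed.

(** * The BSDE on the canonical space *)

Section canonical_bsde.
Context {R : realType} (T : R) (E : ptopologicalType) (dist : E -> E -> R) (k : nat).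
Hypothesis T0 : 0 <= T.
Hypothesis hdist : metrizes dist.
Notation TT := (measurableTypeR R).
Variables (P : R -> R -> R.-pker borel E ~> borel E).
Hypothesis hP : transition_kernel T P.
Variables (PP : R -> borel E -> probability (Omega T E) R).
Hypothesis hPP : canonical_markov_class P PP.
Variable V : cumulative R R.
Hypothesis hV : {within `[0, T], continuous V}.
Variables (Da : set (R * borel E -> R)) (a : (R * borel E -> R) -> R * borel E -> R).
Hypothesis ha : linear_operator_on T Da a.
Hypothesis hMP : solves_martingale_problem PP V Da a.
Variable psi : 'I_k -> R * borel E -> R.
Hypothesis hpsi : forall i, Da (psi i).
Hypothesis hapsi : forall i, L2X PP V (a (psi i)).
Variables (s : R) (x : borel E).
Hypothesis sT : 0 <= s <= T.
Notation Flt := (F_compl PP s x).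
Notation CW := (caratheodory_type ((PP s x)^*)%mu).
Notation mu := (cprob (PP s x)).
Notation I := (Ioc R s T).

Let us : usual mu Flt s T.
Proof. exact: (usual_canonical PP x sT). Qed.
Let hF := us_flt us.
Let s0 : 0 <= s. Proof. by have /andP[] := sT. Qed.
Let sT' : s <= T. Proof. by have /andP[] := sT. Qed.
Let mI : measurable I. Proof. exact: measurable_itv. Qed.
Let natom t : s < t <= T -> dV V [set t] = 0%E.
Proof. by move=> /andP[st tT]; apply: (continuous_no_atom hV); rewrite tT (le_lt_trans s0 st). Qed.
Let in0T t : s <= t -> t <= T -> 0 <= t <= T.
Proof. by move=> st ->; rewrite (le_trans s0 st). Qed.

Let pc phi : borel_on_time_space T phi -> prog Flt s T (fun r (w : CW) => phi (r, X r w)).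
Proof. exact: (prog_comp hdist). Qed.

Let jc phi : borel_on_time_space T phi ->
  measurable_fun (I `*` setT) (fun z : TT * CW => phi (z.1, X z.1 z.2)).
Proof. by move=> /pc h; exact: (prog_joint hF h (lexx s) (lexx T)). Qed.

Lemma joint_comp_X phi : borel_on_time_space T phi ->
  measurable_fun (I `*` setT) (fun z : TT * Omega T E => phi (z.1, X z.1 z.2)).
Proof.
move=> mphi.
apply: (@measurable_comp _ _ _ _ _ _ (time_space T E) phi _ (fun z : TT * Omega T E => ((z.1 : R), (X z.1 z.2 : borel E)))) => //.
- by apply: measurableX => //; exact: measurable_itv.
- move=> _ [[r w] [/= + _] <-]; rewrite in_itv/= => /andP[sr rT]; split => //=.
  by rewrite in_itv/= in0T// ltW.
- have jX : measurable_fun (I `*` setT) (fun z : TT * Omega T E => (X z.1 z.2 : borel E)).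
    exact: (joint_X hdist s0).
  exact: measurable_fun_pairD (measurable_funTS measurable_fst) jX.
Qed.

Lemma iter_compl phi : borel_on_time_space T phi -> (forall z, 0 <= phi z) ->
  (\int[mu]_w \int[dV V]_(r in `]s, T]) (phi (r, X r w))%:E =
  \int[PP s x]_w \int[dV V]_(r in `]s, T]) (phi (r, X r w))%:E)%E.
Proof.
move=> mphi phi0; have j : measurable_fun (I `*` setT) (fun z : TT * Omega T E => (phi (z.1, X z.1 z.2))%:E).
  by apply/measurable_EFinP; exact: joint_comp_X.
apply: ge0_integral_compl => //.
- exact: (measurable_inner (dV V) mI (f := fun r (w : Omega T E) => (phi (r, X r w))%:E) j (fun r w _ => phi0 _)).
- by move=> w _; apply: integral_ge0 => r _; rewrite lee_fin.
Qed.

Lemma borel_sqr (phi : R * borel E -> R) : borel_on_time_space T phi -> borel_on_time_space T (fun z => phi z ^+ 2).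
Proof. by move=> h; exact: measurable_funX. Qed.

Lemma l2_of_iter phi : borel_on_time_space T phi ->
  (\int[PP s x]_w \int[dV V]_(r in `]s, T]) (phi (r, X r w) ^+ 2)%:E < +oo)%E ->
  l2 mu s T V (fun r (w : CW) => phi (r, X r w)).
Proof.
move=> mphi fin; apply: l2_iter; first exact: jc.
have e := iter_compl (borel_sqr mphi) (fun z => sqr_ge0 (phi z)).
by move: fin; rewrite -e.
Qed.

Lemma l2_of_L2X phi : L2X PP V phi -> l2 mu s T V (fun r (w : CW) => phi (r, X r w)).
Proof.
move=> [mphi /(_ s x sT) fin]; apply: l2_of_iter => //; apply: le_lt_trans fin.
rewrite le_eqVlt; apply/orP; left; apply/eqP; apply: eq_integral => w _.
by apply: eq_integral => r _; rewrite real_normK// num_real.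
Qed.

Let mX t : s <= t -> t <= T -> measurable_fun setT (X t : Omega T E -> borel E).
Proof. by move=> st tT; apply: measurable_X => //; exact: in0T. Qed.

Lemma sqi_XT (g : borel E -> R) : measurable_fun setT g ->
  (\int[PP s x]_w (g (X T w) ^+ 2)%:E < +oo)%E -> sqi mu (fun w : CW => g (X T w)).
Proof.
move=> mg fin.
have m1 : measurable_fun setT (fun w : Omega T E => g (X T w)).
  exact: measurableT_comp mg (mX sT' (lexx T)).
have m2 : measurable_fun setT (fun w : CW => g (X T w)).
  move=> _ B mB; rewrite setTI; apply: completed_measurable.
  by rewrite -[X in measurable X]setTI; exact: m1.
split => //.
have m3 : measurable_fun setT (fun w : Omega T E => (g (X T w) ^+ 2)%:E).
  by apply/measurable_EFinP; exact: measurable_funX.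
have e := @ge0_integral_compl _ _ _ (PP s x) setT (fun w => (g (X T w) ^+ 2)%:E) measurableT m3 (fun w _ => sqr_ge0 (g (X T w))).
by rewrite e.
Qed.

(** The law of [X s] is the Dirac mass P s s x, and singletons are Borel since their complements are
    open in the metric topology. *)
Lemma X_start : {ae mu, forall w : CW, X s w = x}.
Proof.
have mx : measurable [set x : borel E].
  have [dist0 _ _ dist_nbhs] := hdist.
  rewrite -[X in measurable X]setCK; apply: measurableC; apply: sub_sigma_algebra.
  rewrite openE => y /= yx; rewrite /interior; apply/dist_nbhs.
  have d0 : 0 < dist y x.
    rewrite lt_def (dist_ge0 hdist) andbT; apply/eqP => /dist0; exact: yx.
  by exists (dist y x) => // z /= + zx; rewrite zx ltxx.
have [hlaw _] := hPP x sT; have [hdirac _] := hP.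
have e : PP s x (X s @^-1` [set x]) = 1%E.
  by rewrite hlaw// (hdirac s s sT sT (lexx s) x _ mx) diracE mem_set.
have mXx : measurable (X s @^-1` [set x] : set (Omega T E)).
  by rewrite -[X in measurable X]setTI; exact: (mX (lexx s) sT').
apply: ae_compl; exists (~` (X s @^-1` [set x])); split.
- exact: measurableC.
- by rewrite probability_setC// e subee.
- by move=> w /= h; exact: h.
Qed.

Lemma kint_end (q : borel E -> R) y : measurable_fun setT q -> kint P T T q y = q y.
Proof.
move=> mq; have [hdirac _] := hP; have TT0 : 0 <= T <= T by rewrite T0 lexx.
rewrite /kint /Rintegral.
have -> : (\int[P T T y]_z (q z)%:E = \int[\d_y]_z (q z)%:E)%E.
  by apply: eq_measure_integral => A mA _; exact: hdirac.
rewrite integral_dirac//; last exact/measurable_EFinP.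
by rewrite diracT mul1e.
Qed.

Lemma left_lim_ae (phi : R * borel E -> R) (w : CW) :
  {ae dV V, forall r, I r -> phi (r, X r w) = phi (r, @left_lim R T E PP s x r w)}.
Proof.
move: (left_lim_null hdist sT w hV); apply: negligibleS => r /= h.
apply: contrapT => n; apply: h; rewrite in_itv/= => rI; congr (phi (_, _)).
by apply: contrapT => ne; apply: n; split => // e; apply: ne; rewrite e.
Qed.

Let slice (phi : R * borel E -> R) t : borel_on_time_space T phi -> 0 <= t <= T ->
  measurable_fun setT (fun y => phi (t, y)).
Proof.
move=> mphi tT; apply: (@measurable_comp _ _ _ _ _ _ (time_space T E) phi setT (fun z : borel E => ((t : R), z))) => //.
- by apply: measurableX => //; exact: measurable_itv.
- by move=> _ [z _ <-]; split => //=; rewrite in_itv.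
- exact: pair1_measurable.
Qed.

Let mXg t (q : borel E -> R) : s <= t -> t <= T -> measurable_fun setT q ->
  measurable_fun setT (fun w : CW => q (X t w)).
Proof.
move=> st tT mq _ B mB; rewrite setTI; apply: completed_measurable.
rewrite -[X in measurable X]setTI; exact: (measurableT_comp mq (mX st tT) measurableT mB).
Qed.

Let bpsi i : borel_on_time_space T (psi i). Proof. by have [+ _ _ _] := ha; move=> /(_ _ (hpsi i))[]. Qed.
Let bapsi i : borel_on_time_space T (a (psi i)). Proof. by case: (hapsi i). Qed.

Lemma Mart_facts i : [/\ martingale mu Flt s T (Mart V a (psi i) s x),
  sqi mu (Mart V a (psi i) s x T) & ae_cadlag mu s T (Mart V a (psi i) s x)].
Proof.
have [_ /(_ _ (hpsi i))[_ [m1 c1 q1]]] := hMP x sT.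
pose L t (w : CW) := psi i (t, X t w) - \int[dV V]_(r in `]s, t]) a (psi i) (r, X r w).
have TsT : s <= T <= T by rewrite sT' lexx.
have sL : sqi mu (L T) by split; [exact: (martingale_measurable hF (M := L) m1 TsT)|exact: (q1 T TsT)].
have e t w : L t w - psi i (s, x) = Mart V a (psi i) s x t w by rewrite /L /Mart addrAC.
split.
- apply: (martingale_ext hF _ (martingaleB hF (M := L) m1 (martingale_cst mu hF (psi i (s, x))))).
  by move=> t w _; exact: e.
- have := sqiB sL (sqi_cst mu (psi i (s, x))); congr (sqi _ _).
  by apply/funext => w; exact: e.
- apply: filterS c1 => w [h1 h2]; split => t tab.
    have -> : (Mart V a (psi i) s x)^~ w = (fun t => L t w - psi i (s, x)) by apply/funext => r; rewrite e.
    by rewrite -(e t w); apply: cvgB; [exact: h1|exact: cvg_cst].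
  have -> : (Mart V a (psi i) s x)^~ w = (fun t => L t w - psi i (s, x)) by apply/funext => r; rewrite e.
  have [l hl] := h2 t tab; exists (l - psi i (s, x)).
  by apply: cvgB; [exact: hl|exact: cvg_cst].
Qed.

Let lal i : l2 mu s T V (fun r (w : CW) => a (psi i) (r, X r w)).
Proof. exact: l2_of_L2X. Qed.

(** psi_i(t, X_t) is a square-integrable martingale plus a constant plus the integral of a(psi_i),
    which is in L^2. The integrability of [psi i] times the driver and of the terminal product
    follows from this. *)
Lemma l2_psi i : l2 mu s T V (fun r (w : CW) => psi i (r, X r w)) /\
  sqi mu (fun w : CW => psi i (T, X T w)).
Proof.
have [mN sN cN] := Mart_facts i.
have [N' nN' eN] := nice_version us mN sN cN.
pose al' := regular_part s T V (fun r (w : CW) => a (psi i) (r, X r w)).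
have pal' : prog Flt s T al' by exact: (regular_prog us (l2_path us (lal i)) (pc (bapsi i))).
have lal' : l2 mu s T V al' by exact: (regular_l2 us (pc (bapsi i)) (lal i)).
have eal := regular_ae (l2_path us (lal i)).
have ial' w : dV_integrable V s T (al'^~ w) by exact: regular_int.
pose D t (w : CW) := pint V s (al'^~ w) t.
have pD : prog Flt s T D.
  apply: (rcont_prog hF) => [t tab|w r rab]; first exact: (prog_pint hF V pal' tab).
  exact: (pint_cadlag natom (ial' w)).1.
have lD : l2 mu s T V D.
  have sB : sqi mu (fun w => \int[dV V]_(r in `]s, T]) `|al' r w|) by exact: (l2_inner sT' (l2_norm lal')).
  apply: (le_l2 _ _ (rv_l2 V sT' sB)); first exact: (prog_joint hF pD (lexx s) (lexx T)).
  move=> r w /andP[_ rT]; apply: le_trans (ler_norm _).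
  exact: (pint_bound (ial' w) rT).
pose S t (w : CW) := N' t w + psi i (s, x) + D t w.
have eS : {ae mu, forall w : CW, forall t, psi i (t, X t w) = S t w}.
  move: eN eal; apply: filterS2 => w e1 e2 t.
  have e3 : D t w = pint V s (fun r => a (psi i) (r, X r w)) t by apply: eq_pint => r _; exact: e2.
  by rewrite /S -e1 e3 /Mart /pint; ring.
split.
  have lS : l2 mu s T V S.
    have l1 : l2 mu s T V N' by exact: (nice_l2 V us nN').
    have l3 := l2D l1 (rv_l2 V sT' (sqi_cst mu (psi i (s, x)))).
    have l4 := l2D l3 lD.
    exact: l4.
  have aeS : {ae mu, forall w : CW, {ae dV V, forall r, I r -> psi i (r, X r w) = S r w}}.
    by apply: filterS eS => w e; apply: aeW => r _; exact: e.
  exact: (@l2_ae _ CW R mu s T V (fun r w => psi i (r, X r w)) S (jc (bpsi i)) lS aeS).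
have TsT : s <= T <= T by rewrite sT' lexx.
have eST : {ae mu, forall w : CW, S T w = psi i (T, X T w)} by apply: filterS eS => w e; rewrite e.
apply: (sqi_ae _ eST).
- by apply: (mXg (q := fun y => psi i (T, y)) sT' (lexx T)); apply: slice => //; rewrite T0 lexx.
- apply: sqiD; last exact: (l2_inner sT' lal').
  by apply: sqiD; [exact: (nice_sqi us nN' TsT)|exact: sqi_cst].
Qed.

Section growth.
Variables (f : R * borel E * R * k.-tuple R -> R) (g : borel E -> R).
Variables (u : R * borel E -> R) (v : 'I_k -> R * borel E -> R).
Hypothesis mf : measurable_fun [set q | 0 <= q.1.1.1 <= T] f.
Hypothesis mg : measurable_fun setT g.
Hypothesis hIP : IP_solution P PP V a psi f g u v.
Notation F := (fuv f u v).
Hypothesis lF : l2 mu s T V (fun r (w : CW) => F (r, X r w)).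
Hypothesis sg : sqi mu (fun w : CW => g (X T w)).

Let hu : L2X PP V u. Proof. have [h _ _] := hIP; exact: h. Qed.
Let hv i : L2X PP V (v i). Proof. have [_ h _] := hIP; exact: h. Qed.
Let bu : borel_on_time_space T u. Proof. by case: hu. Qed.
Let bv i : borel_on_time_space T (v i). Proof. by case: (hv i). Qed.

Let bF : borel_on_time_space T F.
Proof.
apply: (@measurable_driver R T E k f _ _ (time_space T E) id u v _ mf _ bu bv).
- by apply: measurableX => //; exact: measurable_itv.
- exact: measurable_id.
- by move=> [r y] [/= + _]; rewrite in_itv.
Qed.

Let T0T : 0 <= T <= T. Proof. by rewrite T0 lexx. Qed.

Lemma u_end y : u (T, y) = g y.
Proof.
have [_ _ /(_ T y T0T)[-> _]] := hIP.
by rewrite kint_end// set_itv_ge ?Rintegral_set0 ?addr0// bnd_simp ltxx.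
Qed.

Lemma u_martingale : martingale mu Flt s T (fun t w => u (t, X t w) + pint V s (fun r => F (r, X r w)) t).
Proof.
have ih : ini (dV V) mu I (fun r (w : CW) => F (r, X r w)).
  have := l2_mul lF (rv_l2 V sT' (sqi_cst mu 1)); apply: (eq_ini mI) => r w _.
  by rewrite mulr1.
have mU t : 0 <= t <= T -> measurable_fun setT (fun y => u (t, y)) by exact: slice.
have UE t y : 0 <= t <= T -> u (t, y) = kint P t T g y +
    1 * \int[dV V]_(r in `]t, T]) kint P t r (fun z => F (r, z)) y.
  by move=> tT; have [_ _ /(_ t y tT)[-> _]] := hIP; rewrite mul1r.
have := markov_martingale T0 hdist hPP sT mU bF mg (sqi_integrable sg) ih UE.
by apply: (martingale_ext hF) => t w _; rewrite mul1r.
Qed.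

Lemma upsi_martingale i : martingale mu Flt s T (fun t w => u (t, X t w) * psi i (t, X t w) -
  pint V s (fun r => v i (r, X r w) + u (r, X r w) * a (psi i) (r, X r w) - psi i (r, X r w) * F (r, X r w)) t).
Proof.
pose h z := v i z + u z * a (psi i) z - psi i z * F z.
have [lpsi sp] := l2_psi i.
have lu := l2_of_L2X hu; have lv := l2_of_L2X (hv i).
have bh : borel_on_time_space T h.
  exact: (measurable_funB (measurable_funD (bv i) (measurable_funM bu (bapsi i))) (measurable_funM (bpsi i) bF)).
have iv1 : ini (dV V) mu I (fun r (w : CW) => v i (r, X r w)).
  have := l2_mul lv (rv_l2 V sT' (sqi_cst mu 1)); apply: (eq_ini mI) => r w _.
  by rewrite mulr1.
have ih : ini (dV V) mu I (fun r (w : CW) => h (r, X r w)).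
  exact: (iniB mI (iniD mI iv1 (l2_mul lu (lal i))) (l2_mul lpsi lF)).
have mU t : 0 <= t <= T -> measurable_fun setT (fun y => u (t, y) * psi i (t, y)).
  by move=> tT; apply: measurable_funM; exact: slice.
have mg' : measurable_fun setT (fun y => g y * psi i (T, y)).
  by apply: measurable_funM => //; exact: slice.
have UE t y : 0 <= t <= T -> u (t, y) * psi i (t, y) = kint P t T (fun y => g y * psi i (T, y)) y +
    (-1) * \int[dV V]_(r in `]t, T]) kint P t r (fun z => h (r, z)) y.
  by move=> tT; have [_ _ /(_ t y tT)[_ ->]] := hIP; rewrite mulN1r.
have := markov_martingale T0 hdist hPP sT mU bh mg' (sqiM_integrable sg sp) ih UE.
by apply: (martingale_ext hF) => t w _; rewrite mulN1r.
Qed.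

Let ff r (w : CW) (y : R) (z : 'I_k -> R) : R := f (r, X r w, y, [tuple z i | i < k]).

Lemma prog_driver (y : R -> CW -> R) (z : 'I_k -> R -> CW -> R) : prog Flt s T y ->
  (forall i, prog Flt s T (z i)) -> prog Flt s T (fun r w => ff r w (y r w) (fun i => z i r w)).
Proof.
move=> py pz t tsT; have /andP[st tT] := tsT.
have mIt : measurable (Ioc R s t) by exact: measurable_itv.
have mst := prog_X hdist (PP := PP) (x := x) sT tsT.
apply: (@measurable_driver R T E k f _ _ _
  (fun q : TT * g_sigma_algebraType (Flt t) => ((q.1 : R), (X q.1 q.2 : borel E))) (fun q => y q.1 q.2) (fun i q => z i q.1 q.2) _ mf).
- exact: measurableX.
- exact: (measurable_time_pair mst).
- exact: py.
- by move=> i; exact: pz.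
- move=> [r w] [/= + _]; rewrite in_itv/= => /andP[sr rt].
  by apply: in0T; [exact: ltW|exact: le_trans rt tT].
Qed.

Lemma abstract_existence : exists Y M : R -> CW -> R,
  [/\ forall t, s <= t <= T -> {ae mu, forall w : CW, Y t w = u (t, X t w)},
  forall t, s <= t <= T -> {ae mu, forall w : CW, M t w = u (t, X t w) - u (s, x) +
  \int[dV V]_(r in `]s, t]) fuv f u v (r, X r w)} &
  @abstract_solution _ CW R mu Flt s T V k (fun i => Mart V a (psi i) s x) (fun w => g (X T w)) ff Y M].
Proof.
have pF := pc bF.
have ua : {ae mu, forall w : CW, u (s, X s w) = u (s, x)} by apply: filterS X_start => w ->.
have uT : {ae mu, forall w : CW, u (T, X T w) = g (X T w)} by apply: aeW => w; exact: u_end.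
have pv i := pc (bv i). have lv i := l2_of_L2X (hv i).
have pZ i : predictable_map Flt s T (fun r (w : CW) => v i (r, left_lim r w)).
  have h : predictable_map Flt s T (fun r (w : Omega T E) => v i (r, @left_lim R T E PP s x r w)).
    apply/(predictableP _ sT'); exact: (predictable_comp hdist sT (bv i)).
  exact: h.
have NE i t (w : CW) : Mart V a (psi i) s x t w =
    psi i (t, X t w) - psi i (s, x) - pint V s (fun r => a (psi i) (r, X r w)) t by [].
have mN i : martingale mu Flt s T (Mart V a (psi i) s x) by case: (Mart_facts i).
have sN i : sqi mu (Mart V a (psi i) s x T) by case: (Mart_facts i).
have cN i : ae_cadlag mu s T (Mart V a (psi i) s x) by case: (Mart_facts i).
have [Y [M [hY hM [aY cY] [nM M0] [hZ YU hE]]]] := @bsde_existence _ CW R mu Flt s T V us natom k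
  (fun r w => u (r, X r w)) (fun r w => F (r, X r w)) (fun w => g (X T w)) (u (s, x))
  (fun i r w => v i (r, X r w)) (fun i r w => v i (r, left_lim r w)) (fun i r w => psi i (r, X r w))
  (fun i r w => a (psi i) (r, X r w)) (fun i => Mart V a (psi i) s x) (fun i => psi i (s, x))
  (l2_of_L2X hu) pF lF u_martingale uT sg ua pv lv pZ (fun i w => left_lim_ae (v i) w)
  (fun i => jc (bpsi i)) (fun i => pc (bapsi i)) lal NE mN sN cN upsi_martingale.
have pY : prog Flt s T Y by apply: (rcont_prog hF aY) => w r; have [+ _] := cY w; exact.
have lY : l2 mu s T V Y.
  exact: (@l2_ae _ CW R mu s T V Y (fun r w => u (r, X r w)) (prog_joint hF pY (lexx s) (lexx T)) (l2_of_L2X hu) YU).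
pose Z i := sval (cid2 (hZ i)).
have pZ' i : predictable_map Flt s T (Z i) by rewrite /Z; case: cid2 => ? [].
have eZ i : {ae mu, forall w r, Z i r w = v i (r, left_lim r w)} by rewrite /Z; case: cid2 => ? [].
have hA i : angle_bracket mu Flt s T M (Mart V a (psi i) s x) (fun t w => pint V s ((Z i)^~ w) t).
  by rewrite /Z; case: cid2 => ? ? [].
have iZ i w : dV_integrable V s T ((Z i)^~ w).
  by rewrite /Z; case: cid2 => ? ? [].
have gZ i : prog Flt s T (Z i) := predictable_map_prog hF sT' (pZ' i).
have pPhi := prog_driver pY gZ.
(* The driver in IP uses [u] and [v] along [X], the one in the BSDE uses [Y] and [v] along left
   limits; on almost every path they agree at almost every time. *)
have ePhi : {ae mu, forall w, {ae dV V, forall r, I r ->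
    F (r, X r w) = ff r w (Y r w) (fun i => Z i r w)}}.
  have eZa : {ae mu, forall w, forall i r, Z i r w = v i (r, left_lim r w)}.
    by apply: filter_forall => i; exact: eZ.
  move: eZa YU; apply: filterS2 => w e1 e2.
  have e3 : {ae dV V, forall r, forall i, I r -> v i (r, X r w) = v i (r, left_lim r w)}.
    by apply: filter_forall => i; exact: left_lim_ae.
  move: e2 e3; apply: filterS2 => r h2 h3 Ir; rewrite /ff /fuv (h2 Ir); congr (f (_, _)).
  by apply: eq_from_tnth => i; rewrite !tnth_mktuple e1 h3.
have mPath (q : R -> CW -> R) w : prog Flt s T q -> measurable_fun I (q^~ w).
  move=> pq; apply: (measurable_pathI mI (f := q)); exact: (prog_joint hF pq (lexx s) (lexx T)).
exists Y, M; split.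
- exact: hY.
- exact: hM.
have [mM sM cM _] := nM.
have c1 : ae_cadlag mu s T M by apply: aeW => w; exact: cM.
have q1 t : s <= t <= T -> (\int[mu]_w ((M t w) ^+ 2)%:E < +oo)%E.
  by move=> tsT; have [_ h] := nice_sqi us nM tsT; exact: h.
split.
- exact: aY.
- by apply: aeW => w; exact: cY.
- by have := iter_EI lY; move=> e; rewrite e ltry.
- by split; [split|exact: M0].
- exists (fun i t w => pint V s ((Z i)^~ w) t), Z; split.
  + exact: hA.
  + by move=> i; apply/(predictableP _ sT'); exact: pZ'.
  + by move=> i; apply: aeW => w; exact: pint_density.
  + apply: (@filterS2 CW (nbhs (almost_everywhere mu)) _ _ _ _ _ ePhi hE) => w e [iF {}hE]; split.
    exact: (ae_eq_integrable mI (mPath _ w pPhi) e iF).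
    move=> t /[dup] tsT /andP[st tT]; rewrite (hE t tsT); congr (_ + _ - _).
    have mt : measurable (Ioc R t T) by exact: measurable_itv.
    have sub : (Ioc R t T) `<=` I.
    by move=> r /=; rewrite !in_itv/= => /andP[tr ->]; rewrite (le_lt_trans st tr).
    apply: (ae_eq_Rintegral mt (measurable_funS mI sub (mPath _ w pF)) (measurable_funS mI sub (mPath _ w pPhi))).
    by apply: filterS e => r h /sub; exact: h.
Qed.

Lemma abstract_BSDE (Y M : R -> CW -> R) :
  @abstract_solution _ CW R mu Flt s T V k (fun i => Mart V a (psi i) s x) (fun w => g (X T w)) ff Y M ->
  BSDE_solution PP V a psi f g s x Y M.
Proof.
rewrite /BSDE_solution /P_compl cprobE.
case=> aY cY Y2 [nM M0] [A [Z [hA hZ hD hE]]].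
split.
- exact: aY.
- exact: cY.
- exact: Y2.
- split.
  + exact: nM.
  + exact: M0.
- exists A, Z; split.
  + exact: hA.
  + exact: hZ.
  + exact: hD.
  + exact: hE.
Qed.

Lemma canonical_existence : exists Y M : R -> Omega T E -> R,
  [/\ modification PP s x Y (fun t w => u (t, X t w)),
  modification PP s x M (fun t w => u (t, X t w) - u (s, x) +
  \int[dV V]_(r in `]s, t]) fuv f u v (r, X r w)) &
  BSDE_solution PP V a psi f g s x Y M].
Proof.
have h0 := abstract_existence.
case: h0 => Y h1.
case: h1 => M h2.
case: h2 => hY hM h.
exists Y.
exists M.
split.
- by rewrite /modification /P_compl cprobE; exact: hY.
- by rewrite /modification /P_compl cprobE; exact: hM.
- exact: abstract_BSDE h.
Qed.

End growth.

Section lipschitz.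
Variables (f : R * borel E * R * k.-tuple R -> R) (g : borel E -> R) (G : 'I_k -> R * borel E -> R).
Hypothesis mf : measurable_fun [set q | 0 <= q.1.1.1 <= T] f.
Hypothesis hG : forall i, bracket_density PP V a (psi i) (G i).
Hypothesis hGb : forall i, bounded_up_to_zero_potential PP V (G i).
Variables KY KZ : R.
Hypotheses (KY0 : 0 < KY) (KZ0 : 0 < KZ).
Hypothesis hlip : forall t x y y' z z', 0 <= t <= T ->
  `|f (t, x, y, z) - f (t, x, y', z')| <=
  KY * `|y - y'| + KZ * euclidean_norm (fun i => tnth z i - tnth z' i).

Let ff r (w : CW) (y : R) (z : 'I_k -> R) : R := f (r, X r w, y, [tuple z i | i < k]).

Let lip r w y y' z z' : s < r <= T ->
  `|ff r w y z - ff r w y' z'| <= (KY + KZ) * (`|y - y'| + \sum_(i < k) `|z i - z' i|).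
Proof.
move=> /andP[sr rT]; have r0 : 0 <= r <= T by apply: in0T => //; exact: ltW.
apply: le_trans (hlip _ _ _ _ _ r0) _.
have h := euclidean_norm_le_sum (fun i => tnth [tuple z i | i < k] i - tnth [tuple z' i | i < k] i).
have e : \sum_(i < k) `|tnth [tuple z i | i < k] i - tnth [tuple z' i | i < k] i| = \sum_(i < k) `|z i - z' i|.
  by apply: eq_bigr => i _; rewrite !tnth_mktuple.
rewrite e in h; have y0 := normr_ge0 (y - y').
have s1 : 0 <= \sum_(i < k) `|z i - z' i| by exact: sumr_ge0.
rewrite mulrDl !mulrDr; have h2 := ler_wpM2l (ltW KZ0) h.
have := mulr_ge0 (ltW KY0) s1; have := mulr_ge0 (ltW KZ0) y0; lra.
Qed.

Let C i := sval (cid (hGb i)).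
(** One bound for all bracket densities; the summand 1 makes it positive even if there are no
    components. *)
Let c : R := 1 + \sum_(i < k) `|C i|.

Let Cc i : C i <= c.
Proof.
apply: le_trans (ler_norm _) _; rewrite /c (bigD1 i)//= addrCA lerDl.
by rewrite addr_ge0// sumr_ge0.
Qed.

Let c0 : 0 < c.
Proof. by rewrite /c ltr_pwDl// sumr_ge0. Qed.

(** A set of zero potential is avoided, under this initial condition, at almost every time of almost
    every path. *)
Let density_bound i : {ae mu, forall w : CW, {ae dV V, forall r, I r -> `|G i (r, X r w)| <= c}}.
Proof.
have [mA _ /(_ s x sT) z] := svalP (cid (hGb i)).
set A := time_space T E `&` _ in mA z.
have bA : borel_on_time_space T (\1_A : R * borel E -> R) by exact: measurable_indic.
have i0 q : 0 <= \1_A q :> R by rewrite indicE ler0n.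
have e := iter_compl bA i0.
rewrite z in e.
have := @ae_ae0 _ CW R mu s T V (fun r w => \1_A (r, X r w)) (fun r w => i0 _) (jc bA) e.
apply: filterS => w; apply: filterS => r h Ir; rewrite leNgt; apply/negP => cG.
have : \1_A (r, X r w) = 1 :> R.
  rewrite indicE mem_set//; split.
    move: Ir; rewrite /= in_itv/= => /andP[sr rT]; split => //=.
    by rewrite in_itv/= in0T// ltW.
  exact: le_lt_trans (Cc i) cG.
by rewrite h// => /eqP; rewrite eq_sym oner_eq0.
Qed.

Let hN i : exists2 N', nice mu Flt s T N' /\ {ae mu, forall w t, Mart V a (psi i) s x t w = N' t w} &
  bracket_le mu Flt V s T c N'.
Proof.
have [mN sN cN] := Mart_facts i; have [bG /(_ s x sT)[B]] := hG i.
rewrite /P_compl cprobE => -[hB dB].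
have := @bounded_density _ CW R mu Flt s T V us (Mart V a (psi i) s x) (fun r w => G i (r, X r w)) B c
  (ltW c0) mN sN cN (pc bG) (density_bound i) hB dB.
by move=> [N' h1 h2]; exists N'; [exact: h1|exact: h2].
Qed.

Lemma solution_abstract Y M : BSDE_solution PP V a psi f g s x Y M ->
  @abstract_solution _ CW R mu Flt s T V k (fun i => Mart V a (psi i) s x) (fun w => g (X T w)) ff Y M.
Proof.
rewrite /BSDE_solution /P_compl cprobE => -[aY cY Y2 [nM M0] [A [Z [hA hZ hD hE]]]]; split.
- exact: aY.
- exact: cY.
- exact: Y2.
- split; [exact: nM|exact: M0].
- exists A, Z; split; [exact: hA|exact: hZ|exact: hD|exact: hE].
Qed.

Lemma canonical_unique Y M Y' M' : BSDE_solution PP V a psi f g s x Y M ->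
  BSDE_solution PP V a psi f g s x Y' M' ->
  {ae mu, forall w : CW, forall t, s <= t <= T -> Y' t w = Y t w /\ M' t w = M t w}.
Proof.
move=> /solution_abstract s1 /solution_abstract s2.
have pff := prog_driver mf.
have mN i : martingale mu Flt s T (Mart V a (psi i) s x) by case: (Mart_facts i).
have K0 : 0 <= KY + KZ by rewrite addr_ge0// ltW.
exact: (@abstract_unique _ CW R mu Flt s T V us natom k (fun i => Mart V a (psi i) s x) (fun w => g (X T w))
  (KY + KZ) ff pff K0 lip c c0 hN Y' M' Y M s2 s1).
Qed.

End lipschitz.

End canonical_bsde.

(** * Growth hypotheses and conclusion *)

Section growth_conditions.
Context {R : realType} (T : R) (E : ptopologicalType) (dist : E -> E -> R) (k : nat).
Hypothesis hdist : metrizes dist.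
Variables (PP : R -> borel E -> probability (Omega T E) R) (V : cumulative R R).
Variables (s : R) (x : borel E).
Hypothesis sT : 0 <= s <= T.
Variables zeta eta : borel E -> R.
Hypotheses (mzeta : measurable_fun setT zeta) (meta : measurable_fun setT eta).
Hypothesis hmom : H_mom PP V zeta eta.
Notation CW := (caratheodory_type ((PP s x)^*)%mu).
Notation mu := (cprob (PP s x)).

Let hF := us_flt (usual_canonical PP x sT).
Let sT' : s <= T. Proof. by have /andP[] := sT. Qed.
Let s0 : 0 <= s. Proof. by have /andP[] := sT. Qed.

Lemma sqi_terminal (g : borel E -> R) C : measurable_fun setT g ->
  (forall y, `|g y| <= C * (1 + zeta y)) -> sqi mu (fun w : CW => g (X T w)).
Proof.
move=> mg hg.
have [z2 _] := hmom x sT.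
have sz := sqi_XT sT mzeta z2.
have mgX : measurable_fun setT (fun w : CW => g (X T w)).
  move=> _ B mB; rewrite setTI; apply: completed_measurable.
  have m1 : measurable_fun setT (fun w : Omega T E => g (X T w)).
    apply: measurableT_comp mg _; apply: measurable_X; rewrite lexx andbT.
    exact: le_trans s0 sT'.
  by rewrite -[X in measurable X]setTI; exact: m1.
apply: (le_sqi mgX _ (sqiZ C (sqiD (sqi_cst mu 1) sz)) (sqi0 mu)) => w.
rewrite expr0n addr0 -(real_normK (num_real (g _))).
have h := hg (X T w); rewrite lerXn2r// ?nnegrE//.
exact: le_trans h.
Qed.

Lemma l2_eta : l2 mu s T V (fun r (w : CW) => eta (X r w)).
Proof.
have be : borel_on_time_space T (fun z : R * borel E => eta z.2).
  by apply: measurable_funTS; apply: measurableT_comp meta measurable_snd.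
apply: (l2_of_iter hdist sT be).
have [_ e2] := hmom x sT; apply: le_lt_trans e2.
have e0 y : (0 <= (eta y ^+ 2)%:E)%E by rewrite lee_fin sqr_ge0.
apply: le_nonneg_integral => w; first by apply: integral_ge0 => r _; exact: e0.
rewrite 2!(integral_mkcond (Ioc R _ _)).
apply: le_nonneg_integral => r; first by rewrite patchE; case: ifP.
rewrite !patchE; case: ifPn => [|_]; last by case: ifP.
rewrite inE/= in_itv/= => /andP[sr rT]; rewrite mem_set//= in_itv/= rT andbT.
exact: le_lt_trans sr.
Qed.

Lemma l2_growth (f : R * borel E * R * k.-tuple R -> R) (u : R * borel E -> R)
  (v : 'I_k -> R * borel E -> R) C : measurable_fun [set q | 0 <= q.1.1.1 <= T] f ->
  L2X PP V u -> (forall i, L2X PP V (v i)) -> 0 < C ->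
  (forall t y p z, 0 <= t <= T ->
  `|f (t, y, p, z)| <= C * (1 + eta y + `|p| + euclidean_norm (tnth z))) ->
  l2 mu s T V (fun r (w : CW) => fuv f u v (r, X r w)).
Proof.
move=> mf hu hv C0 hf.
have bF : borel_on_time_space T (fuv f u v).
  apply: (@measurable_driver R T E k f _ _ (time_space T E) id u v _ mf _ hu.1 (fun i => (hv i).1)).
  - by apply: measurableX => //; exact: measurable_itv.
  - exact: measurable_id.
  - by move=> [r y] [/= + _]; rewrite in_itv.
have jF := prog_joint hF (prog_comp hdist sT bF) (lexx s) (lexx T).
have lu := l2_of_L2X hdist x sT hu.
have lv i := l2_of_L2X hdist x sT (hv i).
have lc := rv_l2 V sT' (sqi_cst mu 1).
have lS := l2Z C (l2D (l2D (l2D lc l2_eta) (l2_norm lu)) (l2_sum (fun i => l2_norm (lv i)))).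
apply: (le_l2 jF _ lS) => r w /andP[sr rT].
have r0 : 0 <= r <= T by rewrite rT (le_trans s0 (ltW sr)).
apply: le_trans (hf _ _ _ _ r0) _; apply: le_trans (ler_norm _).
apply: ler_wpM2l; first exact: ltW.
rewrite lerD2l; apply: le_trans (euclidean_norm_le_sum _) _.
by apply: ler_sum => i _; rewrite tnth_mktuple.
Qed.

End growth_conditions.

(** Compare [f] with its value at y = 0, z = 0; the sum of the three constants covers all four terms
    of the growth bound. *)
Lemma H_lip_growth (R : realType) (T : R) (E : ptopologicalType) (d : nat)
  (zeta eta : borel E -> R) (f : R * borel E * R * d.-tuple R -> R) (g : borel E -> R) :
  (forall x, 0 <= eta x) -> H_lip T zeta eta f g -> H_growth T zeta eta f g.
Proof.
move=> eta0 [hg [C C0 hf] [KY [KZ [KY0 KZ0 hl]]]]; split => //.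
exists (C + KY + KZ) => [|t x y z tT]; first by rewrite !addr_gt0.
have h1 := hf t x tT; have h2 := hl t x y 0 z [tuple 0 | i < d] tT.
have en : euclidean_norm (fun i => tnth z i - tnth [tuple 0 | i < d] i) = euclidean_norm (tnth z).
  by rewrite /euclidean_norm; congr Num.sqrt; apply: eq_bigr => i _; rewrite tnth_mktuple subr0.
rewrite en subr0 in h2; have n0 : 0 <= euclidean_norm (tnth z) := sqrtr_ge0 _.
have y0 := normr_ge0 y; have e0 := eta0 x.
have h3 : `|f (t, x, y, z)| <= `|f (t, x, y, z) - f (t, x, 0, [tuple 0 | i < d])| + `|f (t, x, 0, [tuple 0 | i < d])|.
  by rewrite -[X in `|X| <= _](subrK (f (t, x, 0, [tuple 0 | i < d]))); exact: ler_normD.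
move: (`|f (t, x, y, z)|) (`|_ - _|) (`|f _|) h1 h2 h3 => F1 F2 F3 h1 h2 h3.
have := mulr_ge0 (ltW KY0) e0; have := mulr_ge0 (ltW KZ0) e0.
have := mulr_ge0 (ltW C0) y0; have := mulr_ge0 (ltW C0) n0.
have := mulr_ge0 (ltW KY0) n0; have := mulr_ge0 (ltW KZ0) y0.
by lra.
Qed.

Lemma modification_sym (R : realType) (T : R) (E : ptopologicalType)
  (PP : R -> borel E -> probability (Omega T E) R) s x (N N' : R -> Omega T E -> R) :
  modification PP s x N N' -> modification PP s x N' N.
Proof.
rewrite /modification /P_compl cprobE => h t tsT.
apply: (@filterS (caratheodory_type ((PP s x)^*)%mu) (nbhs (almost_everywhere (cprob (PP s x)))) _ _ _ _ (h t tsT)).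
by move=> w ->.
Qed.

Theorem proposition5p23 (R : realType) (T : R) (E : ptopologicalType) (d : nat)
  (hT : 0 <= T) (hE : polish R E)
  (P : R -> R -> R.-pker borel E ~> borel E)
  (hP : transition_kernel T P) (hPt : measurable_in_time T P)
  (PP : R -> borel E -> probability (Omega T E) R)
  (hPP : canonical_markov_class P PP)
  (V : cumulative R R) (hV : {within `[0, T], continuous V}) (hV0 : V 0 = 0)
  (Da : set (R * borel E -> R))
  (a : (R * borel E -> R) -> R * borel E -> R)
  (ha : linear_operator_on T Da a)
  (hMP : solves_martingale_problem PP V Da a)
  (psi : 'I_d -> R * borel E -> R)
  (hpsi : forall i, Da (psi i))
  (hAC : forall i, bracket_abs_continuous PP V a (psi i))
  (hapsi : forall i, L2X PP V (a (psi i)))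
  (G : 'I_d -> R * borel E -> R)
  (hG : forall i, bracket_density PP V a (psi i) (G i))
  (hGb : forall i, bounded_up_to_zero_potential PP V (G i))
  (zeta eta : borel E -> R)
  (mzeta : measurable_fun setT zeta) (meta : measurable_fun setT eta)
  (zeta_ge0 : forall x, 0 <= zeta x) (eta_ge0 : forall x, 0 <= eta x)
  (hmom : H_mom PP V zeta eta)
  (f : R * borel E * R * d.-tuple R -> R) (g : borel E -> R)
  (hfg : borel_data T f g) :
  (H_growth T zeta eta f g ->
   forall (u : R * borel E -> R) (v : 'I_d -> R * borel E -> R),
     IP_solution P PP V a psi f g u v ->
   forall (s : R) (x : borel E), 0 <= s <= T ->
   exists Y M : R -> Omega T E -> R,
     [/\ modification PP s x Y (fun t w => u (t, X t w)),
         modification PP s x M (fun t w => u (t, X t w) - u (s, x) +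
           \int[dV V]_(r in `]s, t]) fuv f u v (r, X r w)) &
         BSDE_solution PP V a psi f g s x Y M]) /\
  (H_lip T zeta eta f g ->
   forall (u : R * borel E -> R) (v : 'I_d -> R * borel E -> R),
     IP_unique_solution P PP V a psi f g u v ->
   forall (s : R) (x : borel E), 0 <= s <= T ->
   exists Y M : R -> Omega T E -> R,
     [/\ BSDE_unique_solution PP V a psi f g s x Y M,
         modification PP s x (fun t w => u (t, X t w)) Y &
         modification PP s x (fun t w => u (t, X t w) - u (s, x) +
           \int[dV V]_(r in `]s, t]) fuv f u v (r, X r w)) M]).
Proof.
have [mf mg] := hfg.
have [_ [dist [dist0 distC distD dist_nbhs _]]] := hE.
have hdist : metrizes dist by split.
(* The Lipschitz part takes its existence statement from the growth part. *)
have with_first (A B : Prop) : A -> (A -> B) -> A /\ B by move=> h /(_ h).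
apply: with_first => [|existence].
- move=> [[C C0 hg] [C' C'0 hf]] u v hIP s x sT; have [hu hv _] := hIP.
  have lF := l2_growth hdist x sT meta hmom mf hu hv C'0 hf.
  have sg := sqi_terminal x sT mzeta hmom mg hg.
  exact: (canonical_existence hT hdist hP hPP hV ha hMP hpsi hapsi sT mf mg hIP lF sg).
move=> hl u v [hIP _] s x sT.
have [Y [M [hY hM hS]]] := existence (H_lip_growth eta_ge0 hl) u v hIP s x sT.
have [_ _ [KY [KZ [KY0 KZ0 hlip]]]] := hl.
exists Y, M; split.
- split; first exact: hS.
  move=> Y' M' hS'; rewrite /P_compl cprobE.
  exact: (canonical_unique hdist hV hMP hpsi sT mf hG hGb KY0 KZ0 hlip hS hS').
- exact: modification_sym.
- exact: modification_sym.
Qed.
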